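(* Let $\mathbf v=(v_1,\dots,v_{ne})$ be the solution of the transformed (fixed-domain) nonlocal parabolic problem (P) described in the context, for fixed data $\alpha,\beta,T,a_i,f_i,u_{i0}$ satisfying the standing hypotheses. Let $M>0$. Then there is a constant $C>0$, depending only on these data and on $M$ (in particular, not on $h$, $k$ or $\delta$), such that the following holds. Let $k\ge1$ be an integer for which $\mathbf v$ satisfies the regularity assumption (R) of the context with bound $M$, let $\mathcal T_h$ be any partition of $\Omega=\,]0,1[$ into intervals with maximal length $h$, let $N\ge1$ be an integer, $\delta=T/N$, $t_n=n\delta$, and let $\mathbf V^{(n)}=(V_1^{(n)},\dots,V_{ne}^{(n)})\in(S_h^k)^{ne}$, $n=0,1,\dots,N$, be the solution of the linearized Crank-Nicolson-Galerkin scheme (CN) of the context. Then $$\|V_i^{(n)}-v_i(\cdot,t_n)\|\le C(h^{k+1}+\delta^2),\qquad n=1,\dots,N,\quad i=1,\dots,ne,$$ where $\|\cdot\|$ is the $L_2(0,1)$ norm.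
   Context: **Data and standing hypotheses.** $T>0$ is a real number and $ne\ge 1$ an integer. The functions $\alpha,\beta\in C^2([0,T])$ satisfy $\alpha'(t)<0$ and $\beta'(t)>0$ for all $t\in[0,T]$, and $\gamma(t)=\beta(t)-\alpha(t)$ satisfies $0<\gamma_0<\gamma(t)<\gamma_1<\infty$ for all $t\in[0,T]$, for some constants $\gamma_0,\gamma_1$; moreover $\alpha',\beta'\in L_1(]0,T[)\cap L_2(]0,T[)$. Put $\Omega_t=\,]\alpha(t),\beta(t)[$. For $i=1,\dots,ne$: $u_{i0}\in H_0^1(\Omega_0)$; $f_i\in L_2(0,T;L_2(\Omega_t))\cap L_1(0,T;L_2(\Omega_t))$; and $a_i:\mathbb R^{ne}\to\mathbb R^+$ is Lipschitz-continuous with $0<m_a\le a_i(s)\le M_a$ for all $s\in\mathbb R^{ne}$. **Transformed problem (P).** Let $\Omega=\,]0,1[$, $g_i(y,t)=f_i(\alpha(t)+\gamma(t)y,t)$, $v_{i0}(y)=u_{i0}(\alpha(0)+\gamma(0)y)$, $$b_1(y,t)=\frac{\alpha'(t)+\gamma'(t)y}{\gamma(t)},\qquad b_2(t)=\frac1{\gamma(t)^2},$$ and, at each time $t$, $l(w)=\gamma(t)\int_0^1 w\,dy$. Problem (P) is, for $i=1,\dots,ne$, $$\frac{\partial v_i}{\partial t}-a_i(l(v_1),\dots,l(v_{ne}))\,b_2(t)\frac{\partial^2v_i}{\partial y^2}-b_1(y,t)\frac{\partial v_i}{\partial y}=g_i(y,t)\quad\text{in }\Omega\times]0,T[,$$ $$v_i(0,t)=v_i(1,t)=0\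 (t>0),\qquad v_i(y,0)=v_{i0}(y)\ (y\in\Omega).$$ (It arises from the moving-boundary problem $\partial_t u_i-a_i(\int_{\Omega_t}u_1dx,\dots,\int_{\Omega_t}u_{ne}dx)\,\partial_x^2u_i=f_i$ with zero Dirichlet conditions at $x=\alpha(t),\beta(t)$ and $u_i(\cdot,0)=u_{i0}$, via $v_i(y,t)=u_i(\alpha(t)+\gamma(t)y,t)$.) A solution is understood in the weak sense: for each $i$, $v_i\in L_\infty(0,T;H_0^1(\Omega)\cap H^2(\Omega))$, $\partial_tv_i\in L_2(0,T;L_2(\Omega))$, $v_i(\cdot,0)=v_{i0}$, and for all $w_i\in H_0^1(\Omega)$, in the sense of $D'(0,T)$, $$\int_0^1\frac{\partial v_i}{\partial t}w_i\,dy+a_i(l(v_1),\dots,l(v_{ne}))\,b_2\int_0^1\frac{\partial v_i}{\partial y}\frac{\partial w_i}{\partial y}\,dy-\int_0^1b_1\frac{\partial v_i}{\partial y}w_i\,dy=\int_0^1g_iw_i\,dy.$$ **Regularity assumption (R) with bound $M$ (for the degree $k$).** For every $i$: $v_{i0}\in H^{k+1}(\Omega)$, $v_i,\partial_tv_i\in L_\infty(0,T;H^{k+1}(\Omega))$, $\partial_t^2v_i\in L_\infty(0,T;H^1(\Omega))$, $\partial_t^3v_i\in L_\infty(0,T;L_2(\Omega))$, and the corresponding norms are all at most $M$. (Then $g_i$ has a representative continuous in $t$ with values in $L_2(\Omega)$, which is the one evaluated below.) **Finite element space.** $\mathcal T_h$ is a partition of $\Omega$ into finitely many disjoint intervals,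 $h$ the maximum of their lengths. $S_h^k$ is the space of continuous functions on $[0,1]$ vanishing at $0$ and $1$ whose restriction to each interval of $\mathcal T_h$ is a polynomial of degree at most $k$. $I_hu\in S_h^k$ is the Lagrange interpolant of a continuous function $u$ vanishing at $0$ and $1$: it coincides with $u$ at the nodes, which consist in each interval of the two endpoints and $k-1$ distinct interior points. **Notation for the scheme.** $t_{n-1/2}=(t_n+t_{n-1})/2$; for a function $\phi$ of time, $\phi^{(n-1/2)}$ denotes its value at $t_{n-1/2}$. For sequences, $\hat V_i^{(n)}=\frac12(V_i^{(n)}+V_i^{(n-1)})$, $\overline\partial V_i^{(n)}=\frac1\delta(V_i^{(n)}-V_i^{(n-1)})$, $\overline V_i^{(n)}=\frac32V_i^{(n-1)}-\frac12V_i^{(n-2)}$. In the equation for step $n$ below, $l$ is taken at time $t_{n-1/2}$ (so with factor $\gamma(t_{n-1/2})$), except that in the predictor equation for $V_i^{(1,0)}$ the expression $l(V_j^{(0)})$ may be taken with factor $\gamma(t_{1/2})$ or $\gamma(0)$. **Scheme (CN).** All equations hold for $i=1,\dots,ne$ and all $W_i\in S_h^k$; all unknowns lie in $S_h^k$. Initial value: $V_i^{(0)}=I_hv_{i0}$. First step, predictor $V_i^{(1,0)}$: $$\int_0^1\frac{V_i^{(1,0)}-V_i^{(0)}}{\delta}W_i\,dy+a_i(l(V_1^{(0)}),\dots,l(V_{ne}^{(0)}))\,b_2^{(1/2)}\int_0^1\frac{\partial}{\partial y}\Big(\frac{V_i^{(1,0)}+V_i^{(0)}}2\Big)\frac{\partial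 W_i}{\partial y}\,dy$$ $$-\int_0^1b_1^{(1/2)}\frac{\partial}{\partial y}\Big(\frac{V_i^{(1,0)}+V_i^{(0)}}2\Big)W_i\,dy=\int_0^1g_i^{(1/2)}W_i\,dy.$$ First step, corrector $V_i^{(1)}$: $$\int_0^1\overline\partial V_i^{(1)}W_i\,dy+a_i\Big(l\big(\tfrac{V_1^{(1,0)}+V_1^{(0)}}2\big),\dots,l\big(\tfrac{V_{ne}^{(1,0)}+V_{ne}^{(0)}}2\big)\Big)b_2^{(1/2)}\int_0^1\frac{\partial\hat V_i^{(1)}}{\partial y}\frac{\partial W_i}{\partial y}\,dy$$ $$-\int_0^1b_1^{(1/2)}\frac{\partial\hat V_i^{(1)}}{\partial y}W_i\,dy=\int_0^1g_i^{(1/2)}W_i\,dy.$$ Steps $2\le n\le N$: $$\int_0^1\overline\partial V_i^{(n)}W_i\,dy+a_i(l(\overline V_1^{(n)}),\dots,l(\overline V_{ne}^{(n)}))\,b_2^{(n-1/2)}\int_0^1\frac{\partial\hat V_i^{(n)}}{\partial y}\frac{\partial W_i}{\partial y}\,dy$$ $$-\int_0^1b_1^{(n-1/2)}\frac{\partial\hat V_i^{(n)}}{\partial y}W_i\,dy=\int_0^1g_i^{(n-1/2)}W_i\,dy.$$ *)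

(* Defs.v *)
From mathcomp Require Import all_boot all_order all_algebra.
From mathcomp Require Import all_classical all_reals all_analysis.

Set Implicit Arguments.
Unset Strict Implicit.
Unset Printing Implicit Defensive.

Import Order.TTheory GRing.Theory Num.Theory.
Import numFieldNormedType.Exports.

Local Open Scope classical_set_scope.
Local Open Scope ring_scope.

(* Functions of (y, t) are curried with time first, as functions of time with
   values in functions of space: [v t y] stands for v(y,t). Elements of
   Lebesgue spaces are represented by Borel functions; their values outside
   the interval (or space-time domain) under consideration are irrelevant. *)

Section Sobolev.
Context {R : realType}.
Implicit Types (a b : R) (u g phi : R -> R).
Local Notation mu := (@lebesgue_measure R).

Definition L2 a b u : Prop := u \_ `]a, b[ \in Lfun mu 2%:E.

Definition L2norm a b u : \bar R := ('N[mu]_2%:E [EFin \o (u \_ `]a, b[)])%E.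

(* phi is in C_c^oo(]a, b[) = D(a, b), extended by 0 to the line *)
Definition test_function a b phi : Prop :=
  (forall n x, derivable (derive1n n phi) x 1) /\
  (exists c d, [/\ a < c, d < b & forall x, x \notin `[c, d] -> phi x = 0]).

(* g in L_2(a, b) is the j-th distributional derivative of u in L_2(a, b) *)
Definition weak_deriv a b (j : nat) u g : Prop :=
  [/\ L2 a b u, L2 a b g & forall phi, test_function a b phi ->
    \int[mu]_(x in `]a, b[) (u x * derive1n j phi x) =
    (-1) ^+ j * \int[mu]_(x in `]a, b[) (g x * phi x)].

(* D 0 = u, D 1, ..., D m are the weak derivatives of u up to order m, and the
   resulting norm of u in H^m(a, b) is at most M (for M >= 0) *)
Definition Hm_derivs_le a b (m : nat) u (D : nat -> R -> R) (M : R) : Prop :=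
  (forall j, (j <= m)%N -> weak_deriv a b j u (D j)) /\
  (\sum_(j < m.+1) L2norm a b (D j) ^+ 2 <= (M ^+ 2)%:E)%E.

Definition Hm_norm_le a b m u M : Prop := exists D, Hm_derivs_le a b m u D M.

(* H_0^1(a, b), the closure of C_c^oo(]a, b[) in H^1(a, b) *)
Definition H10 a b u : Prop :=
  exists2 du, weak_deriv a b 1 u du &
  exists phi : nat -> R -> R,
    [/\ forall n, test_function a b (phi n),
        (L2norm a b (phi n \- u) @[n --> \oo] --> 0%E) &
        (L2norm a b (derive1 (phi n) \- du) @[n --> \oo] --> 0%E)].

(* z in L_p(0, T; L_2(]a(t), b(t)[)) *)
Definition LpL2 (T : R) (a b : R -> R) (p : \bar R) (z : R -> R -> R) : Prop :=
  measurable_fun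
    [set q : R * R | (q.1 \in `]0, T[) && (q.2 \in `]a q.1, b q.1[)]
    (fun q => z q.1 q.2) /\
  ('N[mu]_p [(fun t => L2norm (a t) (b t) (z t)) \_ `]0%R, T[] < +oo)%E.

Definition cylinder (T : R) : set (R * R) :=
  `]0, T[%classic `*` `]0, 1[%classic.

(* z in L_oo(0, T; H^m(0, 1)), with norm at most M; joint measurability of z
   and of its spatial derivatives expresses strong measurability in H^m *)
Definition LooHm_norm_le (T : R) (m : nat) (z : R -> R -> R) (M : R) : Prop :=
  measurable_fun (cylinder T) (fun q => z q.1 q.2) /\
  exists D : nat -> R -> R -> R,
    (forall j, (j <= m)%N ->
       measurable_fun (cylinder T) (fun q => D j q.1 q.2)) /\
    {ae mu, forall t, t \in `]0, T[ ->
       Hm_derivs_le 0 1 m (z t) (fun j => D j t) M}.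

(* z in C([0, T]; L_2(0, 1)) *)
Definition C0L2 (T : R) (z : R -> R -> R) : Prop :=
  forall t, t \in `[0, T] ->
    L2 0 1 (z t) /\
    L2norm 0 1 (z s \- z t) @[s --> within `[0, T] (nbhs t)] --> 0%E.

(* z is the j-th derivative of v in the sense of distributions on ]0, T[ with
   values in L_2(0, 1); the equality of the two L_2(0, 1)-valued integrals is
   expressed almost everywhere in ]0, 1[ *)
Definition time_deriv (T : R) (j : nat) (v z : R -> R -> R) : Prop :=
  forall phi, test_function 0 T phi ->
  {ae mu, forall y, y \in `]0, 1[ ->
    \int[mu]_(t in `]0, T[) (v t y * derive1n j phi t) =
    (-1) ^+ j * \int[mu]_(t in `]0, T[) (z t y * phi t)}.

(* f in C^2([0, T]) with derivative df; at 0 and T, where the derivative is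
   one-sided, df is determined by continuity *)
Definition C2 (T : R) (f df : R -> R) : Prop :=
  exists ddf : R -> R,
    [/\ {within `[0, T], continuous f}, {within `[0, T], continuous df},
        {within `[0, T], continuous ddf},
        forall t, t \in `]0, T[ -> is_derive t 1 f (df t) &
        forall t, t \in `]0, T[ -> is_derive t 1 df (ddf t)].

End Sobolev.

Section Problem.
Context {R : realType} {ne : nat}.
Local Notation mu := (@lebesgue_measure R).

Record data := Data {
  horizon : R;                      (* T *)
  alpha : R -> R; alpha' : R -> R;  (* alpha' is the derivative of alpha *)
  beta : R -> R; beta' : R -> R;    (* beta' is the derivative of beta *)
  coef : 'I_ne -> 'rV[R]_ne -> R;   (* the functions a_i *)
  source : 'I_ne -> R -> R -> R;    (* [source i t x] is f_i(x,t) *)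
  u0 : 'I_ne -> R -> R }.

Implicit Types (d : data) (v : 'I_ne -> R -> R -> R).

Definition gamma d t := beta d t - alpha d t.
Definition gamma' d t := beta' d t - alpha' d t.

Record standing_hypotheses d : Prop := {
  T_gt0 : 0 < horizon d;
  alphaC2 : C2 (horizon d) (alpha d) (alpha' d);
  betaC2 : C2 (horizon d) (beta d) (beta' d);
  alpha'_lt0 : forall t, t \in `[0, horizon d] -> alpha' d t < 0;
  beta'_gt0 : forall t, t \in `[0, horizon d] -> 0 < beta' d t;
  gamma_bounds : exists gamma0 gamma1, 0 < gamma0 /\
    forall t, t \in `[0, horizon d] -> gamma0 < gamma d t < gamma1;
  alpha'_L1L2 : (alpha' d) \_ `]0, horizon d[ \in Lfun mu 1 /\
    (alpha' d) \_ `]0, horizon d[ \in Lfun mu 2%:E;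
  beta'_L1L2 : (beta' d) \_ `]0, horizon d[ \in Lfun mu 1 /\
    (beta' d) \_ `]0, horizon d[ \in Lfun mu 2%:E;
  u0_H10 : forall i, H10 (alpha d 0) (beta d 0) (u0 d i);
  f_L2L1 : forall i, LpL2 (horizon d) (alpha d) (beta d) 2%:E (source d i) /\
    LpL2 (horizon d) (alpha d) (beta d) 1 (source d i);
  a_lipschitz : forall i, [lipschitz coef d i s | s in setT];
  a_bounds : exists ma Ma, 0 < ma /\ forall i s, ma <= coef d i s <= Ma }.

Definition g d i t y := source d i t (alpha d t + gamma d t * y).
Definition v0 d i y := u0 d i (alpha d 0 + gamma d 0 * y).
Definition b1 d t y := (alpha' d t + gamma' d t * y) / gamma d t.
Definition b2 d t := (gamma d t ^+ 2)^-1.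
Definition ell d t (w : R -> R) := gamma d t * \int[mu]_(y in `]0, 1[) w y.

(* (l(w_1), ..., l(w_ne)) at time t *)
Definition ells d t (w : 'I_ne -> R -> R) : 'rV[R]_ne :=
  \row_j ell d t (w j).

(* v is the representative of the weak solution that is continuous in time
   with values in L_2(0, 1); vt and vy are dv/dt and dv/dy *)
Definition weak_solution d v : Prop := forall i,
  [/\ C0L2 (horizon d) (v i),
      (exists K, LooHm_norm_le (horizon d) 2 (v i) K),
      {ae mu, forall t, t \in `]0, horizon d[ -> H10 0 1 (v i t)},
      {ae mu, forall y, y \in `]0, 1[ -> v i 0 y = v0 d i y} &
  exists vt vy : R -> R -> R,
  [/\ LpL2 (horizon d) (cst 0) (cst 1) 2%:E vt,
      time_deriv (horizon d) 1 (v i) vt,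
      measurable_fun (cylinder (horizon d)) (fun q => vy q.1 q.2),
      {ae mu, forall t, t \in `]0, horizon d[ ->
         weak_deriv 0 1 1 (v i t) (vy t)} &
  forall w dw, H10 0 1 w -> weak_deriv 0 1 1 w dw ->
  forall phi, test_function 0 (horizon d) phi ->
    \int[mu]_(t in `]0, horizon d[)
      ((\int[mu]_(y in `]0, 1[) (vt t y * w y)
        + coef d i (ells d t (fun j => v j t)) * b2 d t
          * \int[mu]_(y in `]0, 1[) (vy t y * dw y)
        - \int[mu]_(y in `]0, 1[) (b1 d t y * vy t y * w y)) * phi t) =
    \int[mu]_(t in `]0, horizon d[)
      (\int[mu]_(y in `]0, 1[) (g d i t y * w y) * phi t)]].

Definition regular d (k : nat) (M : R) v : Prop := forall i,
  [/\ Hm_norm_le 0 1 k.+1 (v0 d i) M,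
      LooHm_norm_le (horizon d) k.+1 (v i) M &
  exists vt vtt vttt : R -> R -> R,
  [/\ time_deriv (horizon d) 1 (v i) vt /\
        LooHm_norm_le (horizon d) k.+1 vt M,
      time_deriv (horizon d) 2 (v i) vtt /\
        LooHm_norm_le (horizon d) 1 vtt M &
      time_deriv (horizon d) 3 (v i) vttt /\
        LooHm_norm_le (horizon d) 0 vttt M]].

(* gc i is the representative of g i that is continuous in time with values in
   L_2(0, 1) *)
Definition continuous_repr d (gc : 'I_ne -> R -> R -> R) : Prop := forall i,
  C0L2 (horizon d) (gc i) /\
  {ae mu, forall t, t \in `]0, horizon d[ ->
    {ae mu, forall y, y \in `]0, 1[ -> gc i t y = g d i t y}}.

End Problem.

Arguments data : clear implicits.

Section FiniteElements.
Context {R : realType}.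
Local Notation mu := (@lebesgue_measure R).

(* A partition of ]0, 1[ is given by s = [:: x_1; ...; x_m] with
   [itv_partition 0 1 s], that is, 0 < x_1 < ... < x_m = 1; its j-th interval,
   j < m, is ]lnode s j, rnode s j[. *)
Definition lnode (s : seq R) (j : nat) : R := nth 0 (0 :: s) j.
Definition rnode (s : seq R) (j : nat) : R := nth 0 s j.

Definition mesh (s : seq R) : R :=
  \big[Num.max/0]_(j < size s) (rnode s j - lnode s j).

Definition Sh (s : seq R) (k : nat) (W : R -> R) : Prop :=
  [/\ {within `[0, 1], continuous W}, W 0 = 0, W 1 = 0 &
      forall j, (j < size s)%N -> exists2 p : {poly R}, (size p <= k.+1)%N &
        forall y, y \in `[lnode s j, rnode s j] -> W y = p.[y]].

(* z j lists the k - 1 interior Lagrange nodes of the j-th interval *)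
Definition interior_nodes (s : seq R) (k : nat) (z : nat -> seq R) : Prop :=
  forall j, (j < size s)%N ->
    [/\ size (z j) = k.-1, uniq (z j) &
        forall y, y \in z j -> y \in `]lnode s j, rnode s j[].

(* V = I_h u, where u is given up to equality almost everywhere and uc is its
   continuous representative *)
Definition interpolant (s : seq R) k (z : nat -> seq R) (u V : R -> R) : Prop :=
  Sh s k V /\
  exists uc : R -> R,
    [/\ {within `[0, 1], continuous uc},
        {ae mu, forall y, y \in `]0, 1[ -> uc y = u y} &
        forall j, (j < size s)%N -> forall y,
          y \in [:: lnode s j, rnode s j & z j] -> V y = uc y].

End FiniteElements.

Section Scheme.
Context {R : realType} {ne : nat}.
Local Notation mu := (@lebesgue_measure R).
Implicit Types d : data R ne.

Definition step d (N : nat) : R := horizon d / N%:R.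
Definition tn d N (n : nat) : R := n%:R * step d N.
Definition tmid d N (n : nat) : R := (tn d N n + tn d N n.-1) / 2.

(* The linear equations of the n-th step from Vold to Vnew, with lam the
   argument of the coefficients a_i. The derivatives of functions of S_h^k are
   classical; they exist except at the nodes of the partition. *)
Definition cn_step d (gc : 'I_ne -> R -> R -> R) (s : seq R) k N n
    (lam : 'rV[R]_ne) (Vold Vnew : 'I_ne -> R -> R) : Prop :=
  let t := tmid d N n in
  forall i W, Sh s k W ->
    let Vhat := fun y => (Vnew i y + Vold i y) / 2 in
    \int[mu]_(y in `]0, 1[) ((Vnew i y - Vold i y) / step d N * W y)
    + coef d i lam * b2 d t
      * \int[mu]_(y in `]0, 1[) (derive1 Vhat y * derive1 W y)
    - \int[mu]_(y in `]0, 1[) (b1 d t y * derive1 Vhat y * W y)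
    = \int[mu]_(y in `]0, 1[) (gc i t y * W y).

(* tau is the time at which l is taken in the predictor equation;
   P is the predictor V^(1,0) *)
Definition cn_scheme d gc s k (z : nat -> seq R) N (tau : R)
    (V : nat -> 'I_ne -> R -> R) : Prop :=
  [/\ forall i, interpolant s k z (v0 d i) (V 0%N i),
      forall n i, (n <= N)%N -> Sh s k (V n i),
      exists P : 'I_ne -> R -> R,
        [/\ forall i, Sh s k (P i),
            cn_step d gc s k N 1 (ells d tau (V 0%N)) (V 0%N) P &
            cn_step d gc s k N 1
              (ells d (tmid d N 1) (fun j y => (P j y + V 0%N j y) / 2))
              (V 0%N) (V 1%N)] &
      forall n, (2 <= n <= N)%N ->
        cn_step d gc s k N n
          (ells d (tmid d N n)
             (fun j y => 3 / 2 * V n.-1 j y - 1 / 2 * V n.-2 j y))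
          (V n.-1) (V n)].

End Scheme.

(* Main.v *)
(* The error is split by means of the elliptic projection vh(t) in S_h^k of v(t): the
   L2 projection of dv/dy(t) onto the piecewise polynomials of degree < k, integrated
   from 0. In one space dimension this primitive vanishes at both ends, one has
   <vh', W'> = <v', W'> for all W in S_h^k, and v - vh, as well as its time derivative,
   is of order h^(k+1), uniformly in k.

   The difference V - vh is tested with its average over a time step. The convection
   term is dissipative, because <b1 W', W> = - (gamma'/(2 gamma)) |W|^2 and gamma' > 0, so
   that the residual is absorbed by the diffusion without any smallness of delta. Since
   the arguments of the a_i are extrapolated from earlier steps, a discrete Gronwall
   inequality closes the estimate. The predictor is only of order h^(k+1) + delta^(3/2),
   but its error enters the corrector with a weight delta.

   The time regularity is a property of distributions. For fixed w and q, the scalar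
   functions <v(t), w> and <dv/dy(t), q> have C^1 representatives with Lipschitz
   derivatives, by the lemma of du Bois-Reymond, and the truncation errors in time are
   those of scalar functions, carried over to norms by duality. The weak equation may
   be tested with W in S_h^k, because piecewise polynomials are limits of test functions
   in L2, and it holds at every time by continuity. *)

Require Import Defs.
From mathcomp Require Import all_boot all_order all_algebra.
From mathcomp Require Import all_classical all_reals all_analysis.
From mathcomp Require Import measurable_realfun ring lra.

Set Implicit Arguments.
Unset Strict Implicit.
Unset Printing Implicit Defensive.

Import Order.TTheory GRing.Theory Num.Theory.
Import numFieldNormedType.Exports.

Local Open Scope classical_set_scope.
Local Open Scope ring_scope.

(** * Square integrable functions *)

(** The coefficient [a_i(l(v)) b2] depends on time only. The projection therefore belongs to the
    plain Dirichlet form, is the same operator at all times and commutes with the time derivative,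
    so that the diffusion term leaves no projection error. Convection cannot profit from this
    orthogonality: the derivative of the projection error is only of order h^k. It is integrated by
    parts, and the derivative that falls on the test function is absorbed by diffusion.

    Uniformity in k excludes approximation constants that depend on the degree. All bounds in space
    come from repeated integration over one element, starting from a point where the primitive
    vanishes; each integration gains a factor h with constant one.

    The difference quotient at the midpoint needs <v, w> twice differentiable with a Lipschitz
    second derivative; for the averages of <dv/dy, q> one derivative less suffices. This matches the
    norms in (R). The predictor freezes the argument of a_i at time 0, an error of order delta whose
    square enters the energy estimate with a weight delta: hence the power 3/2. *)

Section L2_space.
Context {R : realType}.
Local Notation mu := (@lebesgue_measure R).
Local Notation mR := (measurableTypeR R).
Implicit Types (D : set mR) (u v w f g : R -> R).

Lemma aeS (P Q : R -> Prop) : (forall x, P x -> Q x) ->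
  {ae mu, forall x, P x} -> {ae mu, forall x, Q x}.
Proof. exact: (@filterS _ _ (ae_filter_ringOfSetsType mu)). Qed.

Lemma aeS2 (P Q S : R -> Prop) : (forall x, P x -> Q x -> S x) ->
  {ae mu, forall x, P x} -> {ae mu, forall x, Q x} -> {ae mu, forall x, S x}.
Proof. exact: (@filterS2 _ _ (ae_filter_ringOfSetsType mu)). Qed.

Lemma aeT (P : R -> Prop) : (forall x, P x) -> {ae mu, forall x, P x}.
Proof. by move=> h; apply: (aeS (fun x _ => h x)); exact: aeW. Qed.

(** Real-valued notions on a domain; [L2P] and [L2normE] translate those of the statement into them.
    [ip] is a [Rintegral], hence meaningful only when the product is summable. *)
Definition summable_on D f := mu.-integrable D (EFin \o f).
Definition sq_int D u := measurable_fun D u /\ summable_on D (fun x => u x ^+ 2).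
Definition ip D u w : R := \int[mu]_(x in D) (u x * w x).
Definition nrm D u : R := Num.sqrt (ip D u u).

Lemma ae_eq_Rintegral D f g : measurable D -> measurable_fun D f ->
  measurable_fun D g -> {ae mu, forall x, D x -> f x = g x} ->
  \int[mu]_(x in D) f x = \int[mu]_(x in D) g x.
Proof.
move=> mD mf mg fg; congr fine; apply: ae_eq_integral => //.
- exact/measurable_EFinP.
- exact/measurable_EFinP.
by apply: aeS fg => x fg Dx; congr EFin; exact: fg.
Qed.

Section fixed_domain.
Variables (D : set mR) (mD : measurable D).

Lemma summable_meas f : summable_on D f -> measurable_fun D f.
Proof. by move=> /integrableP[] /measurable_EFinP. Qed.

Lemma summableD f g : summable_on D f -> summable_on D g ->
  summable_on D (fun x => f x + g x).
Proof. by move=> hf hg; have := integrableD mD hf hg. Qed.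

Lemma summableZ c f : summable_on D f -> summable_on D (fun x => c * f x).
Proof. by move=> hf; have := integrableZl mD c hf. Qed.

Lemma summableB f g : summable_on D f -> summable_on D g ->
  summable_on D (fun x => f x - g x).
Proof. by move=> hf hg; have := integrableB mD hf hg. Qed.

Lemma summable_norm f : summable_on D f -> summable_on D (fun x => `|f x|).
Proof. by move=> hf; have := integrable_norm hf. Qed.

Lemma summable_le f g : measurable_fun D f -> summable_on D g ->
  (forall x, D x -> `|f x| <= `|g x|) -> summable_on D f.
Proof.
by move=> mf ig fg; apply: le_integrable ig => //; exact/measurable_EFinP.
Qed.

Lemma eq_summable f g : (forall x, D x -> f x = g x) -> summable_on D f ->
  summable_on D g.
Proof.
move=> fg; apply: eq_integrable => // x /set_mem Dx.
by rewrite /= fg.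
Qed.

Lemma summableM f g : sq_int D f -> sq_int D g ->
  summable_on D (fun x => f x * g x).
Proof.
move=> [mf sf] [mg sg]; apply: summable_le (summableD sf sg) _.
  exact: measurable_funM.
move=> x _; rewrite [leRHS]ger0_norm ?addr_ge0 ?sqr_ge0// normrM.
have := sqr_ge0 (`|f x| - `|g x|).
rewrite -[f x ^+ 2]real_normK ?num_real// -[g x ^+ 2]real_normK ?num_real//.
have : 0 <= `|f x| * `|g x| by exact: mulr_ge0.
nra.
Qed.

Lemma sq_intD u w : sq_int D u -> sq_int D w -> sq_int D (fun x => u x + w x).
Proof.
move=> hu hw; split; first exact: measurable_funD hu.1 hw.1.
have := summableD hu.2 (summableD hw.2 (summableZ 2 (summableM hu hw))).
apply: eq_summable => x _; ring.
Qed.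

Lemma sq_intZ c u : sq_int D u -> sq_int D (fun x => c * u x).
Proof.
move=> hu; split; first exact: measurable_funM hu.1.
have := summableZ (c ^+ 2) hu.2.
by apply: eq_summable => x _; rewrite exprMn.
Qed.

Lemma sq_intN u : sq_int D u -> sq_int D (fun x => - u x).
Proof.
move=> /(sq_intZ (-1)); congr sq_int; apply/funext => x; exact: mulN1r.
Qed.

Lemma sq_intB u w : sq_int D u -> sq_int D w -> sq_int D (fun x => u x - w x).
Proof. by move=> hu /sq_intN; exact: sq_intD. Qed.

Lemma sq_int0 : sq_int D (fun=> 0).
Proof.
split; first exact: measurable_cst.
have := integrable0 mu D.
by apply: eq_integrable => // x _; rewrite /= expr0n.
Qed.

Lemma sq_int_sum (I : Type) (r : seq I) (c : I -> R) (F : I -> R -> R) :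
  (forall i, sq_int D (F i)) -> sq_int D (fun x => \sum_(i <- r) c i * F i x).
Proof.
move=> hF; elim: r => [|i r IH].
  by have := sq_int0; congr sq_int; apply/funext => x; rewrite big_nil.
have := sq_intD (sq_intZ (c i) (hF i)) IH.
by congr sq_int; apply/funext => x; rewrite big_cons.
Qed.

Lemma sq_intM_bounded (K : R) f u : measurable_fun D f ->
  (forall x, D x -> `|f x| <= K) -> sq_int D u ->
  sq_int D (fun x => f x * u x).
Proof.
move=> mf fK hu; split; first exact: measurable_funM mf hu.1.
apply: summable_le (summableZ (K ^+ 2) hu.2) _.
  apply: measurable_funX; exact: measurable_funM mf hu.1.
move=> x Dx; rewrite -exprMn !normrX lerXn2r ?nnegrE// !normrM ler_wpM2r//.
by apply: le_trans (ler_norm _); exact: fK.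
Qed.

Lemma eq_sq_int u w : (forall x, D x -> u x = w x) -> sq_int D u -> sq_int D w.
Proof.
move=> uw [mu_ su]; split.
  by apply: eq_measurable_fun mu_ => x /set_mem; exact: uw.
by apply: eq_summable su => x Dx; rewrite uw.
Qed.

Lemma ae_sq_int u w : measurable_fun D w ->
  {ae mu, forall x, D x -> u x = w x} -> sq_int D u -> sq_int D w.
Proof.
move=> mw uw [mu_ su]; split=> //.
have mw2 : measurable_fun D (EFin \o (fun x => w x ^+ 2)).
  by apply/measurable_EFinP; exact: measurable_funX.
have mu2 : measurable_fun D (EFin \o (fun x => u x ^+ 2)).
  by apply/measurable_EFinP; exact: measurable_funX.
apply/integrableP; split=> //; move/integrableP : su => [_].
rewrite (ae_eq_integral (fun x : mR => `|(w x ^+ 2)%:E|)%E)//.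
- exact: measurableT_comp.
- exact: measurableT_comp.
by apply: aeS uw => x h Dx; rewrite /= (h Dx).
Qed.

Lemma eq_ip u u' w w' : (forall x, D x -> u x = u' x) ->
  (forall x, D x -> w x = w' x) -> ip D u w = ip D u' w'.
Proof.
by move=> uu' ww'; apply: eq_Rintegral => x /set_mem Dx; rewrite uu' ?ww'.
Qed.

Lemma ipC u w : ip D u w = ip D w u.
Proof. by apply: eq_Rintegral => x _; rewrite mulrC. Qed.

Lemma ipDl u v w : sq_int D u -> sq_int D v -> sq_int D w ->
  ip D (fun x => u x + v x) w = ip D u w + ip D v w.
Proof.
move=> hu hv hw; rewrite -[RHS]RintegralD//; [|exact: summableM..].
by apply: eq_Rintegral => x _; rewrite mulrDl.
Qed.

Lemma ipZl c u w : sq_int D u -> sq_int D w ->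
  ip D (fun x => c * u x) w = c * ip D u w.
Proof.
move=> hu hw; rewrite -RintegralZl//; last exact: summableM.
by apply: eq_Rintegral => x _; rewrite mulrA.
Qed.

Lemma ipNl u w : sq_int D u -> sq_int D w ->
  ip D (fun x => - u x) w = - ip D u w.
Proof.
move=> hu hw; rewrite -mulN1r -ipZl//.
by apply: eq_Rintegral => x _; rewrite mulN1r.
Qed.

Lemma ipBl u v w : sq_int D u -> sq_int D v -> sq_int D w ->
  ip D (fun x => u x - v x) w = ip D u w - ip D v w.
Proof. by move=> hu hv hw; rewrite ipDl ?ipNl//; exact: sq_intN. Qed.

Lemma ipDr u v w : sq_int D u -> sq_int D v -> sq_int D w ->
  ip D w (fun x => u x + v x) = ip D w u + ip D w v.
Proof. by move=> hu hv hw; rewrite ipC ipDl// !(ipC w). Qed.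

Lemma ipZr c u w : sq_int D u -> sq_int D w ->
  ip D w (fun x => c * u x) = c * ip D w u.
Proof. by move=> hu hw; rewrite ipC ipZl// (ipC w). Qed.

Lemma ipBr u v w : sq_int D u -> sq_int D v -> sq_int D w ->
  ip D w (fun x => u x - v x) = ip D w u - ip D w v.
Proof. by move=> hu hv hw; rewrite ipC ipBl// !(ipC w). Qed.

Lemma ip_suml (I : Type) (r : seq I) (c : I -> R) (F : I -> R -> R) w :
  (forall i, sq_int D (F i)) -> sq_int D w ->
  ip D (fun x => \sum_(i <- r) c i * F i x) w = \sum_(i <- r) c i * ip D (F i) w.
Proof.
move=> hF hw; elim: r => [|i r IH].
  rewrite big_nil -[RHS](mul0r (ip D w w)) -ipZl//.
  by apply: eq_ip => // x _; rewrite big_nil mul0r.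
rewrite big_cons -IH -ipZl// -ipDl//; [|exact: sq_intZ|exact: sq_int_sum].
by apply: eq_ip => // x _; rewrite big_cons.
Qed.

Lemma ip_ge0 u : 0 <= ip D u u.
Proof. by apply: Rintegral_ge0 => x _; rewrite -expr2 sqr_ge0. Qed.

Lemma ae_eq_ip u u' w : measurable_fun D u -> measurable_fun D u' ->
  measurable_fun D w -> {ae mu, forall x, D x -> u x = u' x} ->
  ip D u w = ip D u' w.
Proof.
move=> hu hu' hw uu'; apply: ae_eq_Rintegral => //; [exact: measurable_funM..|].
by apply: filterS uu' => x + Dx => ->.
Qed.

Lemma ip_quad c u w : sq_int D u -> sq_int D w ->
  ip D (fun x => u x - c * w x) (fun x => u x - c * w x) =
  ip D u u - 2 * c * ip D u w + c ^+ 2 * ip D w w.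
Proof.
move=> hu hw; have hcw := sq_intZ c hw.
rewrite ipBl ?ipBr ?ipZl ?ipZr//; last exact: sq_intB.
rewrite (ipC w u); ring.
Qed.

(** Positivity of the quadratic polynomial [ip_quad] in [c], at its minimiser <u,w>/<w,w>. When
    <w,w> vanishes the polynomial is affine in [c] and bounded below, hence constant. *)
Lemma CS2 u w : sq_int D u -> sq_int D w -> ip D u w ^+ 2 <= ip D u u * ip D w w.
Proof.
move=> hu hw; have := ip_ge0 w; rewrite le_eqVlt => /orP[/eqP w0|w0].
  have h c : 2 * c * ip D u w <= ip D u u.
    have := ip_ge0 (fun x => u x - c * w x).
    by rewrite ip_quad// -w0 mulr0 addr0 subr_ge0.
  rewrite -w0 mulr0; have [->|nz] := eqVneq (ip D u w) 0; first by rewrite expr0n.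
  (* For this [c] the left-hand side of [h] is <u,u> + 1. *)
  have := h ((ip D u u + 1) / (2 * ip D u w)).
  have -> : 2 * ((ip D u u + 1) / (2 * ip D u w)) * ip D u w = ip D u u + 1.
    by field; rewrite nz.
  by rewrite gerDl ler10.
have := ip_ge0 (fun x => u x - (ip D u w / ip D w w) * w x).
rewrite ip_quad//; have := gt_eqF w0 => /negbT nz.
have -> : ip D u u - 2 * (ip D u w / ip D w w) * ip D u w +
   (ip D u w / ip D w w) ^+ 2 * ip D w w =
  ip D u u - ip D u w ^+ 2 / ip D w w by field.
by rewrite subr_ge0 ler_pdivrMr.
Qed.

Lemma nrm_ge0 u : 0 <= nrm D u. Proof. exact: sqrtr_ge0. Qed.

Lemma nrm2 u : nrm D u ^+ 2 = ip D u u.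
Proof. by rewrite sqr_sqrtr// ip_ge0. Qed.

Lemma CS u w : sq_int D u -> sq_int D w -> `|ip D u w| <= nrm D u * nrm D w.
Proof.
move=> hu hw; rewrite -sqrtrM ?ip_ge0// -sqrtr_sqr ler_wsqrtr// CS2//.
Qed.

Lemma nrmD u w : sq_int D u -> sq_int D w ->
  nrm D (fun x => u x + w x) <= nrm D u + nrm D w.
Proof.
move=> hu hw; rewrite -(@ler_pXn2r _ 2)// ?nnegrE ?addr_ge0 ?nrm_ge0//.
rewrite nrm2 sqrrD !nrm2 ipDl ?ipDr//; last exact: sq_intD.
have := CS hu hw; rewrite ler_norml => /andP[_].
rewrite (ipC w u); lra.
Qed.

Lemma nrmZ c u : sq_int D u -> nrm D (fun x => c * u x) = `|c| * nrm D u.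
Proof.
move=> hu; rewrite /nrm ipZl ?ipZr//; last exact: sq_intZ.
by rewrite mulrA sqrtrM -?expr2 ?sqr_ge0// sqrtr_sqr.
Qed.

Lemma nrmN u : sq_int D u -> nrm D (fun x => - u x) = nrm D u.
Proof.
move=> hu; rewrite -[RHS]mul1r -normr1 -normrN -nrmZ//; congr Num.sqrt.
by apply: eq_ip => x _; rewrite mulN1r.
Qed.

Lemma nrmB u w : sq_int D u -> sq_int D w ->
  nrm D (fun x => u x - w x) <= nrm D u + nrm D w.
Proof. by move=> hu hw; rewrite -(nrmN hw); exact/nrmD/sq_intN. Qed.

Lemma eq_nrm u w : (forall x, D x -> u x = w x) -> nrm D u = nrm D w.
Proof. by move=> uw; congr Num.sqrt; exact: eq_ip. Qed.

Lemma ae_eq_nrm u w : measurable_fun D u -> measurable_fun D w ->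
  {ae mu, forall x, D x -> u x = w x} -> nrm D u = nrm D w.
Proof.
move=> hu hw uw; congr Num.sqrt; apply: ae_eq_Rintegral => //.
- exact: measurable_funM.
- exact: measurable_funM.
- by apply: aeS uw => x + Dx => ->.
Qed.

(** Used with a bound of <u, w> by [K] times the norm of [w], taken at [w = u]: this is how
    estimates of scalar functions of time become estimates of norms. *)
Lemma nrm_le_dual K u : 0 <= K -> sq_int D u ->
  (ip D u u <= K * nrm D u) -> nrm D u <= K.
Proof.
move=> K0 hu; rewrite -nrm2 expr2; have := nrm_ge0 u.
rewrite le_eqVlt => /orP[/eqP <-//|n0]; by rewrite ler_pM2r.
Qed.

Lemma nrm_le K u : 0 <= K -> ip D u u <= K ^+ 2 -> nrm D u <= K.
Proof. by move=> K0 h; rewrite -[leRHS](ger0_norm K0) -sqrtr_sqr ler_wsqrtr. Qed.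

End fixed_domain.

Lemma sqr_Lnorm D u : measurable D ->
  ('N[mu]_2%:E [EFin \o (u \_ D)] = (\int[mu]_(x in D) (u x ^+ 2)%:E) `^ 2^-1)%E.
Proof.
move=> mD; rewrite unlock; congr (_ `^ _)%E.
rewrite [RHS]integral_mkcond; apply: eq_integral => x _ /=.
rewrite !patchE; case: ifPn => _; rewrite /= ?normr0 ?powR0//.
by rewrite powR_mulrn// real_normK ?num_real.
Qed.

Lemma L2P a b u : L2 a b u <-> sq_int `]a, b[ u.
Proof.
have mD : measurable (`]a, b[%classic : set mR) by exact: measurable_itv.
split=> [h|[mu_ su]].
  have := h; rewrite /L2 inE => /andP[]; rewrite inE /= => mu_ _.
  have {}mu_ : measurable_fun (`]a, b[%classic : set mR) u.
    by apply/(measurable_restrictT _ _).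
  split=> //; have := Lfun2_integrable_sqr h.
  rewrite /summable_on; move/(integrableS measurableT mD (@subsetT _ _)).
  apply: eq_integrable => // x xD /=.
  by rewrite patchE xD.
rewrite /L2 inE; apply/andP; split; rewrite inE/=.
  exact: (measurable_restrictT u mD).1 mu_.
rewrite /finite_norm sqr_Lnorm// poweR_lty//.
move/integrableP : su => [_].
by under eq_integral => x _ do rewrite /= ger0_norm ?sqr_ge0//.
Qed.

Lemma L2normE a b u : sq_int `]a, b[ u -> L2norm a b u = (nrm `]a, b[ u)%:E.
Proof.
have mD : measurable (`]a, b[%classic : set mR) by exact: measurable_itv.
move=> [_ su]; rewrite /L2norm sqr_Lnorm// -[X in (X `^ _)%E]fineK; last first.
  exact: integrable_fin_num su.
rewrite poweR_EFin powR12_sqrt; last first.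
  by apply: fine_ge0; apply: integral_ge0 => x _; rewrite lee_fin sqr_ge0.
congr (Num.sqrt _)%:E; apply: eq_Rintegral => x _; exact: expr2.
Qed.

End L2_space.

(** * Fubini's theorem for real-valued integrals *)

Section Fubini_real.
Context {R : realType}.
Local Notation mu := (@lebesgue_measure R).
Local Notation mR := (measurableTypeR R).
(** Extension by zero, so that Fubini's theorem on the whole plane applies to functions on a
    rectangle. *)
Definition xpatch (D1 D2 : set mR) (h : R -> R -> R) : mR * mR -> R :=
  (fun q => h q.1 q.2) \_ (D1 `*` D2).

Section fixed.
Variables (D1 D2 : set mR) (mD1 : measurable D1) (mD2 : measurable D2).
Variable h : R -> R -> R.
Hypothesis mh : measurable_fun (D1 `*` D2 : set (mR * mR)) (fun q => h q.1 q.2).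

Let mD : measurable (D1 `*` D2 : set (mR * mR)). Proof. exact: measurableX. Qed.
Local Notation H := (xpatch D1 D2 h).
Let mH : measurable_fun setT (EFin \o H).
Proof. by apply/measurable_EFinP; exact: (measurable_restrictT _ mD).1. Qed.

Let HE x y : D1 x -> D2 y -> H (x, y) = h x y.
Proof. by move=> Dx Dy; rewrite /xpatch patchE mem_set. Qed.

Let HE1 x y : ~ D1 x -> H (x, y) = 0.
Proof. by move=> Dx; rewrite /xpatch patchE memNset// => -[]. Qed.

Let HE2 x y : ~ D2 y -> H (x, y) = 0.
Proof. by move=> Dx; rewrite /xpatch patchE memNset// => -[]. Qed.

Lemma measurable_slice1 x : D1 x -> measurable_fun D2 (h x).
Proof.
move=> Dx; have : measurable_fun setT (fun y : mR => H (x, y)).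
  by have /measurable_EFinP := mH; move/(measurableT_comp); apply.
move/(@measurable_funTS _ _ _ _ D2); apply: eq_measurable_fun => y /set_mem Dy.
exact: HE.
Qed.

Let intH1 x : D1 x ->
  (\int[mu]_y (H (x, y))%:E = \int[mu]_(y in D2) (h x y)%:E)%E.
Proof.
move=> Dx; rewrite [RHS]integral_mkcond; apply: eq_integral => y _.
rewrite patchE; case: ifPn => [/set_mem|/negP]/= Dy; first by rewrite HE.
by rewrite HE2// => /mem_set.
Qed.

Lemma measurable_Rintegral_slice :
  measurable_fun D1 (fun x => \int[mu]_(y in D2) h x y).
Proof.
have mF : measurable_fun setT (fun x : mR => \int[mu]_y (H (x, y))%:E)%E.
  rewrite (_ : (fun x => _) = (fun x => \int[mu]_y (EFin \o H)^\+ (x, y) -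
    \int[mu]_y (EFin \o H)^\- (x, y))%E); last first.
    apply/funext => x.
    have -> : (fun y : mR => (H (x, y))%:E) = (EFin \o H) \o pair x by [].
    rewrite [LHS]integralE.
    under eq_integral do rewrite funepos_comp/=.
    by under [X in (_ - X)%E = _]eq_integral do rewrite funeneg_comp/=.
  by apply: emeasurable_funB; apply: measurable_fun_fubini_tonelli_F => //;
    [exact: measurable_funepos|exact: measurable_funeneg].
have : measurable_fun D1 (fun x : mR => fine (\int[mu]_y (H (x, y))%:E))%E.
  by apply: measurable_funTS; apply: measurableT_comp mF; exact: fine_measurable.
by apply: eq_measurable_fun => x /set_mem Dx; rewrite intH1.
Qed.

Lemma integral_norm_xpatch : (\int[mu]_x \int[mu]_y `|xpatch D1 D2 h (x, y)|%:E =
  \int[mu]_(x in D1) \int[mu]_(y in D2) `|h x y|%:E)%E.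
Proof.
rewrite [RHS]integral_mkcond; apply: eq_integral => x _; rewrite patchE.
case: ifPn => [/set_mem|/negP] Dx; last first.
  by rewrite integral0_eq// => y _; rewrite /= HE1 ?normr0// => /mem_set.
rewrite [RHS]integral_mkcond; apply: eq_integral => y _.
rewrite patchE; case: ifPn => [/set_mem|/negP]/= Dy; first by rewrite HE.
by rewrite HE2 ?normr0// => /mem_set.
Qed.

(** Tonelli's criterion from a bound of the slices that holds only for almost every [x], as do
    bounds in L_p(0, T; L_2). *)
Lemma dominated_slices (K : R -> R) : summable_on D1 K ->
  {ae mu, forall x, D1 x ->
    (\int[mu]_(y in D2) `|h x y|%:E <= (K x)%:E)%E} ->
  (\int[mu]_(x in D1) \int[mu]_(y in D2) `|h x y|%:E < +oo)%E.
Proof.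
move=> /integrableP[mK fK] hK; apply: le_lt_trans fK.
apply: ae_ge0_le_integral => //.
- by move=> x _; apply: integral_ge0 => y _; rewrite lee_fin.
- have mF : measurable_fun D1 (fun x : mR => \int[mu]_y `|H (x, y)|%:E)%E.
    apply: measurable_funTS.
    apply: (measurable_fun_fubini_tonelli_F (abse \o (EFin \o H))).
      exact: measurableT_comp.
    by move=> z; exact: abse_ge0.
  apply: eq_measurable_fun mF => x /set_mem Dx.
  rewrite [RHS]integral_mkcond; apply: eq_integral => y _.
  rewrite patchE; case: ifPn => [/set_mem|/negP]/= Dy; first by rewrite HE.
  by rewrite HE2 ?normr0// => /mem_set.
- exact: measurableT_comp.
- apply: aeS hK => x + Dx => /(_ Dx) /le_trans; apply.
  by rewrite lee_fin ler_norm.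
Qed.

Hypothesis fin : (\int[mu]_(x in D1) \int[mu]_(y in D2) `|h x y|%:E < +oo)%E.

Lemma integrable_xpatch : (mu \x mu)%E.-integrable setT (EFin \o xpatch D1 D2 h).
Proof.
apply/integrable12ltyP => //; apply: le_lt_trans fin.
by rewrite integral_norm_xpatch.
Qed.

Let ifin1 : mu.-integrable setT (fun x : mR => \int[mu]_y (H (x, y))%:E)%E.
Proof. exact: (integrable_fubini_F integrable_xpatch). Qed.

(** Inner integrals are finite for almost every [x], so that passing to real values by [fine]
    changes the iterated integral on a null set only. *)
Let aefin1 : {ae mu, forall x, D1 x ->
  (\int[mu]_(y in D2) h x y)%:E = (\int[mu]_(y in D2) (h x y)%:E)%E}.
Proof.
apply: aeS (integrable_ae measurableT ifin1) => x /(_ I) + Dx.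
by rewrite intH1// => /fineK.
Qed.

Let eqD1 : (\int[mu]_(x in D1) (\int[mu]_(y in D2) h x y)%:E =
  \int[mu]_x \int[mu]_y (H (x, y))%:E)%E.
Proof.
transitivity (\int[mu]_(x in D1) \int[mu]_y (H (x, y))%:E)%E.
  apply: ae_eq_integral => //.
  - apply/measurable_EFinP; exact: measurable_Rintegral_slice.
  - apply: measurable_funTS; exact: measurable_int ifin1.
  - by apply: aeS aefin1 => x + Dx => ->//; rewrite intH1.
rewrite [LHS]integral_mkcond; apply: eq_integral => x _.
rewrite patchE; case: ifPn => // /negP Dx; apply/esym/integral0_eq => y _.
by rewrite HE1// => /mem_set.
Qed.

Lemma summable_Rintegral : summable_on D1 (fun x => \int[mu]_(y in D2) h x y).
Proof.
have : mu.-integrable D1 (fun x : mR => \int[mu]_y (H (x, y))%:E)%E.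
  exact: integrableS ifin1.
move/integrableP => [mF fF]; apply/integrableP; split.
  apply/measurable_EFinP; exact: measurable_Rintegral_slice.
apply: le_lt_trans fF; rewrite le_eqVlt; apply/orP; left; apply/eqP.
apply: ae_eq_integral => //.
- apply: measurableT_comp => //; apply/measurable_EFinP.
  exact: measurable_Rintegral_slice.
- exact: measurableT_comp.
- by apply: aeS aefin1 => x hx Dx; rewrite /comp (hx Dx) intH1.
Qed.

Lemma ae_summable_slice : {ae mu, forall x, D1 x -> summable_on D2 (h x)}.
Proof.
apply: aeS (ae_integrable1 integrable_xpatch) => x + Dx.
move/(integrableS measurableT mD2 (@subsetT _ _)).
by apply: eq_integrable => // y /set_mem Dy /=; rewrite HE.
Qed.

Lemma Rintegral_xpatch : \int[mu]_(x in D1) \int[mu]_(y in D2) h x y =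
  fine (\int[mu]_x \int[mu]_y (xpatch D1 D2 h (x, y))%:E)%E.
Proof. by congr fine. Qed.

End fixed.

Lemma xpatch_flip D1 D2 h x y :
  xpatch D2 D1 (fun y x => h x y) (y, x) = xpatch D1 D2 h (x, y).
Proof.
rewrite /xpatch !patchE; congr (if _ then _ else _).
by apply/idP/idP => /set_mem[? ?]; exact/mem_set.
Qed.

(** The two additional clauses make the swapped inner integral usable: [Rintegral] is linear only on
    summable slices. *)
Lemma RFubini D1 D2 (h : R -> R -> R) : measurable D1 -> measurable D2 ->
  measurable_fun (D1 `*` D2 : set (mR * mR)) (fun q => h q.1 q.2) ->
  (\int[mu]_(x in D1) \int[mu]_(y in D2) `|h x y|%:E < +oo)%E ->
  \int[mu]_(x in D1) \int[mu]_(y in D2) h x y =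
  \int[mu]_(y in D2) \int[mu]_(x in D1) h x y
  /\ summable_on D2 (fun y => \int[mu]_(x in D1) h x y)
  /\ {ae mu, forall y, D2 y -> summable_on D1 (h ^~ y)}.
Proof.
move=> mD1 mD2 mh fin; have iH := integrable_xpatch mD1 mD2 mh fin.
have mh' : measurable_fun (D2 `*` D1 : set (mR * mR)) (fun q => h q.2 q.1).
  apply: (measurable_comp (F := D1 `*` D2) (f := fun q : mR * mR => h q.1 q.2)
    (g := fun q : mR * mR => (q.2, q.1))) => //.
  - exact: measurableX.
  - by move=> _ [[x y] [/= ? ?] <-].
  - by apply: measurable_funTS; exact: measurable_swap.
have fin' : (\int[mu]_(y in D2) \int[mu]_(x in D1) `|h x y|%:E < +oo)%E.
  rewrite -(integral_norm_xpatch D2 D1 (fun y x => h x y)).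
  under eq_integral do under eq_integral do rewrite xpatch_flip.
  have [+ _] := @integrable21ltyP _ _ _ _ R mu mu (EFin \o xpatch D1 D2 h)
    (measurable_int _ iH).
  exact.
split; last first.
  split; first exact: (summable_Rintegral mD2 mD1 mh').
  exact: (ae_summable_slice mD2 mD1 mh').
rewrite (Rintegral_xpatch mD1 mD2 mh fin) (Rintegral_xpatch mD2 mD1 mh' fin').
congr fine; under [RHS]eq_integral do under eq_integral do rewrite xpatch_flip.
exact: (Fubini iH).
Qed.

Section triangle.
Variables (a b : R) (f w : R -> R).
Hypotheses (sf : summable_on `]a, b[ f) (sw : summable_on `]a, b[ w).
Local Notation D := (`]a, b[%classic : set mR).

Let mD : measurable D. Proof. exact: measurable_itv. Qed.

Let h x y := if x < y then f x * w y else 0.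

Let mh : measurable_fun (D `*` D : set (mR * mR)) (fun q => h q.1 q.2).
Proof.
have m1 : measurable_fun (D `*` D : set (mR * mR)) (fun q => f q.1).
  apply: (measurable_comp (F := D) (f := f) (g := @fst mR mR)) => //.
  - by move=> _ [[x y] [/= ? ?] <-].
  - exact: summable_meas.
  - apply: measurable_funTS; exact: measurable_fst.
have m2 : measurable_fun (D `*` D : set (mR * mR)) (fun q => w q.2).
  apply: (measurable_comp (F := D) (f := w) (g := @snd mR mR)) => //.
  - by move=> _ [[x y] [/= ? ?] <-].
  - exact: summable_meas.
  - apply: measurable_funTS; exact: measurable_snd.
apply: measurable_fun_if => //.
- exact: measurableX.
- apply: measurable_fun_ltr; apply: measurable_funTS; [exact: measurable_fst|exact: measurable_snd].
- by apply: measurable_funS (measurable_funM m1 m2); [exact: measurableX|move=> ? []].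
Qed.

Let fin : (\int[mu]_(x in D) \int[mu]_(y in D) `|h x y|%:E < +oo)%E.
Proof.
apply: (dominated_slices mD mD mh (K := fun x => `|f x| * \int[mu]_(y in D) `|w y|)).
  have := summableZ mD (\int[mu]_(y in D) `|w y|) (summable_norm sf).
  by apply: eq_summable => // x _; rewrite mulrC.
apply: aeT => x Dx; rewrite EFinM.
have -> : (\int[mu]_(y in D) `|w y|)%:E = (\int[mu]_(y in D) `|w y|%:E)%E.
  by rewrite fineK//; exact: integrable_fin_num (summable_norm sw).
have mw : measurable_fun D (fun y => `|w y|%:E).
  exact: measurable_int (summable_norm sw).
rewrite -(@ge0_integralZl _ _ _ mu D mD (fun y => `|w y|%:E)%E mw)//.
apply: ge0_le_integral => //.
- apply/measurable_EFinP; apply: measurableT_comp => //.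
  exact: measurable_slice1 mh _ Dx.
- exact: measurable_funeM.
move=> y _; rewrite -EFinM lee_fin /h; case: ifP => _; rewrite ?normrM// normr0.
exact: mulr_ge0.
Qed.

Lemma primitiveM_slice y : y \in `]a, b[ ->
  \int[mu]_(x in D) h x y = (\int[mu]_(x in `]a, y[) f x) * w y.
Proof.
rewrite in_itv/= => /andP[ay yb].
rewrite -RintegralZr//; last first.
  apply: integrableS sf => //; apply: subset_itvl; rewrite bnd_simp; exact: ltW.
rewrite [LHS]Rintegral_mkcond [RHS]Rintegral_mkcond.
apply: eq_Rintegral => x _.
rewrite !patchE !mem_setE !in_itv/= /h.
by case: (ltP x y) => [xy|]; rewrite ?andbF ?andbT ?(lt_trans xy yb) ?andbT//; case: ifP.
Qed.

Lemma summable_primitiveM :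
  summable_on `]a, b[ (fun y => (\int[mu]_(x in `]a, y[) f x) * w y).
Proof.
have [_ [+ _]] := RFubini mD mD mh fin.
by apply: eq_summable => // y Dy; exact: primitiveM_slice.
Qed.

(** Fubini on the triangle [x < y]. When [w] is the derivative of a function that vanishes at [b],
    this is integration by parts for the primitive of a function that is merely summable. *)
Lemma Rintegral_triangle :
  \int[mu]_(y in `]a, b[) ((\int[mu]_(x in `]a, y[) f x) * w y) =
  \int[mu]_(x in `]a, b[) (f x * \int[mu]_(y in `]x, b[) w y).
Proof.
have [E _] := RFubini mD mD mh fin.
transitivity (\int[mu]_(y in D) \int[mu]_(x in D) h x y); last first.
  rewrite -E; apply: eq_Rintegral => x /set_mem/=; rewrite in_itv/= => /andP[ax xb].
  rewrite -RintegralZl//; last first.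
    apply: integrableS sw => //; apply: subset_itvr; rewrite bnd_simp; exact: ltW.
  rewrite [LHS]Rintegral_mkcond [RHS]Rintegral_mkcond.
  apply: eq_Rintegral => y _.
  rewrite !patchE !mem_setE !in_itv/= /h.
  by case: (ltP x y) => [xy|]; rewrite ?andbF ?(lt_trans ax xy)//; case: ifP.
by apply: eq_Rintegral => y /set_mem Dy; rewrite primitiveM_slice.
Qed.

End triangle.

End Fubini_real.

(** * Smooth functions and test functions *)

Section Smooth_functions.
Context {R : realType}.
Local Notation mu := (@lebesgue_measure R).
Local Notation mR := (measurableTypeR R).
Implicit Types (f g phi psi : R -> R).

Definition smooth f := forall n x, derivable (derive1n n f) x 1.

(** Finite order of differentiability, by recursion on the function instead of iteration of the
    derivative; products and affine substitutions are then treated by induction on the order. *)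
Fixpoint Ck (n : nat) f : Prop :=
  (forall x, derivable f x 1) /\ if n is m.+1 then Ck m (derive1 f) else True.

Lemma CkS n f : Ck n.+1 f -> Ck n f.
Proof.
elim: n f => [|n IH] f [df Cf]; split=> //; exact: IH.
Qed.

Lemma smoothP f : smooth f <-> forall n, Ck n f.
Proof.
split=> [sf n|Cf n x].
  have {}sf : forall m, (m <= n)%N -> forall x, derivable (derive1n m f) x 1.
    by move=> m _; exact: sf.
  elim: n f sf => [|n IH] f sf /=; first by split=> //; exact: (sf 0%N).
  split; first exact: (sf 0%N).
  apply: IH => m mn x; have := sf m.+1 mn x.
  by rewrite /derive1n iterSr.
elim: n f Cf => [|n IH] f Cf; first exact: (Cf 0%N).1.
rewrite /derive1n iterSr; apply: IH => m; exact: (Cf m.+1).2.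
Qed.

Lemma smooth_derive1 f : smooth f -> smooth (derive1 f).
Proof. by move=> sf n; have := sf n.+1; rewrite /derive1n iterSr. Qed.

Lemma is_derive_congr f g (x l l' : R) : f =1 g -> l = l' ->
  is_derive x 1 f l -> is_derive x 1 g l'.
Proof. by move=> /funext -> ->. Qed.

Lemma derive1_unique f (x l : R) : is_derive x 1 f l -> derive1 f x = l.
Proof. by move=> h; rewrite derive1E; exact: derive_val. Qed.

Lemma derivable_is_derive1 f (x : R) : derivable f x 1 -> is_derive x 1 f (derive1 f x).
Proof. by move=> h; rewrite derive1E; exact: derivableP. Qed.

Lemma smooth_continuous f : smooth f -> continuous f.
Proof.
move=> sf x; apply: differentiable_continuous; apply/derivable1_diffP.
exact: (sf 0%N).
Qed.

Lemma smooth_of_derive f f' : (forall x : R, is_derive x 1 f (f' x)) -> smooth f' ->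
  smooth f.
Proof.
move=> df sf' n.
have E : derive1 f = f' by apply/funext => x; exact: derive1_unique.
case: n => [|n] x; first exact: ex_derive.
by rewrite /derive1n iterSr E; exact: sf'.
Qed.

Lemma CkD n f g : Ck n f -> Ck n g -> Ck n (fun x => f x + g x).
Proof.
elim: n f g => [|n IH] f g [df Cf] [dg Cg].
  by split=> // x; exact: (@derivableD _ _ _ f g).
split.
  by move=> x; exact: (@derivableD _ _ _ f g).
have -> : derive1 (fun x => f x + g x) = fun x => derive1 f x + derive1 g x.
  apply/funext => x; apply: derive1_unique; apply: is_deriveD;
  exact: derivable_is_derive1.
exact: IH.
Qed.

Lemma CkM n f g : Ck n f -> Ck n g -> Ck n (fun x => f x * g x).
Proof.
elim: n f g => [|n IH] f g Cf Cg.
  by case: Cf Cg => df _ [dg _]; split=> // x; exact: (@derivableM _ _ f g).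
case: (Cf) (Cg) => df Cf' [dg Cg']; split; first by move=> x; exact: (@derivableM _ _ f g).
have -> : derive1 (fun x => f x * g x) =
    fun x => derive1 f x * g x + f x * derive1 g x.
  apply/funext => x; apply: derive1_unique.
  have h1 := derivable_is_derive1 (df x); have h2 := derivable_is_derive1 (dg x).
  have := is_deriveM h1 h2; rewrite /GRing.scale/= addrC.
  by rewrite [g x * _]mulrC.
by apply: CkD; apply: IH => //; exact: CkS.
Qed.

Lemma Ck_cst n c : Ck n (fun=> c : R).
Proof.
elim: n c => [|n IH] c; split=> //.
have -> : derive1 (fun=> c : R) = fun=> 0; last exact: IH.
by apply/funext => x; apply: derive1_unique; exact: is_derive_cst.
Qed.

Lemma smooth_cst c : smooth (fun=> c).
Proof. by apply/smoothP => n; exact: Ck_cst. Qed.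

Lemma smoothD f g : smooth f -> smooth g -> smooth (fun x => f x + g x).
Proof. by move=> /smoothP Cf /smoothP Cg; apply/smoothP => n; exact: CkD. Qed.

Lemma smoothM f g : smooth f -> smooth g -> smooth (fun x => f x * g x).
Proof. by move=> /smoothP Cf /smoothP Cg; apply/smoothP => n; exact: CkM. Qed.

Lemma smoothZ c f : smooth f -> smooth (fun x => c * f x).
Proof. by apply: smoothM; exact: smooth_cst. Qed.

Lemma smoothB f g : smooth f -> smooth g -> smooth (fun x => f x - g x).
Proof.
move=> sf sg; have -> : (fun x => f x - g x) = (fun x => f x + (-1) * g x).
  by apply/funext => x; rewrite mulN1r.
by apply: smoothD => //; exact: smoothZ.
Qed.

Lemma is_derive_affine (a b x : R) : is_derive x 1 (fun x => a * x + b) a.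
Proof.
have := is_deriveD (is_deriveZ a (is_derive_id x 1)) (is_derive_cst b x 1).
by rewrite addr0 [a%:A]mulr1.
Qed.

Lemma smooth_affine a b : smooth (fun x => a * x + b).
Proof.
by apply: (smooth_of_derive (fun x => is_derive_affine a b x)); exact: smooth_cst.
Qed.

Lemma is_derive_comp_affine f (a b x l : R) : is_derive (a * x + b) 1 f l ->
  is_derive x 1 (fun x => f (a * x + b)) (a * l).
Proof.
move=> h; have := @is_derive1_comp _ f (fun x => a * x + b) x _ _ h (is_derive_affine a b x).
by rewrite mulrC.
Qed.

Lemma smooth_comp_affine f a b : smooth f -> smooth (fun x => f (a * x + b)).
Proof.
move=> /smoothP Cf; apply/smoothP => n; move: (Cf n) => {Cf}.
elim: n f => [|n IH] f [df Cf].
  split=> // x; have := is_derive_comp_affine (derivable_is_derive1 (df (a * x + b))).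
  by move=> ?; exact: ex_derive.
split; first move=> x.
  have := is_derive_comp_affine (derivable_is_derive1 (df (a * x + b))).
  by move=> ?; exact: ex_derive.
have -> : derive1 (fun x => f (a * x + b)) = fun x => a * derive1 f (a * x + b).
  apply/funext => x; apply: derive1_unique; apply: is_derive_comp_affine.
  exact: derivable_is_derive1.
apply: (@CkM n (fun=> a)); last exact: IH.
exact: Ck_cst.
Qed.

(** The difference quotient is at most C|h|. This settles the point 0, where the two branches of
    [flat] meet. *)
Lemma is_derive_quadratic f (C x : R) : f x = 0 ->
  (forall y, `|f y| <= C * (y - x) ^+ 2) -> is_derive x 1 f 0.
Proof.
move=> fx fC.
have C0 : 0 <= C.
  by have := fC (x + 1); rewrite addrAC subrr add0r expr1n mulr1; apply: le_trans.
have L : h^-1 *: (f (h *: 1 + x) - f x) @[h --> 0^'] --> (0 : R).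
  apply/cvgr0Pnorm_lt => e e0; near=> h.
  have h0 : h != 0 by near: h; exact: nbhs_dnbhs_neq.
  rewrite fx subr0 normrM normfV ltr_pdivrMl ?normr_gt0//.
  apply: le_lt_trans (fC _) _; rewrite [h *: 1]mulr1 addrK.
  rewrite -real_normK ?num_real// expr2 mulrA mulrC ltr_pM2l ?normr_gt0//.
  apply: le_lt_trans (_ : (C + 1) * `|h| < e); first by rewrite ler_wpM2r// lerDl.
  rewrite -ltr_pdivlMl ?ltr_wpDl//; near: h.
  apply: dnbhs0_lt; by rewrite mulr_gt0// invr_gt0 ltr_wpDl.
apply: DeriveDef; first by apply/cvg_ex; exists 0.
exact: cvg_lim.
Unshelve. all: by end_near. Qed.

Section flat.

(** The functions x^(-m) exp(-1/x), extended by 0. The power [m] makes the family closed under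
    differentiation up to linear combinations, and smoothness follows by one induction for all
    [m]. *)
Definition flat (m : nat) (x : R) : R :=
  if 0 < x then x^-1 ^+ m * expR (- x^-1) else 0.

(** One term of the exponential series suffices: exp(1/x) is at least x^(-m-2)/(m+2)!. *)
Lemma flat_le m x : 0 <= flat m x <= (m.+2)`!%:R * x ^+ 2.
Proof.
rewrite /flat; case: ltP => x0; last by rewrite lexx mulr_ge0 ?sqr_ge0.
have ix0 : 0 < x^-1 by rewrite invr_gt0.
apply/andP; split.
  by rewrite mulr_ge0// ?expR_ge0// exprn_ge0// ltW.
have := @expR_ge1Dxn R x^-1 m.+1 (ltW ix0).
rewrite expRN => h; rewrite ler_pdivrMr ?expR_gt0//.
have f0 : (0 : R) < (m.+2)`!%:R by rewrite ltr0n fact_gt0.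
apply: le_trans (_ : (m.+2)`!%:R * x ^+ 2 * (x^-1 ^+ m.+2 / (m.+2)`!%:R) <= _).
  rewrite le_eqVlt; apply/orP; left; apply/eqP.
  rewrite -addn2 exprD; have x20 : x ^+ 2 != 0 by rewrite expf_neq0// gt_eqF.
  rewrite [x^-1 ^+ 2]exprVn; move: (x^-1 ^+ m) (x ^+ 2) x20 f0 => y z z0.
  rewrite addn2; move: ((m.+2)`!%:R) => w w0; field.
  by rewrite z0 gt_eqF.
rewrite ler_wpM2l//; first by rewrite mulr_ge0 ?sqr_ge0.
by apply: le_trans h; rewrite lerDr.
Qed.

Lemma is_derive_flat m (x : R) :
  is_derive x 1 (flat m) (- m%:R * flat m.+1 x + flat m.+2 x).
Proof.
have [x0|x0|->] := ltgtP x 0.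
- have E : \near x, flat m x = 0.
    near=> y; rewrite /flat ltNge; suff -> : y <= 0 by [].
    by apply: ltW; near: y; exact: lt_nbhsl.
  have -> : - m%:R * flat m.+1 x + flat m.+2 x = 0.
    by rewrite /flat ltNge (ltW x0) mulr0 addr0.
  apply: (near_eq_is_derive _ (is_derive_cst (0 : R) x 1)).
  by apply: filterS E => y ->.
- have E : \near x, flat m x = x^-1 ^+ m * expR (- x^-1).
    near=> y; rewrite /flat; suff -> : 0 < y by [].
    by near: y; exact: lt_nbhsr.
  have xn0 : x != 0 by rewrite gt_eqF.
  have dV := is_deriveV xn0 (is_derive_id x 1).
  have dm : is_derive x 1 (fun y : R => y^-1 ^+ m) (- m%:R * x^-1 ^+ m.+1).
    apply: is_derive_congr (is_deriveX m dV) => [y|].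
      elim: (m) => [|k IH]; first by rewrite !expr0.
      by rewrite exprS [RHS]exprS -IH.
    rewrite /GRing.scale/= mulr1 -exprVn; case: m {E} => [|k].
      by rewrite mulr0n oppr0 !mul0r.
    by rewrite /= !exprS; ring.
  have de : is_derive x 1 (fun y : R => expR (- y^-1)) (expR (- x^-1) * x^-1 ^+ 2).
    have dN : is_derive x 1 (fun y : R => - y^-1) (x^-1 ^+ 2).
      apply: is_derive_congr (is_deriveN dV) => [y//|].
      by rewrite [_%:A]mulr1 opprK exprVn.
    exact: (@is_derive1_comp _ expR (fun y : R => - y^-1) _ _ _
      (is_derive_expR _) dN).
  have dP : is_derive x 1 (fun y : R => y^-1 ^+ m * expR (- y^-1))
      (- m%:R * flat m.+1 x + flat m.+2 x).
    apply: is_derive_congr (is_deriveM dm de) => [y//|].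
    by rewrite /flat x0 /GRing.scale/= !exprS; ring.
  apply: near_eq_is_derive dP.
  by apply: filterS E => y ->.
have -> : - m%:R * flat m.+1 0 + flat m.+2 0 = 0.
  by rewrite /flat ltxx mulr0 addr0.
apply: (@is_derive_quadratic _ (m.+2)`!%:R); first by rewrite /flat ltxx.
move=> y; have /andP[f0 fle] := flat_le m y.
by rewrite ger0_norm// subr0.
Unshelve. all: by end_near. Qed.

Lemma smooth_flat m : smooth (flat m).
Proof.
apply/smoothP => n; elim: n m => [|n IH] m.
  by split=> // x; have := is_derive_flat m x => ?; exact: ex_derive.
split; first by move=> x; have := is_derive_flat m x => ?; exact: ex_derive.
have -> : derive1 (flat m) = fun x => - m%:R * flat m.+1 x + flat m.+2 x.
  by apply/funext => x; apply: derive1_unique; exact: is_derive_flat.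
apply: CkD => //; apply: (@CkM n (fun=> - m%:R)) => //.
exact: Ck_cst.
Qed.

Lemma flat0_bound x : 0 <= flat 0 x <= 1.
Proof.
rewrite /flat; case: ifPn => x0; last by rewrite lexx ler01.
by rewrite expr0 mul1r expR_ge0/= expR_le1 oppr_le0 invr_ge0 ltW.
Qed.

Lemma flat0_ge x : 0 < x -> 1 - x^-1 <= flat 0 x.
Proof. by move=> x0; rewrite /flat x0 expr0 mul1r expR_ge1Dx. Qed.

Lemma flat0_le0 m x : x <= 0 -> flat m x = 0.
Proof. by move=> x0; rewrite /flat ltNge x0. Qed.

End flat.

Lemma test_functionP a b phi : test_function a b phi <-> smooth phi /\
  exists c d, [/\ a < c, d < b & forall x, x \notin `[c, d] -> phi x = 0].
Proof. by []. Qed.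

Lemma derive1_eq0_out (c d : R) phi : smooth phi ->
  (forall x, x \notin `[c, d] -> phi x = 0) ->
  forall x, x \notin `[c, d] -> derive1 phi x = 0.
Proof.
move=> sphi h x xcd; apply: derive1_unique.
apply: (near_eq_is_derive _ (is_derive_cst (0 : R) x 1)).
move: xcd; rewrite in_itv/= negb_and -!ltNge => /orP[xc|dx].
  near=> y; rewrite h// in_itv/= negb_and -!ltNge; apply/orP; left.
  by near: y; exact: lt_nbhsl.
near=> y; rewrite h// in_itv/= negb_and -!ltNge; apply/orP; right.
by near: y; exact: lt_nbhsr.
Unshelve. all: by end_near. Qed.

Lemma test_derive1 a b phi : test_function a b phi -> test_function a b (derive1 phi).
Proof.
move=> [sphi [c [d [ac db h]]]]; split; first exact: smooth_derive1.
by exists c, d; split=> //; exact: derive1_eq0_out.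
Qed.

Lemma test_derive1n k a b phi :
  test_function a b phi -> test_function a b (derive1n k phi).
Proof.
by move=> h; elim: k => [//|k IH]; rewrite derive1nS; exact: test_derive1.
Qed.

Lemma test_smoothM a b f phi : smooth f -> test_function a b phi ->
  test_function a b (fun x => f x * phi x).
Proof.
move=> sf [sphi [c [d [ac db h]]]]; split; first exact: smoothM.
by exists c, d; split=> // x xcd; rewrite h// mulr0.
Qed.

Lemma testZ a b c phi : test_function a b phi ->
  test_function a b (fun x => c * phi x).
Proof. by apply: test_smoothM; exact: smooth_cst. Qed.

Lemma testB a b phi psi : test_function a b phi -> test_function a b psi ->
  test_function a b (fun x => phi x - psi x).
Proof.
move=> [sphi [c [d [ac db h]]]] [spsi [c' [d' [ac' db' h']]]].
split; first exact: smoothB.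
exists (Num.min c c'), (Num.max d d'); split.
- by rewrite lt_min ac.
- by rewrite gt_max db.
move=> x; rewrite in_itv/= negb_and -!ltNge lt_min gt_max => xout.
rewrite h ?h' ?subrr// in_itv/= negb_and -!ltNge.
  by case/orP : xout => /andP[xc xc']; rewrite ?xc ?xc' ?orbT.
by case/orP : xout => /andP[xc xc']; rewrite ?xc ?xc' ?orbT.
Qed.

(** Smooth approximation of the indicator of ]c, d[. The factor [n.+1] steepens the profile, the
    shift by 1 keeps the support at distance 1/(n+1) from the end points. For small [n] the
    supporting interval may be empty, and the function is then zero. *)
Definition bump (c d : R) (n : nat) (x : R) : R :=
  flat 0 (n.+1%:R * (x - c) - 1) * flat 0 (n.+1%:R * (d - x) - 1).

Lemma test_bump a b c d n : a <= c -> d <= b -> test_function a b (bump c d n).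
Proof.
move=> ac db; have n0 : 0 < (n.+1%:R)^-1 :> R by rewrite invr_gt0 ltr0n.
split.
  apply: smoothM.
    have -> : (fun x => flat 0 (n.+1%:R * (x - c) - 1)) =
        (fun x => flat 0 (n.+1%:R * x + (- n.+1%:R * c - 1))).
      by apply/funext => x; congr (flat _ _); ring.
    exact/smooth_comp_affine/smooth_flat.
  have -> : (fun x => flat 0 (n.+1%:R * (d - x) - 1)) =
      (fun x => flat 0 (- n.+1%:R * x + (n.+1%:R * d - 1))).
    by apply/funext => x; congr (flat _ _); ring.
  exact/smooth_comp_affine/smooth_flat.
exists (c + n.+1%:R^-1), (d - n.+1%:R^-1); split.
- by rewrite (le_lt_trans ac)// ltrDl.
- by rewrite (lt_le_trans _ db)// ltrBlDr ltrDl.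
move=> x; rewrite in_itv/= negb_and -!ltNge /bump => /orP[h|h].
  rewrite flat0_le0 ?mul0r// subr_le0 -ler_pdivlMl ?ltr0n// mulr1.
  by rewrite lerBlDr addrC ltW.
rewrite [X in _ * X]flat0_le0 ?mulr0// subr_le0 -ler_pdivlMl ?ltr0n// mulr1.
by rewrite lerBlDr -lerBlDl ltW.
Qed.

Lemma bump_bound c d n x : 0 <= bump c d n x <= 1.
Proof.
rewrite /bump; have /andP[? ?] := flat0_bound (n.+1%:R * (x - c) - 1).
have /andP[? ?] := flat0_bound (n.+1%:R * (d - x) - 1).
by rewrite mulr_ge0//= mulr_ile1.
Qed.

Lemma bump_out c d n x : x \notin `]c, d[ -> bump c d n x = 0.
Proof.
rewrite in_itv/= negb_and -!leNgt /bump => /orP[h|h].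
  rewrite flat0_le0 ?mul0r// subr_le0 (@le_trans _ _ 0)//.
  by rewrite mulr_ge0_le0// subr_le0.
rewrite [X in _ * X]flat0_le0 ?mulr0// subr_le0 (@le_trans _ _ 0)//.
by rewrite mulr_ge0_le0// subr_le0.
Qed.

Lemma cvg_flat0 (r : R) : 0 < r -> flat 0 (n.+1%:R * r - 1) @[n --> \oo] --> (1 : R).
Proof.
move=> r0; apply/cvgrPdist_lt => e e0; near=> n.
have /andP[f0 f1] := flat0_bound (n.+1%:R * r - 1).
rewrite ger0_norm ?subr_ge0//.
have ie0 : 0 < 1 + e^-1 by rewrite addr_gt0// invr_gt0.
have h : 1 + e^-1 < n.+1%:R * r.
  rewrite -ltr_pdivrMr// (@lt_trans _ _ n%:R) ?ltr_nat//.
  by near: n; exact: nbhs_infty_gtr.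
have h0 : 0 < n.+1%:R * r - 1.
  by rewrite subr_gt0; apply: lt_trans h; rewrite ltrDl invr_gt0.
have := flat0_ge h0; rewrite lerBlDr -lerBlDl => /le_lt_trans; apply.
by rewrite invf_plt ?posrE// ltrBrDl.
Unshelve. all: by end_near. Qed.

Lemma cvg_bump c d x : bump c d n x @[n --> \oo] --> ((x \in `]c, d[)%:R : R).
Proof.
case: (boolP (x \in `]c, d[)) => [|xcd]; last first.
  rewrite (_ : (fun n => _) = cst 0); first exact: cvg_cst.
  by apply/funext => n; rewrite bump_out.
rewrite in_itv/= => /andP[cx xd].
rewrite /bump -[X in _ --> X](mulr1 1).
by apply: cvgM; apply: cvg_flat0; rewrite subr_gt0.
Qed.

End Smooth_functions.

(** * Weak derivatives and the lemma of du Bois-Reymond *)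

Section du_Bois_Reymond.
Context {R : realType}.
Local Notation mu := (@lebesgue_measure R).
Local Notation mR := (measurableTypeR R).
Implicit Types (f g phi psi : R -> R).

Lemma Rdominated_cvg (D : set mR) (f_ : nat -> R -> R) f g : measurable D ->
  (forall n, measurable_fun D (f_ n)) -> measurable_fun D f ->
  (forall x, D x -> f_ n x @[n --> \oo] --> f x) ->
  summable_on D g -> (forall n x, D x -> `|f_ n x| <= g x) ->
  \int[mu]_(x in D) f_ n x @[n --> \oo] --> \int[mu]_(x in D) f x.
Proof.
move=> mD mf_ mf cf sg fg.
have [] := @dominated_convergence _ _ _ mu D mD (fun n x => (f_ n x)%:E)
  (fun x => (f x)%:E) (fun x => (g x)%:E).
- by move=> n; apply/measurable_EFinP.
- exact/measurable_EFinP.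
- by apply: aeT => x Dx; apply/fine_cvgP; split; [near=> n|exact: cf].
- exact: sg.
- by apply: aeT => x n Dx; rewrite lee_fin fg.
move=> ifx _ h; apply: fine_cvg.
rewrite [X in _ --> X]fineK; first exact: h.
exact: integrable_fin_num ifx.
Unshelve. all: by end_near. Qed.

Lemma summable_sub_itv (a b c d : R) f : a <= c -> d <= b ->
  summable_on `]a, b[ f -> summable_on `]c, d[ f.
Proof.
move=> ac db; apply: integrableS => //.
by apply: subset_itv; rewrite bnd_simp.
Qed.

Lemma summable_restrict (D : set mR) f : measurable D -> summable_on D f ->
  summable_on setT (f \_ D).
Proof.
move=> mD; rewrite /summable_on (integrable_mkcond _ mD).
apply: eq_integrable => // x _ /=.
by rewrite !patchE; case: ifP.
Qed.

(** The primitive of the extension by zero vanishes identically, and by Lebesgue's differentiation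
    theorem its derivative is the function almost everywhere. *)
Lemma ae_eq0_itv (a b : R) g : a < b -> summable_on `]a, b[ g ->
  (forall c, a < c -> c <= b -> \int[mu]_(x in `]a, c[) g x = 0) ->
  {ae mu, forall x, x \in `]a, b[ -> g x = 0}.
Proof.
move=> ab sg g0.
have mD : measurable (`]a, b[%classic : set mR) by exact: measurable_itv.
set f := g \_ `]a, b[.
have sf : summable_on setT f by exact: summable_restrict.
have F0 x : \int[mu]_(t in `]-oo, x]) f t = 0.
  have [xa|ax] := leP x a.
    rewrite (@eq_Rintegral _ _ _ mu _ (cst 0)) ?Rintegral_cst ?mul0r// => t.
    rewrite /f patchE inE/= in_itv/= => tx.
    by rewrite memNset//= in_itv/= => /andP[+ _]; rewrite ltNge (le_trans tx xa).
  have [bx|xb] := leP b x.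
    rewrite -(g0 b ab (lexx b)) Rintegral_mkcond [RHS]Rintegral_mkcond.
    apply: eq_Rintegral => t _; rewrite /f !patchE !mem_setE !in_itv/=.
    case: (ltP t b) => tb; last by rewrite andbF; case: ifP.
    by rewrite (le_trans (ltW tb) bx).
  transitivity (\int[mu]_(t in `]a, x]) g t).
    rewrite Rintegral_mkcond [RHS]Rintegral_mkcond.
    apply: eq_Rintegral => t _; rewrite /f !patchE !mem_setE !in_itv/=.
    case: (leP t x) => tx; last by rewrite andbF.
    by rewrite (le_lt_trans tx xb) !andbT.
  rewrite -Rintegral_itv_bndo_bndc ?g0 ?ltW//.
  by apply: summable_sub_itv sg => //; exact: ltW.
have locf : locally_integrable [set: R] f.
  exact: integrable_locally.
have [] := @FTC1Ny R f _ locf => [y|]; first exact: integrableS sf.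
move=> N [mN N0 sN]; exists N; split=> //; apply: subset_trans sN => x /= h1 h2.
apply: h1; rewrite in_itv/= => /andP[ax xb].
have [_] := h2.
have -> : (fun x => \int[mu]_(t in [set` `]-oo, x]]) f t) = cst 0.
  by apply/funext => t; exact: F0.
rewrite (derive1_unique (is_derive_cst (0 : R) x 1)) /f patchE mem_set//=.
by rewrite in_itv/= ax.
Qed.

(* The fundamental lemma of the calculus of variations. *)
Lemma ae_eq0_test (a b : R) g : a < b -> summable_on `]a, b[ g ->
  (forall phi, test_function a b phi ->
     \int[mu]_(x in `]a, b[) (g x * phi x) = 0) ->
  {ae mu, forall x, x \in `]a, b[ -> g x = 0}.
Proof.
move=> ab sg g0; apply: ae_eq0_itv => // c ac cb.
have mD : measurable (`]a, b[%classic : set mR) by exact: measurable_itv.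
have mg := summable_meas sg.
have tb n : test_function a b (bump a c n) by exact: test_bump.
have : \int[mu]_(x in `]a, b[) (g x * bump a c n x) @[n --> \oo] -->
    \int[mu]_(x in `]a, b[) (g x * (x \in `]a, c[)%:R).
  apply: (@Rdominated_cvg _ _ _ (fun x => `|g x|)) => //.
  - move=> n; apply: measurable_funM => //; apply: measurable_funTS.
    by apply: continuous_measurable_fun; apply: smooth_continuous; case: (tb n).
  - apply: measurable_funM => //.
    apply: (eq_measurable_fun (\1_(`]a, c[%classic : set mR) : mR -> R)).
      by move=> x _; rewrite indicE mem_setE.
    exact: measurable_indic.
  - by move=> x _; apply: cvgMr; exact: cvg_bump.
  - exact: summable_norm.
  - move=> n x _; have /andP[? ?] := bump_bound a c n x.
    by rewrite normrM ler_piMr// ger0_norm.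
have -> : (fun n => \int[mu]_(x in `]a, b[) (g x * bump a c n x)) = cst 0.
  by apply/funext => n; exact: g0.
move/(cvg_unique (@Rhausdorff R)) => /(_ _ (cvg_cst _)) <-.
rewrite Rintegral_mkcond [RHS]Rintegral_mkcond; apply: eq_Rintegral => x _.
rewrite !patchE !mem_setE !in_itv/=.
case: (ltP x c) => xc; last by rewrite !andbF mulr0; case: ifP.
rewrite (lt_le_trans xc cb) andbT; case: ifP => _; by rewrite ?mulr1.
Qed.

(** Version of [weak_deriv] of order one without square integrability, for the scalar functions of
    time <z(t), w>. *)
Definition weak_derivative (a b : R) f g := forall phi, test_function a b phi ->
  \int[mu]_(x in `]a, b[) (f x * derive1 phi x) =
  - \int[mu]_(x in `]a, b[) (g x * phi x).

Lemma test_bounded (a b : R) phi : test_function a b phi ->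
  exists2 K, 0 <= K & forall x, `|phi x| <= K.
Proof.
move=> [sphi [c [d [ac db h]]]]; have [cd|dc] := leP c d; last first.
  (* The definition of a test function admits an empty supporting interval. *)
  exists 0 => // x; rewrite h ?normr0// in_itv/=.
  by apply/negP => /andP[/le_trans hcx /hcx]; rewrite leNgt dc.
have cphi : {within `[c, d], continuous (fun x => `|phi x|)}.
  apply: continuous_subspaceT => x; apply: continuous_comp; last exact: norm_continuous.
  exact: smooth_continuous.
have [m mcd hm] := EVT_max cd cphi; exists `|phi m| => // x.
by have [xcd|xcd] := boolP (x \in `[c, d]); [exact: hm|rewrite h// normr0].
Qed.

Lemma measurable_smooth (D : set mR) phi : smooth phi -> measurable_fun D phi.
Proof.
move=> sphi; apply: measurable_funTS; apply: continuous_measurable_fun.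
exact: smooth_continuous.
Qed.

Lemma summableM_bounded (D : set mR) f g (K : R) : measurable D ->
  summable_on D f -> measurable_fun D g -> (forall x, D x -> `|g x| <= K) ->
  summable_on D (fun x => f x * g x).
Proof.
move=> mD sf mg gK; apply: (summable_le mD _ (summableZ mD K sf)).
  by apply: measurable_funM => //; exact: summable_meas sf.
move=> x Dx; rewrite !normrM mulrC ler_wpM2r//.
by apply: le_trans (ler_norm _); exact: gK.
Qed.

Lemma summableM_test (a b : R) f phi : summable_on `]a, b[ f ->
  test_function a b phi -> summable_on `]a, b[ (fun x => f x * phi x).
Proof.
move=> sf tphi; have [K K0 hK] := test_bounded tphi.
apply: (@summableM_bounded _ _ _ K) => //; apply: measurable_smooth.
by case: tphi.
Qed.

Lemma summable_cst (a b : R) (c : R) : summable_on `]a, b[ (fun=> c).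
Proof.
apply/integrableP; split; first exact: measurable_cst.
rewrite integral_cst//= lebesgue_measure_itv/=; case: ifP => _.
  by rewrite -EFinD -EFinM ltry.
by rewrite mule0.
Qed.

Lemma summable_test (a b : R) phi : test_function a b phi ->
  summable_on `]a, b[ phi.
Proof.
move=> tphi; have := summableM_test (summable_cst a b 1) tphi.
by apply: eq_summable => // x _; rewrite mul1r.
Qed.

Lemma Rintegral_smooth_derive1 (x y : R) phi : smooth phi -> x < y ->
  \int[mu]_(t in `]x, y[) derive1 phi t = phi y - phi x.
Proof.
move=> sphi xy; have cd := smooth_continuous (smooth_derive1 sphi).
have ic : summable_on `[x, y] (derive1 phi).
  apply: continuous_compact_integrable; first exact: segment_compact.
  exact: continuous_subspaceT.
have := @continuous_FTC2 R (derive1 phi) phi x y xy.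
rewrite Rintegral_itv_obnd_cbnd ?Rintegral_itv_bndo_bndc; last 2 first.
- by apply: integrableS ic => //; apply: subset_itvl; rewrite bnd_simp.
- by apply: integrableS ic => //; apply: subset_itv; rewrite bnd_simp.
move=> h; rewrite /Rintegral h//; first exact: continuous_subspaceT.
split=> [z _||]; first exact: (sphi 0%N).
- apply: cvg_at_right_filter; exact: smooth_continuous.
- apply: cvg_at_left_filter; exact: smooth_continuous.
Qed.

(** The primitive from minus infinity vanishes to the left of the support of [psi], and to its right
    because the mean is zero. *)
Lemma test_primitive (a b : R) psi : test_function a b psi ->
  \int[mu]_(x in `]a, b[) psi x = 0 ->
  exists2 phi, test_function a b phi & derive1 phi = psi.
Proof.
move=> [spsi [c [d [ac db h]]]] int0.
have cpsi := smooth_continuous spsi.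
have sT : summable_on setT psi.
  have : summable_on `[c, d] psi.
    apply: continuous_compact_integrable; first exact: segment_compact.
    exact: continuous_subspaceT.
  move/(summable_restrict (measurable_itv _)); apply: eq_summable => // x _.
  by rewrite patchE mem_setE; case: ifPn => // /h ->.
pose phi x := \int[mu]_(t in `]-oo, x]) psi t.
have dphi (x : R) : is_derive x 1 phi (psi x).
  have [] := @continuous_FTC1 R psi -oo%O x (x + 1).
  - by rewrite ltrDl.
  - exact: integrableS sT.
  - by rewrite ltNyr.
  - exact: cpsi.
  by move=> d1 d2; have := derivable_is_derive1 d1; rewrite d2.
exists phi; last by apply/funext => x; exact: derive1_unique.
split; first exact: smooth_of_derive spsi.
exists c, d; split=> // x; rewrite in_itv/= negb_and -!ltNge => /orP[xc|dx].
  rewrite /phi (@eq_Rintegral _ _ _ mu _ (cst 0)) ?Rintegral_cst ?mul0r// => t.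
  rewrite inE/= in_itv/= => tx; rewrite h// in_itv/= negb_and -ltNge.
  by rewrite (le_lt_trans tx xc).
rewrite /phi -int0 Rintegral_mkcond [RHS]Rintegral_mkcond.
apply: eq_Rintegral => t _; rewrite !patchE !mem_setE.
have [tcd|/h ->] := boolP (t \in `[c, d]); last by case: ifP; case: ifP.
move: tcd; rewrite !in_itv/= => /andP[ct td].
by rewrite (le_trans td (ltW dx)) (lt_le_trans ac ct) (le_lt_trans td db).
Qed.

(** The integrals of the bumps tend to [b - a], so one of them is nonzero and can be normalised. *)
Lemma exists_unit_test (a b : R) : a < b -> exists2 chi,
  test_function a b chi & \int[mu]_(x in `]a, b[) chi x = 1.
Proof.
move=> ab.
suff [n n0] : exists n, \int[mu]_(x in `]a, b[) bump a b n x != 0.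
  exists (fun x => (\int[mu]_(x in `]a, b[) bump a b n x)^-1 * bump a b n x).
    by apply: testZ; exact: test_bump.
  rewrite RintegralZl ?mulVf//; apply: summable_test; exact: test_bump.
apply: contrapT => nex.
have : \int[mu]_(x in `]a, b[) bump a b n x @[n --> \oo] -->
    \int[mu]_(x in `]a, b[) (fun=> 1) x.
  apply: (@Rdominated_cvg _ _ _ (fun=> 1)) => //.
  - by move=> n; apply: measurable_smooth; case: (@test_bump _ a b a b n).
  - move=> x /= xab; have := @cvg_bump R a b x.
    by rewrite xab.
  - exact: summable_cst.
  - by move=> n x _; have /andP[? ?] := bump_bound a b n x; rewrite ger0_norm.
have -> : (fun n => \int[mu]_(x in `]a, b[) bump a b n x) = cst 0.
  apply/funext => n; apply: contrapT => /eqP n0; by apply: nex; exists n.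
move/(cvg_unique (@Rhausdorff R)) => /(_ _ (cvg_cst _)) /eqP.
rewrite Rintegral_cst// mul1r /= lebesgue_measure_itv/= lte_fin ab /= eq_sym.
by rewrite eq_sym subr_eq0 gt_eqF.
Qed.

Lemma summable_primitive (a b : R) g : summable_on `]a, b[ g ->
  summable_on `]a, b[ (fun y => \int[mu]_(x in `]a, y[) g x).
Proof.
move=> sg; have := summable_primitiveM sg (summable_cst a b 1).
by apply: eq_summable => // y _; rewrite mulr1.
Qed.

(** By Fubini on a triangle, the primitive of [g] has weak derivative [g]; the difference [H] then
    annihilates all derivatives of test functions, that is, all test functions of mean zero. It is
    therefore constant, and the constant is its mean against a unit test function [chi]. *)
Lemma weak_derivative_primitive (a b : R) f g : a < b ->
  summable_on `]a, b[ f -> summable_on `]a, b[ g -> weak_derivative a b f g ->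
  exists c, {ae mu, forall x, x \in `]a, b[ ->
    f x = c + \int[mu]_(t in `]a, x[) g t}.
Proof.
move=> ab sf sg fg; pose I x := \int[mu]_(t in `]a, x[) g t.
have sI : summable_on `]a, b[ I by exact: summable_primitive.
pose H x := f x - I x.
have sH : summable_on `]a, b[ H by exact: summableB.
have H0 phi : test_function a b phi ->
    \int[mu]_(x in `]a, b[) (H x * derive1 phi x) = 0.
  move=> tphi; have td := test_derive1 tphi.
  have -> : \int[mu]_(x in `]a, b[) (H x * derive1 phi x) =
      \int[mu]_(x in `]a, b[) (f x * derive1 phi x) -
      \int[mu]_(x in `]a, b[) (I x * derive1 phi x).
    rewrite -RintegralB//; [|exact: summableM_test..].
    by apply: eq_Rintegral => x _; rewrite mulrBl.
  rewrite fg// Rintegral_triangle//; last exact: summable_test.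
  apply/eqP; rewrite subr_eq0; apply/eqP.
  rewrite -mulN1r -RintegralZl//; last exact: summableM_test.
  apply: eq_Rintegral => x /set_mem/=; rewrite in_itv/= => /andP[ax xb].
  have [sphi [c [d [ac db h]]]] := tphi.
  rewrite Rintegral_smooth_derive1// (h b) ?sub0r; first by ring.
  by rewrite in_itv/= negb_and -[~~ (b <= d)]ltNge db orbT.
have [chi tchi chi1] := exists_unit_test ab.
pose c := \int[mu]_(x in `]a, b[) (H x * chi x); exists c.
have sHc : summable_on `]a, b[ (fun x => H x - c).
  apply: summableB => //; exact: summable_cst.
have : {ae mu, forall x, x \in `]a, b[ -> H x - c = 0}.
  apply: ae_eq0_test => // psi tpsi.
  (* Subtracting [m * chi] from [psi] leaves mean zero, so that [H0] applies to a primitive. *)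
  pose m := \int[mu]_(x in `]a, b[) psi x.
  have tm : test_function a b (fun x => psi x - m * chi x).
    by apply: testB => //; exact: testZ.
  have int0 : \int[mu]_(x in `]a, b[) (psi x - m * chi x) = 0.
    rewrite RintegralB//; [|exact: summable_test|by apply: summable_test; exact: testZ].
    by rewrite RintegralZl ?chi1 ?mulr1 ?subrr//; exact: summable_test.
  have [phi tphi dphi] := test_primitive tm int0.
  have := H0 _ tphi; rewrite dphi.
  have -> : \int[mu]_(x in `]a, b[) (H x * (psi x - m * chi x)) =
      \int[mu]_(x in `]a, b[) (H x * psi x) - m * c.
    rewrite -RintegralZl//; last exact: summableM_test.
    rewrite -RintegralB//; [|exact: summableM_test|].
      by apply: eq_Rintegral => x _; ring.
    apply: summableZ => //; exact: summableM_test.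
  move=> <-; rewrite mulrC /m -RintegralZl//; last exact: summable_test.
  rewrite -RintegralB//; [|exact: summableM_test|].
    by apply: eq_Rintegral => x _; rewrite mulrBl.
  apply: summableZ => //; exact: summable_test.
apply: aeS => x h xab; have := h xab; rewrite /H => /eqP.
by rewrite subr_eq0 subr_eq => /eqP.
Qed.

End du_Bois_Reymond.

(** * Scalar functions of time *)

Section Time_regularity.
Context {R : realType}.
Local Notation mu := (@lebesgue_measure R).
Local Notation mR := (measurableTypeR R).
Implicit Types (f g : R -> R) (s t r : R).

Definition cont_on (a b : R) f := {within `[a, b], continuous f}.

Lemma cont_onP (a b : R) f : cont_on a b f <->
  forall t, t \in `[a, b] -> forall e, 0 < e -> exists2 d, 0 < d &
    forall s, s \in `[a, b] -> `|s - t| < d -> `|f s - f t| < e.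
Proof.
split=> [/subspace_continuousP cf t tab e e0|h].
  have /cvgrPdist_lt/(_ e e0) := cf t tab.
  rewrite near_withinE => -[d /= d0 hd]; exists d => // s sab st.
  by rewrite distrC; apply: hd => //=; rewrite distrC.
apply/subspace_continuousP => t tab; apply/cvgrPdist_lt => e e0.
have [d d0 hd] := h t tab e e0; rewrite near_withinE.
exists d => //= s st sab; rewrite distrC; apply: hd => //.
by rewrite distrC.
Qed.

Lemma cont_onD a b f g : cont_on a b f -> cont_on a b g ->
  cont_on a b (fun x => f x + g x).
Proof. by move=> cf cg x; apply: cvgD; [exact: cf|exact: cg]. Qed.

Lemma cont_onM a b f g : cont_on a b f -> cont_on a b g ->
  cont_on a b (fun x => f x * g x).
Proof. by move=> cf cg x; apply: cvgM; [exact: cf|exact: cg]. Qed.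

Lemma cont_on_cst a b (c : R) : cont_on a b (fun=> c).
Proof. by move=> x; exact: cvg_cst. Qed.

Lemma cont_onZ a b c f : cont_on a b f -> cont_on a b (fun x => c * f x).
Proof. by apply: cont_onM; exact: cont_on_cst. Qed.

Lemma cont_onN a b f : cont_on a b f -> cont_on a b (fun x => - f x).
Proof. by move=> cf x; apply: cvgN; exact: cf. Qed.

Lemma cont_onB a b f g : cont_on a b f -> cont_on a b g ->
  cont_on a b (fun x => f x - g x).
Proof. by move=> cf cg; apply: cont_onD => //; exact: cont_onN. Qed.

Lemma cont_on_norm a b f : cont_on a b f -> cont_on a b (fun x => `|f x|).
Proof. by move=> cf x; apply: cvg_norm; exact: cf. Qed.

Lemma cont_on_sum a b (I : Type) (l : seq I) (F : I -> R -> R) :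
  (forall i, cont_on a b (F i)) -> cont_on a b (fun x => \sum_(i <- l) F i x).
Proof.
move=> cF; elim: l => [|i l IH].
  rewrite (_ : (fun x => _) = fun=> 0); first exact: cont_on_cst.
  by apply/funext => x; rewrite big_nil.
rewrite (_ : (fun x => _) = fun x => F i x + \sum_(j <- l) F j x).
  exact: cont_onD.
by apply/funext => x; rewrite big_cons.
Qed.

Lemma lipschitz_cont_on (a b K : R) f :
  (forall s r, s \in `[a, b] -> r \in `[a, b] -> `|f r - f s| <= K * `|r - s|) ->
  cont_on a b f.
Proof.
move=> fK; apply/cont_onP => t tab e e0.
have K0 : 0 < `|K| + 1 by rewrite ltr_wpDl.
exists (e / (`|K| + 1)); first by rewrite divr_gt0.
move=> s sab st; apply: le_lt_trans (fK _ _ tab sab) _.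
apply: le_lt_trans (_ : (`|K| + 1) * `|s - t| < _).
  by rewrite ler_wpM2r// (le_trans (ler_norm K))// lerDl.
by rewrite mulrC -ltr_pdivlMr.
Qed.

Lemma cont_on_bounded (a b : R) f : a <= b -> cont_on a b f ->
  exists2 K, 0 <= K & forall t, t \in `[a, b] -> `|f t| <= K.
Proof.
move=> ab /cont_on_norm cf; have [m mab hm] := EVT_max ab cf.
by exists `|f m|.
Qed.

Lemma cont_on_measurable (a b : R) f : cont_on a b f ->
  measurable_fun (`]a, b[%classic : set mR) f.
Proof.
move=> cf; have : measurable_fun (`[a, b]%classic : set mR) f.
  by apply: subspace_continuous_measurable_fun.
apply: measurable_funS => //.
exact: subset_itv_oo_cc.
Qed.

Lemma cont_on_summable (a b : R) f : a <= b -> cont_on a b f ->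
  summable_on `]a, b[ f.
Proof.
move=> ab cf; have [K K0 hK] := cont_on_bounded ab cf.
have := @summableM_bounded R `]a, b[ (fun=> 1) f K (measurable_itv _)
  (summable_cst a b 1) (cont_on_measurable cf).
move=> h; apply: eq_summable (h _) => // [x _|x xab]; first by rewrite mul1r.
by apply: hK; exact: subset_itv_oo_cc.
Qed.

(** A null set contains no interval. This carries inequalities between continuous functions from
    almost every time to every time, end points included. *)
Lemma ae_dense (a b : R) (P : R -> Prop) : a < b ->
  {ae mu, forall t, t \in `]a, b[ -> P t} ->
  forall t, t \in `[a, b] -> forall e, 0 < e ->
  exists s, [/\ s \in `]a, b[, `|s - t| < e & P s].
Proof.
move=> ab [N [mN N0 hN]] t; rewrite in_itv/= => /andP[at_ tb] e e0.
pose c := Num.max a (t - e); pose d := Num.min b (t + e).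
have cd : c < d.
  rewrite /c /d gt_max !lt_min ab/= ltrBlDr.
  by apply/and3P; split; lra.
apply: contrapT => hs.
have : (`]c, d[%classic : set mR) `<=` N.
  move=> s /=; rewrite in_itv/= gt_max lt_min => /andP[/andP[as_ tes] /andP[sb ste]].
  apply: hN => /= h; apply: hs; exists s.
  have sab : s \in `]a, b[ by rewrite in_itv/= as_.
  by split=> //; [rewrite ltr_norml; apply/andP; split; lra|exact: h].
move/(le_measure mu); rewrite !inE => /(_ (measurable_itv _) mN).
rewrite [X in (_ <= X)%E](_ : _ = 0%E)//= lebesgue_measure_itv/= lte_fin cd -EFinD lee_fin subr_le0.
by rewrite leNgt cd.
Qed.

Lemma ae_le_cont_on (a b K : R) f : a < b -> cont_on a b f ->
  {ae mu, forall t, t \in `]a, b[ -> f t <= K} ->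
  forall t, t \in `[a, b] -> f t <= K.
Proof.
move=> ab /cont_onP cf hK t tab; rewrite leNgt; apply/negP => Kft.
have [d d0 hd] := cf t tab (f t - K) (ltac:(by rewrite subr_gt0)).
have [s [sab st fs]] := ae_dense ab hK tab d0.
have := hd s (subset_itv_oo_cc sab) st; rewrite ltr_norml => /andP[+ _].
move: fs; lra.
Qed.

Lemma ae_eq_cont_on (a b : R) f g : a < b -> cont_on a b f -> cont_on a b g ->
  {ae mu, forall t, t \in `]a, b[ -> f t = g t} ->
  forall t, t \in `[a, b] -> f t = g t.
Proof.
move=> ab cf cg fg t tab; apply/eqP; rewrite -subr_eq0 -normr_le0.
apply: (ae_le_cont_on ab (cont_on_norm (cont_onB cf cg))) => //.
by apply: aeS fg => s h sab; rewrite h// subrr normr0.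
Qed.

Lemma Rintegral_itvD (a b c : R) f : a <= b -> b <= c -> summable_on `]a, c[ f ->
  \int[mu]_(x in `]a, c[) f x =
  \int[mu]_(x in `]a, b[) f x + \int[mu]_(x in `]b, c[) f x.
Proof.
move=> ab bc sf; have [->|nab] := eqVneq a b.
  by rewrite set_itvoo0 Rintegral_set0 add0r.
have [->|nbc] := eqVneq b c.
  by rewrite [X in _ + Rintegral _ X _]set_itvoo0 Rintegral_set0 addr0.
have s1 : summable_on `]a, b[ f by exact: summable_sub_itv sf.
have ab' : a < b by rewrite lt_neqAle nab.
have bc' : b < c by rewrite lt_neqAle nbc.
have E := @Rintegral_itvB R f (BRight a) (BLeft c) b sf.
rewrite -E; [|by rewrite bnd_simp ltW|by rewrite bnd_simp].
rewrite -(Rintegral_itv_bndo_bndc s1); ring.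
Qed.

Section interval.
Variables (T : R) (T0 : 0 < T).
Local Notation D := (`]0, T[%classic : set mR).

Definition ae_bounded (K : R) g := {ae mu, forall t, t \in `]0, T[ -> `|g t| <= K}.

Lemma ae_bounded_ge0 (K : R) g : ae_bounded K g -> 0 <= K.
Proof.
move=> gK; have T0T : (0 : R) \in `[0, T] by rewrite in_itv/= lexx ltW.
have [s [_ _]] := ae_dense T0 gK T0T ltr01.
exact: le_trans.
Qed.

Lemma primitive_lipschitz (K : R) g : summable_on `]0, T[ g -> ae_bounded K g ->
  forall s r, s \in `[0, T] -> r \in `[0, T] ->
  `|\int[mu]_(x in `]0, r[) g x - \int[mu]_(x in `]0, s[) g x| <= K * `|r - s|.
Proof.
move=> sg gK.
suff W s r : s \in `[0, T] -> r \in `[0, T] -> s <= r ->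
  `|\int[mu]_(x in `]0, r[) g x - \int[mu]_(x in `]0, s[) g x| <= K * (r - s).
  move=> s r sT rT; have [sr|rs] := leP s r.
    by rewrite [X in K * X]ger0_norm ?subr_ge0//; exact: W.
  by rewrite distrC [X in K * X]distrC [X in K * X]gtr0_norm ?subr_gt0//; apply: W => //; exact: ltW.
rewrite !in_itv/= => /andP[s0 sT] /andP[r0 rT] sr.
have sgr : summable_on `]0, r[ g by exact: summable_sub_itv sg.
rewrite (Rintegral_itvD s0 sr)// addrAC subrr add0r.
have sgsr : summable_on `]s, r[ g by exact: summable_sub_itv sg.
apply: le_trans (le_normr_Rintegral _ sgsr) _ => //.
have mg : measurable_fun (`]s, r[%classic : set mR) (fun t => `|g t|%:E).
  exact: measurable_int (summable_norm sgsr).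
rewrite -lee_fin /Rintegral fineK; last first.
  exact: integrable_fin_num (summable_norm sgsr).
apply: (@le_trans _ _ (\int[mu]_(x in `]s, r[) K%:E)%E).
  apply: ae_ge0_le_integral => //.
  - by move=> t _; rewrite lee_fin (ae_bounded_ge0 gK).
  apply: aeS gK => t h /=; rewrite in_itv/= => /andP[st tr].
  by rewrite lee_fin h// in_itv/= (le_lt_trans s0 st) (lt_le_trans tr rT).
rewrite integral_cst//= lebesgue_measure_itv/= lte_fin; case: ltP => // sr'.
by rewrite mule0 lee_fin mulr_ge0 ?subr_ge0// (ae_bounded_ge0 gK).
Qed.

Lemma weak_derivative_lipschitz_rep (K : R) f g :
  summable_on `]0, T[ f -> summable_on `]0, T[ g -> weak_derivative 0 T f g ->
  ae_bounded K g -> exists2 fc,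
    (forall s r, s \in `[0, T] -> r \in `[0, T] -> `|fc r - fc s| <= K * `|r - s|) &
    {ae mu, forall t, t \in `]0, T[ -> f t = fc t}.
Proof.
move=> sf sg fg gK; have [c hc] := weak_derivative_primitive T0 sf sg fg.
exists (fun t => c + \int[mu]_(x in `]0, t[) g x); last exact: hc.
by move=> s r sT rT; rewrite opprD addrACA subrr add0r; exact: primitive_lipschitz.
Qed.

(** Continuity identifies [f] with its Lipschitz representative at every time. *)
Lemma weak_derivative_lipschitz (K : R) f g : cont_on 0 T f ->
  summable_on `]0, T[ g -> weak_derivative 0 T f g -> ae_bounded K g ->
  forall s r, s \in `[0, T] -> r \in `[0, T] -> `|f r - f s| <= K * `|r - s|.
Proof.
move=> cf sg fg gK s r sT rT.
have sf : summable_on `]0, T[ f by apply: cont_on_summable => //; exact: ltW.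
have [fc Lfc ffc] := weak_derivative_lipschitz_rep sf sg fg gK.
have E := ae_eq_cont_on T0 cf (lipschitz_cont_on Lfc) ffc.
by rewrite !E//; exact: Lfc.
Qed.

Lemma is_derive_primitive g t : cont_on 0 T g -> t \in `]0, T[ ->
  is_derive t 1 (fun x => \int[mu]_(s in `]0, x[) g s) (g t).
Proof.
move=> cg tT; have sg := cont_on_summable (ltW T0) cg.
move: (tT); rewrite in_itv/= => /andP[t0 tT'].
pose u := (t + T) / 2.
have [] := @continuous_FTC1 R g (BRight 0) t u.
- by rewrite /u; lra.
- apply: integrableS sg => //; apply: subset_itvl; rewrite bnd_simp /u; lra.
- by rewrite lte_fin.
- exact: (within_continuous_continuous T0 cg).
move=> d1 d2; have d3 := derivable_is_derive1 d1; rewrite d2 in d3.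
apply: near_eq_is_derive d3.
near=> x; rewrite -Rintegral_itv_bndo_bndc//.
apply: integrableS sg => //; apply: subset_itvl; rewrite bnd_simp.
by apply: ltW; near: x; exact: lt_nbhsl.
Unshelve. all: by end_near. Qed.

(** Up to a constant [fc] is the primitive of [g], hence of [gc], first almost everywhere and then
    everywhere; the primitive of a continuous function is classically differentiable. *)
Lemma weak_derivative_is_derive (f fc g gc : R -> R) :
  cont_on 0 T fc -> cont_on 0 T gc ->
  summable_on `]0, T[ f -> summable_on `]0, T[ g ->
  {ae mu, forall t, t \in `]0, T[ -> f t = fc t} ->
  {ae mu, forall t, t \in `]0, T[ -> g t = gc t} ->
  weak_derivative 0 T f g ->
  forall t, t \in `]0, T[ -> is_derive t 1 fc (gc t).
Proof.
move=> cf cg sf sg ffc ggc fg t tT.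
have [c hc] := weak_derivative_primitive T0 sf sg fg.
pose I x := \int[mu]_(s in `]0, x[) gc s.
have cI : cont_on 0 T I.
  have [K K0 hK] := cont_on_bounded (ltW T0) cg.
  apply: (@lipschitz_cont_on _ _ K); apply: primitive_lipschitz.
    by apply: cont_on_summable => //; exact: ltW.
  by apply: aeT => s sT; apply: hK; exact: subset_itv_oo_cc.
have sgc : summable_on `]0, T[ gc by apply: cont_on_summable => //; exact: ltW.
have E : forall s, s \in `[0, T] -> fc s = c + I s.
  apply: ae_eq_cont_on => //.
    by apply: cont_onD => //; exact: cont_on_cst.
  apply: aeS2 ffc hc => s h1 h2 sT; rewrite -h1// h2//; congr (c + _).
  move: sT; rewrite in_itv/= => /andP[s0 sT].
  apply: ae_eq_Rintegral => //.
  - by apply: summable_meas; apply: summable_sub_itv sg => //; exact: ltW.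
  - by apply: summable_meas; apply: summable_sub_itv sgc => //; exact: ltW.
  apply: aeS ggc => x h /=; rewrite in_itv/= => /andP[x0 xs]; apply: h.
  by rewrite in_itv/= x0 (lt_trans xs).
apply: near_eq_is_derive (_ : is_derive t 1 (fun x => c + I x) (gc t)).
  move: tT; rewrite in_itv/= => /andP[t0 tT].
  near=> s; rewrite E// in_itv/=; apply/andP; split; apply: ltW; near: s.
    exact: lt_nbhsr.
  exact: lt_nbhsl.
apply: is_derive_congr (is_deriveD (is_derive_cst c t 1) (is_derive_primitive cg tT)) => //.
by rewrite add0r.
Unshelve. all: by end_near. Qed.

End interval.

(** * Truncation errors in time *)

Section Taylor.
Variables (a b : R).
Implicit Types (G H : R -> R) (K : R).

Definition lipschitz_on K f := forall s r, s \in `[a, b] -> r \in `[a, b] ->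
  `|f r - f s| <= K * `|r - s|.

Definition C1_on f g := cont_on a b f /\
  forall t, t \in `]a, b[ -> is_derive t 1 f (g t).

Lemma C1_on_MVT f g s r : C1_on f g -> s \in `[a, b] -> r \in `[a, b] -> s < r ->
  exists2 x, s < x < r & f r - f s = g x * (r - s).
Proof.
move=> [cf df]; rewrite !in_itv/= => /andP[as_ sb] /andP[ar rb] sr.
have sub x : x \in `]s, r[ -> x \in `]a, b[.
  rewrite !in_itv/= => /andP[sx xr].
  by rewrite (le_lt_trans as_ sx) (lt_le_trans xr rb).
have df' x : x \in `]s, r[ -> is_derive x 1 f (g x) by move=> /sub; exact: df.
have cf' : cont_on s r f.
  apply: continuous_subspaceW cf => x /=; rewrite !in_itv/= => /andP[sx xr].
  by rewrite (le_trans as_ sx) (le_trans xr rb).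
have [x xsr E] := MVT sr df' cf'; exists x; last exact: E.
by move: xsr; rewrite in_itv.
Qed.

(** The mean value theorem gives the slope at some point of ]s, r[, whose distance to [p] is at most
    [r - s + e]. *)
Lemma taylor1 K f g s r p : C1_on f g -> lipschitz_on K g -> 0 <= K ->
  s \in `[a, b] -> r \in `[a, b] -> p \in `[a, b] -> s <= r ->
  forall e, s - e <= p <= r + e -> 0 <= e ->
  `|f r - f s - (r - s) * g p| <= K * (r - s) * (r - s + e).
Proof.
move=> fg Lg K0 sab rab pab; rewrite le_eqVlt => /orP[/eqP <-|sr] e /andP[h1 h2] e0.
  by rewrite !subrr mul0r subrr normr0 mulr0 mul0r.
have [x /andP[sx xr] ->] := C1_on_MVT fg sab rab sr.
have xab : x \in `[a, b].
  by move: sab rab; rewrite !in_itv/= => /andP[? ?] /andP[? ?]; apply/andP; split; lra.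
rewrite mulrC -mulrBr normrM gtr0_norm ?subr_gt0// mulrAC [leRHS]mulrC.
have rs0 : 0 <= r - s by rewrite subr_ge0 ltW.
apply: ler_wpM2l => //.
apply: le_trans (Lg _ _ pab xab) _; rewrite ler_wpM2l// ler_norml.
by apply/andP; split; lra.
Qed.

(** Expansions at the midpoint towards both ends: the terms of first order cancel. *)
Lemma second_difference K f g s r : C1_on f g -> lipschitz_on K g -> 0 <= K ->
  s \in `[a, b] -> r \in `[a, b] -> s <= r ->
  `|f ((r + s) / 2) - (f r + f s) / 2| <= K * (r - s) ^+ 2.
Proof.
move=> fg Lg K0 sab rab sr; set p := (r + s) / 2.
have pab : p \in `[a, b].
  move: sab rab; rewrite !in_itv/= => /andP[? ?] /andP[? ?].
  by rewrite /p; apply/andP; split; lra.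
have ee : (0 : R) <= 0 by [].
have h1 : `|f p - f s - (p - s) * g p| <= K * (p - s) * (p - s + 0).
  by apply: taylor1 => //; rewrite /p; [lra|apply/andP; split; lra].
have h2 : `|f r - f p - (r - p) * g p| <= K * (r - p) * (r - p + 0).
  by apply: taylor1 => //; rewrite /p; [lra|apply/andP; split; lra].
have E1 : p - s = (r - s) / 2 by rewrite /p; field.
have E2 : r - p = (r - s) / 2 by rewrite /p; field.
rewrite E1 in h1; rewrite E2 in h2.
have -> : f p - (f r + f s) / 2 =
  ((f p - f s - (r - s) / 2 * g p) - (f r - f p - (r - s) / 2 * g p)) / 2 by field.
rewrite normrM [X in _ * X]ger0_norm; last by rewrite invr_ge0.
apply: le_trans (_ : (K * ((r - s) / 2) * ((r - s) / 2 + 0) +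
  K * ((r - s) / 2) * ((r - s) / 2 + 0)) / 2 <= _).
  rewrite ler_wpM2r ?invr_ge0//; apply: le_trans (ler_normB _ _) _.
  exact: lerD.
have -> : (K * ((r - s) / 2) * ((r - s) / 2 + 0) +
  K * ((r - s) / 2) * ((r - s) / 2 + 0)) / 2 = K * (r - s) ^+ 2 * (1 / 4) by field.
have : 0 <= K * (r - s) ^+ 2 by rewrite mulr_ge0// sqr_ge0.
lra.
Qed.

(** The weights 3/2 and -1/2 reproduce affine functions at [s + d / 2], so only the remainders of
    the two expansions at [s] are left. *)
Lemma extrapolation K f g s (d : R) : C1_on f g -> lipschitz_on K g -> 0 <= K ->
  0 <= d -> s - d \in `[a, b] -> s + d / 2 \in `[a, b] ->
  `|f (s + d / 2) - (3 / 2 * f s - 1 / 2 * f (s - d))| <= 2 * K * d ^+ 2.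
Proof.
move=> fg Lg K0 d0 sab rab.
have pab : s \in `[a, b].
  move: sab rab; rewrite !in_itv/= => /andP[? ?] /andP[? ?].
  by apply/andP; split; lra.
have h1 : `|f (s + d / 2) - f s - (s + d / 2 - s) * g s| <=
    K * (s + d / 2 - s) * (s + d / 2 - s + 0).
  by apply: taylor1 => //; [lra|apply/andP; split; lra].
have h2 : `|f s - f (s - d) - (s - (s - d)) * g s| <=
    K * (s - (s - d)) * (s - (s - d) + 0).
  by apply: taylor1 => //; [lra|apply/andP; split; lra].
have E1 : s + d / 2 - s = d / 2 by ring.
have E2 : s - (s - d) = d by ring.
rewrite E1 in h1; rewrite E2 in h2.
have -> : f (s + d / 2) - (3 / 2 * f s - 1 / 2 * f (s - d)) =
  (f (s + d / 2) - f s - d / 2 * g s) - (f s - f (s - d) - d * g s) / 2 by field.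
apply: le_trans (ler_normB _ _) _; rewrite normrM [X in _ + _ * X]ger0_norm; last by rewrite invr_ge0.
apply: le_trans (lerD h1 (_ : _ <= K * d * (d + 0) / 2)) _.
  by rewrite ler_wpM2r ?invr_ge0.
have -> : K * (d / 2) * (d / 2 + 0) + K * d * (d + 0) / 2 = K * d ^+ 2 * (3 / 4) by field.
have : 0 <= K * d ^+ 2 by rewrite mulr_ge0// sqr_ge0.
lra.
Qed.

(** The odd function [F] of the distance to the midpoint has as derivative the second difference [G]
    of [g]. The mean value theorem for [F] gains one order over a direct expansion of [f]. *)
Lemma midpoint_rule K f g h s r : C1_on f g -> C1_on g h -> lipschitz_on K h ->
  0 <= K -> s \in `[a, b] -> r \in `[a, b] -> s < r ->
  `|(f r - f s) / (r - s) - g ((r + s) / 2)| <= K * (r - s) ^+ 2.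
Proof.
move=> fg gh Lh K0 sab rab sr; set p := (r + s) / 2; set n := (r - s) / 2.
have [/andP[as_ sb] /andP[ar rb]] : (a <= s <= b) /\ (a <= r <= b).
  by move: sab rab; rewrite !in_itv.
have n0 : 0 < n by rewrite /n; lra.
pose F x := f (p + x) - f (p - x) - 2 * x * g p.
pose G x := g (p + x) + g (p - x) - 2 * g p.
have cp : cont_on 0 n (fun x => f (p + x)).
  apply/cont_onP => t; rewrite in_itv/= => /andP[t0 tn] e e0.
  have [|d d0 hd] := (cont_onP a b f).1 fg.1 (p + t) _ e e0.
    by rewrite in_itv/=; apply/andP; split; rewrite /p; move: tn; rewrite /n; lra.
  exists d => // x; rewrite in_itv/= => /andP[x0 xn] xt; apply: hd.
    by rewrite in_itv/=; apply/andP; split; rewrite /p; move: xn; rewrite /n; lra.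
  by rewrite (_ : p + x - (p + t) = x - t)//; ring.
have cm : cont_on 0 n (fun x => f (p - x)).
  apply/cont_onP => t; rewrite in_itv/= => /andP[t0 tn] e e0.
  have [|d d0 hd] := (cont_onP a b f).1 fg.1 (p - t) _ e e0.
    by rewrite in_itv/=; apply/andP; split; rewrite /p; move: tn; rewrite /n; lra.
  exists d => // x; rewrite in_itv/= => /andP[x0 xn] xt; apply: hd.
    by rewrite in_itv/=; apply/andP; split; rewrite /p; move: xn; rewrite /n; lra.
  by rewrite (_ : p - x - (p - t) = t - x) 1?distrC//; ring.
have cF : cont_on 0 n F.
  apply: cont_onB; first exact: cont_onB.
  apply: (@cont_onM 0 n (fun x => 2 * x) (fun=> g p)); last exact: cont_on_cst.
  apply: (@cont_onZ 0 n 2 id).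
  by apply: continuous_subspaceT => x; exact: cvg_id.
have dF x : x \in `]0, n[ -> is_derive x 1 F (G x).
  rewrite in_itv/= => /andP[x0 xn].
  have d1 : is_derive x 1 (fun x => f (p + x)) (g (p + x)).
    have : is_derive (1 * x + p) 1 f (g (p + x)).
      rewrite mul1r addrC; apply: fg.2; rewrite in_itv/=.
      by apply/andP; split; rewrite /p; move: xn; rewrite /n; lra.
    move/is_derive_comp_affine; apply: is_derive_congr => [y|]; last by rewrite mul1r.
    by rewrite mul1r addrC.
  have d2 : is_derive x 1 (fun x => f (p - x)) (- g (p - x)).
    have : is_derive (-1 * x + p) 1 f (g (p - x)).
      rewrite mulN1r addrC; apply: fg.2; rewrite in_itv/=.
      by apply/andP; split; rewrite /p; move: xn; rewrite /n; lra.
    move/is_derive_comp_affine; apply: is_derive_congr => [y|]; last by rewrite mulN1r.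
    by rewrite mulN1r addrC.
  have d3 := is_derive_affine (2 * g p) 0 x.
  apply: is_derive_congr (is_deriveB (is_deriveB d1 d2) d3) => [y|].
    by rewrite /F /=; change (f (p + y) - f (p - y) - (2 * g p * y + 0) = f (p + y) - f (p - y) - 2 * y * g p); ring.
  by rewrite opprK.
have [x xn0 E] := MVT n0 dF cF.
have {xn0} [x0 xn] : 0 < x /\ x < n by apply/andP; move: xn0; rewrite in_itv.
have F0 : F 0 = 0 by rewrite /F addr0 subr0; ring.
have Fn : F n = f r - f s - (r - s) * g p.
  have -> : f r = f (p + n) by congr f; rewrite /p /n; field.
  have -> : f s = f (p - n) by congr f; rewrite /p /n; field.
  by rewrite /F /n; field.
rewrite F0 !subr0 Fn in E.
have pI y : - n <= y <= n -> p + y \in `[a, b].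
  move=> /andP[y1 y2]; rewrite in_itv/=; apply/andP; split; move: y1 y2; rewrite /p /n; lra.
have pab : p \in `[a, b].
  by rewrite -[p]addr0; apply: pI; apply/andP; split; lra.
have h1 : `|g (p + x) - g p - (p + x - p) * h p| <= K * (p + x - p) * (p + x - p + 0).
  apply: taylor1 => //; [|lra|by apply/andP; split; lra].
  by apply: pI; apply/andP; split; lra.
have h2 : `|g p - g (p - x) - (p - (p - x)) * h p| <= K * (p - (p - x)) * (p - (p - x) + 0).
  apply: taylor1 => //; [|lra|by apply/andP; split; lra].
  by apply: pI; apply/andP; split; lra.
have E1 : p + x - p = x by ring.
have E2 : p - (p - x) = x by ring.
rewrite E1 in h1; rewrite E2 in h2.
have rs0 : r - s != 0 by rewrite subr_eq0 gt_eqF.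
have -> : (f r - f s) / (r - s) - g p = G x / 2.
  have -> : (f r - f s) / (r - s) - g p = (f r - f s - (r - s) * g p) / (r - s) by field.
  by rewrite E /n; field.
have -> : G x / 2 = ((g (p + x) - g p - x * h p) - (g p - g (p - x) - x * h p)) / 2.
  by rewrite /G; field.
rewrite normrM [X in _ * X]ger0_norm; last by rewrite invr_ge0.
apply: le_trans (_ : (K * x * (x + 0) + K * x * (x + 0)) / 2 <= _).
  rewrite ler_wpM2r ?invr_ge0//; apply: le_trans (ler_normB _ _) _.
  exact: lerD.
have -> : (K * x * (x + 0) + K * x * (x + 0)) / 2 = K * x ^+ 2 by field.
rewrite ler_wpM2l// lerXn2r ?nnegrE; first by [].
- exact: ltW.
- by rewrite subr_ge0 ltW.
by move: xn; rewrite /n; lra.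
Qed.

End Taylor.
End Time_regularity.

(** * Piecewise polynomials *)

Section Piecewise_polynomials.
Context {R : realType}.
Local Notation mu := (@lebesgue_measure R).
Local Notation mR := (measurableTypeR R).
Implicit Types (f g u w : R -> R) (a b : R) (s : seq R) (p : {poly R}).

(** Induction that removes the leftmost element and keeps the right end [b]; estimates on single
    elements are added up in this way. *)
Lemma itv_partition_rect b (P : R -> seq R -> Prop) : P b [::] ->
  (forall a x s, a < x -> x <= b -> itv_partition x b s -> P x s -> P a (x :: s)) ->
  forall a s, itv_partition a b s -> P a s.
Proof.
move=> P0 PS a s; elim: s a => [|x s IH] a h.
  by rewrite (itv_partition_nil h).
have xs := itv_partition_cons h.
apply: PS => //; [by case: h => /= /andP[]|exact: itv_partition_le xs|exact: IH].
Qed.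

Definition each (Q : R -> R -> Prop) a s :=
  forall j, (j < size s)%N -> Q (nth 0 (a :: s) j) (nth 0 s j).

Lemma each_cons Q a x s : each Q a (x :: s) <-> Q a x /\ each Q x s.
Proof.
split=> [h|[h0 h] [|j]]; last exact: h; last by [].
by split=> [|j js]; [exact: (h 0%N)|exact: (h j.+1)].
Qed.

Lemma each_imp (Q Q' : R -> R -> Prop) a s :
  (forall l r, Q l r -> Q' l r) -> each Q a s -> each Q' a s.
Proof. by move=> QQ' h j js; apply: QQ'; exact: h. Qed.

Lemma each_imp2 (Q Q' Q'' : R -> R -> Prop) a s :
  (forall l r, Q l r -> Q' l r -> Q'' l r) ->
  each Q a s -> each Q' a s -> each Q'' a s.
Proof. by move=> QQ' h h' j js; apply: QQ'; [exact: h|exact: h']. Qed.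

Lemma each_bounds a b s : itv_partition a b s ->
  each (fun l r => [/\ a <= l, l < r & r <= b]) a s.
Proof.
apply: (@itv_partition_rect b (fun a s => each (fun l r => [/\ a <= l, l < r & r <= b]) a s)).
  by move=> [].
move=> {}a x {}s ax xb xs IH; apply/each_cons; split; first by [].
apply: each_imp IH => l r [xl lr rb]; split=> //.
by apply: le_trans xl; exact: ltW.
Qed.

(* open elements for [pw], closed ones (hence continuity) for [cpw] *)
Definition pw (K : nat) a s f := each (fun l r =>
  exists2 p : {poly R}, (size p <= K)%N & forall y, y \in `]l, r[ -> f y = p.[y]) a s.

Definition cpw (K : nat) a s f := each (fun l r =>
  exists2 p : {poly R}, (size p <= K)%N & forall y, y \in `[l, r] -> f y = p.[y]) a s.

Lemma cpw_pw K a s f : cpw K a s f -> pw K a s f.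
Proof.
apply: each_imp => l r [p sp h]; exists p => // y /subset_itv_oo_cc; exact: h.
Qed.

Lemma pwD K a s f g : pw K a s f -> pw K a s g -> pw K a s (fun y => f y + g y).
Proof.
apply: each_imp2 => l r [p sp hp] [q sq hq]; exists (p + q).
  by apply: leq_trans (size_polyD _ _) _; rewrite geq_max sp.
by move=> y yl; rewrite hornerD hp ?hq.
Qed.

Lemma cpwD K a s f g : cpw K a s f -> cpw K a s g -> cpw K a s (fun y => f y + g y).
Proof.
apply: each_imp2 => l r [p sp hp] [q sq hq]; exists (p + q).
  by apply: leq_trans (size_polyD _ _) _; rewrite geq_max sp.
by move=> y yl; rewrite hornerD hp ?hq.
Qed.

Lemma cpwM K K' a s f g : cpw K a s f -> cpw K' a s g ->
  cpw (K + K') a s (fun y => f y * g y).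
Proof.
apply: each_imp2 => l r [p sp hp] [q sq hq]; exists (p * q).
  by apply: leq_trans (size_polyMleq _ _) _; apply: leq_trans (leq_pred _) _; exact: leq_add.
by move=> y yl; rewrite hornerM hp ?hq.
Qed.

Lemma pwZ K a s c f : pw K a s f -> pw K a s (fun y => c * f y).
Proof.
apply: each_imp => l r [p sp hp]; exists (c *: p).
  exact: leq_trans (size_scale_leq _ _) sp.
by move=> y yl; rewrite hornerZ hp.
Qed.

Lemma cpwZ K a s c f : cpw K a s f -> cpw K a s (fun y => c * f y).
Proof.
apply: each_imp => l r [p sp hp]; exists (c *: p).
  exact: leq_trans (size_scale_leq _ _) sp.
by move=> y yl; rewrite hornerZ hp.
Qed.

Lemma cpw_affine a s (c d : R) : cpw 2 a s (fun y => c + d * y).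
Proof.
move=> j _; exists (c%:P + d *: 'X); last by move=> y _; rewrite !hornerE.
apply: leq_trans (size_polyD _ _) _; rewrite geq_max.
rewrite (leq_trans (size_polyC_leq1 _))//=.
by rewrite (leq_trans (size_scale_leq _ _))// size_polyX.
Qed.

Lemma pw_sum K a s (I : Type) (r : seq I) (c : I -> R) (F : I -> R -> R) :
  (forall i, pw K a s (F i)) -> pw K a s (fun y => \sum_(i <- r) c i * F i y).
Proof.
move=> hF; elim: r => [|i r IH].
  by move=> j _; exists 0; [rewrite size_poly0|move=> y _; rewrite big_nil horner0].
have := pwD (pwZ (c i) (hF i)) IH.
by congr pw; apply/funext => y; rewrite big_cons.
Qed.

Lemma pw_derive1 K a s f : pw K.+1 a s f -> pw K a s (derive1 f).
Proof.
apply: each_imp => l r [p sp hp]; exists p^`().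
  have [->|p0] := eqVneq p 0; first by rewrite deriv0 size_poly0.
  by rewrite -ltnS; apply: leq_trans (lt_size_deriv p0) sp.
move=> y; rewrite in_itv/= => /andP[ly yr]; apply: derive1_unique.
apply: near_eq_is_derive (is_derive_poly p y).
near=> z; rewrite hp// in_itv/=; apply/andP; split; near: z.
  exact: lt_nbhsr.
exact: lt_nbhsl.
Unshelve. all: by end_near. Qed.

Lemma setU_itvoo a x b : a < x -> x <= b ->
  (`]a, b[%classic : set R) `<=` (`]a, x[ `|` [set x]) `|` `]x, b[.
Proof.
move=> ax xb y /=; rewrite !in_itv/= => /andP[ay yb].
have [yx|xy|->] := ltgtP y x; [left; left|right|left; right] => //.
by rewrite ay.
Qed.

Lemma pw_measurable K a b s f : itv_partition a b s -> pw K a s f ->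
  measurable_fun (`]a, b[%classic : set mR) f.
Proof.
move=> ps; move: ps f.
apply: (@itv_partition_rect b (fun a s => forall f, pw K a s f ->
  measurable_fun (`]a, b[%classic : set mR) f)) => [f _|{}a x {}s ax xb _ IH f].
  by rewrite set_itvoo0; exact: measurable_fun_set0.
move=> /each_cons[[p _ hp] /IH mf].
apply: (@measurable_funS _ _ _ _ ((`]a, x[ `|` [set x]) `|` `]x, b[ : set mR)).
- by apply: measurableU => //; exact: measurableU.
- exact: setU_itvoo.
apply/measurable_funU => //; first exact: measurableU.
split=> //; apply/measurable_funU => //; split; last exact: measurable_fun_set1.
apply: (@eq_measurable_fun _ _ _ _ _ (horner p)) => [y /set_mem/hp//|].
by apply: measurable_funTS; apply: continuous_measurable_fun; exact: continuous_horner.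
Qed.

Lemma poly_bounded p a b : exists K, forall y, y \in `[a, b] -> `|p.[y]| <= K.
Proof.
have [ab|ba] := leP a b.
  have [|K _ hK] := @cont_on_bounded _ a b (horner p) ab; last by exists K.
  by apply: continuous_subspaceT; exact: continuous_horner.
exists 0 => y; rewrite in_itv/= => /andP[ay /(le_trans ay)].
by rewrite leNgt ba.
Qed.

Lemma pw_bounded K a b s f : itv_partition a b s -> pw K a s f ->
  exists C, forall y, y \in `]a, b[ -> `|f y| <= C.
Proof.
move=> ps; move: ps f.
apply: (@itv_partition_rect b (fun a s => forall f, pw K a s f ->
  exists C, forall y, y \in `]a, b[ -> `|f y| <= C)) => [f _|{}a x {}s ax xb _ IH f].
  by exists 0 => y; rewrite in_itv/= => /andP[by1 /(lt_trans by1)]; rewrite ltxx.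
move=> /each_cons[[p _ hp] /IH[C hC]]; have [C' hC'] := poly_bounded p a x.
exists (Num.max C (Num.max C' `|f x|)) => y yab.
have := setU_itvoo ax xb yab; rewrite !le_max => -[[yax|->]|yxb].
- by rewrite hp// hC' ?orbT//; exact: subset_itv_oo_cc.
- by rewrite lexx !orbT.
- by rewrite hC.
Qed.

Lemma sq_int_bounded a b f C : measurable_fun (`]a, b[%classic : set mR) f ->
  (forall y, y \in `]a, b[ -> `|f y| <= C) -> sq_int `]a, b[ f.
Proof.
move=> mf fC; have mD : measurable (`]a, b[%classic : set mR) by exact: measurable_itv.
have s1 : sq_int `]a, b[ (fun=> 1 : R).
  split; first exact: measurable_cst.
  by have := summable_cst a b 1; apply: eq_summable => // x _; rewrite expr1n.
have := sq_intM_bounded mD mf fC s1.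
by apply: eq_sq_int => // x _; rewrite mulr1.
Qed.

Lemma pw_sq_int K a b s f : itv_partition a b s -> pw K a s f -> sq_int `]a, b[ f.
Proof.
move=> ps pf; have [C hC] := pw_bounded ps pf.
exact: sq_int_bounded (pw_measurable ps pf) hC.
Qed.

Lemma sq_int_cst a b (c : R) : sq_int `]a, b[ (fun=> c).
Proof. by apply: (@sq_int_bounded _ _ _ `|c|) => //; exact: measurable_cst. Qed.

Lemma sq_int_summable a b f : sq_int `]a, b[ f -> summable_on `]a, b[ f.
Proof.
move=> sf; have := summableM (measurable_itv _) sf (sq_int_cst a b 1).
by apply: eq_summable => // x _; rewrite mulr1.
Qed.

Lemma sq_int_sub a b c d f : a <= c -> d <= b ->
  sq_int `]a, b[ f -> sq_int `]c, d[ f.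
Proof.
move=> ac db [mf sf]; split; last exact: summable_sub_itv sf.
apply: measurable_funS mf => //; apply: subset_itv; rewrite bnd_simp//.
Qed.

Lemma sq_int_cont a b f : a <= b -> cont_on a b f -> sq_int `]a, b[ f.
Proof.
move=> ab cf; have [K _ hK] := cont_on_bounded ab cf.
apply: sq_int_bounded (cont_on_measurable cf) (_ : forall y, _ -> _ <= K) => y yab.
by apply: hK; exact: subset_itv_oo_cc.
Qed.

Lemma Rintegral_poly_deriv p x y : x <= y ->
  \int[mu]_(t in `]x, y[) p^`().[t] = p.[y] - p.[x].
Proof.
rewrite le_eqVlt => /orP[/eqP ->|xy]; first by rewrite set_itvoo0 Rintegral_set0 subrr.
rewrite -Rintegral_smooth_derive1//.
  by apply: eq_Rintegral => t _; rewrite derivE.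
have sp n q : Ck n (horner q : R -> R).
  elim: n q => [|n IH] q; split=> //; try (by move=> z; exact: derivable_horner).
  by rewrite -derivE; exact: IH.
by apply/smoothP => n; exact: sp.
Qed.

Lemma poly_primitive p : exists2 q : {poly R}, (size q <= (size p).+1)%N & q^`() = p.
Proof.
exists (\poly_(i < (size p).+1) (p`_i.-1 / i%:R)); first exact: size_poly.
apply/polyP => i; rewrite coef_deriv coef_poly ltnS.
case: ltnP => [|pi]; last by rewrite mul0rn nth_default.
by move=> _; rewrite /= -[LHS]mulr_natr mulfVK// pnatr_eq0.
Qed.

(** The closed elements share their nodes, which makes [f] continuous there; the nodal values of
    [derive1 f] do not affect the integral. *)
Lemma cpw_FTC K a b s f : itv_partition a b s -> cpw K.+1 a s f ->
  forall y, y \in `[a, b] -> f y = f a + \int[mu]_(t in `]a, y[) derive1 f t.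
Proof.
move=> ps; move: ps f.
apply: (@itv_partition_rect b (fun a s => forall f, cpw K.+1 a s f ->
  forall y, y \in `[a, b] -> f y = f a + \int[mu]_(t in `]a, y[) derive1 f t))
  => [f _ y|{}a x {}s ax xb xs IH f cf].
  rewrite in_itv/= -eq_le => /eqP <-.
  by rewrite set_itvoo0 Rintegral_set0 addr0.
have pf := pw_derive1 (cpw_pw cf).
have [[p _ hp] cf'] := (each_cons _ _ _ _).1 cf.
have W y : a <= y -> y <= x -> f y = f a + \int[mu]_(t in `]a, y[) derive1 f t.
  move=> ay yx; rewrite (hp y) ?in_itv/= ?ay// (hp a) ?in_itv/= ?lexx ?(ltW ax)//.
  rewrite -[LHS](subrK p.[a]) addrC; congr (_ + _).
  rewrite -Rintegral_poly_deriv//; apply: eq_Rintegral => t /set_mem/=.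
  rewrite in_itv/= => /andP[at_ ty]; apply/esym/derive1_unique.
  apply: near_eq_is_derive (is_derive_poly p t).
  have tx := lt_le_trans ty yx.
  near=> z; rewrite hp// in_itv/=; apply/andP; split; apply: ltW; near: z.
    exact: lt_nbhsr.
  exact: lt_nbhsl.
move=> y; rewrite in_itv/= => /andP[ay yb].
have [yx|xy] := leP y x; first exact: W.
rewrite (IH _ cf' y) ?in_itv/= ?yb ?(ltW xy)// W ?(ltW ax)// -addrA.
congr (_ + _); rewrite -Rintegral_itvD//; try exact: ltW.
have sf : sq_int `]a, b[ (derive1 f).
  apply: (@pw_sq_int K _ _ (x :: s)) pf.
  by case: xs => xs1 xs2; split; rewrite //= ax.
by apply: sq_int_summable; exact: sq_int_sub sf.
Unshelve. all: by end_near. Qed.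

Lemma eq_cpw K a b s f g : itv_partition a b s ->
  (forall y, y \in `[a, b] -> f y = g y) -> cpw K a s f -> cpw K a s g.
Proof.
move=> ps fg cf; apply: each_imp2 (each_bounds ps) cf => l r [al lr rb] [p sp hp].
exists p => // y; rewrite in_itv/= => /andP[ly yr]; rewrite -hp ?in_itv/= ?ly// fg//.
by rewrite in_itv/= (le_trans al ly) (le_trans yr rb).
Qed.

Lemma pw_primitive K a b s f c : itv_partition a b s -> pw K a s f ->
  cpw K.+1 a s (fun y => c + \int[mu]_(t in `]a, y[) f t).
Proof.
move=> ps; move: ps f c.
apply: (@itv_partition_rect b (fun a s => forall f c, pw K a s f ->
  cpw K.+1 a s (fun y => c + \int[mu]_(t in `]a, y[) f t)))
  => [f c _ []//|{}a x {}s ax xb xs IH f c pf].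
have [[p sp hp] pf'] := (each_cons _ _ _ _).1 pf; apply/each_cons; split.
  have [q sq dq] := poly_primitive p; exists (q + (c - q.[a])%:P).
    apply: leq_trans (size_polyD _ _) _; rewrite geq_max (leq_trans sq)//=.
    by rewrite (leq_trans (size_polyC_leq1 _)).
  move=> y; rewrite in_itv/= => /andP[ay yx].
  rewrite hornerD hornerC addrCA; congr (_ + _).
  rewrite -Rintegral_poly_deriv// dq; apply: eq_Rintegral => t /set_mem/=.
  rewrite in_itv/= => /andP[at_ ty]; apply: hp.
  by rewrite in_itv/= at_ (lt_le_trans ty yx).
apply: (eq_cpw xs _ (IH f (c + \int[mu]_(t in `]a, x[) f t) pf')).
move=> y; rewrite in_itv/= => /andP[xy yb]; rewrite -addrA -Rintegral_itvD//.
  exact: ltW.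
have sf : sq_int `]a, b[ f.
  apply: (@pw_sq_int K _ _ (x :: s)) pf.
  by case: xs => xs1 xs2; split; rewrite //= ax.
by apply: sq_int_summable; exact: sq_int_sub sf.
Qed.

End Piecewise_polynomials.

(** * Approximation by piecewise polynomials *)

Section Projection.
Context {R : realType}.
Local Notation mu := (@lebesgue_measure R).
Local Notation mR := (measurableTypeR R).
Implicit Types (f g u w : R -> R) (a b : R) (s : seq R) (p : {poly R}).

Let mitv a b : measurable (`]a, b[%classic : set mR).
Proof. exact: measurable_itv. Qed.

Lemma Rintegral_cst_itv a b (c : R) : a <= b -> \int[mu]_(x in `]a, b[) c = c * (b - a).
Proof.
move=> ab; rewrite Rintegral_cst//= lebesgue_measure_itv/= lte_fin; case: ltP => //= ba.
have -> : b = a by apply/eqP; rewrite eq_le ab ba.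
by rewrite subrr.
Qed.

Lemma Rintegral_norm_sq_le a b f : a <= b -> sq_int `]a, b[ f ->
  (\int[mu]_(x in `]a, b[) `|f x|) ^+ 2 <= (b - a) * ip `]a, b[ f f.
Proof.
move=> ab sf; have sn : sq_int `]a, b[ (fun x => `|f x|).
  split; first by apply: measurableT_comp => //; exact: sf.1.
  by have := sf.2; apply: eq_summable => // x _; rewrite real_normK ?num_real.
have := CS2 (mitv a b) sn (sq_int_cst a b 1).
have -> : ip `]a, b[ (fun x => `|f x|) (fun=> 1) = \int[mu]_(x in `]a, b[) `|f x|.
  by apply: eq_Rintegral => x _; rewrite mulr1.
have -> : ip `]a, b[ (fun=> 1) (fun=> 1) = b - a.
  by rewrite /ip Rintegral_cst_itv// !mul1r.
have -> : ip `]a, b[ (fun x => `|f x|) (fun x => `|f x|) = ip `]a, b[ f f.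
  by apply: eq_Rintegral => x _; rewrite -normrM ger0_norm// -expr2 sqr_ge0.
by rewrite mulrC.
Qed.

Lemma le_ip a b f g : sq_int `]a, b[ f -> sq_int `]a, b[ g ->
  (forall x, x \in `]a, b[ -> `|f x| <= `|g x|) ->
  ip `]a, b[ f f <= ip `]a, b[ g g.
Proof.
move=> sf sg fg; apply: le_Rintegral => //; [exact: summableM..|].
move=> x xab; rewrite -!expr2 -real_normK ?num_real// -[g x ^+ 2]real_normK ?num_real//.
by rewrite lerXn2r ?nnegrE//; exact: fg.
Qed.

(** By Cauchy-Schwarz the L1 norm of [f] is at most the square root of the length times its L2 norm;
    integrating this constant bound of [e] gives the second square root. The constant is one, which
    makes all approximation estimates uniform in the degree. *)
Lemma local_poincare a b (h : R) (e : R -> R) f : a <= b -> b - a <= h -> measurable_fun (`]a, b[%classic : set mR) e ->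
  sq_int `]a, b[ f ->
  (forall x, x \in `]a, b[ -> `|e x| <= \int[mu]_(x in `]a, b[) `|f x|) ->
  ip `]a, b[ e e <= h ^+ 2 * ip `]a, b[ f f.
Proof.
move=> ab bah me sf ef; set n := \int[mu]_(x in `]a, b[) `|f x| in ef.
have n0 : 0 <= n by apply: Rintegral_ge0.
have se : sq_int `]a, b[ e by apply: sq_int_bounded ef.
apply: (@le_trans _ _ (ip `]a, b[ (fun=> n) (fun=> n))).
  by apply: le_ip => //; [exact: sq_int_cst|move=> x /ef; rewrite [`|n|]ger0_norm].
rewrite /ip Rintegral_cst_itv// -expr2.
apply: (@le_trans _ _ ((b - a) * ip `]a, b[ f f * (b - a))).
  by rewrite ler_wpM2r ?subr_ge0//; exact: Rintegral_norm_sq_le.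
rewrite mulrAC -expr2 ler_wpM2r ?ip_ge0// lerXn2r ?nnegrE ?subr_ge0//.
by apply: le_trans bah; rewrite subr_ge0.
Qed.

Lemma Rintegral_norm_sub a b c d f : a <= c -> d <= b -> summable_on `]a, b[ f ->
  `|\int[mu]_(t in `]c, d[) f t| <= \int[mu]_(t in `]a, b[) `|f t|.
Proof.
move=> ac db sf.
have sf' : summable_on `]c, d[ f by apply: summable_sub_itv sf.
apply: le_trans (le_normr_Rintegral _ sf') _ => //.
apply: fine_le.
- exact: integrable_fin_num (summable_norm sf').
- exact: integrable_fin_num (summable_norm sf).
apply: ge0_subset_integral => //.
- by apply: measurable_int (summable_norm sf).
- by apply: subset_itv; rewrite bnd_simp.
Qed.

Lemma measurable_primitive a b f : summable_on `]a, b[ f ->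
  measurable_fun (`]a, b[%classic : set mR) (fun y => \int[mu]_(t in `]a, y[) f t).
Proof. by move=> sf; apply: summable_meas; exact: summable_primitive. Qed.

Lemma ip_itvD a b c f g : a <= b -> b <= c -> sq_int `]a, c[ f -> sq_int `]a, c[ g ->
  ip `]a, c[ f g = ip `]a, b[ f g + ip `]b, c[ f g.
Proof. by move=> ab bc sf sg; apply: Rintegral_itvD => //; exact: summableM. Qed.

(** Zero mean on each element makes the primitive vanish at every node, so that [local_poincare]
    applies on each element and gains [h] instead of the total length. In one dimension this
    replaces a duality argument. *)
Lemma ip_primitive_le (h : R) a b s f : itv_partition a b s -> sq_int `]a, b[ f ->
  each (fun l r => r - l <= h) a s ->
  each (fun l r => \int[mu]_(t in `]l, r[) f t = 0) a s ->
  ip `]a, b[ (fun y => \int[mu]_(t in `]a, y[) f t)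
             (fun y => \int[mu]_(t in `]a, y[) f t) <=
  h ^+ 2 * ip `]a, b[ f f.
Proof.
move=> ps; move: ps f.
apply: (@itv_partition_rect _ b (fun a s => forall f, sq_int `]a, b[ f ->
  each (fun l r => r - l <= h) a s ->
  each (fun l r => \int[mu]_(t in `]l, r[) f t = 0) a s ->
  ip `]a, b[ (fun y => \int[mu]_(t in `]a, y[) f t)
             (fun y => \int[mu]_(t in `]a, y[) f t) <=
  h ^+ 2 * ip `]a, b[ f f)) => [f _ _ _|{}a x {}s ax xb _ IH f sf].
  by rewrite /ip !set_itvoo0 !Rintegral_set0 mulr0.
move=> /each_cons[hx hs] /each_cons[f0 fs].
have sI := sq_int_summable sf.
have s1 : sq_int `]a, x[ f by exact: sq_int_sub sf.
have s2 : sq_int `]x, b[ f by apply: sq_int_sub sf => //; exact: ltW.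
have sE : sq_int `]a, b[ (fun y => \int[mu]_(t in `]a, y[) f t).
  apply: (@sq_int_bounded _ _ _ _ (\int[mu]_(t in `]a, b[) `|f t|)).
    exact: measurable_primitive.
  by move=> y; rewrite in_itv/= => /andP[ay yb]; apply: Rintegral_norm_sub => //; exact: ltW.
rewrite (ip_itvD (ltW ax) xb sE sE) (ip_itvD (ltW ax) xb sf sf) mulrDr lerD//.
  apply: local_poincare => //; first exact: ltW.
    by apply: measurable_primitive; exact: sq_int_summable.
  move=> y; rewrite in_itv/= => /andP[ay yb]; apply: Rintegral_norm_sub => //.
    exact: ltW.
  exact: sq_int_summable.
apply: le_trans (IH f s2 hs fs); rewrite le_eqVlt; apply/orP; left; apply/eqP.
have E y : y \in `]x, b[ ->
    \int[mu]_(t in `]a, y[) f t = \int[mu]_(t in `]x, y[) f t.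
  rewrite in_itv/= => /andP[xy yb]; rewrite (@Rintegral_itvD _ a x y) ?ltW//.
    by rewrite f0 add0r.
  by apply: summable_sub_itv sI => //; exact: ltW.
by apply: eq_ip => y /E.
Qed.

Lemma pw_glue K a b x s f p : itv_partition x b s -> (size p <= K)%N ->
  pw K x s f -> pw K a (x :: s) (fun y => if y < x then p.[y] else f y).
Proof.
move=> xs sp pf; apply/each_cons; split.
  by exists p => // y; rewrite in_itv/= => /andP[_ ->].
apply: each_imp2 (each_bounds xs) pf => l r [xl lr rb] [q sq hq]; exists q => //.
move=> y ylr; rewrite ltNge (_ : x <= y) ?hq//.
by move: ylr; rewrite in_itv/= => /andP[+ _]; move=> /ltW; exact: le_trans.
Qed.

(** For positive [K] the indicator of an element is an admissible piecewise polynomial. This is one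
    of the places where the degree must be at least one. *)
Lemma ip_orth_elements K a b s f : itv_partition a b s -> sq_int `]a, b[ f ->
  (0 < K)%N -> (forall q, pw K a s q -> ip `]a, b[ f q = 0) ->
  each (fun l r => \int[mu]_(t in `]l, r[) f t = 0) a s.
Proof.
move=> ps; move: ps f.
apply: (@itv_partition_rect _ b (fun a s => forall f, sq_int `]a, b[ f ->
  (0 < K)%N -> (forall q, pw K a s q -> ip `]a, b[ f q = 0) ->
  each (fun l r => \int[mu]_(t in `]l, r[) f t = 0) a s))
  => [f _ _ _ []//|{}a x {}s ax xb xs IH f sf K0 fq].
have pas : itv_partition a b (x :: s) by case: xs => ? ?; split; rewrite //= ax.
have s2 : sq_int `]x, b[ f by apply: sq_int_sub sf => //; exact: ltW.
have ext := fun q1 p1 => @pw_glue K a b x s q1 p1 xs.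
have key q1 (p1 : {poly R}) : (size p1 <= K)%N -> pw K x s q1 ->
    ip `]a, x[ f (horner p1) + ip `]x, b[ f q1 = 0.
  move=> sp1 pq1; rewrite -(fq _ (ext q1 p1 sp1 pq1)) (ip_itvD (ltW ax) xb)//; last first.
    exact: pw_sq_int pas (ext q1 p1 sp1 pq1).
  congr (_ + _); apply: eq_ip => // y /=; rewrite in_itv/= => /andP[h1 h2].
    by rewrite h2.
  by rewrite ltNge ltW.
apply/each_cons; split.
  have := key (fun=> 0) 1; rewrite size_poly1 => /(_ K0) h.
  rewrite -[RHS]h; last by move=> j _; exists 0; [rewrite size_poly0|move=> y _; rewrite horner0].
  have -> : ip `]x, b[ f (fun=> 0) = 0.
    by rewrite /ip -[RHS](mul0r (b - x)) -Rintegral_cst_itv//; apply: eq_Rintegral => t _; rewrite mulr0.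
  by rewrite addr0; apply: eq_Rintegral => t _; rewrite hornerC mulr1.
apply: IH => // q1 pq1; have := key q1 0; rewrite size_poly0 => /(_ isT pq1).
have -> : ip `]a, x[ f (horner 0) = 0.
  rewrite /ip -[RHS](mul0r (x - a)) -Rintegral_cst_itv//; last exact: ltW.
  by apply: eq_Rintegral => t _; rewrite horner0 mulr0.
by rewrite add0r.
Qed.

(** Expansion of [f] in the system [e], stated through inner products because [pw] leaves the values
    at the nodes free. *)
Definition represents a b n (e : 'I_n -> R -> R) f := forall w, sq_int `]a, b[ w ->
  ip `]a, b[ f w = \sum_i ip `]a, b[ f (e i) * ip `]a, b[ (e i) w.

(** Residuals of norm zero are dropped, so the generators may be linearly dependent. The class [C]
    is a linear space that the construction does not leave. *)
Lemma gram_schmidt a b (C : (R -> R) -> Prop) (fs : seq (R -> R)) :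
  (forall f, C f -> sq_int `]a, b[ f) ->
  C (fun=> 0) ->
  (forall f g, C f -> C g -> C (fun x => f x + g x)) ->
  (forall c f, C f -> C (fun x => c * f x)) ->
  (forall j, (j < size fs)%N -> C (nth (fun=> 0) fs j)) ->
  exists n (e : 'I_n -> R -> R),
    [/\ forall i, C (e i), forall i j, ip `]a, b[ (e i) (e j) = (i == j)%:R &
        forall j, (j < size fs)%N -> represents a b e (nth (fun=> 0) fs j)].
Proof.
move=> Csq C0 CD CZ; elim: fs => [|f fs IH] Cfs.
  by exists 0%N, (fun _ _ => 0); split=> [[]|[]|].
have {}IH := IH (fun j js => Cfs j.+1 js).
have [n [e [Ce oe re]]] := IH; have Cf := Cfs 0%N isT; rewrite /= in Cf.
have sf := Csq _ Cf; have se i := Csq _ (Ce i).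
pose c i := ip `]a, b[ f (e i).
have Csum : C (fun x => \sum_i c i * e i x).
  have : forall r : seq 'I_n, C (fun x => \sum_(i <- r) c i * e i x).
    elim=> [|i r IHr]; first by move: C0; congr C; apply/funext => x; rewrite big_nil.
    by have := CD _ _ (CZ (c i) _ (Ce i)) IHr; congr C; apply/funext => x; rewrite big_cons.
  exact.
pose r x := f x - \sum_i c i * e i x.
have Cr : C r.
  have := CD _ _ Cf (CZ (-1) _ Csum); congr C; apply/funext => x.
  by rewrite mulN1r.
have sr := Csq _ Cr; have ssum := Csq _ Csum.
have ipr w : sq_int `]a, b[ w -> ip `]a, b[ r w =
    ip `]a, b[ f w - \sum_i c i * ip `]a, b[ (e i) w.
  by move=> sw; rewrite ipBl// ip_suml.
have re0 i : ip `]a, b[ r (e i) = 0.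
  rewrite ipr// (bigD1 i)//= oe eqxx mulr1 big1 ?addr0 ?subrr// => j ji.
  by rewrite oe (negbTE ji) mulr0.
have [N0|N0] := eqVneq (ip `]a, b[ r r) 0.
  exists n, e; split=> // -[_|j js]; last exact: re.
  move=> w sw; have := CS2 (mitv a b) sr sw; rewrite N0 mul0r.
  move=> h; have /eqP : ip `]a, b[ r w ^+ 2 == 0 by rewrite eq_le sqr_ge0 andbT.
  move/eqP; rewrite expf_eq0/= ipr// subr_eq0 => /eqP ->.
  by [].
have N1 : 0 < ip `]a, b[ r r by rewrite lt_neqAle eq_sym N0 ip_ge0.
set N := Num.sqrt (ip `]a, b[ r r).
have NN : N * N = ip `]a, b[ r r by rewrite -expr2 sqr_sqrtr// ltW.
have Nn : N != 0 by rewrite gt_eqF// sqrtr_gt0.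
pose e0 x := N^-1 * r x.
pose e' (i : 'I_n.+1) := oapp e e0 (unlift ord0 i).
have Ce0 : C e0 by exact: CZ.
have E0 : e' ord0 = e0 by rewrite /e' unlift_none.
have EL i : e' (lift ord0 i) = e i by rewrite /e' liftK.
have rE : forall w, sq_int `]a, b[ w -> ip `]a, b[ e0 w = N^-1 * ip `]a, b[ r w.
  by move=> w sw; rewrite ipZl.
have ipfe0 : ip `]a, b[ f e0 = N.
  have -> : ip `]a, b[ f e0 = N^-1 * ip `]a, b[ r f by rewrite ipC rE.
  have -> : ip `]a, b[ r f = ip `]a, b[ r r.
    rewrite [RHS](_ : _ = ip `]a, b[ r f - \sum_i c i * ip `]a, b[ r (e i)).
      by rewrite big1 ?subr0// => i _; rewrite re0 mulr0.
    rewrite [LHS](_ : _ = ip `]a, b[ r (fun x => f x - \sum_i c i * e i x))//.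
    rewrite ipBr//; congr (_ - _); rewrite ipC ip_suml//.
    by apply: eq_bigr => i _; rewrite [ip _ (e i) _]ipC.
  by rewrite -NN mulKf.
exists n.+1, e'; split.
- by move=> i; have [j ->|->] := unliftP ord0 i; rewrite ?EL ?E0.
- have h i : ip `]a, b[ e0 (e i) = 0 by rewrite rE// re0 mulr0.
  move=> i j; have [i' ->|->] := unliftP ord0 i; have [j' ->|->] := unliftP ord0 j;
    rewrite ?EL ?E0.
  + by rewrite oe (inj_eq lift_inj).
  + by rewrite ipC h eq_sym (negbTE (neq_lift _ _)).
  + by rewrite h (negbTE (neq_lift _ _)).
  + rewrite rE; last exact: Csq.
    by rewrite ipC rE// -NN eqxx mulKf// mulVf.
move=> [_|j js] w sw /=.
  rewrite big_ord_recl E0 ipfe0 rE// mulrA mulfV// mul1r.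
  rewrite ipr// addrAC -addrA (_ : _ - _ = 0) ?addr0//.
  by apply/eqP; rewrite subr_eq0; apply/eqP; apply: eq_bigr => i _; rewrite EL.
have {}js : (j < size fs)%N := js.
rewrite big_ord_recl E0 (_ : ip _ _ e0 = 0) ?mul0r ?add0r.
  by rewrite re//; apply: eq_bigr => i _; rewrite EL.
rewrite re; last exact: Csq.
  by rewrite big1// => i _; rewrite ipC [X in _ * X]ipC rE// re0 mulr0 mulr0.
exact: js.
Qed.

Lemma pw0 K a s : pw K a s (fun=> 0).
Proof. by move=> j _; exists 0; [rewrite size_poly0|move=> y _; rewrite horner0]. Qed.

(** The generators are the monomials on single elements, extended by zero. Spanning is stated by
    induction: every linear class [L] that contains the generators contains each piecewise
    polynomial, up to its values at the nodes. *)
Lemma pw_finitely_spanned K a b s : itv_partition a b s ->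
  exists2 fs : seq (R -> R),
    forall j, (j < size fs)%N -> pw K a s (nth (fun=> 0) fs j) &
    forall L : (R -> R) -> Prop, L (fun=> 0) ->
      (forall f g, L f -> L g -> L (fun x => f x + g x)) ->
      (forall c f, L f -> L (fun x => c * f x)) ->
      (forall j, (j < size fs)%N -> L (nth (fun=> 0) fs j)) ->
      forall f, pw K a s f -> exists2 g, L g &
        forall y, y \in `]a, b[ -> y \notin s -> f y = g y.
Proof.
move=> ps; move: ps.
apply: (@itv_partition_rect _ b (fun a s => exists2 fs : seq (R -> R),
    forall j, (j < size fs)%N -> pw K a s (nth (fun=> 0) fs j) &
    forall L : (R -> R) -> Prop, L (fun=> 0) ->
      (forall f g, L f -> L g -> L (fun x => f x + g x)) ->
      (forall c f, L f -> L (fun x => c * f x)) ->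
      (forall j, (j < size fs)%N -> L (nth (fun=> 0) fs j)) ->
      forall f, pw K a s f -> exists2 g, L g &
        forall y, y \in `]a, b[ -> y \notin s -> f y = g y)).
  exists [::] => // L L0 _ _ _ f _; exists (fun=> 0) => // y.
  by rewrite in_itv/= => /andP[/lt_trans h /h]; rewrite ltxx.
move=> {}a x {}s ax xb xs [fs pfs Lfs].
pose mono m (y : R) := if y < x then y ^+ m else 0.
pose ext (g : R -> R) (y : R) := if y < x then 0 else g y.
exists ([seq mono m | m <- iota 0 K] ++ map ext fs).
  move=> j; rewrite size_cat !size_map size_iota => js; rewrite nth_cat size_map size_iota.
  case: ltnP => jK.
    rewrite (nth_map 0%N) ?size_iota// nth_iota// add0n.
    have := @pw_glue K a b x s (fun=> 0) 'X^j xs; rewrite size_polyXn.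
    move=> /(_ jK (@pw0 K x s)); congr pw; apply/funext => y.
    by rewrite /mono hornerXn.
  have js' : (j - K < size fs)%N by rewrite ltn_subLR.
  rewrite (nth_map (fun=> 0))//.
  have := @pw_glue K a b x s (nth (fun=> 0) fs (j - K)) 0 xs; rewrite size_poly0.
  move=> /(_ isT (pfs _ js')); congr pw; apply/funext => y.
  by rewrite /ext horner0.
move=> L L0 LD LZ Lnth f /each_cons[[p sp hp] pf].
have Lmono m : (m < K)%N -> L (mono m).
  move=> mK; have := Lnth m; rewrite size_cat nth_cat !size_map size_iota mK.
  by rewrite (nth_map 0%N) ?size_iota// nth_iota// add0n; apply; rewrite ltn_addr.
have Lext j : (j < size fs)%N -> L (ext (nth (fun=> 0) fs j)).
  move=> js; have := Lnth (K + j)%N; rewrite size_cat nth_cat !size_map size_iota.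
  rewrite (ltnNge (K + j) K) leq_addr/= addKn (nth_map (fun=> 0))//; apply.
  by rewrite ltn_add2l.
pose g1 y := \sum_(m < K) p`_m * mono m y.
have Lg1 : L g1.
  have : forall r : seq 'I_K, L (fun y => \sum_(m <- r) p`_m * mono m y).
    elim=> [|m r IHr]; first by move: L0; congr L; apply/funext => y; rewrite big_nil.
    have := LD _ _ (LZ p`_m _ (Lmono m (ltn_ord m))) IHr.
    by congr L; apply/funext => y; rewrite big_cons.
  exact.
have [||||g Lg fg] := Lfs (fun g => L (ext g)) _ _ _ _ f pf.
- by move: L0; congr L; apply/funext => y; rewrite /ext; case: ifP.
- move=> f1 f2 L1 L2; have := LD _ _ L1 L2; congr L; apply/funext => y.
  by rewrite /ext; case: ifP; rewrite ?addr0.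
- move=> c f1 L1; have := LZ c _ L1; congr L; apply/funext => y.
  by rewrite /ext; case: ifP; rewrite ?mulr0.
- exact: Lext.
exists (fun y => g1 y + ext g y); first exact: LD.
move=> y; rewrite in_itv/= inE negb_or => /andP[ay yb] /andP[yx ys].
move: yx; rewrite neq_lt => /orP[yx|xy].
  rewrite /ext yx addr0 hp ?in_itv/= ?ay// (horner_coef_wide _ sp) /g1.
  by apply: eq_bigr => m _; rewrite /mono yx.
rewrite /ext ltNge ltW//= -fg ?in_itv/= ?xy// /g1 big1 ?add0r// => m _.
by rewrite /mono ltNge ltW//= mulr0.
Qed.

Lemma ae_notin_seq s : {ae mu, forall y : R, y \notin s}.
Proof.
have cs : countable [set` s] by exact/finite_set_countable/finite_seq.
exists [set` s]; split.
- exact: countable_measurable.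
- exact: countable_lebesgue_measure0.
- by move=> y /= /negP; rewrite negbK.
Qed.

Lemma pw_orthonormal_basis K a b s : itv_partition a b s ->
  exists n (e : 'I_n -> R -> R),
    [/\ forall i, pw K a s (e i), forall i j, ip `]a, b[ (e i) (e j) = (i == j)%:R &
        forall f, pw K a s f -> represents a b e f].
Proof.
move=> ps; have [fs pfs Lfs] := pw_finitely_spanned K ps.
have [||||n [e [pe oe re]]] := @gram_schmidt a b (pw K a s) fs _ _ _ _ pfs.
- by move=> f; exact: pw_sq_int ps.
- exact: pw0.
- by move=> f g; exact: pwD.
- by move=> c f; exact: pwZ.
exists n, e; split=> // f pf.
have se i : sq_int `]a, b[ (e i) := pw_sq_int ps (pe i).
have [||||g [sg rg] fg] := Lfs (fun g => sq_int `]a, b[ g /\ represents a b e g) _ _ _ _ f pf.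
- split=> [|w sw]; first exact: sq_int_cst.
  rewrite big1 => [|i _]; rewrite /ip.
    by under eq_Rintegral do rewrite mul0r; rewrite Rintegral_cst// mul0r.
  by under eq_Rintegral do rewrite mul0r; rewrite Rintegral_cst// mul0r mul0r.
- move=> f1 f2 [s1 r1] [s2 r2]; split=> [|w sw]; first exact: sq_intD.
  rewrite ipDl// r1// r2// -big_split/=; apply: eq_bigr => i _.
  by rewrite ipDl// mulrDl.
- move=> c f1 [s1 r1]; split=> [|w sw]; first exact: sq_intZ.
  rewrite ipZl// r1// mulr_sumr; apply: eq_bigr => i _.
  by rewrite ipZl// mulrA.
- move=> j js; split; last exact: re.
  by apply: pw_sq_int ps _; exact: pfs.
have E w : sq_int `]a, b[ w -> ip `]a, b[ f w = ip `]a, b[ g w.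
  move=> sw; apply: ae_eq_ip => //; [exact: pw_measurable ps pf|exact: sg.1|exact: sw.1|].
  by apply: aeS (ae_notin_seq s) => y ys yab; exact: fg.
move=> w sw; rewrite E// rg//; apply: eq_bigr => i _; by rewrite E.
Qed.

(* [antiderivative_chain m A C] expresses that C 0, ..., C m are absolutely continuous
   representatives of successive derivatives, with C m.+1 = A. *)
Definition antiderivative_chain a b m (C : nat -> R -> R) :=
  (forall j, (j <= m.+1)%N -> sq_int `]a, b[ (C j)) /\
  forall j, (j <= m)%N -> forall x y, a <= x -> x <= y -> y <= b ->
    C j y = C j x + \int[mu]_(t in `]x, y[) C j.+1 t.

(** Taylor expansion at [l] without a remainder formula: the polynomial that approximates [C j.+1]
    is integrated from [l] and given the value of [C j] there. Each integration gains [r - l] by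
    [local_poincare]. *)
Lemma chain_taylor a b m C l r : antiderivative_chain a b m C ->
  a <= l -> l <= r -> r <= b -> forall i, (i <= m.+1)%N ->
  exists2 p : {poly R}, (size p <= i)%N &
    ip `]l, r[ (fun y => C (m.+1 - i)%N y - p.[y]) (fun y => C (m.+1 - i)%N y - p.[y]) <=
    (r - l) ^+ (2 * i) * ip `]l, r[ (C m.+1) (C m.+1).
Proof.
move=> [sC hC] al lr rb; have sp (p : {poly R}) : sq_int `]l, r[ (horner p).
  by apply: sq_int_cont => //; apply: continuous_subspaceT; exact: continuous_horner.
elim=> [_|i IH im].
  exists 0; first by rewrite size_poly0.
  rewrite muln0 expr0 mul1r subn0 le_eqVlt; apply/orP; left; apply/eqP.
  by apply: eq_ip => y _; rewrite horner0 subr0.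
have [p sizep hp] := IH (ltnW im).
have [q sizeq dq] := poly_primitive p.
have E : (m.+1 - i = (m.+1 - i.+1).+1)%N by rewrite subnSK.
set j := (m.+1 - i.+1)%N in E *; rewrite E in hp.
have jm : (j <= m)%N by rewrite /j subSS leq_subr.
exists (q + (C j l - q.[l])%:P).
  apply: leq_trans (size_polyD _ _) _; rewrite geq_max (leq_trans sizeq)//=.
  by rewrite (leq_trans (size_polyC_leq1 _)).
have sCj n : (n <= m.+1)%N -> sq_int `]l, r[ (C n) by move=> nm; exact: sq_int_sub (sC n nm).
have sd : sq_int `]l, r[ (fun y => C j.+1 y - p.[y]).
  by apply: sq_intB => //; exact: sCj.
rewrite mulnS exprD -mulrA; apply: le_trans (_ : (r - l) ^+ 2 * ip `]l, r[
  (fun y => C j.+1 y - p.[y]) (fun y => C j.+1 y - p.[y]) <= _); last first.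
  by rewrite ler_wpM2l// sqr_ge0.
apply: local_poincare => //.
  apply: measurable_funB; first by have [] := sCj j (leqW jm).
  exact: (sp _).1.
move=> y; rewrite in_itv/= => /andP[ly yr].
have -> : C j y - (q + (C j l - q.[l])%:P).[y] =
    \int[mu]_(t in `]l, y[) (C j.+1 t - p.[t]).
  have s1 := sCj j.+1 jm.
  rewrite RintegralB//; first last.
  - by apply: sq_int_summable; apply: sq_int_sub (sp p) => //; exact: ltW.
  - by apply: sq_int_summable; apply: sq_int_sub s1 => //; exact: ltW.
  rewrite (hC j jm l y) ?(ltW ly)//; last by apply: le_trans rb; exact: ltW.
  rewrite hornerD hornerC -dq Rintegral_poly_deriv ?(ltW ly)//; ring.
apply: Rintegral_norm_sub => //; first exact: ltW.
exact: sq_int_summable.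
Qed.

(** The Taylor polynomials of [C 1] at the left ends of the elements, glued together. *)
Lemma chain_best_pw (h : R) a b s m C : itv_partition a b s ->
  antiderivative_chain a b m C -> each (fun l r => r - l <= h) a s ->
  exists2 q, pw m a s q &
    ip `]a, b[ (fun y => C 1%N y - q y) (fun y => C 1%N y - q y) <=
    h ^+ (2 * m) * ip `]a, b[ (C m.+1) (C m.+1).
Proof.
move=> ps; move: ps.
apply: (@itv_partition_rect _ b (fun a s => antiderivative_chain a b m C ->
  each (fun l r => r - l <= h) a s ->
  exists2 q, pw m a s q &
    ip `]a, b[ (fun y => C 1%N y - q y) (fun y => C 1%N y - q y) <=
    h ^+ (2 * m) * ip `]a, b[ (C m.+1) (C m.+1))).
  move=> _ _; exists (fun=> 0); first by [].
  by rewrite /ip !set_itvoo0 !Rintegral_set0 mulr0.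
move=> {}a x {}s ax xb xs IH [sC hC] /each_cons[hx hs].
have pas : itv_partition a b (x :: s) by case: xs => ? ?; split; rewrite //= ax.
have [q pq hq] : exists2 q, pw m x s q &
    ip `]x, b[ (fun y => C 1%N y - q y) (fun y => C 1%N y - q y) <=
    h ^+ (2 * m) * ip `]x, b[ (C m.+1) (C m.+1).
  apply: IH => //; split.
    by move=> j jm; apply: sq_int_sub (sC j jm) => //; exact: ltW.
  by move=> j jm y z xy yz zb; apply: hC => //; apply: le_trans xy; exact: ltW.
have [p sp hp] := chain_taylor (conj sC hC) (lexx a) (ltW ax) xb (leqnSn m).
rewrite subSnn in hp.
have pg := @pw_glue m a b x s q p xs sp pq.
exists (fun y => if y < x then p.[y] else q y) => //.
have sd : sq_int `]a, b[ (fun y => C 1%N y - (if y < x then p.[y] else q y)).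
  by apply: sq_intB => //; [exact: sC|exact: pw_sq_int pas pg].
rewrite (ip_itvD (ltW ax) xb sd sd) (ip_itvD (ltW ax) xb (sC m.+1 _) (sC m.+1 _))//.
rewrite mulrDr lerD//.
  apply: le_trans (_ : (x - a) ^+ (2 * m) * ip `]a, x[ (C m.+1) (C m.+1) <= _).
    apply: le_trans hp; rewrite le_eqVlt; apply/orP; left; apply/eqP.
    by apply: eq_ip => y /=; rewrite in_itv/= => /andP[_ ->].
  rewrite ler_wpM2r ?ip_ge0// lerXn2r ?nnegrE ?subr_ge0 ?(ltW ax)//.
  by apply: le_trans hx; rewrite subr_ge0 ltW.
apply: le_trans hq; rewrite le_eqVlt; apply/orP; left; apply/eqP.
by apply: eq_ip => y /=; rewrite in_itv/= => /andP[xy _]; rewrite ltNge (ltW xy).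
Qed.

Definition proj a b n (e : 'I_n -> R -> R) u y : R := \sum_i ip `]a, b[ u (e i) * e i y.

(** One factor [h] comes from the zero means of the residual of the projection on the elements, the
    other [m] from the approximation of [C 1] by piecewise polynomials of degree less than [m]. *)
Lemma ritz_estimate (h : R) b s m n (e : 'I_n -> R -> R) C :
  itv_partition 0 b s -> (0 < m)%N -> antiderivative_chain 0 b m C ->
  each (fun l r => r - l <= h) 0 s ->
  (forall i, pw m 0 s (e i)) -> (forall f, pw m 0 s f -> represents 0 b e f) ->
  nrm `]0, b[ (fun y => C 0%N y - (C 0%N 0 + \int[mu]_(t in `]0, y[) proj 0 b e (C 1%N) t)) <=
  h ^+ m.+1 * nrm `]0, b[ (C m.+1).
Proof.
move=> ps m0 [sC hC] hs pe re.
(* [h] merely bounds the lengths of the elements, so its sign is known only if there is an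
   element. *)
have h0 : 0 <= h \/ b = 0.
  case: (s) ps hs => [/itv_partition_nil ->|x s' ps' /each_cons[hx _]]; first by right.
  left; apply: le_trans hx; rewrite subr_ge0; case: ps' => /= /andP[/ltW].
  by [].
have se i : sq_int `]0, b[ (e i) := pw_sq_int ps (pe i).
set P := proj 0 b e (C 1%N).
have pP : pw m 0 s P by exact: pw_sum.
have sP := pw_sq_int ps pP.
have s1 : sq_int `]0, b[ (C 1%N) by exact: sC.
pose f y := C 1%N y - P y.
have sf : sq_int `]0, b[ f by exact: sq_intB.
have orth q : pw m 0 s q -> ip `]0, b[ f q = 0.
  move=> pq; have sq := pw_sq_int ps pq.
  rewrite ipBl// [X in _ - X]ip_suml// ipC re//; apply/eqP; rewrite subr_eq0; apply/eqP.
  by apply: eq_bigr => i _; rewrite [ip _ q _]ipC mulrC [ip _ (e i) (C _)]ipC.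
have el0 := ip_orth_elements ps sf m0 orth.
have b0 : 0 <= b := itv_partition_le ps.
have step1 : ip `]0, b[ (fun y => C 0%N y - (C 0%N 0 + \int[mu]_(t in `]0, y[) P t))
    (fun y => C 0%N y - (C 0%N 0 + \int[mu]_(t in `]0, y[) P t)) <= h ^+ 2 * ip `]0, b[ f f.
  apply: le_trans (ip_primitive_le ps sf hs el0).
  rewrite le_eqVlt; apply/orP; left; apply/eqP.
  have E y : y \in `]0, b[ -> C 0%N y - (C 0%N 0 + \int[mu]_(t in `]0, y[) P t) =
      \int[mu]_(t in `]0, y[) f t.
    rewrite in_itv/= => /andP[y0 yb]; rewrite RintegralB//; first last.
    - by apply: sq_int_summable; apply: sq_int_sub sP => //; exact: ltW.
    - by apply: sq_int_summable; apply: sq_int_sub s1 => //; exact: ltW.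
    by rewrite (hC 0%N isT 0 y (lexx 0) (ltW y0) (ltW yb)) opprD addrA [C 0%N 0 + _]addrC addrK.
  by apply: eq_ip => y /E.
have [q pq hq] := chain_best_pw ps (conj sC hC) hs.
have sq := pw_sq_int ps pq.
(* Pythagoras: the orthogonal projection is the best approximation. *)
have step2 : ip `]0, b[ f f <= ip `]0, b[ (fun y => C 1%N y - q y) (fun y => C 1%N y - q y).
  pose g y := P y - q y; have sg : sq_int `]0, b[ g by exact: sq_intB.
  have -> : ip `]0, b[ (fun y => C 1%N y - q y) (fun y => C 1%N y - q y) =
      ip `]0, b[ f f + ip `]0, b[ g g.
    rewrite (@eq_ip _ _ _ (fun y => f y - (-1) * g y) _ (fun y => f y - (-1) * g y));
      [|by move=> y _; rewrite /f /g; ring..].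
    rewrite ip_quad// (orth g) ?mulr0; first by ring.
    rewrite /g (_ : (fun y => _) = fun y => P y + (-1) * q y); last by apply/funext => y; ring.
    by apply: pwD => //; exact: pwZ.
  by rewrite lerDl ip_ge0.
case: h0 => [h0|b00]; last first.
  rewrite b00 /nrm /ip !set_itvoo0 !Rintegral_set0 sqrtr0 mulr0//.
apply: nrm_le; first by rewrite mulr_ge0 ?nrm_ge0// exprn_ge0.
rewrite exprMn nrm2 -exprM mulnC mulnS exprD -mulrA.
apply: le_trans step1 _; rewrite ler_wpM2l ?sqr_ge0//.
exact: le_trans step2 hq.
Qed.

(** Rolle's theorem between consecutive zeros of [f 0] produces one ordered zero of [f 1] less, and
    the induction goes on with the shifted sequence. *)
Lemma iterated_rolle m (f : nat -> R -> R) a b (z : seq R) :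
  (forall j, (j <= m)%N -> cont_on a b (f j)) ->
  (forall j, (j < m)%N -> forall x, x \in `]a, b[ -> is_derive x 1 (f j) (f j.+1 x)) ->
  size z = m.+1 -> path <%R (head 0 z) (behead z) -> (forall x, x \in z -> x \in `[a, b] /\ f 0%N x = 0) ->
  forall j, (j <= m)%N -> exists2 x, x \in `[a, b] & f j x = 0.
Proof.
elim: m f z => [|m IH] f z cf df sz pz fz.
  move=> j; rewrite leqn0 => /eqP ->; case: z sz pz fz => [//|x z] _ _ fz.
  by exists x; [exact: (fz x (mem_head _ _)).1|exact: (fz x (mem_head _ _)).2].
have [z' [sz' pz' fz']] : exists z' : seq R, [/\ size z' = m.+1,
    path <%R (head 0 z') (behead z') & forall x, x \in z' -> x \in `[a, b] /\ f 1%N x = 0].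
  have rolle x y : x \in `[a, b] -> y \in `[a, b] -> x < y -> f 0%N x = 0 ->
      f 0%N y = 0 -> exists c, [/\ x < c, c < y & f 1%N c = 0].
    rewrite !in_itv/= => /andP[ax xb] /andP[ay yb] xy fx fy.
    have [c] := @C1_on_MVT _ a b (f 0%N) (f 1%N) x y (conj (cf 0%N isT) (df 0%N isT))
      (ltac:(by rewrite in_itv/= ax)) (ltac:(by rewrite in_itv/= ay)) xy.
    move=> /andP[xc cy]; rewrite fx fy subrr => /esym/eqP.
    rewrite mulf_eq0 subr_eq0 (gt_eqF xy) orbF => /eqP fc.
    by exists c.
  have : forall (x : R) (l : seq R), path <%R x l ->
      (forall y, y \in x :: l -> y \in `[a, b] /\ f 0%N y = 0) ->
      exists l', [/\ size l' = size l, path <%R x l' &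
        forall y, y \in l' -> y \in `[a, b] /\ f 1%N y = 0].
    move=> x l; elim: l x => [|y l IHl] x /=; first by exists [::].
    move=> /andP[xy pl] hl.
    have [xab fx] := hl x (mem_head _ _).
    have [yab fy] : y \in `[a, b] /\ f 0%N y = 0 by apply: hl; rewrite !inE eqxx orbT.
    have [c [xc cy fc]] := rolle x y xab yab xy fx fy.
    have [|l' [sl' pl' hl']] := IHl y pl.
      by move=> t tl; apply: hl; rewrite inE tl orbT.
    exists (c :: l'); split; rewrite /= ?sl' ?xc//=.
      by case: l' pl' {sl' hl'} => //= t l' /andP[/(lt_trans cy) -> ->].
    move=> t; rewrite inE => /orP[/eqP ->|/hl'//]; split=> //.
    move: xab yab; rewrite !in_itv/= => /andP[ax _] /andP[_ yb].
    by rewrite (le_trans ax (ltW xc)) (le_trans (ltW cy) yb).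
  case: z sz pz fz => [//|x l] /= [sl] pl hl /(_ x l pl hl)[l' [sl' pl' hl']].
  exists l'; split=> //; first by rewrite sl' sl.
  by case: l' pl' {sl' hl'} => //= t l' /andP[].
have {}IH := IH (fun j => f j.+1) z' (fun j jm => cf j.+1 jm) (fun j jm => df j.+1 jm) sz' pz' fz'.
case=> [_|j jm]; last exact: IH.
case: z sz pz fz => [//|x z] _ _ fz.
by exists x; [exact: (fz x (mem_head _ _)).1|exact: (fz x (mem_head _ _)).2].
Qed.

(** The primitive of a square integrable function is Hoelder continuous of exponent 1/2, by
    Cauchy-Schwarz. *)
Lemma chain_cont_on a b m C j : antiderivative_chain a b m C -> (j <= m)%N ->
  cont_on a b (C j).
Proof.
move=> [sC hC] jm; have sj := sC j.+1 jm; set N := ip `]a, b[ (C j.+1) (C j.+1).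
have N0 : 0 <= N := ip_ge0 _ _.
have W x y : a <= x -> x <= y -> y <= b -> (C j y - C j x) ^+ 2 <= (y - x) * N.
  move=> ax xy yb; rewrite (hC j jm x y)// addrAC subrr add0r.
  have sxy : sq_int `]x, y[ (C j.+1) by exact: sq_int_sub sj.
  apply: (@le_trans _ _ ((\int[mu]_(t in `]x, y[) `|C j.+1 t|) ^+ 2)).
    have n0 : 0 <= \int[mu]_(t in `]x, y[) `|C j.+1 t| by apply: Rintegral_ge0.
    rewrite -[X in X <= _]real_normK ?num_real// lerXn2r ?nnegrE//.
    by apply: Rintegral_norm_sub => //; exact: sq_int_summable.
  apply: le_trans (Rintegral_norm_sq_le xy sxy) _; rewrite ler_wpM2l ?subr_ge0//.
  rewrite /N (ip_itvD ax _ sj sj) ?(le_trans xy)//.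
  have sxb : sq_int `]x, b[ (C j.+1) by exact: sq_int_sub sj.
  rewrite (ip_itvD xy yb sxb sxb); have := ip_ge0 `]a, x[ (C j.+1).
  by have := ip_ge0 `]y, b[ (C j.+1); lra.
have W' x y : x \in `[a, b] -> y \in `[a, b] -> (C j y - C j x) ^+ 2 <= `|y - x| * N.
  rewrite !in_itv/= => /andP[ax xb] /andP[ay yb]; have [xy|yx] := leP x y.
    by rewrite ger0_norm ?subr_ge0//; exact: W.
  by rewrite distrC gtr0_norm ?subr_gt0// -sqrrN opprB; apply: W => //; exact: ltW.
apply/cont_onP => t tab e e0; have N1 : 0 < N + 1 by rewrite ltr_wpDl.
exists (e ^+ 2 / (N + 1)); first by rewrite divr_gt0// exprn_gt0.
move=> y yab yt; rewrite -(@ltr_pXn2r _ 2)// ?nnegrE ?(ltW e0)// real_normK ?num_real//.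
apply: le_lt_trans (W' _ _ tab yab) _.
apply: (@le_lt_trans _ _ (`|y - t| * (N + 1))); first by rewrite ler_wpM2l// lerDl.
by rewrite -ltr_pdivlMr.
Qed.

Lemma chain_is_derive b m C j (x : R) : antiderivative_chain 0 b m C -> (j < m)%N ->
  x \in `]0, b[ -> is_derive x 1 (C j) (C j.+1 x).
Proof.
move=> cC jm xb; have b0 : 0 < b by move: xb; rewrite in_itv/= => /andP[]; exact: lt_trans.
have cj := chain_cont_on cC jm; have [sC hC] := cC.
have d : is_derive x 1 (fun y => C j 0 + \int[mu]_(t in `]0, y[) C j.+1 t) (C j.+1 x).
  apply: is_derive_congr (is_deriveD (is_derive_cst (C j 0) x 1)
    (is_derive_primitive b0 cj xb)) => //.
  by rewrite add0r.
apply: near_eq_is_derive d.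
move: xb; rewrite in_itv/= => /andP[x0 xb].
near=> y; rewrite -(hC j (ltnW jm) 0 y)//; apply: ltW; near: y.
  exact: lt_nbhsr.
exact: lt_nbhsl.
Unshelve. all: by end_near. Qed.

Lemma chain_sub a b m C l r : antiderivative_chain a b m C -> a <= l -> r <= b ->
  antiderivative_chain l r m C.
Proof.
move=> [sC hC] al rb; split=> [j jm|j jm x y lx xy yr].
  exact: sq_int_sub (sC j jm).
by apply: hC => //; [exact: le_trans lx|exact: le_trans rb].
Qed.

Lemma chain_subr_poly a b m C p : a <= b -> antiderivative_chain a b m C ->
  antiderivative_chain a b m (fun j y => C j y - p^`(j).[y]).
Proof.
move=> ab [sC hC]; have sp (q : {poly R}) : sq_int `]a, b[ (horner q).
  by apply: sq_int_cont => //; apply: continuous_subspaceT; exact: continuous_horner.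
split=> [j jm|j jm x y ax xy yb].
  by apply: sq_intB => //; exact: sC.
rewrite RintegralB//; first last.
- by apply: sq_int_summable; exact: sq_int_sub (sp _).
- by apply: sq_int_summable; exact: sq_int_sub (sC _ _).
rewrite derivnS Rintegral_poly_deriv// (hC j jm x y)//; ring.
Qed.

(** Each derivative is the integral of the next one from its own zero, so [local_poincare] can be
    iterated up to order [m.+1]. *)
Lemma chain_zeros_le a b m C : a <= b -> antiderivative_chain a b m C ->
  (forall j, (j <= m)%N -> exists2 x, x \in `[a, b] & C j x = 0) ->
  ip `]a, b[ (C 0%N) (C 0%N) <= (b - a) ^+ (2 * m.+1) * ip `]a, b[ (C m.+1) (C m.+1).
Proof.
move=> ab [sC hC] zC.
suff : forall i, (i <= m.+1)%N -> ip `]a, b[ (C (m.+1 - i)%N) (C (m.+1 - i)%N) <=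
    (b - a) ^+ (2 * i) * ip `]a, b[ (C m.+1) (C m.+1).
  by move=> /(_ m.+1 (leqnn _)); rewrite subnn.
elim=> [_|i IH im]; first by rewrite subn0 muln0 expr0 mul1r.
have {}IH := IH (ltnW im).
have E : (m.+1 - i = (m.+1 - i.+1).+1)%N by rewrite subnSK.
set j := (m.+1 - i.+1)%N in E *; rewrite E in IH.
have jm : (j <= m)%N by rewrite /j subSS leq_subr.
have s1 := sC j.+1 jm; have [x] := zC j jm; rewrite in_itv/= => /andP[ax xb] Cx.
rewrite mulnS exprD -mulrA; apply: (@le_trans _ _ ((b - a) ^+ 2 *
  ip `]a, b[ (C j.+1) (C j.+1))); last by rewrite ler_wpM2l ?sqr_ge0.
apply: local_poincare => //; first by have [] := sC j (leqW jm).
move=> y; rewrite in_itv/= => /andP[ay yb]; have [xy|yx] := leP x y.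
  rewrite (hC j jm x y) ?(ltW yb)// Cx add0r.
  by apply: Rintegral_norm_sub => //; [exact: ltW|exact: sq_int_summable].
have := hC j jm y x (ltW ay) (ltW yx) xb; rewrite Cx => /eqP.
rewrite eq_sym addr_eq0 => /eqP ->; rewrite normrN.
by apply: Rintegral_norm_sub => //; [exact: ltW|exact: sq_int_summable].
Qed.

(** The error [C 0 - p] has [m.+1] zeros, hence each of its derivatives up to order [m] has one, and
    the derivative of order [m.+1] no longer contains [p]. The constant is one wherever the nodes
    lie, since no basis polynomial is estimated. *)
Lemma lagrange_element_estimate b m C l r p (z : seq R) : antiderivative_chain 0 b m C ->
  0 <= l -> l < r -> r <= b -> (size p <= m.+1)%N -> size z = m.+1 -> uniq z ->
  (forall x, x \in z -> x \in `[l, r] /\ C 0%N x = p.[x]) ->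
  ip `]l, r[ (fun y => C 0%N y - p.[y]) (fun y => C 0%N y - p.[y]) <=
  (r - l) ^+ (2 * m.+1) * ip `]l, r[ (C m.+1) (C m.+1).
Proof.
move=> cC l0 lr rb sp sz uz hz.
have cF := chain_subr_poly p (ltW lr) (chain_sub cC l0 rb).
have hc j : (j <= m)%N -> cont_on l r (fun y => C j y - p^`(j).[y]).
  by move=> jm; exact: (chain_cont_on cF).
have hd j : (j < m)%N -> forall x : R, x \in `]l, r[ ->
    is_derive x 1 (fun y => C j y - p^`(j).[y]) (C j.+1 x - p^`(j.+1).[x]).
  move=> jm x; rewrite in_itv/= => /andP[lx xr].
  have xb : x \in `]0, b[ by rewrite in_itv/= (le_lt_trans l0 lx) (lt_le_trans xr rb).
  have d1 := chain_is_derive cC jm xb.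
  have d2 := is_derive_poly p^`(j) x; rewrite -derivnS in d2.
  exact: is_deriveB d1 d2.
have hs : size (sort <=%R z) = m.+1 by rewrite size_sort.
have hp : path <%R (head 0 (sort <=%R z)) (behead (sort <=%R z)).
  have : sorted <%R (sort <=%R z) by rewrite lt_sorted_uniq_le sort_uniq uz sort_le_sorted.
  by case: (sort _ z).
have hz' x : x \in sort <=%R z -> x \in `[l, r] /\ C 0%N x - p^`(0).[x] = 0.
  by rewrite mem_sort => /hz[tlr E]; rewrite derivn0 E subrr.
have zr := iterated_rolle hc hd hs hp hz'.
have := chain_zeros_le (ltW lr) cF zr; rewrite derivn0 (derivn_poly0 sp).
have -> // : (fun y => C m.+1 y - (0 : {poly R}).[y]) = C m.+1.
by apply/funext => y; rewrite horner0 subr0.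
Qed.

Lemma le_ip_each a b s (K : R) f g : itv_partition a b s ->
  sq_int `]a, b[ f -> sq_int `]a, b[ g ->
  each (fun l r => ip `]l, r[ f f <= K * ip `]l, r[ g g) a s ->
  ip `]a, b[ f f <= K * ip `]a, b[ g g.
Proof.
move=> ps; move: ps.
apply: (@itv_partition_rect _ b (fun a s =>
  sq_int `]a, b[ f -> sq_int `]a, b[ g ->
  each (fun l r => ip `]l, r[ f f <= K * ip `]l, r[ g g) a s ->
  ip `]a, b[ f f <= K * ip `]a, b[ g g)) => [_ _ _|{}a x {}s ax xb xs IH sf sg].
  by rewrite /ip !set_itvoo0 !Rintegral_set0 mulr0.
move=> /each_cons[h hs].
rewrite (ip_itvD (ltW ax) xb sf sf) (ip_itvD (ltW ax) xb sg sg) mulrDr lerD//.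
by apply: IH => //; apply: sq_int_sub (_ : sq_int `]a, b[ _) => //; exact: ltW.
Qed.

End Projection.

(** * Sobolev functions and finite elements *)

Section Sobolev_facts.
Context {R : realType}.
Local Notation mu := (@lebesgue_measure R).
Local Notation mR := (measurableTypeR R).
Implicit Types (f g u w : R -> R) (a b M : R) (s : seq R) (p : {poly R}).

Let mitv a b : measurable (`]a, b[%classic : set mR).
Proof. exact: measurable_itv. Qed.

Lemma weak_deriv_sq_int a b j u g : weak_deriv a b j u g ->
  sq_int `]a, b[ u /\ sq_int `]a, b[ g.
Proof. by move=> [/L2P su /L2P sg _]. Qed.

Lemma sq_int_test a b phi : test_function a b phi -> sq_int `]a, b[ phi.
Proof.
move=> tphi; have [K _ hK] := test_bounded tphi.
by apply: sq_int_bounded (_ : forall y, _ -> _ <= K) => //; apply: measurable_smooth; case: tphi.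
Qed.

Lemma ae_eq_of_test a b f g : a < b -> sq_int `]a, b[ f -> sq_int `]a, b[ g ->
  (forall phi, test_function a b phi ->
    \int[mu]_(x in `]a, b[) (f x * phi x) = \int[mu]_(x in `]a, b[) (g x * phi x)) ->
  {ae mu, forall x, x \in `]a, b[ -> f x = g x}.
Proof.
move=> ab sf sg fg.
have : {ae mu, forall x, x \in `]a, b[ -> f x - g x = 0}.
  apply: ae_eq0_test => // [|phi tphi].
    by apply: summableB => //; exact: sq_int_summable.
  have st := sq_int_test tphi.
  transitivity (ip `]a, b[ (fun x => f x - g x) phi) => //.
  by rewrite ipBl// /ip fg// subrr.
by apply: aeS => x h xab; apply/eqP; rewrite -subr_eq0 h.
Qed.

Lemma weak_deriv_unique a b j u g g' : a < b -> weak_deriv a b j u g ->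
  weak_deriv a b j u g' -> {ae mu, forall x, x \in `]a, b[ -> g x = g' x}.
Proof.
move=> ab h h'; have [_ sg] := weak_deriv_sq_int h.
have [_ sg'] := weak_deriv_sq_int h'; case: h h' => _ _ h [_ _ h'].
apply: ae_eq_of_test => // phi tphi; have := h phi tphi; rewrite (h' phi tphi).
move/(congr1 ( *%R ((-1) ^+ j))); rewrite !mulrA -!expr2 -exprM mulnC exprM sqrrN expr1n.
by rewrite expr1n !mul1r => ->.
Qed.

Lemma weak_deriv_step a b j u g g' : weak_deriv a b j u g ->
  weak_deriv a b j.+1 u g' -> weak_derivative a b g g'.
Proof.
move=> [_ _ h] [_ _ h'] phi tphi; have := h _ (test_derive1 tphi).
have := h' phi tphi.
rewrite /derive1n iterSr => ->; rewrite exprS -mulrA mulN1r.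
move/(congr1 ( *%R ((-1) ^+ j))); rewrite mulrN !mulrA -!expr2 -exprM mulnC exprM sqrrN expr1n.
by rewrite expr1n !mul1r => ->.
Qed.

Lemma Hm_derivs_norm a b m u D M : 0 <= M -> Hm_derivs_le a b m u D M ->
  forall j, (j <= m)%N -> nrm `]a, b[ (D j) <= M.
Proof.
move=> M0 [wD hM] j jm.
have sD i : (i <= m)%N -> sq_int `]a, b[ (D i).
  by move=> /wD /weak_deriv_sq_int[].
have : (L2norm a b (D j) ^+ 2 <= (M ^+ 2)%:E)%E.
  apply: le_trans hM; rewrite (bigD1 (Ordinal (jm : (j < m.+1)%N)))//= leeDl//.
  apply: sume_ge0 => i _; rewrite L2normE; last by apply: sD; rewrite -ltnS.
  by rewrite mule_ge0// lee_fin nrm_ge0.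
rewrite (L2normE (sD j jm)) => h.
have {}h : ((nrm `]a, b[ (D j) * nrm `]a, b[ (D j))%:E <= (M ^+ 2)%:E)%E := h.
by rewrite -(@ler_pXn2r _ 2)// ?nnegrE ?nrm_ge0// expr2 -lee_fin.
Qed.

(** Successive weak derivatives are primitives of one another up to constants, by
    [weak_derivative_primitive]; replacing each by such a primitive makes the relations hold at
    every point. *)
Lemma Hm_derivs_chain m u D M : 0 <= M -> Hm_derivs_le 0 1 m.+1 u D M ->
  exists C, [/\ antiderivative_chain 0 1 m C,
    forall j, (j <= m.+1)%N -> {ae mu, forall x, x \in `]0, 1[ -> D j x = C j x},
    {ae mu, forall x, x \in `]0, 1[ -> u x = C 0%N x} &
    nrm `]0, 1[ (C m.+1) <= M].
Proof.
move=> M0 hD; have [wD _] := hD; have nD := Hm_derivs_norm M0 hD.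
have sD i : (i <= m.+1)%N -> sq_int `]0, 1[ (D i).
  by move=> /wD /weak_deriv_sq_int[].
have ID i : (i <= m.+1)%N -> summable_on `]0, 1[ (D i).
  by move=> im; apply: sq_int_summable; exact: sD.
have /choice[c hc] : forall j, exists c : R, (j <= m)%N ->
    {ae mu, forall x, x \in `]0, 1[ -> D j x = c + \int[mu]_(t in `]0, x[) D j.+1 t}.
  move=> j; have [jm|_] := leqP j m; last by exists 0.
  have [c h] := weak_derivative_primitive ltr01 (ID j (leqW jm)) (ID j.+1 jm)
    (weak_deriv_step (wD j (leqW jm)) (wD j.+1 jm)).
  by exists c.
(* The derivative of order [m.+1] is not a primitive and is kept as it is. *)
pose C j y := if (j <= m)%N then c j + \int[mu]_(t in `]0, y[) D j.+1 t else D j y.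
have DC j : (j <= m.+1)%N -> {ae mu, forall x, x \in `]0, 1[ -> D j x = C j x}.
  by move=> jm; rewrite /C; case: leqP => [/hc//|_]; exact: aeT.
have sC j : (j <= m.+1)%N -> sq_int `]0, 1[ (C j).
  move=> jm; apply: (ae_sq_int (D := `]0, 1[%classic) (mitv 0 1) _ (DC j jm) (sD j jm)).
  rewrite /C; have [jm'|_] := leqP j m; last by have [] := sD j jm.
  apply: measurable_funD; first exact: measurable_cst.
  by apply: measurable_primitive; exact: ID.
exists C; split=> //.
- split=> // j jm x y x0 xy y1; rewrite {1 2}/C jm -addrA; congr (_ + _).
  have sx : summable_on `]0, y[ (D j.+1) by apply: summable_sub_itv (ID j.+1 jm).
  rewrite (Rintegral_itvD x0 xy sx); congr (_ + _).
  apply: ae_eq_Rintegral => //.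
  + by apply: summable_meas; apply: summable_sub_itv (ID j.+1 jm).
  + by have [] := sq_int_sub x0 y1 (sC j.+1 jm).
  apply: aeS (DC j.+1 jm) => t h /=; rewrite in_itv/= => /andP[xt ty]; apply: h.
  by rewrite in_itv/= (le_lt_trans x0 xt) (lt_le_trans ty y1).
- have [su sD0] := weak_deriv_sq_int (wD 0%N isT).
  have u0 : {ae mu, forall x, x \in `]0, 1[ -> u x = D 0%N x}.
    apply: ae_eq_of_test => // phi tphi; have [_ _ /(_ phi tphi)] := wD 0%N isT.
    by rewrite expr0 mul1r.
  by apply: aeS2 u0 (DC 0%N isT) => x h1 h2 xab; rewrite h1// h2.
- rewrite -(@ae_eq_nrm _ _ (mitv 0 1) (D m.+1)) ?nD//.
  + by have [] := sD m.+1 (leqnn _).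
  + by have [] := sC m.+1 (leqnn _).
  + exact: DC.
Qed.

Lemma L2norm_cvg0 (f_ : nat -> R -> R) : (forall n, sq_int `]0, 1[ (f_ n)) ->
  (L2norm 0 1 (f_ n) @[n --> \oo] --> 0%E) ->
  nrm `]0, 1[ (f_ n) @[n --> \oo] --> (0 : R).
Proof.
move=> sf; have -> : (fun n => L2norm 0 1 (f_ n)) = EFin \o (fun n => nrm `]0, 1[ (f_ n)).
  by apply/funext => n; rewrite L2normE.
by move/fine_cvg.
Qed.

Lemma Rintegral_le_nrm f y : y <= 1 -> sq_int `]0, 1[ f ->
  `|\int[mu]_(t in `]0, y[) f t| <= nrm `]0, 1[ f.
Proof.
move=> y1 sf; apply: le_trans (Rintegral_norm_sub (lexx 0) y1 (sq_int_summable sf)) _.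
have n0 : 0 <= \int[mu]_(x in `]0, 1[) `|f x| by apply: Rintegral_ge0.
rewrite -(@ler_pXn2r _ 2)// ?nnegrE ?nrm_ge0// nrm2.
by have := Rintegral_norm_sq_le (@ler01 R) sf; rewrite subr0 mul1r.
Qed.

Lemma nrm_cst (c : R) : nrm `]0, 1[ (fun=> c) = `|c|.
Proof.
by rewrite /nrm /ip Rintegral_cst_itv// subr0 mulr1 -expr2 sqrtr_sqr.
Qed.

Lemma le_nrm_sup f (K : R) : 0 <= K -> sq_int `]0, 1[ f ->
  (forall x, x \in `]0, 1[ -> `|f x| <= K) -> nrm `]0, 1[ f <= K.
Proof.
move=> K0 sf fK; rewrite -[leRHS](ger0_norm K0) -nrm_cst ler_wsqrtr//.
by apply: le_ip => //; [exact: sq_int_cst|move=> x /fK; rewrite (ger0_norm K0)].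
Qed.

(** Test functions are the primitives from 0 of their derivatives and vanish at 1. Convergence of
    the derivatives in L2 makes these primitives converge uniformly, so both properties pass to the
    limit. *)
Lemma H10_zero_trace m u C : H10 0 1 u -> antiderivative_chain 0 1 m C ->
  (forall du, weak_deriv 0 1 1 u du -> {ae mu, forall x, x \in `]0, 1[ -> du x = C 1%N x}) ->
  {ae mu, forall x, x \in `]0, 1[ -> u x = C 0%N x} ->
  C 0%N 0 = 0 /\ \int[mu]_(x in `]0, 1[) C 1%N x = 0.
Proof.
move=> [du wdu [phi [tphi cphi cdphi]]] [sC hC] hdu uC.
have duC := hdu du wdu; have [su sdu] := weak_deriv_sq_int wdu.
have sphi n := sq_int_test (tphi n); have sdphi n := sq_int_test (test_derive1 (tphi n)).
have {}cphi := L2norm_cvg0 (fun n => sq_intB (mitv 0 1) (sphi n) su) cphi.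
have {}cdphi := L2norm_cvg0 (fun n => sq_intB (mitv 0 1) (sdphi n) sdu) cdphi.
have s0 := sC 0%N isT; have s1 := sC 1%N isT.
have small e : 0 < e -> exists n, nrm `]0, 1[ (phi n \- u) < e /\
    nrm `]0, 1[ (derive1 (phi n) \- du) < e.
  move=> e0; move/cvgr0Pnorm_lt : (cphi) => /(_ e e0) [N1 _ h1].
  move/cvgr0Pnorm_lt : (cdphi) => /(_ e e0) [N2 _ h2]; exists (maxn N1 N2).
  have := h1 (maxn N1 N2) (leq_maxl _ _); have := h2 (maxn N1 N2) (leq_maxr _ _).
  by rewrite /= !ger0_norm ?nrm_ge0.
have phiE n y : 0 < y -> y <= 1 -> phi n y = \int[mu]_(t in `]0, y[) derive1 (phi n) t.
  move=> y0 y1; have [sm [c [d [c0 d1 h]]]] := tphi n.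
  by rewrite Rintegral_smooth_derive1// (h 0) ?subr0// in_itv/= negb_and -ltNge c0.
have phi1 n : phi n 1 = 0.
  have [sm [c [d [c0 d1 h]]]] := tphi n.
  by rewrite h// in_itv/= negb_and -!ltNge d1 orbT.
have EC y : y <= 1 -> \int[mu]_(t in `]0, y[) C 1%N t = \int[mu]_(t in `]0, y[) du t.
  move=> y1; apply/esym/ae_eq_Rintegral => //.
  - by have [] := sq_int_sub (lexx 0) y1 sdu.
  - by have [] := sq_int_sub (lexx 0) y1 s1.
  apply: aeS duC => t h /=; rewrite in_itv/= => /andP[t0 ty]; apply: h.
  by rewrite in_itv/= t0 (lt_le_trans ty y1).
have close n y : 0 < y -> y <= 1 ->
    `|phi n y - \int[mu]_(t in `]0, y[) C 1%N t| <= nrm `]0, 1[ (derive1 (phi n) \- du).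
  move=> y0 y1; rewrite phiE// EC// -RintegralB//.
  - by apply: Rintegral_le_nrm => //; exact: sq_intB.
  - by apply: sq_int_summable; exact: sq_int_sub (sdphi n).
  - by apply: sq_int_summable; exact: sq_int_sub sdu.
have zero (x : R) : (forall e, 0 < e -> `|x| <= e) -> x = 0.
  move=> h; apply/eqP; rewrite -normr_le0; apply/ler_addgt0Pl => e e0.
  by rewrite addr0; exact: h.
split; apply: zero => e e0.
  have e2 : 0 < e / 2 by rewrite divr_gt0.
  have [n [h1 h2]] := small _ e2.
  rewrite -nrm_cst.
  have sI : sq_int `]0, 1[ (fun y => \int[mu]_(t in `]0, y[) C 1%N t).
    apply: (@sq_int_bounded _ _ _ _ (nrm `]0, 1[ (C 1%N))).
      by apply: measurable_primitive; exact: sq_int_summable.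
    by move=> y; rewrite in_itv/= => /andP[y0 y1]; apply: Rintegral_le_nrm => //; exact: ltW.
  pose r y := phi n y - \int[mu]_(t in `]0, y[) C 1%N t.
  have sr : sq_int `]0, 1[ r by exact: sq_intB.
  have nr : nrm `]0, 1[ r <= e / 2.
    apply: le_nrm_sup => //; first exact: ltW.
    move=> y; rewrite in_itv/= => /andP[y0 y1]; apply: le_trans (close n y y0 (ltW y1)) _.
    exact: ltW.
  have sd := sq_intB (mitv 0 1) (sphi n) su.
  rewrite (@ae_eq_nrm _ _ (mitv 0 1) _ (fun y => r y - (phi n y - u y))).
  - apply: le_trans (nrmB (mitv 0 1) sr sd) _; rewrite [leRHS]splitr lerD//; exact: ltW.
  - exact: measurable_cst.
  - by have [] := sq_intB (mitv 0 1) sr sd.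
  - apply: aeS uC => y h y01; rewrite h// /r.
    move: (y01) => /=; rewrite in_itv/= => /andP[y0 y1].
    rewrite (hC 0%N isT 0 y (lexx _) (ltW y0) (ltW y1)); ring.
have [n [h1 h2]] := small e e0.
have := close n 1 ltr01 (lexx 1); rewrite phi1 sub0r normrN => /le_trans; apply.
exact: ltW.
Qed.

(* Inner products with fixed functions can be differentiated weakly in time, traces cannot. *)
Lemma chain_trace_moments m C : antiderivative_chain 0 1 m C ->
  C 0%N 0 = ip `]0, 1[ (C 0%N) (fun=> 1) + ip `]0, 1[ (C 1%N) (fun y => y)
            - \int[mu]_(x in `]0, 1[) C 1%N x.
Proof.
move=> [sC hC]; have s0 := sC 0%N isT; have s1 := sC 1%N isT.
have I1 := sq_int_summable s1.
have sid : sq_int `]0, 1[ (fun y : R => y).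
  apply: (@sq_int_bounded _ _ _ _ 1); first exact: measurable_id.
  by move=> y; rewrite in_itv/= => /andP[y0 y1]; rewrite ger0_norm ltW.
have -> : ip `]0, 1[ (C 0%N) (fun=> 1) = C 0%N 0 + ip `]0, 1[ (C 1%N) (fun y => 1 - y).
  have E0 : \int[mu]_(x in `]0, 1[) C 0%N 0 = C 0%N 0.
    by rewrite Rintegral_cst_itv// subr0 mulr1.
  rewrite -[X in _ = X + _]E0.
  transitivity (\int[mu]_(x in `]0, 1[) (C 0%N 0 + \int[mu]_(t in `]0, x[) C 1%N t * 1)).
    apply: eq_Rintegral => y /set_mem/=; rewrite in_itv/= => /andP[y0 y1].
    by rewrite mulr1 mulr1 (hC 0%N isT 0 y (lexx _) (ltW y0) (ltW y1)).
  have h := summable_primitiveM I1 (summable_cst 0 1 1).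
  rewrite RintegralD//; last exact: summable_cst.
  rewrite Rintegral_triangle//; last exact: summable_cst.
  congr (_ + _); apply: eq_Rintegral => y /set_mem/=; rewrite in_itv/= => /andP[y0 y1].
  by rewrite Rintegral_cst_itv ?mul1r// ltW.
rewrite ipBr//; last exact: sq_int_cst.
have -> : ip `]0, 1[ (C 1%N) (fun=> 1) = \int[mu]_(x in `]0, 1[) C 1%N x.
  by apply: eq_Rintegral => y _; rewrite mulr1.
ring.
Qed.

End Sobolev_facts.

(** * The finite element space and the interpolant *)

Section Finite_elements.
Context {R : realType}.
Local Notation mu := (@lebesgue_measure R).
Local Notation mR := (measurableTypeR R).
Implicit Types (f g u w W : R -> R) (s : seq R) (k : nat).

Let mitv a b : measurable (`]a, b[%classic : set mR).
Proof. exact: measurable_itv. Qed.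

Lemma mesh_each s : each (fun l r => r - l <= mesh s) 0 s.
Proof.
move=> j js; rewrite /mesh; 
exact: (le_bigmax 0 (fun j : 'I_(size s) => rnode s j - lnode s j) (Ordinal js)).
Qed.

Lemma mesh_ge0 s : 0 <= mesh s. Proof. exact: bigmax_ge_id. Qed.

Lemma Sh_cpw s k W : Sh s k W -> cpw k.+1 0 s W.
Proof. by move=> [_ _ _ h]. Qed.

Lemma Sh_derive1 s k W : Sh s k W -> pw k 0 s (derive1 W).
Proof. by move=> /Sh_cpw /cpw_pw; exact: pw_derive1. Qed.

Lemma cpw_sq_int s k W : itv_partition 0 1 s -> cpw k 0 s W -> sq_int `]0, 1[ W.
Proof. by move=> ps /cpw_pw; exact: pw_sq_int. Qed.

Lemma Sh_sq_int s k W : itv_partition 0 1 s -> Sh s k W -> sq_int `]0, 1[ W.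
Proof. by move=> ps /Sh_cpw; exact: cpw_sq_int. Qed.

Lemma Sh_derive1_sq_int s k W : itv_partition 0 1 s -> Sh s k W ->
  sq_int `]0, 1[ (derive1 W).
Proof. by move=> ps /Sh_derive1; exact: pw_sq_int. Qed.

Lemma Sh_primitive s k W : itv_partition 0 1 s -> Sh s k W ->
  forall y, y \in `[0, 1] -> W y = \int[mu]_(t in `]0, y[) derive1 W t.
Proof.
move=> ps hW y y01; rewrite (cpw_FTC ps (Sh_cpw hW) y01).
by have [_ -> _ _] := hW; rewrite add0r.
Qed.

(** Both integrands have the same primitive at every point, so their difference falls under
    [ae_eq0_itv]. *)
Lemma cpw_derive1_ae s K W g : itv_partition 0 1 s -> cpw K.+1 0 s W ->
  sq_int `]0, 1[ g ->
  (forall y, y \in `[0, 1] -> W y = W 0 + \int[mu]_(t in `]0, y[) g t) ->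
  {ae mu, forall y, y \in `]0, 1[ -> derive1 W y = g y}.
Proof.
move=> ps cW sg hg; have sd := pw_sq_int ps (pw_derive1 (cpw_pw cW)).
have : {ae mu, forall y, y \in `]0, 1[ -> derive1 W y - g y = 0}.
  apply: ae_eq0_itv => //.
    by apply: summableB => //; exact: sq_int_summable.
  move=> c c0 c1; rewrite RintegralB//; first last.
  - by apply: sq_int_summable; exact: sq_int_sub sg.
  - by apply: sq_int_summable; exact: sq_int_sub sd.
  have c01 : c \in `[0, 1] by rewrite in_itv/= ltW.
  have := cpw_FTC ps cW c01; rewrite (hg c c01).
  by move/addrI ->; rewrite subrr.
by apply: aeS => y h y01; apply/eqP; rewrite -subr_eq0 h.
Qed.

Lemma ShD s k W W' : Sh s k W -> Sh s k W' -> Sh s k (fun y => W y + W' y).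
Proof.
move=> hW hW'; have cD := cpwD (Sh_cpw hW) (Sh_cpw hW').
move: hW hW' => [c1 W0 W1 _] [c2 W0' W1' _]; split=> //.
- exact: (@cont_onD _ 0 1 W W').
- by rewrite W0 W0' addr0.
- by rewrite W1 W1' addr0.
Qed.

Lemma ShZ s k c W : Sh s k W -> Sh s k (fun y => c * W y).
Proof.
move=> hW; have cZ := cpwZ c (Sh_cpw hW); move: hW => [c1 W0 W1 _]; split=> //.
- exact: (@cont_onZ _ 0 1 c W).
- by rewrite W0 mulr0.
- by rewrite W1 mulr0.
Qed.

Lemma pw_primitive_Sh s k q : itv_partition 0 1 s -> pw k 0 s q ->
  \int[mu]_(t in `]0, 1[) q t = 0 -> Sh s k (fun y => \int[mu]_(t in `]0, y[) q t).
Proof.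
move=> ps pq q0; have sq := pw_sq_int ps pq; have [K hK] := pw_bounded ps pq.
split.
- apply: (@lipschitz_cont_on _ _ _ K); apply: primitive_lipschitz => //.
    exact: sq_int_summable.
  by apply: aeT => t; exact: hK.
- by rewrite set_itvoo0 Rintegral_set0.
- exact: q0.
move=> j js; have [p sp hp] := pw_primitive 0 ps pq js.
by exists p => // y ylr; rewrite -hp// add0r.
Qed.

(** Linearity may fail at a node, where [derive1] can be a default value; it is recovered almost
    everywhere from the linearity of primitives. *)
Lemma derive1_linear_ae s k (c d : R) W W' : itv_partition 0 1 s -> Sh s k W -> Sh s k W' ->
  {ae mu, forall y, y \in `]0, 1[ ->
    derive1 (fun y => c * W y + d * W' y) y = c * derive1 W y + d * derive1 W' y}.
Proof.
move=> ps hW hW'; have hc := ShZ c hW; have hd := ShZ d hW'.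
have s1 := Sh_derive1_sq_int ps hW; have s2 := Sh_derive1_sq_int ps hW'.
apply: (cpw_derive1_ae ps (Sh_cpw (ShD hc hd))).
  by apply: sq_intD => //; exact: sq_intZ.
move=> y y01; have [_ W0 _ _] := hW; have [_ W0' _ _] := hW'.
rewrite W0 W0' !mulr0 !add0r (Sh_primitive ps hW y01) (Sh_primitive ps hW' y01).
move: y01; rewrite in_itv/= => /andP[y0 y1].
have i1 : summable_on `]0, y[ (derive1 W) by apply: sq_int_summable; exact: sq_int_sub s1.
have i2 : summable_on `]0, y[ (derive1 W') by apply: sq_int_summable; exact: sq_int_sub s2.
by rewrite RintegralD ?RintegralZl//; exact: summableZ.
Qed.

Lemma poincare s k W : itv_partition 0 1 s -> Sh s k W ->
  nrm `]0, 1[ W <= nrm `]0, 1[ (derive1 W).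
Proof.
move=> ps hW; have sd := Sh_derive1_sq_int ps hW.
apply: le_nrm_sup; [exact: nrm_ge0|exact: Sh_sq_int hW|].
move=> y y01; rewrite (Sh_primitive ps hW) ?subset_itv_oo_cc//.
by apply: Rintegral_le_nrm => //; move: y01; rewrite in_itv/= => /andP[_ /ltW].
Qed.

Lemma Rintegral_derive1_cpw0 s K X : itv_partition 0 1 s -> cpw K.+1 0 s X ->
  X 0 = 0 -> X 1 = 0 -> \int[mu]_(t in `]0, 1[) derive1 X t = 0.
Proof.
move=> ps cX X0 X1; have := cpw_FTC ps cX; move=> /(_ 1).
by rewrite in_itv/= ler01 lexx X0 X1 add0r => /(_ isT) <-.
Qed.

Lemma pw_derivable_ae s K (a b : R) f : itv_partition a b s -> pw K a s f ->
  {ae mu, forall y : R, y \in `]a, b[ -> derivable f y 1}.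
Proof.
move=> ps pf; apply: aeS (ae_notin_seq s) => y; move: ps pf.
apply: (@itv_partition_rect _ b (fun a s => pw K a s f -> y \notin s ->
  y \in `]a, b[ -> derivable f y 1)) => [_ _|{}a x {}s ax xb _ IH].
  by rewrite in_itv/= => /andP[/lt_trans h /h]; rewrite ltxx.
move=> /each_cons[[p _ hp] pf]; rewrite inE negb_or => /andP[yx ys].
rewrite in_itv/= => /andP[ay yb]; move: yx; rewrite neq_lt => /orP[yx|xy].
  have d : is_derive y 1 f p^`().[y].
    apply: near_eq_is_derive (is_derive_poly p y).
    near=> z; rewrite hp// in_itv/=; apply/andP; split; near: z.
      exact: lt_nbhsr.
    exact: lt_nbhsl.
  exact: ex_derive.
by apply: IH => //; rewrite in_itv/= xy.
Unshelve. all: by end_near. Qed.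

(** The product of [c + d * y], [U] and [W] is a continuous piecewise polynomial that vanishes at
    both ends, so its derivative has integral zero. *)
Lemma Sh_by_parts s k (c d : R) U W : itv_partition 0 1 s -> Sh s k U -> Sh s k W ->
  ip `]0, 1[ (fun y => (c + d * y) * derive1 U y) W =
  - ip `]0, 1[ U (fun y => d * W y + (c + d * y) * derive1 W y).
Proof.
move=> ps hU hW; pose A (y : R) := c + d * y.
have cX := cpwM (@cpw_affine _ 0 s c d) (cpwM (Sh_cpw hU) (Sh_cpw hW)).
have := Rintegral_derive1_cpw0 ps cX; have [_ U0 U1 _] := hU.
rewrite U0 U1 !mul0r !mulr0 => /(_ erefl erefl) I0.
have sU := Sh_sq_int ps hU; have sW := Sh_sq_int ps hW.
have sdU := Sh_derive1_sq_int ps hU; have sdW := Sh_derive1_sq_int ps hW.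
have [K hK] := pw_bounded ps (cpw_pw (@cpw_affine _ 0 s c d)).
have mA := pw_measurable ps (cpw_pw (@cpw_affine _ 0 s c d)).
have sAU := sq_intM_bounded (mitv 0 1) mA hK sdU.
have sAW := sq_intM_bounded (mitv 0 1) mA hK sdW.
have sr : sq_int `]0, 1[ (fun y => d * W y + (c + d * y) * derive1 W y).
  by apply: sq_intD => //; exact: sq_intZ.
apply/eqP; rewrite -addr_eq0 -RintegralD//; [|exact: summableM..].
rewrite -[eqbRHS]I0; apply/eqP; apply: ae_eq_Rintegral => //.
- apply: measurable_funD; apply: measurable_funM.
  + exact: sAU.1.
  + exact: sW.1.
  + exact: sU.1.
  + exact: sr.1.
- exact: (pw_measurable ps (pw_derive1 (cpw_pw cX))).
have pd : {ae mu, forall y, y \in `]0, 1[ -> derivable U y 1 /\ derivable W y 1}.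
  apply: aeS2 (pw_derivable_ae ps (cpw_pw (Sh_cpw hU)))
    (pw_derivable_ae ps (cpw_pw (Sh_cpw hW))) => y h1 h2 y01.
  by split; [exact: h1|exact: h2].
apply: aeS pd => y h y01; have [dU dW] := h y01.
have d1 := derivable_is_derive1 dU; have d2 := derivable_is_derive1 dW.
have d0 : is_derive y 1 (fun y => c + d * y) d.
  by have := is_derive_affine d c y; congr is_derive; apply/funext => z; rewrite addrC.
have dX : is_derive y 1 (fun y => (c + d * y) * (U y * W y))
    (d * (U y * W y) + (c + d * y) * (derive1 U y * W y + U y * derive1 W y)).
  apply: is_derive_congr (is_deriveM d0 (is_deriveM d1 d2)) => [//|].
  by rewrite /GRing.scale/= -[(U * W) y]/(U y * W y); ring.
rewrite (derive1_unique dX); ring.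
Qed.

Lemma Sh_convection_dissipative s k (c d : R) W : itv_partition 0 1 s -> Sh s k W ->
  ip `]0, 1[ (fun y => (c + d * y) * derive1 W y) W = - (d / 2) * ip `]0, 1[ W W.
Proof.
move=> ps hW; have := Sh_by_parts c d ps hW hW.
have sW := Sh_sq_int ps hW; have sdW := Sh_derive1_sq_int ps hW.
have [K hK] := pw_bounded ps (cpw_pw (@cpw_affine _ 0 s c d)).
have mA := pw_measurable ps (cpw_pw (@cpw_affine _ 0 s c d)).
have sA := sq_intM_bounded (mitv 0 1) mA hK sdW.
rewrite ipDr//; last exact: sq_intZ.
rewrite ipZr// [X in - (_ + X)]ipC; lra.
Qed.

(** [lagrange_element_estimate] on each element: two end points and [k - 1] interior nodes are the
    [k.+1] zeros for a chain of order [k]. *)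
Lemma interpolant_estimate s k (z : nat -> seq R) u V (M : R) : (1 <= k)%N -> 0 <= M ->
  itv_partition 0 1 s -> interior_nodes s k z -> Hm_norm_le 0 1 k.+1 u M ->
  interpolant s k z u V -> sq_int `]0, 1[ u /\
  nrm `]0, 1[ (fun y => V y - u y) <= mesh s ^+ k.+1 * M.
Proof.
move=> k1 M0 ps hz [D hD] [hV [uc [cuc ucu Vuc]]].
have [C [cC DC uC nC]] := Hm_derivs_chain M0 hD.
have su : sq_int `]0, 1[ u.
  by have [h _] := hD; have [] := weak_deriv_sq_int (h 0%N isT).
have sV := Sh_sq_int ps hV; have [sC hC] := cC; have s0 := sC 0%N isT.
split=> //.
have E : forall y, y \in `[0, 1] -> uc y = C 0%N y.
  apply: ae_eq_cont_on => //; first exact: chain_cont_on cC _.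
  by apply: aeS2 ucu uC => y h1 h2 y01; rewrite h1// h2.
have sd : sq_int `]0, 1[ (fun y => C 0%N y - V y) by exact: sq_intB.
have -> : nrm `]0, 1[ (fun y => V y - u y) = nrm `]0, 1[ (fun y => C 0%N y - V y).
  rewrite -[RHS]nrmN//; apply: ae_eq_nrm => //.
  - by have [] := sq_intB (mitv 0 1) sV su.
  - by have [] := sq_intN (mitv 0 1) sd.
  - by apply: aeS uC => y h y01; rewrite (h y01) opprB.
have h0 := mesh_ge0 s.
apply: (@le_trans _ _ (mesh s ^+ k.+1 * nrm `]0, 1[ (C k.+1))); last first.
  by rewrite ler_wpM2l// exprn_ge0.
apply: nrm_le; first by rewrite mulr_ge0 ?nrm_ge0// exprn_ge0.
rewrite exprMn nrm2 -exprM mulnC.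
apply: (le_ip_each ps sd (sC _ (leqnn _))) => j js.
have [l0 lr r1] := each_bounds ps js; have hl := mesh_each js.
have [sz uz zin] := hz j js; have [_ _ _ /(_ j js)[p sp hp]] := hV.
set l := nth 0 (0 :: s) j in l0 lr hl *; set r := nth 0 s j in lr r1 hl *.
have hn x : x \in [:: l, r & z j] -> x \in `[l, r].
  have lrW := ltW lr.
  rewrite in_cons in_cons => /or3P[/eqP ->|/eqP ->|/zin]; last exact: subset_itv_oo_cc.
    by rewrite in_itv/= -/l -/r lexx.
  by rewrite in_itv/= -/l -/r lexx andbT.
apply: (@le_trans _ _ ((r - l) ^+ (2 * k.+1) * ip `]l, r[ (C k.+1) (C k.+1))).
  have -> : ip `]l, r[ (fun y => C 0%N y - V y) (fun y => C 0%N y - V y) =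
      ip `]l, r[ (fun y => C 0%N y - p.[y]) (fun y => C 0%N y - p.[y]).
    have e y : `]l, r[%classic y -> C 0%N y - V y = C 0%N y - p.[y].
      by move=> ylr; rewrite hp//; exact: subset_itv_oo_cc.
    exact: eq_ip.
  apply: (lagrange_element_estimate cC l0 lr r1 sp (z := [:: l, r & z j])).
  - by rewrite /= sz prednK.
  - have lz : l \notin z j by apply/negP => /zin; rewrite in_itv/= ltxx.
    have rz : r \notin z j by apply/negP => /zin; rewrite in_itv/= ltxx andbF.
    by rewrite /= inE negb_or lz rz uz (lt_eqF lr).
  - move=> x xz; have xlr := hn x xz; split=> //.
    have x01 : x \in `[0, 1].
      by move: xlr; rewrite !in_itv/= => /andP[lx xr]; rewrite (le_trans l0 lx) (le_trans xr r1).
    by rewrite -(E x x01) -(Vuc j js x xz) hp.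
rewrite ler_wpM2r ?ip_ge0// lerXn2r ?nnegrE ?subr_ge0 ?(ltW lr)//.
Qed.

End Finite_elements.

(** * Functions of space and time *)

Section Space_time.
Context {R : realType}.
Local Notation mu := (@lebesgue_measure R).
Local Notation mR := (measurableTypeR R).
Variables (T : R) (T0 : 0 < T).
Implicit Types (v z : R -> R -> R) (w : R -> R) (K : R -> R) (t y : R).
Local Notation D := (`]0, T[%classic : set mR).
Local Notation O := (`]0, 1[%classic : set mR).

Let mitv a b : measurable (`]a, b[%classic : set mR).
Proof. exact: measurable_itv. Qed.

(** A function of time with values in L2, encoded by joint measurability and dominated in norm by
    [K]. The bound may depend on time, since the time derivative in the definition of a solution is
    only square integrable in time. *)
Definition L2_valued K z := measurable_fun (cylinder T) (fun q => z q.1 q.2) /\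
  {ae mu, forall t, t \in `]0, T[ -> sq_int `]0, 1[ (z t) /\ nrm `]0, 1[ (z t) <= K t}.

Lemma measurable_time w : measurable_fun D w ->
  measurable_fun (D `*` O : set (mR * mR)) (fun q => w q.1).
Proof.
move=> mw; apply: (@measurable_comp _ _ _ _ _ _ D w) => //.
- by move=> _ [q [q1 _] <-].
- by apply: measurable_funTS; exact: measurable_fst.
Qed.

Lemma measurable_space w : measurable_fun O w ->
  measurable_fun (D `*` O : set (mR * mR)) (fun q => w q.2).
Proof.
move=> mw; apply: (@measurable_comp _ _ _ _ _ _ O w) => //.
- by move=> _ [q [_ q2] <-].
- by apply: measurable_funTS; exact: measurable_snd.
Qed.

Section fixed.
Variables (K : R -> R) (z : R -> R -> R).
Hypotheses (sK : summable_on `]0, T[ K) (zz : L2_valued K z).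
Variables (w : R -> R) (sw : sq_int `]0, 1[ w).

Let mzw : measurable_fun (D `*` O : set (mR * mR)) (fun q => z q.1 q.2 * w q.2).
Proof. by apply: measurable_funM; [case: zz|exact: (measurable_space sw.1)]. Qed.

Lemma measurable_ip_slice : measurable_fun D (fun t => ip `]0, 1[ (z t) w).
Proof. exact: (measurable_Rintegral_slice (mitv _ _) (mitv _ _) mzw). Qed.

Lemma L2_valued_ip_le : {ae mu, forall t, t \in `]0, T[ ->
  `|ip `]0, 1[ (z t) w| <= K t * nrm `]0, 1[ w}.
Proof.
apply: aeS zz.2 => t h tT; have [sz nz] := h tT.
by apply: (le_trans (CS (mitv _ _) sz sw)); rewrite ler_wpM2r// nrm_ge0.
Qed.

Lemma summable_ip : summable_on `]0, T[ (fun t => ip `]0, 1[ (z t) w).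
Proof.
have : summable_on `]0, T[ (fun t => nrm `]0, 1[ w * K t) by exact: summableZ.
move=> sKw; rewrite /summable_on; apply/integrableP; split; first by apply/measurable_EFinP; exact: measurable_ip_slice.
apply: (@le_lt_trans _ _ (\int[mu]_(t in D) `|(nrm `]0, 1[ w * K t)%:E|)%E); last first.
  by case/integrableP : sKw.
apply: ae_ge0_le_integral => //=.
- by apply/measurable_EFinP; apply: measurableT_comp => //; exact: measurable_ip_slice.
- by apply/measurable_EFinP; apply: measurableT_comp => //; exact: summable_meas sKw.
- apply: aeS L2_valued_ip_le => t h tT; rewrite lee_fin.
  by rewrite mulrC (le_trans (h _))// ler_norm.
Qed.

Variables (f : R -> R) (C : R).
Hypotheses (mf : measurable_fun D f) (fC : forall t, `|f t| <= C).

Lemma measurable_weighted : measurable_fun (D `*` O : set (mR * mR))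
  (fun q => z q.1 q.2 * f q.1 * w q.2).
Proof.
apply: measurable_funM; last exact: (measurable_space sw.1).
by apply: measurable_funM; [case: zz|exact: (measurable_time mf)].
Qed.

Let fin : (\int[mu]_(t in D) \int[mu]_(y in O) `|z t y * f t * w y|%:E < +oo)%E.
Proof.
have C0 : 0 <= C by apply: le_trans (fC 0).
apply: (@dominated_slices _ _ _ (mitv _ _) (mitv _ _) (fun t y => z t y * f t * w y)
  measurable_weighted (fun t => (C * nrm `]0, 1[ w) * K t)).
  exact: summableZ.
apply: aeS zz.2 => t h tT; have [sz nz] := h tT.
have sfz : sq_int `]0, 1[ (fun y => f t * z t y) by exact: sq_intZ.
pose az y := `|f t * z t y|; pose aw y := `|w y|.
have sn u : sq_int `]0, 1[ u -> sq_int `]0, 1[ (fun y => `|u y|).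
  move=> [mu1 su]; split; first exact: measurableT_comp.
  by apply: eq_summable su => // x _; rewrite real_normK ?num_real.
have nn u : nrm `]0, 1[ (fun y => `|u y|) = nrm `]0, 1[ u.
  rewrite /nrm; congr Num.sqrt; apply: eq_Rintegral => x _.
  by rewrite -normrM ger0_norm// -expr2 sqr_ge0.
have sM := summableM (mitv _ _) (sn _ sfz) (sn _ sw).
have := CS (mitv _ _) (sn _ sfz) (sn _ sw); rewrite !nn nrmZ// => h2.
have -> : (\int[mu]_(y in O) `|z t y * f t * w y|%:E =
  (ip `]0, 1[ az aw)%:E)%E.
  rewrite /ip /Rintegral fineK; last exact: integrable_fin_num.
  by apply: eq_integral => y _; rewrite /az /aw -!normrM [z t y * _]mulrC.
rewrite lee_fin (le_trans (ler_norm _))// (le_trans h2)//.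
rewrite mulrAC ler_pM ?mulr_ge0 ?nrm_ge0//.
by rewrite ler_wpM2r ?nrm_ge0.
Qed.

Lemma RFubini_weighted :
  \int[mu]_(t in D) \int[mu]_(y in O) (z t y * f t * w y) =
  \int[mu]_(y in O) \int[mu]_(t in D) (z t y * f t * w y) /\
  summable_on O (fun y => \int[mu]_(t in D) (z t y * f t * w y)) /\
  {ae mu, forall y, O y -> summable_on D (fun t => z t y * f t * w y)}.
Proof. exact: (@RFubini _ D O (fun t y => z t y * f t * w y) (mitv _ _) (mitv _ _) measurable_weighted fin). Qed.

End fixed.

Lemma Fubini_ip K z w (f : R -> R) (C : R) : summable_on `]0, T[ K -> L2_valued K z ->
  sq_int `]0, 1[ w -> measurable_fun D f -> (forall t, `|f t| <= C) ->
  \int[mu]_(t in `]0, T[) (ip `]0, 1[ (z t) w * f t) =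
  \int[mu]_(y in `]0, 1[) ((\int[mu]_(t in `]0, T[) (z t y * f t)) * w y) /\
  summable_on `]0, 1[ (fun y => (\int[mu]_(t in `]0, T[) (z t y * f t)) * w y).
Proof.
move=> sK zz sw mf fC.
have [e [s a]] := RFubini_weighted sK zz sw mf fC.
have [_ [s1 a1]] := RFubini_weighted sK zz (sq_int_cst 0 1 1) mf fC.
have sZ : summable_on `]0, 1[ (fun y => \int[mu]_(t in `]0, T[) (z t y * f t)).
  by apply: eq_summable s1 => // y _; apply: eq_Rintegral => t _; rewrite mulr1.
have mZw : measurable_fun O (fun y => (\int[mu]_(t in `]0, T[) (z t y * f t)) * w y).
  by apply: measurable_funM; [exact: summable_meas sZ|exact: sw.1].
have eZ : {ae mu, forall y, O y -> \int[mu]_(t in D) (z t y * f t * w y) =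
    (\int[mu]_(t in `]0, T[) (z t y * f t)) * w y}.
  apply: aeS a1 => y h Oy; rewrite RintegralZr//.
  by apply: eq_summable (h Oy) => // t _; rewrite mulr1.
split.
  rewrite -(ae_eq_Rintegral _ _ mZw eZ)//; last exact: summable_meas s.
  rewrite -e; apply: ae_eq_Rintegral => //.
  - apply: measurable_funM => //. exact: (measurable_ip_slice zz sw).
  - exact: (measurable_Rintegral_slice (mitv _ _) (mitv _ _) (measurable_weighted zz sw mf)).
  - apply: aeS zz.2 => t h tT; have [sz _] := h tT.
    rewrite /ip -RintegralZr//; first by apply: eq_Rintegral => y _; rewrite mulrAC.
    exact: summableM.
apply/integrableP; split; first exact/measurable_EFinP.
have /integrableP[_] := s; apply: le_lt_trans.
apply: ae_ge0_le_integral => //=.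
- by apply/measurable_EFinP; apply: measurableT_comp.
- by apply/measurable_EFinP; apply: measurableT_comp => //; exact: (summable_meas s).
- by apply: aeS eZ => y h Oy; rewrite -h.
Qed.

Lemma summable_time_average K z (f : R -> R) (C : R) : summable_on `]0, T[ K ->
  L2_valued K z -> measurable_fun D f -> (forall t, `|f t| <= C) ->
  summable_on `]0, 1[ (fun y => \int[mu]_(t in `]0, T[) (z t y * f t)).
Proof.
move=> sK zz mf fC; have [_] := Fubini_ip sK zz (sq_int_cst 0 1 1) mf fC.
by apply: eq_summable => // y _; rewrite mulr1.
Qed.

Lemma time_deriv_ip j v z (K K' : R -> R) phi w :
  summable_on `]0, T[ K -> summable_on `]0, T[ K' ->
  L2_valued K v -> L2_valued K' z -> time_deriv T j v z -> test_function 0 T phi ->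
  sq_int `]0, 1[ w ->
  \int[mu]_(t in `]0, T[) (ip `]0, 1[ (v t) w * derive1n j phi t) =
  (-1) ^+ j * \int[mu]_(t in `]0, T[) (ip `]0, 1[ (z t) w * phi t).
Proof.
move=> sK sK' vK zK' td tphi sw.
have tj : test_function 0 T (derive1n j phi) by exact: test_derive1n.
have [C _ hC] := test_bounded tj; have [C' _ hC'] := test_bounded tphi.
have mt psi : test_function 0 T psi -> measurable_fun D psi.
  by move=> /test_functionP[/measurable_smooth].
have [e s] := Fubini_ip sK vK sw (mt _ tj) hC.
have [e' s'] := Fubini_ip sK' zK' sw (mt _ tphi) hC'.
rewrite e e' -RintegralZl//; apply: ae_eq_Rintegral => //.
- exact: summable_meas s.
- by apply: summable_meas; exact: summableZ.
- by apply: aeS (td _ tphi) => y h Oy; rewrite (h Oy) mulrA.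
Qed.

Lemma time_deriv0 v : time_deriv T 0 v v.
Proof. by move=> phi _; apply: aeT => y _; rewrite mul1r. Qed.

Lemma time_deriv_step j v z z' (K K' K'' : R -> R) w :
  summable_on `]0, T[ K -> summable_on `]0, T[ K' -> summable_on `]0, T[ K'' ->
  L2_valued K v -> L2_valued K' z -> L2_valued K'' z' ->
  time_deriv T j v z -> time_deriv T j.+1 v z' -> sq_int `]0, 1[ w ->
  weak_derivative 0 T (fun t => ip `]0, 1[ (z t) w) (fun t => ip `]0, 1[ (z' t) w).
Proof.
move=> sK sK' sK'' vK zK' zK'' td td' sw phi tphi.
have tp : test_function 0 T (derive1 phi) by exact: test_derive1.
have e := time_deriv_ip sK sK' vK zK' td tp sw.
have e' := time_deriv_ip sK sK'' vK zK'' td' tphi sw.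
have jj : derive1n j.+1 phi = derive1n j (derive1 phi) by rewrite derive1Sn.
rewrite jj e exprS in e'.
apply: (@mulfI _ ((-1) ^+ j)); first by rewrite signr_eq0.
by rewrite e' mulN1r mulNr mulrN.
Qed.

(* For a test function [w], integrating by parts in space reduces the claim to the
   hypothesis for the derivative of [w]; the general case follows by Fubini. *)
Lemma time_deriv_space z z' dz dz' (K K' : R -> R) w :
  summable_on `]0, T[ K -> summable_on `]0, T[ K' ->
  L2_valued K dz -> L2_valued K' dz' ->
  {ae mu, forall t, t \in `]0, T[ -> weak_deriv 0 1 1 (z t) (dz t)} ->
  {ae mu, forall t, t \in `]0, T[ -> weak_deriv 0 1 1 (z' t) (dz' t)} ->
  (forall q, sq_int `]0, 1[ q ->
    weak_derivative 0 T (fun t => ip `]0, 1[ (z t) q) (fun t => ip `]0, 1[ (z' t) q)) ->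
  (forall q, sq_int `]0, 1[ q ->
    summable_on `]0, T[ (fun t => ip `]0, 1[ (z t) q)) ->
  (forall q, sq_int `]0, 1[ q ->
    summable_on `]0, T[ (fun t => ip `]0, 1[ (z' t) q)) ->
  sq_int `]0, 1[ w ->
  weak_derivative 0 T (fun t => ip `]0, 1[ (dz t) w) (fun t => ip `]0, 1[ (dz' t) w).
Proof.
move=> sK sK' dzK dzK' wd wd' zz mz mz' sw phi tphi.
have tp : test_function 0 T (derive1 phi) by exact: test_derive1.
have [C _ hC] := test_bounded tp; have [C' _ hC'] := test_bounded tphi.
have mt psi : test_function 0 T psi -> measurable_fun D psi.
  by move=> /test_functionP[/measurable_smooth].
pose Z1 y := \int[mu]_(t in `]0, T[) (dz t y * derive1 phi t).
pose Z2 y := \int[mu]_(t in `]0, T[) (dz' t y * phi t).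
have sZ1 : summable_on `]0, 1[ Z1 by exact: summable_time_average sK dzK (mt _ tp) hC.
have sZ2 : summable_on `]0, 1[ Z2 by exact: summable_time_average sK' dzK' (mt _ tphi) hC'.
have Z0 : {ae mu, forall y, y \in `]0, 1[ -> Z1 y + Z2 y = 0}.
  apply: ae_eq0_test => //; first exact: summableD.
  move=> q tq; have sq := sq_int_test tq; have sq' := sq_int_test (test_derive1 tq).
  have [e s] := Fubini_ip sK dzK sq (mt _ tp) hC.
  have [e' s'] := Fubini_ip sK' dzK' sq (mt _ tphi) hC'.
  transitivity (\int[mu]_(y in `]0, 1[) (Z1 y * q y + Z2 y * q y)).
    by apply: eq_Rintegral => y _; rewrite mulrDl.
  rewrite RintegralD// -e -e'.
  have E u du : weak_deriv 0 1 1 u du ->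
      ip `]0, 1[ du q = - ip `]0, 1[ u (derive1 q).
    by move=> [_ _ /(_ _ tq)]; rewrite /ip expr1 mulN1r => ->; rewrite opprK.
  rewrite (_ : \int[mu]_(t in `]0, T[) (ip `]0, 1[ (dz t) q * derive1 phi t) =
    \int[mu]_(t in `]0, T[) (- (ip `]0, 1[ (z t) (derive1 q) * derive1 phi t))); last first.
    apply: ae_eq_Rintegral => //.
    - by apply: measurable_funM; [exact: (measurable_ip_slice dzK sq)|exact: mt].
    - by apply: measurableT_comp => //; apply: measurable_funM; [exact: (summable_meas (mz _ sq'))|exact: mt].
    - by apply: aeS wd => t h tT; rewrite (E _ _ (h tT)) mulNr.
  rewrite (_ : \int[mu]_(t in `]0, T[) (ip `]0, 1[ (dz' t) q * phi t) =
    \int[mu]_(t in `]0, T[) (- (ip `]0, 1[ (z' t) (derive1 q) * phi t))); last first.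
    apply: ae_eq_Rintegral => //.
    - by apply: measurable_funM; [exact: (measurable_ip_slice dzK' sq)|exact: mt].
    - by apply: measurableT_comp => //; apply: measurable_funM; [exact: (summable_meas (mz' _ sq'))|exact: mt].
    - by apply: aeS wd' => t h tT; rewrite (E _ _ (h tT)) mulNr.
  have N f : summable_on `]0, T[ f ->
      \int[mu]_(t in `]0, T[) (- f t) = - \int[mu]_(t in `]0, T[) f t.
    by move=> sf; rewrite -mulN1r -RintegralZl//; apply: eq_Rintegral => t _; rewrite mulN1r.
  rewrite (N _ (summableM_test (mz _ sq') tp)) (N _ (summableM_test (mz' _ sq') tphi)).
  by rewrite (zz _ sq' _ tphi) opprK subrr.
have [e s] := Fubini_ip sK dzK sw (mt _ tp) hC.
have [e' s'] := Fubini_ip sK' dzK' sw (mt _ tphi) hC'.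
rewrite e e'; apply/eqP; rewrite -subr_eq0 opprK -RintegralD//; apply/eqP.
rewrite (@ae_eq_Rintegral _ _ _ (fun=> 0)) ?Rintegral_cst ?mul0r//.
- exact: (summable_meas (summableD (mitv _ _) s s')).
- by apply: aeS Z0 => y h Oy; rewrite -mulrDl h ?mul0r.
Qed.

End Space_time.

(** * Linear combinations of weak derivatives *)

Section Weak_derivatives.
Context {R : realType}.
Local Notation mu := (@lebesgue_measure R).
Local Notation mR := (measurableTypeR R).
Implicit Types (f g h : R -> R).

Let mitv a b : measurable (`]a, b[%classic : set mR).
Proof. exact: measurable_itv. Qed.

Lemma weak_derivative_ae (a b : R) f f' g g' : summable_on `]a, b[ f ->
  summable_on `]a, b[ f' -> summable_on `]a, b[ g -> summable_on `]a, b[ g' ->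
  {ae mu, forall t, t \in `]a, b[ -> f t = f' t} ->
  {ae mu, forall t, t \in `]a, b[ -> g t = g' t} ->
  weak_derivative a b f g -> weak_derivative a b f' g'.
Proof.
move=> sf sf' sg sg' ff' gg' wd phi tphi; have tp := test_derive1 tphi.
rewrite -(@ae_eq_Rintegral _ _ (fun t => f t * derive1 phi t))//; last first.
- by apply: aeS ff' => t h tT; rewrite h.
- exact: summable_meas (summableM_test sf' tp).
- exact: summable_meas (summableM_test sf tp).
rewrite wd//; congr (- _); apply: ae_eq_Rintegral => //.
- exact: summable_meas (summableM_test sg tphi).
- exact: summable_meas (summableM_test sg' tphi).
- by apply: aeS gg' => t h tT; rewrite h.
Qed.

Lemma weak_derivative0 (a b : R) : weak_derivative a b (fun=> 0) (fun=> 0).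
Proof.
move=> phi _.
have Z psi : \int[mu]_(t in `]a, b[) (0 * psi t) = 0 :> R.
  by under eq_Rintegral do rewrite mul0r; rewrite Rintegral_cst// mul0r.
by rewrite !Z oppr0.
Qed.

Lemma weak_derivativeD (a b c : R) f f' g g' : summable_on `]a, b[ f ->
  summable_on `]a, b[ f' -> summable_on `]a, b[ g -> summable_on `]a, b[ g' ->
  weak_derivative a b f g -> weak_derivative a b f' g' ->
  weak_derivative a b (fun t => f t + c * f' t) (fun t => g t + c * g' t).
Proof.
move=> sf sf' sg sg' fg fg' phi tphi; have tp := test_derive1 tphi.
have E u u' psi : summable_on `]a, b[ u -> summable_on `]a, b[ u' ->
    test_function a b psi ->
    \int[mu]_(t in `]a, b[) ((u t + c * u' t) * psi t) =
    \int[mu]_(t in `]a, b[) (u t * psi t) + c * \int[mu]_(t in `]a, b[) (u' t * psi t).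
  move=> su su' tpsi; have s1 := summableM_test su tpsi.
  have s2 := summableM_test su' tpsi.
  rewrite -RintegralZl// -RintegralD//; last exact: summableZ.
  by apply: eq_Rintegral => t _; rewrite mulrDl mulrA.
by rewrite !E// fg// fg'// mulrN opprD.
Qed.

Lemma weak_derivative_sum (a b : R) (I : Type) (r : seq I) (c : I -> R)
    (f g : I -> R -> R) :
  (forall i, summable_on `]a, b[ (f i)) -> (forall i, summable_on `]a, b[ (g i)) ->
  (forall i, weak_derivative a b (f i) (g i)) ->
  [/\ weak_derivative a b (fun t => \sum_(i <- r) c i * f i t)
        (fun t => \sum_(i <- r) c i * g i t),
      summable_on `]a, b[ (fun t => \sum_(i <- r) c i * f i t) &
      summable_on `]a, b[ (fun t => \sum_(i <- r) c i * g i t)].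
Proof.
move=> sf sg fg; elim: r => [|i r [IH s1 s2]].
  have E F : (fun t => \sum_(j <- [::]) c j * F j t) = (fun=> 0 : R).
    by apply/funext => t; rewrite big_nil.
  by rewrite !E; split; [exact: weak_derivative0|exact: summable_cst|exact: summable_cst].
have E F : (fun t => \sum_(j <- i :: r) c j * F j t) =
    (fun t => \sum_(j <- r) c j * F j t + c i * F i t).
  by apply/funext => t; rewrite big_cons addrC.
rewrite !E; split; first exact: weak_derivativeD.
- by apply: summableD => //; exact: summableZ.
- by apply: summableD => //; exact: summableZ.
Qed.

Lemma weak_derivative_zero (a b : R) f g : a < b -> summable_on `]a, b[ f ->
  summable_on `]a, b[ g ->
  {ae mu, forall t, t \in `]a, b[ -> f t = 0} -> weak_derivative a b f g ->
  {ae mu, forall t, t \in `]a, b[ -> g t = 0}.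
Proof.
move=> ab sf sg f0 fg; apply: ae_eq0_test => // phi tphi.
have tp := test_derive1 tphi; apply: oppr_inj; rewrite -fg// oppr0.
rewrite (@ae_eq_Rintegral _ _ _ (fun=> 0)) ?Rintegral_cst ?mul0r//.
- exact: summable_meas (summableM_test sf tp).
- by apply: aeS f0 => t h tT; rewrite h ?mul0r.
Qed.

Lemma C1_on_lipschitz (a b K : R) f g : C1_on a b f g -> 0 <= K ->
  (forall t, t \in `[a, b] -> `|g t| <= K) -> lipschitz_on a b K f.
Proof.
move=> fg K0 gK.
have H s r : s \in `[a, b] -> r \in `[a, b] -> s < r -> `|f r - f s| <= K * `|r - s|.
  move=> sT rT sr; have [x /andP[sx xr] ->] := C1_on_MVT fg sT rT sr.
  rewrite normrM ler_wpM2r// gK// in_itv/=.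
  by move: sT rT; rewrite !in_itv/= => /andP[? _] /andP[_ ?]; apply/andP; split; lra.
move=> s r sT rT; have [sr|rs|->] := ltgtP s r; first exact: H.
- by rewrite distrC [`|r - s|]distrC H.
- by rewrite !subrr normr0 mulr0.
Qed.

End Weak_derivatives.

(** * Continuity in time of inner products *)

Section Time_continuity.
Context {R : realType}.
Local Notation mu := (@lebesgue_measure R).
Local Notation mR := (measurableTypeR R).
Variables (T : R) (T0 : 0 < T).
Implicit Types (v z : R -> R -> R) (w : R -> R).

Let mitv a b : measurable (`]a, b[%classic : set mR).
Proof. exact: measurable_itv. Qed.

Lemma C0L2_sq_int z t : C0L2 T z -> t \in `[0, T] -> sq_int `]0, 1[ (z t).
Proof. by move=> h /h[/L2P]. Qed.

Lemma C0L2_cont_on z w : C0L2 T z -> sq_int `]0, 1[ w ->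
  cont_on 0 T (fun t => ip `]0, 1[ (z t) w).
Proof.
move=> zC sw; apply/cont_onP => t tT e e0.
have [_ cz] := zC t tT; have sz u := @C0L2_sq_int z u zC.
have n0 := nrm_ge0 `]0, 1[ w.
have e1 : 0 < e / (nrm `]0, 1[ w + 1) by rewrite divr_gt0// ltr_pwDr.
have /= /(_ _ e1) : forall e, 0 < e ->
    \forall s \near within `[0, T] (nbhs t), (L2norm 0 1 (z s \- z t)%R < e%:E)%E.
  move=> e' e'0; apply: (cz [set x | (x < e'%:E)%E]).
  by apply: open_nbhs_nbhs; split; [exact: open_ereal_lt_ereal|rewrite /= lte_fin].
rewrite near_withinE => /nbhs_ballP[d /= d0 hd]; exists d => // s sT std.
have := hd s; rewrite /ball/= distrC => /(_ std sT).
rewrite (L2normE (sq_intB (mitv _ _) (sz _ sT) (sz _ tT))) lte_fin => h.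
rewrite -ipBl//; try exact: sz.
apply: (le_lt_trans (CS (mitv _ _) (sq_intB (mitv _ _) (sz _ sT) (sz _ tT)) sw)).
apply: (@le_lt_trans _ _ (e / (nrm `]0, 1[ w + 1) * nrm `]0, 1[ w)).
  by rewrite ler_wpM2r// ltW.
by rewrite mulrAC ltr_pdivrMr ?ltr_pwDr// ltr_pM2l//; lra.
Qed.

Lemma weak_deriv0_ae u g : weak_deriv 0 1 0 u g ->
  {ae mu, forall y : R, y \in `]0, 1[ -> g y = u y}.
Proof.
move=> [/L2P su /L2P sg h]; apply: ae_eq_of_test => // phi tphi.
by have := h phi tphi; rewrite expr0 mul1r.
Qed.

Lemma LooHm_derivs m z (M : R) : 0 <= M -> LooHm_norm_le T m z M ->
  L2_valued T (fun=> M) z /\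
  exists D, (forall j, (j <= m)%N -> L2_valued T (fun=> M) (D j)) /\
    {ae mu, forall t, t \in `]0, T[ -> Hm_derivs_le 0 1 m (z t) (fun j => D j t) M}.
Proof.
move=> M0 [mz [D [mD aD]]]; split; last first.
  exists D; split=> // j jm; split; first exact: mD.
  apply: aeS aD => t h tT; split; last exact: Hm_derivs_norm (h tT) _ jm.
  by have [/(_ j jm)/weak_deriv_sq_int[]] := h tT.
split=> //; apply: aeS aD => t h tT.
have [/(_ 0%N (leq0n _)) w0 _] := h tT; have [su sD] := weak_deriv_sq_int w0.
split=> //; rewrite -(@ae_eq_nrm _ _ (mitv 0 1) (D 0%N t)) //.
- exact: Hm_derivs_norm (h tT) _ _.
- exact: sD.1.
- exact: su.1.
- exact: weak_deriv0_ae.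
Qed.

End Time_continuity.

(** * The elliptic projection of a regular solution *)

Section Regular_solution.
Context {R : realType}.
Local Notation mu := (@lebesgue_measure R).
Local Notation mR := (measurableTypeR R).
Variables (T : R) (T0 : 0 < T) (M : R) (M0 : 0 <= M) (k : nat) (k1 : (1 <= k)%N).
Variables (v vt vtt vttt : R -> R -> R).
Hypotheses (vC : C0L2 T v) (vH10 : {ae mu, forall t, t \in `]0, T[ -> H10 0 1 (v t)}).
Hypotheses (hv : LooHm_norm_le T k.+1 v M) (hvt : LooHm_norm_le T k.+1 vt M).
Hypotheses (hvtt : LooHm_norm_le T 1 vtt M) (hvttt : LooHm_norm_le T 0 vttt M).
Hypotheses (td1 : time_deriv T 1 v vt) (td2 : time_deriv T 2 v vtt)
  (td3 : time_deriv T 3 v vttt).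
Implicit Types (w q : R -> R).

Let mitv a b : measurable (`]a, b[%classic : set mR).
Proof. exact: measurable_itv. Qed.

Let sM : summable_on `]0, T[ (fun=> M).
Proof. exact: summable_cst. Qed.

Let vL := (LooHm_derivs M0 hv).1.
Let vtL := (LooHm_derivs M0 hvt).1.
Let vttL := (LooHm_derivs M0 hvtt).1.
Let vtttL := (LooHm_derivs M0 hvttt).1.

Let sip z w : L2_valued T (fun=> M) z -> sq_int `]0, 1[ w ->
  summable_on `]0, T[ (fun t => ip `]0, 1[ (z t) w).
Proof. by move=> zL sw; apply: summable_ip sM zL _ sw. Qed.

Let ipb z w : L2_valued T (fun=> M) z -> sq_int `]0, 1[ w ->
  ae_bounded T (M * nrm `]0, 1[ w) (fun t => ip `]0, 1[ (z t) w).
Proof. by move=> zL sw; apply: L2_valued_ip_le zL _ sw. Qed.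

Let wd01 w : sq_int `]0, 1[ w -> weak_derivative 0 T
  (fun t => ip `]0, 1[ (v t) w) (fun t => ip `]0, 1[ (vt t) w).
Proof. exact: (time_deriv_step sM sM sM vL vL vtL (@time_deriv0 _ T v) td1). Qed.

Let wd12 w : sq_int `]0, 1[ w -> weak_derivative 0 T
  (fun t => ip `]0, 1[ (vt t) w) (fun t => ip `]0, 1[ (vtt t) w).
Proof. exact: (time_deriv_step sM sM sM vL vtL vttL td1 td2). Qed.

Let wd23 w : sq_int `]0, 1[ w -> weak_derivative 0 T
  (fun t => ip `]0, 1[ (vtt t) w) (fun t => ip `]0, 1[ (vttt t) w).
Proof. exact: (time_deriv_step sM sM sM vL vttL vtttL td2 td3). Qed.

Lemma Rintegral_lincomb (a b : R) (n : nat) (c : 'I_n -> R) (F : 'I_n -> R -> R) :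
  (forall i, sq_int `]a, b[ (F i)) ->
  \int[mu]_(x in `]a, b[) (\sum_i c i * F i x) = \sum_i c i * \int[mu]_(x in `]a, b[) F i x.
Proof.
move=> sF; have s1 := sq_int_cst a b (1 : R).
have E f : \int[mu]_(x in `]a, b[) f x = ip `]a, b[ f (fun=> 1).
  by apply: eq_Rintegral => x _; rewrite mulr1.
by rewrite E ip_suml//; apply: eq_bigr => i _; rewrite -E.
Qed.

(** The bounds on the derivatives of second and third order make the moments of [vt] and [vtt] equal
    almost everywhere to Lipschitz functions [A] and [A']. Continuity of these functions turns weak
    derivatives into classical ones, and continuity of [v] gives the result for [v] itself at every
    time. *)
Lemma ip_solution_C2 w : sq_int `]0, 1[ w -> exists A A',
  [/\ C1_on 0 T (fun t => ip `]0, 1[ (v t) w) A, C1_on 0 T A A',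
      lipschitz_on 0 T (M * nrm `]0, 1[ w) A /\ lipschitz_on 0 T (M * nrm `]0, 1[ w) A',
      (forall t, t \in `[0, T] -> `|A t| <= M * nrm `]0, 1[ w) &
      {ae mu, forall t, t \in `]0, T[ -> ip `]0, 1[ (vt t) w = A t}].
Proof.
move=> sw; have K0 : 0 <= M * nrm `]0, 1[ w by rewrite mulr_ge0 ?nrm_ge0.
have [A' LA' eA'] := weak_derivative_lipschitz_rep T0 (sip vttL sw) (sip vtttL sw)
  (wd23 sw) (ipb vtttL sw).
have [A LA eA] := weak_derivative_lipschitz_rep T0 (sip vtL sw) (sip vttL sw)
  (wd12 sw) (ipb vttL sw).
have cA : cont_on 0 T A by exact: lipschitz_cont_on LA.
have cA' : cont_on 0 T A' by exact: lipschitz_cont_on LA'.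
have cv := C0L2_cont_on vC sw.
exists A, A'; split=> //.
- split=> // t tT; apply: (weak_derivative_is_derive T0 cv cA (sip vL sw) (sip vtL sw) _ eA (wd01 sw)) => //.
  exact: aeT.
- by split=> // t tT; apply: (weak_derivative_is_derive T0 cA cA' (sip vtL sw) (sip vttL sw) eA eA' (wd12 sw)).
- apply: (@ae_le_cont_on _ 0 T _ (fun t => `|A t|)) => //; first exact: cont_on_norm.
  by apply: aeS2 eA (ipb vtL sw) => t e h tT; rewrite -e// h.
Qed.

Lemma zero_trace_moments u C : antiderivative_chain 0 1 k C ->
  {ae mu, forall y, y \in `]0, 1[ -> u y = C 0%N y} -> sq_int `]0, 1[ u ->
  C 0%N 0 = ip `]0, 1[ u (fun=> 1) + ip `]0, 1[ (C 1%N) (fun y => y)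
            - ip `]0, 1[ (C 1%N) (fun=> 1).
Proof.
move=> cC uC su; rewrite (chain_trace_moments cC).
have s1 := sq_int_cst 0 1 (1 : R).
rewrite (ae_eq_ip (mitv _ _) su.1 (cC.1 0%N isT).1 s1.1 uC); congr (_ + _ - _).
by apply: eq_Rintegral => y _; rewrite mulr1.
Qed.

Let sy : sq_int `]0, 1[ (fun y : R => y).
Proof.
apply: (@sq_int_bounded _ _ _ _ 1); first exact: measurable_id.
by move=> y; rewrite in_itv/= => /andP[y0 y1]; rewrite ger0_norm ltW.
Qed.

(** Membership in H^(k+1) and H_0^1 in the form used by [ritz_estimate]; the zero integral of [C 1]
    is the trace at 1. *)
Definition zero_trace_chain u du :=
  exists C, [/\ antiderivative_chain 0 1 k C,
     C 0%N 0 = 0 /\ \int[mu]_(y in `]0, 1[) C 1%N y = 0,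
     {ae mu, forall y, y \in `]0, 1[ -> u y = C 0%N y},
     {ae mu, forall y, y \in `]0, 1[ -> du y = C 1%N y} &
     nrm `]0, 1[ (C k.+1) <= M].

Section derivatives.
Variables (Dv Dvt Dvtt : nat -> R -> R -> R).
Hypotheses
  (DvL : forall j, (j <= k.+1)%N -> L2_valued T (fun=> M) (Dv j))
  (aDv : {ae mu, forall t, t \in `]0, T[ -> Hm_derivs_le 0 1 k.+1 (v t) (fun j => Dv j t) M})
  (DvtL : forall j, (j <= k.+1)%N -> L2_valued T (fun=> M) (Dvt j))
  (aDvt : {ae mu, forall t, t \in `]0, T[ -> Hm_derivs_le 0 1 k.+1 (vt t) (fun j => Dvt j t) M})
  (DvttL : forall j, (j <= 1)%N -> L2_valued T (fun=> M) (Dvtt j))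
  (aDvtt : {ae mu, forall t, t \in `]0, T[ -> Hm_derivs_le 0 1 1 (vtt t) (fun j => Dvtt j t) M}).

Lemma solution_zero_trace :
  {ae mu, forall t, t \in `]0, T[ -> zero_trace_chain (v t) (Dv 1%N t)}.
Proof.
apply: aeS2 aDv vH10 => t hD h10 tT; have hDt := hD tT.
have [C [cC eC uC nC]] := Hm_derivs_chain M0 hDt; exists C.
have [|a b] := H10_zero_trace (h10 tT) cC _ uC.
  move=> du wdu; have wd1 := hDt.1 1%N isT.
  have := weak_deriv_unique ltr01 wdu wd1.
  by apply: aeS2 (eC 1%N isT) => y e1 e2 yI; rewrite e2// e1.
by split=> //; exact: eC.
Qed.

Lemma D1_weak_derivative q : sq_int `]0, 1[ q -> weak_derivative 0 T
  (fun t => ip `]0, 1[ (Dv 1%N t) q) (fun t => ip `]0, 1[ (Dvt 1%N t) q).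
Proof.
apply: (time_deriv_space (z := v) (z' := vt) sM sM (DvL _) (DvtL _)) => //.
- by apply: aeS aDv => t h tT; have [/(_ 1%N isT)] := h tT.
- by apply: aeS aDvt => t h tT; have [/(_ 1%N isT)] := h tT.
- by move=> w sw; exact: sip.
- by move=> w sw; exact: sip.
Qed.

Lemma D1t_weak_derivative q : sq_int `]0, 1[ q -> weak_derivative 0 T
  (fun t => ip `]0, 1[ (Dvt 1%N t) q) (fun t => ip `]0, 1[ (Dvtt 1%N t) q).
Proof.
apply: (time_deriv_space (z := vt) (z' := vtt) sM sM (DvtL _) (DvttL _)) => //.
- by apply: aeS aDvt => t h tT; have [/(_ 1%N isT)] := h tT.
- by apply: aeS aDvtt => t h tT; have [/(_ 1%N isT)] := h tT.
- by move=> w sw; exact: sip.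
- by move=> w sw; exact: sip.
Qed.

(* The traces at 0 and 1 are inner products, so that they vanish together with
   their time derivatives. *)
Lemma time_derivative_zero_trace :
  {ae mu, forall t, t \in `]0, T[ -> zero_trace_chain (vt t) (Dvt 1%N t)}.
Proof.
have s1 := sq_int_cst 0 1 (1 : R); have sD := DvL (isT : 1 <= k.+1)%N.
have sDt := DvtL (isT : 1 <= k.+1)%N.
have Z1 : {ae mu, forall t, t \in `]0, T[ -> ip `]0, 1[ (Dvt 1%N t) (fun=> 1) = 0}.
  apply: weak_derivative_zero T0 (sip sD s1) (sip sDt s1) _ (D1_weak_derivative s1).
  apply: aeS2 solution_zero_trace sD.2 => t h hs tT.
  have [C [cC [_ i1] _ eD _]] := h tT; have [sDv _] := hs tT.
  rewrite (ae_eq_ip (mitv _ _) sDv.1 (cC.1 1%N isT).1 s1.1 eD) -[RHS]i1.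
  by apply: eq_Rintegral => y _; rewrite mulr1.
have Z2 : {ae mu, forall t, t \in `]0, T[ ->
    ip `]0, 1[ (vt t) (fun=> 1) + 1 * ip `]0, 1[ (Dvt 1%N t) (fun y => y) = 0}.
  apply: (weak_derivative_zero T0 _ _ _ (weak_derivativeD 1 (sip vL s1) (sip sD sy)
    (sip vtL s1) (sip sDt sy) (wd01 s1) (D1_weak_derivative sy))).
  - by apply: summableD (sip _ _) (summableZ _ _ (sip _ _)).
  - by apply: summableD (sip _ _) (summableZ _ _ (sip _ _)).
  - apply: aeS2 (aeS2 (fun t => @conj _ _) solution_zero_trace sD.2) vL.2 => t [h hs] hv0 tT.
    have [C [cC [c0 i1] eu eD _]] := h tT; have [sDv _] := hs tT; have [su _] := hv0 tT.
    have E := zero_trace_moments cC eu su.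
    rewrite mul1r (ae_eq_ip (mitv _ _) sDv.1 (cC.1 1%N isT).1 sy.1 eD) -[RHS]c0 E.
    rewrite [X in _ = _ - X](_ : _ = 0) ?subr0//.
    by rewrite -[RHS]i1; apply: eq_Rintegral => y _; rewrite mulr1.
have {}Z : {ae mu, forall t, t \in `]0, T[ -> ip `]0, 1[ (Dvt 1%N t) (fun=> 1) = 0 /\
    ip `]0, 1[ (vt t) (fun=> 1) + ip `]0, 1[ (Dvt 1%N t) (fun y => y) = 0}.
  apply: aeS2 Z1 Z2 => t a b tT; split; first exact: a.
  by rewrite -[RHS](b tT) mul1r.
apply: aeS2 (aeS2 (fun t => @conj _ _) aDvt Z) (aeS2 (fun t => @conj _ _) sDt.2 vtL.2).
move=> t [hD hZ] [hs hv0] tT; have [z1 z2] := hZ tT.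
have [sDv _] := hs tT; have [su _] := hv0 tT.
have [C [cC eC uC nC]] := Hm_derivs_chain M0 (hD tT); exists C.
have e w : sq_int `]0, 1[ w -> ip `]0, 1[ (Dvt 1%N t) w = ip `]0, 1[ (C 1%N) w.
  by move=> sw; apply: (ae_eq_ip (mitv _ _) sDv.1 (cC.1 1%N isT).1 sw.1 (eC 1%N isT)).
split=> //; last exact: eC; split.
  by rewrite (zero_trace_moments cC uC su) -!e// z1 z2 subr0.
by rewrite -[RHS]z1 e//; apply: eq_Rintegral => y _; rewrite mulr1.
Qed.

Variables (s : seq R) (hs : itv_partition 0 1 s).
Local Notation h := (mesh s).

Lemma ip_D1_C1 q : sq_int `]0, 1[ q -> exists B B',
  [/\ C1_on 0 T B B', lipschitz_on 0 T (M * nrm `]0, 1[ q) B',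
      forall t, t \in `[0, T] -> `|B t| <= M * nrm `]0, 1[ q &
      {ae mu, forall t, t \in `]0, T[ -> ip `]0, 1[ (Dv 1%N t) q = B t}].
Proof.
move=> sq; have sD := DvL (isT : 1 <= k.+1)%N.
have sDt := DvtL (isT : 1 <= k.+1)%N; have sDtt := DvttL (isT : 1 <= 1)%N.
have [B LB eB] := weak_derivative_lipschitz_rep T0 (sip sD sq) (sip sDt sq)
  (D1_weak_derivative sq) (ipb sDt sq).
have [B' LB' eB'] := weak_derivative_lipschitz_rep T0 (sip sDt sq) (sip sDtt sq)
  (D1t_weak_derivative sq) (ipb sDtt sq).
have cB : cont_on 0 T B by exact: lipschitz_cont_on LB.
have cB' : cont_on 0 T B' by exact: lipschitz_cont_on LB'.
exists B, B'; split=> //.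
- by split=> // t tT; apply: (weak_derivative_is_derive T0 cB cB' (sip sD sq) (sip sDt sq) eB eB' (D1_weak_derivative sq)).
- apply: (@ae_le_cont_on _ 0 T _ (fun t => `|B t|)) => //; first exact: cont_on_norm.
  by apply: aeS2 eB (ipb sD sq) => t e b tT; rewrite -e// b.
Qed.

(** The coefficients of the projection of dv/dy in an orthonormal basis have continuous
    representatives, which define [vh] at every time, although dv/dy is controlled only at almost
    every time. The estimates hold almost everywhere by [ritz_estimate] and are extended by
    continuity of inner products with one fixed function. *)
Lemma elliptic_projection : exists vh : R -> R -> R,
  [/\ forall t, t \in `[0, T] -> Sh s k (vh t),
  forall q, pw k 0 s q -> exists B B',
    [/\ C1_on 0 T B B', lipschitz_on 0 T (M * nrm `]0, 1[ q) B',
        forall t, t \in `[0, T] -> `|B t| <= M * nrm `]0, 1[ q,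
        forall t, t \in `[0, T] -> ip `]0, 1[ (derive1 (vh t)) q = B t &
        {ae mu, forall t, t \in `]0, T[ -> ip `]0, 1[ (Dv 1%N t) q = B t}],
  forall t, t \in `[0, T] ->
    nrm `]0, 1[ (fun y => v t y - vh t y) <= h ^+ k.+1 * M &
  forall r t, r \in `[0, T] -> t \in `[0, T] ->
    nrm `]0, 1[ (fun y => (v r y - vh r y) - (v t y - vh t y)) <=
      h ^+ k.+1 * M * `|r - t|].
Proof.
have sD := DvL (isT : 1 <= k.+1)%N; have sDt := DvtL (isT : 1 <= k.+1)%N.
have [n [e [pe oe re]]] := pw_orthonormal_basis k hs.
have se i : sq_int `]0, 1[ (e i) by exact: pw_sq_int (pe i).
have /choice[B hB] : forall i, exists B, cont_on 0 T B /\
    {ae mu, forall t, t \in `]0, T[ -> ip `]0, 1[ (Dv 1%N t) (e i) = B t}.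
  by move=> i; have [B [B' [[cB _] _ _ eB]]] := ip_D1_C1 (se i); exists B.
have cB i := (hB i).1.
have aB : {ae mu, forall t, t \in `]0, T[ ->
    forall i, ip `]0, 1[ (Dv 1%N t) (e i) = B i t}.
  pose P i t := t \in `]0, T[ -> ip `]0, 1[ (Dv 1%N t) (e i) = B i t.
  have : \forall t \near almost_everywhere mu, forall i : 'I_n, P i t.
    by apply: filter_forall => i; exact: (hB i).2.
  by apply: aeS => t h tT i; exact: h.
pose E i y := \int[mu]_(x in `]0, y[) e i x.
pose vh t y := \int[mu]_(x in `]0, y[) (\sum_i B i t * e i x).
have sE i : sq_int `]0, 1[ (E i).
  apply: (eq_sq_int (mitv 0 1) _ (pw_sq_int hs (cpw_pw (pw_primitive 0 hs (pe i))))).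
  by move=> y _; rewrite add0r.
have vhE (c : 'I_n -> R) (y : R) : y \in `]0, 1[ ->
    \int[mu]_(x in `]0, y[) (\sum_i c i * e i x) = \sum_i c i * E i y.
  rewrite in_itv/= => /andP[_ y1]; apply: Rintegral_lincomb => i.
  by apply: (@sq_int_sub _ 0 1) => //; exact: ltW.
have Dv1 : {ae mu, forall t, t \in `]0, T[ -> ip `]0, 1[ (fun=> 1) (Dv 1%N t) = 0}.
  apply: aeS2 solution_zero_trace sD.2 => t a b tT.
  have [C [cC [_ z] _ eC _]] := a tT; have [sDv _] := b tT.
  rewrite ipC -[RHS]z (ae_eq_ip (mitv _ _) sDv.1 (cC.1 1%N isT).1 _ eC)//.
  by apply: eq_Rintegral => y _; rewrite mulr1.
have pq t : pw k 0 s (fun x => \sum_i B i t * e i x) by exact: pw_sum.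
have ipB q : sq_int `]0, 1[ q -> cont_on 0 T (fun t => \sum_i B i t * ip `]0, 1[ (e i) q).
  move=> sq; apply: cont_on_sum => i.
  by under eq_fun do rewrite mulrC; exact: cont_onZ.
(* The constant 1 is a piecewise polynomial of degree less than [k], so the projection keeps the
   mean of dv/dy, which is zero. *)
have i1 t : t \in `[0, T] -> \int[mu]_(x in `]0, 1[) (\sum_i B i t * e i x) = 0.
  move=> tT; have s1 := sq_int_cst 0 1 (1 : R).
  rewrite Rintegral_lincomb//.
  have -> : \sum_i B i t * \int[mu]_(x in `]0, 1[) e i x =
      \sum_i B i t * ip `]0, 1[ (e i) (fun=> 1).
    by apply: eq_bigr => i _; congr (_ * _); apply: eq_Rintegral => x _; rewrite mulr1.
  apply: (@ae_eq_cont_on _ 0 T (fun t => \sum_i B i t * ip `]0, 1[ (e i) (fun=> 1)) (fun=> 0)) => //.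
  + exact: ipB.
  + exact: cont_on_cst.
  + apply: aeS2 (aeS2 (fun t => @conj _ _) aB Dv1) sD.2 => t' [a b] c t'T.
    have [sDv _] := c t'T.
    have p1 : pw k 0 s (fun=> 1).
      move=> j _; exists 1%:P; first by rewrite (leq_trans (size_polyC_leq1 _)).
      by move=> y _; rewrite hornerC.
    rewrite -[RHS](b t'T) (re _ p1 _ sDv); apply: eq_bigr => i _.
    by rewrite -a// [ip _ (fun=> 1) _]ipC [ip _ (e i) (Dv _ _)]ipC mulrC.
have Svh t : t \in `[0, T] -> Sh s k (vh t).
  by move=> tT; apply: pw_primitive_Sh; rewrite ?i1.
have dvh t : t \in `[0, T] -> {ae mu, forall y, y \in `]0, 1[ ->
    derive1 (vh t) y = \sum_i B i t * e i y}.
  move=> tT; apply: (cpw_derive1_ae hs (Sh_cpw (Svh t tT))).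
    exact: pw_sq_int (pq t).
  by move=> y _; rewrite /vh set_itvoo0 Rintegral_set0 add0r.
have svh t : t \in `[0, T] -> sq_int `]0, 1[ (vh t).
  by move=> tT; exact: Sh_sq_int (Svh t tT).
have hk0 : 0 <= h ^+ k.+1 by rewrite exprn_ge0 ?mesh_ge0.
(* The projection error tested with [w], for a general [u], because it is needed for [v t] and for
   [vt t]. *)
have ritz u du C w : antiderivative_chain 0 1 k C -> C 0%N 0 = 0 -> 
    {ae mu, forall y, y \in `]0, 1[ -> u y = C 0%N y} ->
    {ae mu, forall y, y \in `]0, 1[ -> du y = C 1%N y} ->
    nrm `]0, 1[ (C k.+1) <= M -> sq_int `]0, 1[ u -> sq_int `]0, 1[ du ->
    sq_int `]0, 1[ w ->
    `|ip `]0, 1[ u w - \sum_i ip `]0, 1[ (E i) w * ip `]0, 1[ du (e i)| <=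
    h ^+ k.+1 * M * nrm `]0, 1[ w.
  move=> cC c0 uC eC nC su sdu sw.
  have eip i : ip `]0, 1[ du (e i) = ip `]0, 1[ (C 1%N) (e i).
    exact: (ae_eq_ip (mitv _ _) sdu.1 (cC.1 1%N isT).1 (se i).1 eC).
  have sp : sq_int `]0, 1[ (fun y => \sum_i ip `]0, 1[ du (e i) * E i y) by exact: sq_int_sum.
  have -> : \sum_i ip `]0, 1[ (E i) w * ip `]0, 1[ du (e i) =
      ip `]0, 1[ (fun y => \sum_i ip `]0, 1[ du (e i) * E i y) w.
    by rewrite ip_suml//; apply: eq_bigr => i _; rewrite mulrC.
  have sB := sq_intB (mitv 0 1) su sp.
  rewrite -ipBl//; apply: le_trans (CS (mitv _ _) sB sw) _.
  rewrite ler_wpM2r ?nrm_ge0//.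
  pose X y := C 0%N y - (C 0%N 0 + \int[mu]_(x in `]0, y[) proj 0 1 e (C 1%N) x).
  have XE y : y \in `]0, 1[ -> X y = C 0%N y - \sum_i ip `]0, 1[ du (e i) * E i y.
    move=> yI; rewrite /X /proj c0 add0r vhE//; congr (_ - _).
    by apply: eq_bigr => i _; rewrite eip.
  have sX : sq_int `]0, 1[ X.
    apply: (@eq_sq_int _ _ (mitv 0 1) (fun y => C 0%N y - \sum_i ip `]0, 1[ du (e i) * E i y)).
      by move=> y yI; rewrite XE.
    by apply: sq_intB => //; exact: cC.1.
  have -> : nrm `]0, 1[ (fun y => u y - \sum_i ip `]0, 1[ du (e i) * E i y) =
      nrm `]0, 1[ X.
    apply: (ae_eq_nrm (mitv _ _) sB.1 sX.1).
    by apply: aeS uC => y a yI; rewrite XE// a.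
  apply: (le_trans (ritz_estimate hs k1 cC (@mesh_each _ s) pe re)).
  by rewrite ler_wpM2l.
have Hw w t : t \in `[0, T] -> sq_int `]0, 1[ w ->
    ip `]0, 1[ (fun y => v t y - vh t y) w =
    ip `]0, 1[ (v t) w - \sum_i ip `]0, 1[ (E i) w * B i t.
  move=> tT sw; rewrite ipBl//; [|exact: C0L2_sq_int vC tT|exact: svh].
  congr (_ - _); rewrite (@eq_ip _ `]0, 1[ _ (fun y => \sum_i B i t * E i y) w w)//.
    by rewrite ip_suml//; apply: eq_bigr => i _; rewrite mulrC.
  by move=> y yI; exact: vhE.
have cH w : sq_int `]0, 1[ w ->
    cont_on 0 T (fun t => ip `]0, 1[ (v t) w - \sum_i ip `]0, 1[ (E i) w * B i t).
  move=> sw; apply: cont_onB; first exact: C0L2_cont_on.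
  by apply: cont_on_sum => i; exact: cont_onZ.
exists vh; split=> //.
- move=> q pwq; have sq := pw_sq_int hs pwq.
  have [Bq [Bq' [C1q Lq bq eq]]] := ip_D1_C1 sq.
  exists Bq, Bq'; split=> // t tT.
  rewrite (@ae_eq_ip _ _ (mitv 0 1) _ (fun y => \sum_i B i t * e i y)); first last.
  + exact: dvh.
  + exact: sq.1.
  + exact: pw_measurable (pq t).
  + exact: (Sh_derive1_sq_int hs (Svh _ tT)).1.
  rewrite ip_suml//.
  apply: (@ae_eq_cont_on _ 0 T (fun t => \sum_i B i t * ip `]0, 1[ (e i) q)) => //.
  + exact: ipB.
  + exact: C1q.1.
  + apply: aeS2 (aeS2 (fun t => @conj _ _) aB eq) sD.2 => t' [a b] c t'T.
    have [sDv _] := c t'T.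
    rewrite -b// [RHS]ipC (re _ pwq _ sDv); apply: eq_bigr => i _.
    by rewrite -a// [ip _ q _]ipC [ip _ (e i) (Dv _ _)]ipC mulrC.
- move=> t tT; have st := sq_intB (mitv _ _) (C0L2_sq_int vC tT) (svh _ tT).
  apply: nrm_le_dual => //; first by rewrite mulr_ge0.
  (* The error at the fixed time [t] is taken as [w]; only then does time vary in the first
     argument. *)
  rewrite (Hw _ _ tT st); set w := (X in ip _ _ X) in st *.
  apply: le_trans (ler_norm _) _.
  apply: (@ae_le_cont_on _ 0 T _ (fun t => `|ip `]0, 1[ (v t) w - \sum_i ip `]0, 1[ (E i) w * B i t|)) => //.
  + by apply: cont_on_norm; exact: cH.
  + apply: aeS2 (aeS2 (fun t => @conj _ _) aB solution_zero_trace) (aeS2 (fun t => @conj _ _) vL.2 sD.2).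
    move=> t' [a b] [c d] t'T; have [C [cC [c0 _] uC eC nC]] := b t'T.
    have [su _] := c t'T; have [sdu _] := d t'T.
    have := ritz _ _ _ _ cC c0 uC eC nC su sdu st.
    by under eq_bigr do rewrite a//.
- move=> r t rT tT.
  have sr := sq_intB (mitv _ _) (C0L2_sq_int vC rT) (svh _ rT).
  have st := sq_intB (mitv _ _) (C0L2_sq_int vC tT) (svh _ tT).
  have srt := sq_intB (mitv _ _) sr st.
  apply: nrm_le_dual => //; first by rewrite !mulr_ge0.
  rewrite ipBl// (Hw _ _ tT srt) (Hw _ _ rT srt); set w := (X in ip _ _ X) in srt *.
  apply: le_trans (ler_norm _) _; rewrite mulrAC.
  have sB i : summable_on `]0, T[ (B i) by exact: cont_on_summable (ltW T0) (cB i).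
  have wBi i : weak_derivative 0 T (B i) (fun t => ip `]0, 1[ (Dvt 1%N t) (e i)).
    apply: weak_derivative_ae (D1_weak_derivative (se i)) => //; try exact: sip.
    - by apply: aeS aB => t' a t'T; exact: a.
    - exact: aeT.
  have [wB sB1 sB2] := weak_derivative_sum (index_enum 'I_n) (fun i => ip `]0, 1[ (E i) w) sB
    (fun i => sip sDt (se i)) wBi.
  (* The projection commutes with the time derivative: the weak derivative of the tested error is
     the tested projection error of [vt], to which [ritz] applies again. *)
  apply: (@weak_derivative_lipschitz _ _ T0 _ _ (fun t => ip `]0, 1[ (vt t) w -
    \sum_i ip `]0, 1[ (E i) w * ip `]0, 1[ (Dvt 1%N t) (e i))) (cH _ srt) _ _ _ _ _ tT rT.
  + by apply: summableB => //; exact: sip.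
  + have := weak_derivativeD (-1) (sip vL srt) sB1 (sip vtL srt) sB2 (wd01 srt) wB.
    congr weak_derivative; apply/funext => t'; rewrite mulN1r //.
  + apply: aeS2 (aeS2 (fun t => @conj _ _) vtL.2 time_derivative_zero_trace) sDt.2.
    move=> t' [a b] c t'T; have [C [cC [c0 _] uC eC nC]] := b t'T.
    have [su _] := a t'T; have [sdu _] := c t'T.
    exact: ritz cC c0 uC eC nC su sdu srt.
Qed.

End derivatives.
End Regular_solution.

(** * The weak equation at every time *)

Section Test_approximation.
Context {R : realType}.
Local Notation mu := (@lebesgue_measure R).
Local Notation mR := (measurableTypeR R).
Implicit Types (f g q w W : R -> R) (s : seq R) (k : nat) (p : {poly R}).

Let mitv a b : measurable (`]a, b[%classic : set mR).
Proof. exact: measurable_itv. Qed.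

Lemma smooth_horner p : smooth (horner p).
Proof.
elim/poly_ind: p => [|p c IH].
  by rewrite (_ : horner 0 = fun=> 0) ?funeqE; [exact: smooth_cst|move=> x; rewrite horner0].
rewrite (_ : horner _ = fun x => p.[x] * (1 * x + 0) + c).
  by apply: smoothD; [apply: smoothM => //; exact: smooth_affine|exact: smooth_cst].
by apply/funext => x; rewrite hornerMXaddC mul1r addr0.
Qed.

Lemma testD (a b : R) f g : test_function a b f -> test_function a b g ->
  test_function a b (fun x => f x + g x).
Proof.
move=> tf tg; have := testB tf (testZ (-1) tg).
by congr test_function; apply/funext => x; rewrite mulN1r opprK.
Qed.

Lemma test_widen (a b c d : R) f : a <= c -> d <= b -> test_function c d f ->
  test_function a b f.
Proof.
move=> ac db [sf [l [r [cl rd h]]]]; split=> //; exists l, r; split=> //.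
  exact: le_lt_trans cl.
exact: lt_le_trans db.
Qed.

Lemma test_out (a b : R) f y : test_function a b f -> y \notin `]a, b[ -> f y = 0.
Proof.
move=> [_ [l [r [al rb h]]]] yab; apply: h; apply: contraNN yab.
by rewrite !in_itv/= => /andP[ly yr]; rewrite (lt_le_trans al)//= (le_lt_trans yr).
Qed.

(** On each element the polynomial is multiplied by bumps. The limit is 0 at the nodes, and the
    bound uniform in [n] prepares dominated convergence. *)
Lemma pw_test_approximation k (a b : R) s q : itv_partition a b s -> pw k a s q ->
  exists C, exists2 psi : nat -> R -> R,
    forall n, test_function a b (psi n) /\ forall y, `|psi n y| <= C &
    forall y, y \in `]a, b[ ->
      psi n y @[n --> \oo] --> (if y \in s then 0 else q y).
Proof.
move=> ps; move: a s ps; apply: itv_partition_rect => [_|a x s ax xb ps IH].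
  (* The zero function, written so that [test_bump] applies. *)
  exists 0, (fun _ y => 0 * bump b b 0 y) => [n|y]; last first.
    by rewrite in_itv/= => /andP[b1 b2]; have := lt_trans b1 b2; rewrite ltxx.
  split=> [|y]; last by rewrite mul0r normr0.
  by apply: testZ; apply: test_bump.
move=> /each_cons[[p sp hp] /IH[C [psi hpsi cpsi]]].
have [Cp hCp] := poly_bounded p a x.
have Cp0 : 0 <= Cp by apply: le_trans (hCp a _); rewrite // in_itv/= lexx ltW.
exists (Cp + C), (fun n y => p.[y] * bump a x n y + psi n y) => [n|y].
  have [tp hb] := hpsi n; split=> [|y].
    apply: testD; last by apply: test_widen tp => //; exact: ltW.
    by apply: test_smoothM; [exact: smooth_horner|exact: test_bump].
  rewrite (le_trans (ler_normD _ _))// lerD//.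
  have [yax|yax] := boolP (y \in `]a, x[); last by rewrite bump_out// mulr0 normr0.
  have /andP[b0 b1] := bump_bound a x n y.
  rewrite normrM (ger0_norm b0) (le_trans (ler_piMr _ b1))// hCp//.
  by move: yax; rewrite !in_itv/= => /andP[? ?]; rewrite !ltW.
rewrite in_itv/= => /andP[ay yb]; rewrite inE.
have xs : forall z, z \in s -> x < z.
  by move: ps => [+ _] z zs => /(order_path_min lt_trans)/allP; exact.
have [yx|xy|->] /= := ltgtP y x.
- have -> : y \in s = false by apply/negP => /xs; rewrite ltNge ltW.
  have yax : y \in `]a, x[ by rewrite in_itv/= ay.
  rewrite hp//.
  rewrite (_ : (fun n => _) = (fun n => p.[y] * bump a x n y)).
    rewrite -[X in _ --> X]mulr1; apply: cvgM; first exact: cvg_cst.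
    by have := @cvg_bump _ a x y; rewrite yax.
  apply/funext => n; have [tp _] := hpsi n.
  by rewrite (test_out tp) ?addr0// in_itv/= lt_gtF.
- rewrite (_ : (fun n => _) = (fun n => psi n y)); first by apply: cpsi; rewrite in_itv/= xy.
  apply/funext => n; rewrite bump_out ?mulr0 ?add0r//.
  by rewrite in_itv/= [y < x]lt_gtF// andbF.
- rewrite (_ : (fun n => _) = (fun=> 0)); first exact: cvg_cst.
  apply/funext => n; have [tp _] := hpsi n.
  by rewrite (test_out tp) ?bump_out ?mulr0 ?addr0// in_itv/= ltxx ?andbF.
Qed.

Lemma pw_L2_approximation k s q : itv_partition 0 1 s -> pw k 0 s q ->
  exists2 psi : nat -> R -> R, forall n, test_function 0 1 (psi n) &
    nrm `]0, 1[ (fun y => psi n y - q y) @[n --> \oo] --> (0 : R).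
Proof.
move=> ps pwq; have sq := pw_sq_int ps pwq.
have [C [psi hpsi cpsi]] := pw_test_approximation ps pwq; exists psi => [n|].
  by have [] := hpsi n.
have [C' hC'] := pw_bounded ps pwq.
have mpsi n : measurable_fun (`]0, 1[%classic : set mR) (psi n).
  by have [/test_functionP[/measurable_smooth]] := hpsi n.
suff : Num.sqrt (ip `]0, 1[ (fun y => psi n y - q y) (fun y => psi n y - q y))
    @[n --> \oo] --> (Num.sqrt 0 : R) by rewrite sqrtr0.
apply: (@continuous_cvg _ _ _ _ _ _ Num.sqrt); first exact: sqrt_continuous.
(* The pointwise limit of [psi], which differs from [q] at most at the nodes. *)
pose q0 y := if y \in s then 0 else q y.
have eq0 : {ae mu, forall y, y \in `]0, 1[ -> q y = q0 y}.
  by apply: aeS (ae_notin_seq s) => y ys _; rewrite /q0 (negPf ys).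
have mq0 : measurable_fun (`]0, 1[%classic : set mR) q0.
  apply: (measurable_fun_cvg (h := psi)) => // y yI; exact: cpsi.
have mB0 n : measurable_fun (`]0, 1[%classic : set mR) (fun y => (psi n y - q0 y) ^+ 2).
  by apply: measurable_funX; exact: measurable_funB.
have -> : (fun n => ip `]0, 1[ (fun y => psi n y - q y) (fun y => psi n y - q y)) =
    (fun n => \int[mu]_(y in `]0, 1[) ((psi n y - q0 y) ^+ 2)).
  apply/funext => n; apply: ae_eq_Rintegral => //.
  - have mB : measurable_fun (`]0, 1[%classic : set mR) (fun y => psi n y - q y).
      by apply: measurable_funB => //; exact: sq.1.
    exact: measurable_funM.
  - by apply: aeS eq0 => y h yI; rewrite h// expr2.
rewrite -[X in _ --> X](_ : \int[mu]_(y in `]0, 1[) (0 : R) = 0); last first.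
  by rewrite Rintegral_cst// mul0r.
apply: (@Rdominated_cvg _ _ _ _ (fun=> (C + C') ^+ 2)) => //.
- move=> y yI; rewrite [X in _ --> X](_ : 0 = (q0 y - q0 y) ^+ 2); last by rewrite subrr expr0n.
  rewrite expr2; apply: cvgM; (apply: cvgB; last exact: cvg_cst); exact: cpsi.
- exact: summable_cst.
- move=> n y yI; have [_ hC] := hpsi n.
  have C0 : 0 <= C by apply: le_trans (hC 0).
  have C'0 : 0 <= C' by apply: le_trans (hC' y yI).
  rewrite normrX lerXn2r ?nnegrE ?normr_ge0 ?addr_ge0//.
  rewrite (le_trans (ler_normB _ _))// lerD// /q0.
  by case: ifP => _; [rewrite normr0|exact: hC'].
Qed.

Lemma Sh_weak_deriv s k W : itv_partition 0 1 s -> Sh s k W ->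
  weak_deriv 0 1 1 W (derive1 W).
Proof.
move=> ps hW; have sW := Sh_sq_int ps hW; have sdW := Sh_derive1_sq_int ps hW.
split; [exact/L2P|exact/L2P|move=> phi tphi].
have tp := test_derive1 tphi; have [smp _] := (test_functionP 0 1 phi).1 tphi.
rewrite expr1 mulN1r /=.
transitivity (\int[mu]_(y in `]0, 1[) ((\int[mu]_(x in `]0, y[) derive1 W x) * derive1 phi y)).
  apply: eq_Rintegral => y /set_mem/=; rewrite in_itv/= => /andP[y0 y1].
  by rewrite -(Sh_primitive ps hW)// in_itv/= !ltW.
rewrite (Rintegral_triangle (sq_int_summable sdW) (summable_test tp)).
have sM := summableM_test (sq_int_summable sdW) tphi.
rewrite -mulN1r -RintegralZl//; apply: eq_Rintegral => y /set_mem/=.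
rewrite in_itv/= => /andP[y0 y1]; rewrite Rintegral_smooth_derive1//.
by rewrite (test_out tphi (y := 1)) ?in_itv/= ?ltxx ?andbF// sub0r mulrN mulN1r.
Qed.

Lemma L2norm_cvg0_nrm (f_ : nat -> R -> R) (r : nat -> R) :
  (forall n, sq_int `]0, 1[ (f_ n)) -> (forall n, nrm `]0, 1[ (f_ n) <= r n) ->
  r n @[n --> \oo] --> (0 : R) -> L2norm 0 1 (f_ n) @[n --> \oo] --> 0%E.
Proof.
move=> sf fr r0.
rewrite (_ : (fun n => _) = (fun n => (nrm `]0, 1[ (f_ n))%:E)); last first.
  by apply/funext => n; rewrite L2normE.
apply/fine_cvgP; split; first by near=> n.
apply: (@squeeze_cvgr _ _ _ _ (fun=> 0) r) => //; last exact: cvg_cst.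
by near=> n; rewrite nrm_ge0 fr.
Unshelve. all: by end_near. Qed.

(** The derivative of [W] is approximated in L2 by test functions, and their means are removed with
    a fixed unit test function so that the primitives are test functions. The means tend to zero
    because the derivative of [W] has mean zero. *)
Lemma Sh_H10 s k W : itv_partition 0 1 s -> Sh s k W -> H10 0 1 W.
Proof.
move=> ps hW; have sW := Sh_sq_int ps hW; have sdW := Sh_derive1_sq_int ps hW.
exists (derive1 W); first exact: Sh_weak_deriv ps hW.
have [psi tpsi cpsi] := pw_L2_approximation ps (Sh_derive1 hW).
have [chi tchi i1] := exists_unit_test (@ltr01 R).
have schi := sq_int_test tchi.
pose m n := \int[mu]_(y in `]0, 1[) psi n y.
pose r n := nrm `]0, 1[ (fun y => psi n y - derive1 W y).
have sB n : sq_int `]0, 1[ (fun y => psi n y - derive1 W y).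
  by apply: sq_intB => //; exact: sq_int_test.
have mr n : `|m n| <= r n.
  have W0 : \int[mu]_(y in `]0, 1[) derive1 W y = 0.
    have [_ _ W1 _] := hW.
    by rewrite -(Sh_primitive ps hW) ?in_itv/= ?lexx ?ler01.
  rewrite -[m n]subr0 -W0 -RintegralB//.
  - exact: Rintegral_le_nrm.
  - exact: summable_test.
  - exact: sq_int_summable.
have /choice[Phi hPhi] : forall n, exists Phi, test_function 0 1 Phi /\
    derive1 Phi = (fun y => psi n y - m n * chi y).
  move=> n; have [||Phi tPhi dPhi] := @test_primitive _ 0 1 (fun y => psi n y - m n * chi y).
  - by apply: testB => //; exact: testZ.
  - rewrite RintegralB//; [|exact: summable_test|by apply: summableZ => //; exact: summable_test].
    by rewrite RintegralZl ?i1 ?mulr1 ?subrr//; exact: summable_test.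
  - by exists Phi.
have sD n : sq_int `]0, 1[ (fun y => derive1 (Phi n) y - derive1 W y).
  by apply: sq_intB => //; apply: sq_int_test; apply: test_derive1; have [] := hPhi n.
have sP n : sq_int `]0, 1[ (fun y => Phi n y - W y).
  by apply: sq_intB => //; apply: sq_int_test; have [] := hPhi n.
have dr n : nrm `]0, 1[ (fun y => derive1 (Phi n) y - derive1 W y) <=
    (1 + nrm `]0, 1[ chi) * r n.
  have [_ ->] := hPhi n.
  rewrite (@eq_nrm _ _ _ (fun y => (psi n y - derive1 W y) - m n * chi y)); last first.
    by move=> y _; ring.
  apply: le_trans (nrmB (mitv _ _) (sB n) (sq_intZ (mitv _ _) (m n) schi)) _.
  by rewrite nrmZ// mulrDl mul1r lerD2l mulrC ler_wpM2l ?nrm_ge0.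
have cr : (1 + nrm `]0, 1[ chi) * r n @[n --> \oo] --> (0 : R).
  by rewrite -[X in _ --> X](mulr0 (1 + nrm `]0, 1[ chi)); exact: cvgZr.
exists Phi; split=> [n||]; first by have [] := hPhi n.
- apply: (L2norm_cvg0_nrm sP _ cr) => n; apply: le_trans (dr n).
  apply: le_nrm_sup; [exact: nrm_ge0|exact: sP|].
  move=> y yI; have := yI; rewrite in_itv/= => /andP[y0 y1].
  apply: le_trans (Rintegral_le_nrm (ltW y1) (sD n)).
  have [tP _] := hPhi n; have [smP _] := (test_functionP 0 1 (Phi n)).1 tP.
  have tP' := test_derive1 tP.
  rewrite RintegralB//.
  + rewrite -(Sh_primitive ps hW) ?in_itv/= ?(ltW y0) ?(ltW y1)//.
    rewrite Rintegral_smooth_derive1// (test_out tP (y := 0)) ?subr0//.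
    by rewrite in_itv/= ltxx.
  + by apply: (@summable_sub_itv _ 0 1) => //; [exact: ltW|exact: summable_test].
  + by apply: (@summable_sub_itv _ 0 1) => //; [exact: ltW|exact: sq_int_summable].
- exact: L2norm_cvg0_nrm sD dr cr.
Qed.

Lemma chain_by_parts k s m C X : itv_partition 0 1 s -> Sh s k X ->
  antiderivative_chain 0 1 m C ->
  ip `]0, 1[ (C 1%N) X = - ip `]0, 1[ (C 0%N) (derive1 X).
Proof.
move=> ps hX [sC hC]; have sX := Sh_sq_int ps hX; have sdX := Sh_derive1_sq_int ps hX.
have sC1 := sC 1%N isT; have sC0 := sC 0%N isT.
transitivity (\int[mu]_(y in `]0, 1[) ((\int[mu]_(x in `]0, y[) derive1 X x) * C 1%N y)).
  apply: eq_Rintegral => y /set_mem/=; rewrite in_itv/= => /andP[y0 y1].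
  by rewrite -(Sh_primitive ps hX) ?in_itv/= ?ltW// mulrC.
rewrite (Rintegral_triangle (sq_int_summable sdX) (sq_int_summable sC1)).
transitivity (\int[mu]_(x in `]0, 1[) (C 0%N 1 * derive1 X x - C 0%N x * derive1 X x)).
  apply: eq_Rintegral => y /set_mem/=; rewrite in_itv/= => /andP[y0 y1].
  by rewrite (hC 0%N isT y 1)// ?ltW//; ring.
have sdX1 := sq_int_summable sdX.
rewrite RintegralB//; [|exact: summableZ|exact: summableM].
rewrite RintegralZl// [X in _ * X - _](_ : _ = 0) ?mulr0 ?sub0r//.
have [_ _ X1 _] := hX.
by rewrite -(Sh_primitive ps hX) ?in_itv/= ?lexx ?ler01.
Qed.

End Test_approximation.

(** * Measurability and summability in space-time *)

Section Space_time_measurability.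
Context {R : realType}.
Local Notation mu := (@lebesgue_measure R).
Local Notation mR := (measurableTypeR R).
Variables (T : R) (T0 : 0 < T).
Local Notation D := (`]0, T[%classic : set mR).
Local Notation O := (`]0, 1[%classic : set mR).

Let mitv a b : measurable (`]a, b[%classic : set mR).
Proof. exact: measurable_itv. Qed.

(** The dominating function is the norm itself, summable because its square is summable on a bounded
    interval. *)
Lemma L2_valued_of_square (z : R -> R -> R) :
  measurable_fun (cylinder T) (fun q => z q.1 q.2) ->
  (\int[mu]_(t in D) \int[mu]_(y in O) ((z t y) ^+ 2)%:E < +oo)%E ->
  exists2 K, summable_on `]0, T[ K & L2_valued T K z.
Proof.
move=> mz fin; pose z2 t y := z t y ^+ 2.
have mz' : measurable_fun (D `*` O : set (mR * mR)) (fun q => z q.1 q.2) by [].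
have mz2 : measurable_fun (D `*` O : set (mR * mR)) (fun q => z2 q.1 q.2).
  exact: measurable_funX.
have fin2 : (\int[mu]_(t in D) \int[mu]_(y in O) `|z2 t y|%:E < +oo)%E.
  by under eq_integral do under eq_integral do rewrite ger0_norm ?sqr_ge0//.
have as2 := ae_summable_slice (mitv _ _) (mitv _ _) mz2 fin2.
have s2 := summable_Rintegral (mitv _ _) (mitv _ _) mz2 fin2.
exists (fun t => nrm `]0, 1[ (z t)).
  apply: sq_int_summable; split.
    apply: (measurableT_comp (continuous_measurable_fun (@sqrt_continuous R))).
    apply: (eq_measurable_fun (fun t => \int[mu]_(y in O) z2 t y)); last exact: summable_meas s2.
    by move=> t _; apply: eq_Rintegral => y _.
  apply: eq_summable s2 => // t _; rewrite nrm2.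
  by apply: eq_Rintegral => y _.
split=> //; apply: aeS as2 => t h tT; split=> //; split; last exact: h.
exact: (measurable_slice1 (mitv _ _) (mitv _ _) mz' (x := t) tT).
Qed.

Lemma LpL2_L2_valued (z : R -> R -> R) : LpL2 T (cst 0) (cst 1) 2%:E z ->
  exists2 K, summable_on `]0, T[ K & L2_valued T K z.
Proof.
move=> [mz fin].
have mz' : measurable_fun (cylinder T) (fun q => z q.1 q.2).
  rewrite (_ : cylinder T = [set q : R * R | (q.1 \in `]0, T[) && (q.2 \in `](cst 0 q.1 : R), cst 1 q.1[)])//.
  by apply/seteqP; split=> [q [a b]|q /andP[a b]] /=; [apply/andP|].
apply: L2_valued_of_square => //.
have : ('N[mu]_2%:E [(fun t => L2norm 0%R 1%R (z t)) \_ `]0%R, T[] `^ 2 < +oo)%E.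
  exact: poweR_lty.
rewrite poweR_Lnorm ?pnatr_eq0//; congr (_ < _)%E.
rewrite [RHS]integral_mkcond; apply: eq_integral => t _ /=.
rewrite !patchE; case: ifPn => _; last by rewrite abse0 poweR0r ?pnatr_eq0.
rewrite gee0_abs ?Lnorm_ge0// poweR_Lnorm ?pnatr_eq0//.
rewrite [RHS]integral_mkcond; apply: eq_integral => y _ /=.
rewrite !patchE; case: ifPn => _; rewrite /= ?normr0 ?powR0// ?pnatr_eq0//.
by rewrite powR_mulrn// real_normK ?num_real.
Qed.

(** The domain is cut out by the positivity of the two measurable functions [q.2 - a q.1] and
    [b q.1 - q.2]. *)
Lemma measurable_moving_domain (a b : R -> R) : measurable_fun D a -> measurable_fun D b ->
  measurable ([set q : mR * mR | (q.1 \in `]0, T[) && (q.2 \in `]a q.1, b q.1[)]).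
Proof.
move=> ma mb.
have mS : measurable (D `*` setT : set (mR * mR)) by exact: measurableX.
have mf (f : R -> R) : measurable_fun D f ->
    measurable_fun (D `*` setT : set (mR * mR)) (fun q => f q.1).
  move=> mf; apply: (@measurable_comp _ _ _ _ _ _ D f) => //.
  - by move=> _ [q [q1 _] <-].
  - by apply: measurable_funTS; exact: measurable_fst.
have m2 : measurable_fun (D `*` setT : set (mR * mR)) (fun q => q.2 : R).
  by apply: measurable_funTS; exact: measurable_snd.
have ma' : measurable ((D `*` setT : set (mR * mR)) `&` (fun q => q.2 - a q.1) @^-1` `]0, +oo[).
  by apply: (measurable_funB m2 (mf _ ma)) => //; exact: measurable_itv.
have mb' : measurable ((D `*` setT : set (mR * mR)) `&` (fun q => b q.1 - q.2) @^-1` `]0, +oo[).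
  by apply: (measurable_funB (mf _ mb) m2) => //; exact: measurable_itv.
have := measurableI _ _ ma' mb'; congr measurable.
apply/seteqP; split=> q /=.
  rewrite !in_itv/= !andbT !subr_gt0 => -[[[q1 _] qa] [_ qb]].
  by apply/andP; split => //; rewrite qa.
rewrite !in_itv/= !andbT !subr_gt0 => /andP[q1 /andP[qa qb]].
by split; split=> //; split.
Qed.

Lemma measurable_moving_source (a b : R -> R) (f : R -> R -> R) :
  measurable_fun D a -> measurable_fun D b ->
  (forall t, t \in `]0, T[ -> a t < b t) ->
  measurable_fun [set q : R * R | (q.1 \in `]0, T[) && (q.2 \in `]a q.1, b q.1[)]
    (fun q => f q.1 q.2) ->
  measurable_fun (D `*` O : set (mR * mR))
    (fun q => f q.1 (a q.1 + (b q.1 - a q.1) * q.2)).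
Proof.
move=> ma mb ab mf.
pose X q : mR * mR := (q.1, a q.1 + (b q.1 - a q.1) * q.2).
apply: (@measurable_comp _ _ _ _ _ _
  [set q : mR * mR | (q.1 \in `]0, T[) && (q.2 \in `]a q.1, b q.1[)]
  (fun q => f q.1 q.2) _ X) => //.
- exact: measurable_moving_domain.
- move=> _ [q [q1 q2] <-]; rewrite /X /= q1/= !in_itv/=.
  have := ab _ q1; move: q2; rewrite /= in_itv/= => /andP[y0 y1] abt.
  by apply/andP; split; nra.
(* Extended by zero, [a] and [b] give a change of variables that is measurable on the whole
   plane. *)
- pose aD := a \_ D; pose bD := b \_ D.
  have maD : measurable_fun [set: mR] aD := (measurable_restrictT a (mitv _ _)).1 ma.
  have mbD : measurable_fun [set: mR] bD := (measurable_restrictT b (mitv _ _)).1 mb.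
  pose Y q : mR * mR := (q.1, aD q.1 + (bD q.1 - aD q.1) * q.2).
  apply: (eq_measurable_fun Y); last first.
    apply: measurable_funTS; apply: measurable_fun_pair; first exact: measurable_fst.
    have m1 (c : R -> R) : measurable_fun [set: mR] c ->
        measurable_fun [set: mR * mR] (fun q => c q.1).
      by move=> mc; apply: measurableT_comp => //; exact: measurable_fst.
    apply: measurable_funD; first exact: m1.
    apply: measurable_funM; last exact: measurable_snd.
    by apply: measurable_funB; exact: m1.
  by move=> q /set_mem[q1 _]; rewrite /X /Y /aD /bD !patchE mem_set.
Qed.

End Space_time_measurability.

(** * Integration by parts with an affine weight *)

Section Affine_by_parts.
Context {R : realType}.
Local Notation mu := (@lebesgue_measure R).
Local Notation mR := (measurableTypeR R).

Let mitv a b : measurable (`]a, b[%classic : set mR).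
Proof. exact: measurable_itv. Qed.

Lemma cpw_Sh (s : seq R) k (W : R -> R) : cpw k.+1 0 s W -> cont_on 0 1 W ->
  W 0 = 0 -> W 1 = 0 -> Sh s k W.
Proof. by move=> cW ctW W0 W1; split=> // j js; have := cW j js. Qed.

Lemma cont_on_affine (a b c d : R) : cont_on a b (fun y => c + d * y).
Proof.
apply: cont_onD; first exact: cont_on_cst.
apply: cont_onZ; apply: (lipschitz_cont_on (K := 1)) => s r _ _.
by rewrite mul1r.
Qed.

(** The product leaves S_h^k but stays in a space of the same kind and of higher degree, to which
    [chain_by_parts] applies. *)
Lemma Sh_affineM (s : seq R) k (c d : R) (W : R -> R) : itv_partition 0 1 s -> Sh s k W ->
  Sh s k.+2 (fun y => (c + d * y) * W y) /\
  {ae mu, forall y, y \in `]0, 1[ ->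
    derive1 (fun y => (c + d * y) * W y) y = d * W y + (c + d * y) * derive1 W y}.
Proof.
move=> ps hW; have [cW W0 W1 _] := hW; split.
  apply: cpw_Sh; last by rewrite W1 mulr0.
  - exact: (cpwM (@cpw_affine _ 0 s c d) (Sh_cpw hW)).
  - by apply: cont_onM => //; exact: cont_on_affine.
  - by rewrite W0 mulr0.
apply: aeS (pw_derivable_ae ps (cpw_pw (Sh_cpw hW))) => y h y01.
have d2 := derivable_is_derive1 (h y01).
have d0 : is_derive y 1 (fun y => c + d * y) d.
  by have := is_derive_affine d c y; congr is_derive; apply/funext => z; rewrite addrC.
have dX : is_derive y 1 (fun y => (c + d * y) * W y) (d * W y + (c + d * y) * derive1 W y).
  apply: is_derive_congr (is_deriveM d0 d2) => [//|].
  by rewrite /GRing.scale/=; ring.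
exact: derive1_unique dX.
Qed.

Lemma affine_sq_int (c d : R) u : sq_int `]0, 1[ u -> sq_int `]0, 1[ (fun y => (c + d * y) * u y).
Proof.
move=> su; have cA : cont_on 0 1 (fun y => c + d * y) by exact: cont_on_affine.
have [K _ hK] := cont_on_bounded ler01 cA.
apply: (sq_intM_bounded (mitv 0 1) (K := K)) su; first exact: cont_on_measurable.
by move=> y yI; apply: hK; move: yI => /=; rewrite !in_itv/= => /andP[? ?]; rewrite !ltW.
Qed.

Lemma chain_affine_by_parts m (s : seq R) k (c d : R) W u du C : itv_partition 0 1 s ->
  Sh s k W -> antiderivative_chain 0 1 m C -> sq_int `]0, 1[ u -> sq_int `]0, 1[ du ->
  {ae mu, forall y, y \in `]0, 1[ -> u y = C 0%N y} ->
  {ae mu, forall y, y \in `]0, 1[ -> du y = C 1%N y} ->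
  ip `]0, 1[ (fun y => (c + d * y) * du y) W =
  - ip `]0, 1[ u (fun y => d * W y + (c + d * y) * derive1 W y).
Proof.
move=> ps hW cC su sdu uC duC; have [hX dX] := Sh_affineM c d ps hW.
have sW := Sh_sq_int ps hW; have sdW := Sh_derive1_sq_int ps hW.
have sX := Sh_sq_int ps hX; have sdX := Sh_derive1_sq_int ps hX.
have sr : sq_int `]0, 1[ (fun y => d * W y + (c + d * y) * derive1 W y).
  by apply: sq_intD => //; [exact: sq_intZ|exact: affine_sq_int].
transitivity (ip `]0, 1[ (C 1%N) (fun y => (c + d * y) * W y)).
  rewrite -(ae_eq_ip (mitv _ _) sdu.1 (cC.1 1%N isT).1 sX.1 duC).
  by apply: eq_Rintegral => y _; rewrite mulrCA mulrA.
rewrite (chain_by_parts ps hX cC) -(ae_eq_ip (mitv _ _) su.1 (cC.1 0%N isT).1 sdX.1 uC).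
by rewrite [in LHS]ipC [in RHS]ipC (ae_eq_ip (mitv _ _) sdX.1 sr.1 su.1 dX).
Qed.

Lemma ae_summable (D : set mR) f g : measurable D -> measurable_fun D g ->
  {ae mu, forall x, D x -> f x = g x} -> summable_on D f -> summable_on D g.
Proof.
move=> mD mg fg sf; apply/integrableP; split; first exact/measurable_EFinP.
have /integrableP[_] := sf; apply: le_lt_trans.
apply: ae_ge0_le_integral => //=.
- by apply/measurable_EFinP; apply: measurableT_comp.
- by apply/measurable_EFinP; apply: measurableT_comp => //; exact: (summable_meas sf).
- by apply: aeS fg => y h Oy; rewrite -h.
Qed.

End Affine_by_parts.

(** * From an equation in distributions to an equation at every time *)

Section Weak_equation.
Context {R : realType}.
Local Notation mu := (@lebesgue_measure R).
Local Notation mR := (measurableTypeR R).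
Variables (T : R) (T0 : 0 < T).
Local Notation D := (`]0, T[%classic : set mR).
Local Notation O := (`]0, 1[%classic : set mR).

Let mitv a b : measurable (`]a, b[%classic : set mR).
Proof. exact: measurable_itv. Qed.

Lemma neg1_inj (x y z : R) : z = (-1) ^+ 1 * x -> z = (-1) ^+ 1 * y -> x = y.
Proof. by rewrite expr1 !mulN1r => -> /oppr_inj. Qed.

(** Convection is moved onto [W], so that it involves [v], which is continuous in time, and not its
    derivative in space. Every term then has a continuous representative; the fundamental lemma
    gives equality almost everywhere, and continuity gives it at all times. *)
Lemma weak_equation (M : R) m (v vt vws vy g gc : R -> R -> R) (a c d A B W : R -> R)
    (s : seq R) k :
  0 <= M -> itv_partition 0 1 s -> Sh s k W ->
  C0L2 T v -> LooHm_norm_le T m.+1 v M -> L2_valued T (fun=> M) vt -> time_deriv T 1 v vt ->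
  LpL2 T (cst 0) (cst 1) 2%:E vws -> time_deriv T 1 v vws ->
  measurable_fun (cylinder T) (fun q => vy q.1 q.2) ->
  {ae mu, forall t, t \in `]0, T[ -> weak_deriv 0 1 1 (v t) (vy t)} ->
  measurable_fun (cylinder T) (fun q => g q.1 q.2) -> C0L2 T gc ->
  {ae mu, forall t, t \in `]0, T[ -> {ae mu, forall y, y \in `]0, 1[ -> gc t y = g t y}} ->
  cont_on 0 T a -> cont_on 0 T c -> cont_on 0 T d -> cont_on 0 T A -> cont_on 0 T B ->
  {ae mu, forall t, t \in `]0, T[ -> ip `]0, 1[ (vt t) W = A t} ->
  {ae mu, forall t, t \in `]0, T[ -> ip `]0, 1[ (vy t) (derive1 W) = B t} ->
  (forall phi, test_function 0 T phi ->
    \int[mu]_(t in `]0, T[) ((ip `]0, 1[ (vws t) W + a t * ip `]0, 1[ (vy t) (derive1 W)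
      - ip `]0, 1[ (fun y => (c t + d t * y) * vy t y) W) * phi t) =
    \int[mu]_(t in `]0, T[) (ip `]0, 1[ (g t) W * phi t)) ->
  forall t, t \in `[0, T] ->
    A t + a t * B t + ip `]0, 1[ (v t) (fun y => d t * W y + (c t + d t * y) * derive1 W y) =
    ip `]0, 1[ (gc t) W.
Proof.
move=> M0 ps hW vC hv vtL td1 hvws tdws mvy wvy mg gcC gcg ca cc cd cA cB eA eB eq.
have sW := Sh_sq_int ps hW; have sdW := Sh_derive1_sq_int ps hW.
have sM : summable_on `]0, T[ (fun=> M) by exact: summable_cst.
have [K sK vwsL] := LpL2_L2_valued hvws.
have [vL [Dv [DvL aDv]]] := LooHm_derivs M0 hv.
have sy1 : sq_int `]0, 1[ (fun y => (0 + 1 * y) * derive1 W y) by exact: affine_sq_int.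
pose X t := ip `]0, 1[ (v t) (fun y => d t * W y + (c t + d t * y) * derive1 W y).
(* The weight depends on time only through the scalars [c t] and [d t], which leaves inner products
   of [v t] with three fixed functions. *)
have XE t : t \in `[0, T] -> X t = d t * ip `]0, 1[ (v t) W +
    (c t * ip `]0, 1[ (v t) (derive1 W) +
     d t * ip `]0, 1[ (v t) (fun y => (0 + 1 * y) * derive1 W y)).
  move=> tT; have sv := C0L2_sq_int vC tT.
  rewrite /X -!ipZr// -!ipDr//; try exact: sq_intZ; last by apply: sq_intD => //; exact: sq_intZ.
  by apply: eq_ip => // y _; ring.
have cX : cont_on 0 T (fun t => d t * ip `]0, 1[ (v t) W +
    (c t * ip `]0, 1[ (v t) (derive1 W) +
     d t * ip `]0, 1[ (v t) (fun y => (0 + 1 * y) * derive1 W y))).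
  have c1 := C0L2_cont_on vC sW; have c2 := C0L2_cont_on vC sdW.
  have c3 := C0L2_cont_on vC sy1.
  exact: (cont_onD (cont_onM cd c1) (cont_onD (cont_onM cc c2) (cont_onM cd c3))).
set X' := (X in cont_on _ _ X) in cX.
have subT t : t \in `]0, T[ -> t \in `[0, T].
  by rewrite !in_itv/= => /andP[? ?]; rewrite !ltW.
have eX : {ae mu, forall t, t \in `]0, T[ ->
    - ip `]0, 1[ (fun y => (c t + d t * y) * vy t y) W = X' t}.
  apply: aeS2 aDv wvy => t h1 h2 tT; rewrite -[X' t]XE ?subT//.
  have [C [cC eC uC _]] := Hm_derivs_chain M0 (h1 tT).
  have [sv sdv] := weak_deriv_sq_int (h2 tT).
  have uy : {ae mu, forall y, y \in `]0, 1[ -> vy t y = C 1%N y}.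
    have := weak_deriv_unique ltr01 (h2 tT) ((h1 tT).1 1%N isT).
    by apply: aeS2 (eC 1%N isT) => y e1 e2 yI; rewrite e2// e1.
  by rewrite (chain_affine_by_parts (c t) (d t) ps hW cC sv sdv uC uy) opprK.
pose Q t := a t * ip `]0, 1[ (vy t) (derive1 W)
      - ip `]0, 1[ (fun y => (c t + d t * y) * vy t y) W.
pose Q' t := a t * B t + X' t.
have eQ : {ae mu, forall t, t \in `]0, T[ -> Q t = Q' t}.
  by apply: aeS2 eB eX => t h1 h2 tT; rewrite /Q h1// h2.
have cQ' : cont_on 0 T Q' by apply: cont_onD => //; exact: cont_onM.
have mm f : cont_on 0 T f -> measurable_fun D f by exact: cont_on_measurable.
have mvy' : measurable_fun (D `*` O : set (mR * mR)) (fun q => vy q.1 q.2) by [].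
have mQ : measurable_fun D Q.
  apply: measurable_funB.
    apply: measurable_funM; first exact: mm.
    apply: (measurable_Rintegral_slice (mitv _ _) (mitv _ _)
      (h := fun t y => vy t y * derive1 W y)).
    by apply: measurable_funM => //; exact: (measurable_space sdW.1).
  apply: (measurable_Rintegral_slice (mitv _ _) (mitv _ _)
      (h := fun t y => (c t + d t * y) * vy t y * W y)).
  apply: measurable_funM; last exact: (measurable_space sW.1).
  apply: measurable_funM => //; apply: measurable_funD; first exact: (measurable_time (mm _ cc)).
  apply: measurable_funM; first exact: (measurable_time (mm _ cd)).
  exact: (measurable_space (@measurable_id _ _ _)).
have sQ' := cont_on_summable (ltW T0) cQ'.
have sQ : summable_on `]0, T[ Q.
  apply: (ae_summable (mitv _ _) mQ _ sQ').
  by apply: aeS eQ => t h tT; rewrite h.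
have cG := C0L2_cont_on gcC sW.
pose Z t := A t + Q' t - ip `]0, 1[ (gc t) W.
have cZ : cont_on 0 T Z by apply: cont_onB => //; exact: cont_onD.
suff Z0 : forall t, t \in `[0, T] -> Z t = 0.
  move=> t tT; have /eqP := Z0 t tT; rewrite subr_eq0 => /eqP <-.
  by rewrite -addrA; congr (_ + (_ + _)); rewrite -/(X t) XE.
apply: (@ae_eq_cont_on _ 0 T Z (fun=> 0)) => //; first exact: cont_on_cst.
apply: (ae_eq0_test T0 (cont_on_summable (ltW T0) cZ)) => phi tphi.
have sws : summable_on `]0, T[ (fun t => ip `]0, 1[ (vws t) W) by exact: (summable_ip sK vwsL sW).
have svt : summable_on `]0, T[ (fun t => ip `]0, 1[ (vt t) W) by exact: (summable_ip sM vtL sW).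
(* [vws] comes from the definition of a solution and [vt] from the regularity assumption; as
   derivatives of the same [v] they have the same tested moments. *)
have E1 : \int[mu]_(t in `]0, T[) (ip `]0, 1[ (vws t) W * phi t) =
    \int[mu]_(t in `]0, T[) (A t * phi t).
  transitivity (\int[mu]_(t in `]0, T[) (ip `]0, 1[ (vt t) W * phi t)).
    exact: (neg1_inj (time_deriv_ip sM sK vL vwsL tdws tphi sW)
      (time_deriv_ip sM sM vL vtL td1 tphi sW)).
  apply: ae_eq_Rintegral => //.
  - exact: summable_meas (summableM_test svt tphi).
  - exact: summable_meas (summableM_test (cont_on_summable (ltW T0) cA) tphi).
  - by apply: aeS eA => t h tT; rewrite h.
have E2 : \int[mu]_(t in `]0, T[) (Q t * phi t) = \int[mu]_(t in `]0, T[) (Q' t * phi t).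
  apply: ae_eq_Rintegral => //.
  - exact: summable_meas (summableM_test sQ tphi).
  - exact: summable_meas (summableM_test sQ' tphi).
  - by apply: aeS eQ => t h tT; rewrite h.
have mg' : measurable_fun (D `*` O : set (mR * mR)) (fun q => g q.1 q.2) by [].
have mgW : measurable_fun D (fun t => ip `]0, 1[ (g t) W).
  apply: (measurable_Rintegral_slice (mitv _ _) (mitv _ _) (h := fun t y => g t y * W y)).
  by apply: measurable_funM => //; exact: (measurable_space sW.1).
have mphi : measurable_fun D phi.
  by have /test_functionP[/measurable_smooth] := tphi.
have sG := cont_on_summable (ltW T0) cG.
have E3 : \int[mu]_(t in `]0, T[) (ip `]0, 1[ (g t) W * phi t) =
    \int[mu]_(t in `]0, T[) (ip `]0, 1[ (gc t) W * phi t).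
  apply: ae_eq_Rintegral => //.
  - exact: measurable_funM.
  - exact: summable_meas (summableM_test sG tphi).
  - apply: aeS gcg => t h tT; congr (_ * _).
    have sgc := C0L2_sq_int gcC (subT _ tT).
    have mgt : measurable_fun O (g t).
      exact: (measurable_slice1 (mitv _ _) (mitv _ _) mg' (x := t) tT).
    apply: (ae_eq_ip (mitv _ _) mgt sgc.1 sW.1).
    by apply: aeS (h tT) => y e yI; rewrite e.
have := eq phi tphi; rewrite E3.
rewrite (_ : \int[mu]_(t in `]0, T[) _ = \int[mu]_(t in `]0, T[) (ip `]0, 1[ (vws t) W * phi t)
   + \int[mu]_(t in `]0, T[) (Q t * phi t)); last first.
  rewrite -(RintegralD (mitv _ _) (summableM_test sws tphi) (summableM_test sQ tphi)).
  by apply: eq_Rintegral => t _; rewrite /Q -addrA mulrDl.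
rewrite E1 E2 => E.
have sA := cont_on_summable (ltW T0) cA.
transitivity (\int[mu]_(t in `]0, T[) (A t * phi t + Q' t * phi t - ip `]0, 1[ (gc t) W * phi t)).
  by apply: eq_Rintegral => t _; rewrite /Z !mulrDl mulNr.
have sp := summableM_test sA tphi; have sq := summableM_test sQ' tphi.
have sr := summableM_test sG tphi.
rewrite (RintegralB (mitv _ _) (summableD (mitv _ _) sp sq) sr).
by rewrite (RintegralD (mitv _ _) sp sq) E subrr.
Qed.

End Weak_equation.

(** * The energy estimate *)

Section Energy_step.
Context {R : realType}.
Local Notation mu := (@lebesgue_measure R).
Local Notation mR := (measurableTypeR R).
Local Notation ip := (ip (`]0, 1[%classic : set mR)).
Local Notation nrm := (nrm (`]0, 1[%classic : set mR)).
Local Notation sq_int := (sq_int (`]0, 1[%classic : set mR)).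

Let mitv a b : measurable (`]a, b[%classic : set mR).
Proof. exact: measurable_itv. Qed.

Lemma ip_derive1_linear (s : seq R) k (a b : R) U U' q : itv_partition 0 1 s ->
  Sh s k U -> Sh s k U' -> sq_int q ->
  ip (derive1 (fun y => a * U y + b * U' y)) q =
  a * ip (derive1 U) q + b * ip (derive1 U') q.
Proof.
move=> ps hU hU' sq.
have sU := Sh_derive1_sq_int ps hU; have sU' := Sh_derive1_sq_int ps hU'.
have sUU := Sh_derive1_sq_int ps (ShD (ShZ a hU) (ShZ b hU')).
have saU := sq_intZ (mitv 0 1) a sU; have sbU := sq_intZ (mitv 0 1) b sU'.
rewrite (ae_eq_ip (mitv _ _) sUU.1 (sq_intD (mitv _ _) saU sbU).1 sq.1
  (derive1_linear_ae a b ps hU hU')).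
by rewrite ipDl// !ipZl.
Qed.

(* The derivative of [(c + d y) W], which appears when the convection term is
   integrated by parts. *)
Definition conv (c d : R) (W : R -> R) (y : R) : R := d * W y + (c + d * y) * derive1 W y.

Lemma conv_sq_int (s : seq R) k c d W : itv_partition 0 1 s -> Sh s k W -> sq_int (conv c d W).
Proof.
move=> ps hW; apply: sq_intD => //; first exact: sq_intZ (Sh_sq_int ps hW).
exact: affine_sq_int (Sh_derive1_sq_int ps hW).
Qed.

Lemma conv_nrm (s : seq R) k c d W : itv_partition 0 1 s -> Sh s k W ->
  nrm (conv c d W) <= (`|c| + 2 * `|d|) * nrm (derive1 W).
Proof.
move=> ps hW; have sW := Sh_sq_int ps hW; have sdW := Sh_derive1_sq_int ps hW.
have sA := affine_sq_int c d sdW.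
apply: (le_trans (nrmD (mitv _ _) (sq_intZ (mitv _ _) d sW) sA)).
rewrite nrmZ//.
have : nrm (fun y => (c + d * y) * derive1 W y) <= (`|c| + `|d|) * nrm (derive1 W).
  rewrite -[X in _ <= X * _]ger0_norm ?addr_ge0// -nrmZ//.
  rewrite /nrm ler_wsqrtr// le_ip//; first exact: sq_intZ.
  move=> y; rewrite in_itv/= => /andP[y0 y1]; rewrite !normrM ler_wpM2r//.
  rewrite [leRHS]ger0_norm ?addr_ge0// (le_trans (ler_normD _ _))// lerD2l normrM.
  by rewrite ler_piMr// ger0_norm ltW.
have := poincare ps hW; have := nrm_ge0 (`]0, 1[%classic : set mR) W.
have := normr_ge0 d; nra.
Qed.

Lemma combination_sub (x y : R) : 1 * x + (-1) * y = x - y.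
Proof. by rewrite mul1r mulN1r. Qed.

Lemma combination_sub2 (n h2 o h1 : R) :
  n - h2 - o + h1 = (1 * n + (-1) * h2) - (1 * o + (-1) * h1).
Proof. by ring. Qed.

Lemma half_sum (x y : R) : (x + y) / 2 = 2^-1 * x + 2^-1 * y.
Proof. by field. Qed.

Lemma half_diff (x y a b : R) : 2^-1 * (x - a) + 2^-1 * (y - b) = (x + y) / 2 - (b + a) / 2.
Proof. by field. Qed.

Lemma half_diff' (x y a b : R) : (x + y) / 2 - (a + b) / 2 = 2^-1 * (x - a) + 2^-1 * (y - b).
Proof. by field. Qed.

Lemma sqr_diff (x y z : R) :
  x - z = 2 * ((2^-1 * x + 2^-1 * y) - (2^-1 * y + 2^-1 * z)).
Proof. by field. Qed.

(** Young's inequality: [C0 * X * T1 - mu0 * T1 ^+ 2] is at most C0^2 X^2 / (4 mu0), for every value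
    of [T1]. *)
Lemma energy_arith (dl X T1 mu0 C0 Q : R) : 0 < dl -> 0 < mu0 ->
  Q <= 2 * dl * (C0 * X * T1 - mu0 * T1 ^+ 2) -> Q <= dl * (C0 ^+ 2 / (2 * mu0)) * X ^+ 2.
Proof.
move=> dl0 mu00 /le_trans; apply.
rewrite (_ : dl * _ * _ = 2 * dl * (C0 ^+ 2 * X ^+ 2 / (4 * mu0))); last by field; lra.
rewrite ler_pM2l; last by lra.
rewrite ler_pdivlMr; last by lra.
have := sqr_ge0 (C0 * X - 2 * mu0 * T1); nra.
Qed.

(** The algebra of [energy_step] on scalars. [n], [o], [h2], [h1], [p2], [p1] are the inner products
    with W of the new and old iterates, of the projections and of the solution at both times; a
    final [b] marks inner products with [conv c d W], and [pb] belongs to the midpoint. [dn], [do_],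
    [B2], [B1] are those of the derivatives with W'; [A] and [B] are the exact moments at the
    midpoint, [av] and [aV] the exact and the discrete coefficient. [T1] is the norm of W' and [W2]
    is <W,W>. *)
Lemma residual_arith (dl n o h2 h1 p2 p1 nb ob h2b h1b p2b p1b pb dn do_ B1 B2 B A av aV b2
    T1 W2 d eps eta Cb Mb be Ma mu0 : R) : 0 < dl -> 0 <= T1 -> 0 <= eps -> 0 <= eta ->
  0 <= Cb -> 0 <= d -> 0 <= W2 -> 0 <= b2 -> b2 <= be -> 0 <= aV -> aV <= Ma ->
  mu0 <= aV * b2 -> 0 <= Mb ->
  (n - o) / dl + aV * b2 * ((dn + do_) / 2) + (nb + ob) / 2 = A + av * b2 * B + pb ->
  T1 ^+ 2 = (dn + do_) / 2 - (B1 + B2) / 2 ->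
  (nb + ob) / 2 - (h2b + h1b) / 2 = d / 2 * W2 ->
  `|(p2 - h2) - (p1 - h1)| <= dl * eta * T1 ->
  `|p2b - h2b| <= eta * (Cb * T1) -> `|p1b - h1b| <= eta * (Cb * T1) ->
  `|A - (p2 - p1) / dl| <= eps * T1 -> `|B - (B2 + B1) / 2| <= eps * T1 ->
  `|pb - (p2b + p1b) / 2| <= eps * (Cb * T1) -> `|B| <= Mb * T1 ->
  2 * (n - h2 - o + h1) <=
    2 * dl * ((1 + be + Ma * be + Cb) * (eps + eta + Mb * `|av - aV|) * T1 - mu0 * T1 ^+ 2).
Proof.
move=> dl0 T10 e0 eta0 Cb0 d0 W20 b20 b2be aV0 aVMa mub Mb0 E N2 Db r1 r2 r3 r4 r5 r6 r7.
have -> : 2 * (n - h2 - o + h1) = 2 * dl * ((n - o) / dl - (h2 - h1) / dl) by field; lra.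
rewrite ler_pM2l; last by lra.
(* Residuals in this order: truncation of the difference quotient, projection error of the time
   derivative, error of the coefficient, truncation of diffusion, the dissipative diffusion term,
   truncation of convection, projection error of convection, the dissipative convection term. *)
have -> : (n - o) / dl - (h2 - h1) / dl =
  (A - (p2 - p1) / dl) + ((p2 - h2) - (p1 - h1)) / dl + (av - aV) * b2 * B
  + aV * b2 * (B - (B2 + B1) / 2) - aV * b2 * T1 ^+ 2 + (pb - (p2b + p1b) / 2)
  + 2^-1 * ((p1b - h1b) + (p2b - h2b)) - d / 2 * W2.
  have -> : (n - o) / dl = A + av * b2 * B + pb - aV * b2 * ((dn + do_) / 2) - (nb + ob) / 2.
    by rewrite -E; ring.
  by rewrite N2 -Db; field; lra.
have s1 := le_trans (ler_norm _) r4.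
have s2 : ((p2 - h2) - (p1 - h1)) / dl <= eta * T1.
  rewrite ler_pdivrMr// (le_trans (le_trans (ler_norm _) r1))//; lra.
have s3 : (av - aV) * b2 * B <= be * (Mb * `|av - aV|) * T1.
  rewrite (le_trans (ler_norm _))// !normrM (ger0_norm b20).
  have := normr_ge0 (av - aV); have := normr_ge0 B.
  set x := `|av - aV|; set z := `|B| => z0 x0.
  have h1' : x * b2 <= x * be by rewrite ler_wpM2l.
  have h2' : x * b2 * z <= x * be * (Mb * T1).
    by rewrite ler_pM// mulr_ge0.
  by apply: (le_trans h2'); rewrite le_eqVlt; apply/orP; left; apply/eqP; ring.
have s4 : aV * b2 * (B - (B2 + B1) / 2) <= Ma * be * (eps * T1).
  rewrite (le_trans (ler_norm _))// normrM ger0_norm ?mulr_ge0// ler_pM ?mulr_ge0//.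
  by rewrite ler_pM.
have s5 : mu0 * T1 ^+ 2 <= aV * b2 * T1 ^+ 2 by rewrite ler_wpM2r ?sqr_ge0.
have s6 := le_trans (ler_norm _) r6.
have s7 := le_trans (ler_norm _) r2; have s8 := le_trans (ler_norm _) r3.
have s9 : 0 <= d / 2 * W2 by rewrite mulr_ge0// divr_ge0.
have x0 : 0 <= Mb * `|av - aV| by rewrite mulr_ge0.
have be0 := le_trans b20 b2be; have Ma0 := le_trans aV0 aVMa.
set X := Mb * `|av - aV| in s3 x0 *.
have t1 : 0 <= be * eps * T1 by rewrite !mulr_ge0.
have t2 : 0 <= be * eta * T1 by rewrite !mulr_ge0.
have t3 : 0 <= Ma * be * eta * T1 by rewrite !mulr_ge0.
have t4 : 0 <= Ma * be * X * T1 by rewrite !mulr_ge0.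
have t5 : 0 <= Cb * X * T1 by rewrite !mulr_ge0.
have t6 : 0 <= X * T1 by rewrite !mulr_ge0.
have -> : (1 + be + Ma * be + Cb) * (eps + eta + X) * T1 = eps * T1 + eta * T1 + X * T1 +
  be * eps * T1 + be * eta * T1 + be * X * T1 + Ma * be * (eps * T1) + Ma * be * eta * T1 +
  Ma * be * X * T1 + eps * (Cb * T1) + eta * (Cb * T1) + Cb * X * T1 by ring.
lra.
Qed.

(** Stated for one abstract step, so that predictor, corrector and later steps are instances which
    differ only in the coefficient [aV]. [eps] measures truncation in time, [eta] the projection
    error. *)
Lemma energy_step (s : seq R) k (Vo Vn vh1 vh2 v1 v2 vm gm : R -> R)
    (dl av aV b2 c d eps eta Cb Mb be Ma mu0 : R) :
  itv_partition 0 1 s -> Sh s k Vo -> Sh s k Vn -> Sh s k vh1 -> Sh s k vh2 ->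
  sq_int v1 -> sq_int v2 -> sq_int vm ->
  0 < dl -> 0 <= eps -> 0 <= eta -> `|c| + 2 * `|d| <= Cb -> 0 <= d ->
  0 <= b2 <= be -> 0 <= aV <= Ma -> 0 < mu0 <= aV * b2 -> 0 <= Mb ->
  (forall W, Sh s k W ->
    ip (fun y => (Vn y - Vo y) / dl) W
    + aV * b2 * ip (derive1 (fun y => (Vn y + Vo y) / 2)) (derive1 W)
    - ip (fun y => (c + d * y) * derive1 (fun y => (Vn y + Vo y) / 2) y) W = ip gm W) ->
  (forall W, Sh s k W -> exists A B,
    [/\ A + av * b2 * B + ip vm (conv c d W) = ip gm W,
        `|A - (ip v2 W - ip v1 W) / dl| <= eps * nrm W,
        `|B - (ip (derive1 vh2) (derive1 W) + ip (derive1 vh1) (derive1 W)) / 2| <=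
          eps * nrm (derive1 W) &
        `|B| <= Mb * nrm (derive1 W)]) ->
  (forall w, sq_int w -> `|ip vm w - (ip v2 w + ip v1 w) / 2| <= eps * nrm w) ->
  nrm (fun y => v1 y - vh1 y) <= eta -> nrm (fun y => v2 y - vh2 y) <= eta ->
  nrm (fun y => (v2 y - vh2 y) - (v1 y - vh1 y)) <= dl * eta ->
  nrm (fun y => Vn y - vh2 y) ^+ 2 <= nrm (fun y => Vo y - vh1 y) ^+ 2 +
    dl * ((1 + be + Ma * be + Cb) ^+ 2 / (2 * mu0)) * (eps + eta + Mb * `|av - aV|) ^+ 2.
Proof.
move=> ps hVo hVn hvh1 hvh2 s1 s2 sm dl0 eps0 eta0 Cbd d0 /andP[b20 b2be] /andP[aV0 aVMa]
  /andP[mu00 mub] Mb0 eqV pkg mid n1 n2 n12.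
pose tn y := 1 * Vn y + (-1) * vh2 y; pose to y := 1 * Vo y + (-1) * vh1 y.
have htn : Sh s k tn by apply: ShD; exact: ShZ.
have hto : Sh s k to by apply: ShD; exact: ShZ.
have stn := Sh_sq_int ps htn; have sto := Sh_sq_int ps hto.
pose W y := 2^-1 * tn y + 2^-1 * to y.
have hW : Sh s k W by apply: ShD; exact: ShZ.
have sW := Sh_sq_int ps hW; have sdW := Sh_derive1_sq_int ps hW.
have sVo := Sh_sq_int ps hVo; have sVn := Sh_sq_int ps hVn.
have sh1 := Sh_sq_int ps hvh1; have sh2 := Sh_sq_int ps hvh2.
have sb := conv_sq_int c d ps hW; set bW := conv c d W in sb.
pose Vh y := 2^-1 * Vn y + 2^-1 * Vo y.
have VhE : (fun y => (Vn y + Vo y) / 2) = Vh by apply/funext => y; rewrite /Vh; lra.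
have hVh : Sh s k Vh by apply: ShD; exact: ShZ.
have ipW q : sq_int q -> ip W q = 2^-1 * (ip Vn q - ip vh2 q) + 2^-1 * (ip Vo q - ip vh1 q).
  move=> sq; rewrite /W ipDl//; try exact: sq_intZ.
  rewrite !ipZl// /tn /to !ipDl//; try exact: sq_intZ.
  by rewrite !ipZl//; congr (_ * _ + _ * _); exact: combination_sub.
have ipdW : ip (derive1 W) (derive1 W) =
    2^-1 * (ip (derive1 Vn) (derive1 W) - ip (derive1 vh2) (derive1 W)) +
    2^-1 * (ip (derive1 Vo) (derive1 W) - ip (derive1 vh1) (derive1 W)).
  rewrite [LHS](ip_derive1_linear _ _ ps htn hto sdW).
  rewrite (ip_derive1_linear _ _ ps hVn hvh2 sdW) (ip_derive1_linear _ _ ps hVo hvh1 sdW).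
  by congr (_ * _ + _ * _); exact: combination_sub.
have [A [B [eA rA rB bB]]] := pkg W hW.
have E := eqV W hW; rewrite VhE in E.
(* All residuals are expressed by the norm of W', which is the quantity that diffusion controls. *)
have PW := poincare ps hW.
have T0 := nrm_ge0 (`]0, 1[%classic : set mR) (derive1 W).
have cW : nrm bW <= Cb * nrm (derive1 W).
  by apply: (le_trans (conv_nrm c d ps hW)); rewrite ler_wpM2r.
have Cb0 : 0 <= Cb by apply: le_trans Cbd; rewrite addr_ge0// mulr_ge0.
have n10 := nrm_ge0 (`]0, 1[%classic : set mR) bW.
have n20 := nrm_ge0 (`]0, 1[%classic : set mR) W.
have sB1 := sq_intB (mitv 0 1) s1 sh1; have sB2 := sq_intB (mitv 0 1) s2 sh2.
have r1 : `|(ip v2 W - ip vh2 W) - (ip v1 W - ip vh1 W)| <= dl * eta * nrm (derive1 W).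
  rewrite -!ipBl//; apply: (le_trans (CS (mitv _ _) (sq_intB (mitv _ _) sB2 sB1) sW)).
  by rewrite ler_pM// nrm_ge0.
have r2 : `|ip v2 bW - ip vh2 bW| <= eta * (Cb * nrm (derive1 W)).
  by rewrite -ipBl//; apply: (le_trans (CS (mitv _ _) sB2 sb)); rewrite ler_pM// nrm_ge0.
have r3 : `|ip v1 bW - ip vh1 bW| <= eta * (Cb * nrm (derive1 W)).
  by rewrite -ipBl//; apply: (le_trans (CS (mitv _ _) sB1 sb)); rewrite ler_pM// nrm_ge0.
have r4 : `|A - (ip v2 W - ip v1 W) / dl| <= eps * nrm (derive1 W).
  by apply: (le_trans rA); rewrite ler_wpM2l.
have r6 : `|ip vm bW - (ip v2 bW + ip v1 bW) / 2| <= eps * (Cb * nrm (derive1 W)).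
  by apply: (le_trans (mid _ sb)); rewrite ler_wpM2l.
have eV : (ip Vn W - ip Vo W) / dl + aV * b2 * ((ip (derive1 Vn) (derive1 W)
    + ip (derive1 Vo) (derive1 W)) / 2) + (ip Vn bW + ip Vo bW) / 2 =
    A + av * b2 * B + ip vm bW.
  rewrite eA -E.
  have -> : ip (fun y => (c + d * y) * derive1 Vh y) W = - ip Vh bW.
    exact: Sh_by_parts ps hVh hW.
  rewrite opprK (ip_derive1_linear _ _ ps hVn hVo sdW).
  have -> : ip Vh bW = 2^-1 * ip Vn bW + 2^-1 * ip Vo bW.
    by rewrite /Vh ipDl//; [rewrite !ipZl|exact: sq_intZ..].
  have -> : ip (fun y => (Vn y - Vo y) / dl) W = (ip Vn W - ip Vo W) / dl.
    rewrite -ipBl// [RHS]mulrC -ipZl//; last exact: sq_intB.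
    by apply: eq_ip => // y _; rewrite mulrC.
  by congr (_ + _ * _ + _); exact: half_sum.
(* Difference of squares: 2 <tn - to, (tn + to)/2>. *)
have Q : nrm (fun y => Vn y - vh2 y) ^+ 2 - nrm (fun y => Vo y - vh1 y) ^+ 2 =
    2 * (ip Vn W - ip vh2 W - ip Vo W + ip vh1 W).
  have -> : nrm (fun y => Vn y - vh2 y) = nrm tn.
    by apply: eq_nrm => y _; rewrite /tn; ring.
  have -> : nrm (fun y => Vo y - vh1 y) = nrm to.
    by apply: eq_nrm => y _; rewrite /to; ring.
  have tW t' : sq_int t' -> ip t' W = 2^-1 * ip t' tn + 2^-1 * ip t' to.
    by move=> st; rewrite /W ipDr//; [rewrite !ipZr|exact: sq_intZ..].
  have -> : ip Vn W - ip vh2 W - ip Vo W + ip vh1 W = ip tn W - ip to W.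
    rewrite /tn /to !ipDl//; try exact: sq_intZ.
    by rewrite !ipZl//; exact: combination_sub2.
  by rewrite !nrm2 !tW// [ip to tn]ipC; exact: sqr_diff.
rewrite -lerBlDl Q; apply: (@energy_arith _ _ (nrm (derive1 W)) _ _ _ dl0 mu00).
apply: (@residual_arith _ _ _ _ _ (ip v2 W) (ip v1 W) (ip Vn bW) (ip Vo bW) (ip vh2 bW)
  (ip vh1 bW) (ip v2 bW) (ip v1 bW) (ip vm bW) (ip (derive1 Vn) (derive1 W))
  (ip (derive1 Vo) (derive1 W)) (ip (derive1 vh1) (derive1 W)) (ip (derive1 vh2) (derive1 W))
  B A av aV b2 (nrm (derive1 W)) (ip W W) d eps eta Cb Mb be Ma mu0) => //.
- exact: ip_ge0.
- by rewrite nrm2 ipdW; exact: half_diff.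
- have -> : (ip Vn bW + ip Vo bW) / 2 - (ip vh2 bW + ip vh1 bW) / 2 = ip W bW.
    by rewrite ipW//; exact: half_diff'.
  have := Sh_convection_dissipative c d ps hW; rewrite (Sh_by_parts c d ps hW hW).
  by rewrite mulNr => /oppr_inj.
Qed.

End Energy_step.

Ltac nonneg := repeat first [assumption | exact: sqr_ge0 | exact: ler01 | exact: ler0n
  | exact: expR_ge0 | apply: addr_ge0 | apply: mulr_ge0 | apply: ltW; assumption].

(** * Discrete Gronwall inequality and accumulation of the errors *)

Section Recursion.
Context {R : realType}.

(** The induction carries two consecutive indices. Each of the three terms in the bracket is at most
    K q^(n+1) E2, whence the factor 3 in [q]; [1 <= K] is what covers [E2] itself. *)
Lemma discrete_gronwall (K C E2 dl : R) (S : nat -> R) N : 1 <= K -> 0 <= C -> 0 <= dl ->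
  0 <= E2 -> S 0%N <= K * E2 -> S 1%N <= K * E2 ->
  (forall n, (2 <= n <= N)%N ->
    S n <= S n.-1 + dl * C * (E2 + S n.-1 + S n.-2)) ->
  forall n, (n <= N)%N -> S n <= K * (1 + 3 * C * dl) ^+ n * E2.
Proof.
move=> K1 C0 dl0 E0 S0 S1 step; set q := 1 + 3 * C * dl.
have dC : 0 <= dl * C by rewrite mulr_ge0.
have q1 : 1 <= q by rewrite /q lerDl mulr_ge0// mulr_ge0.
have q0 : 0 <= q by apply: le_trans q1.
have qn n : 1 <= q ^+ n by rewrite exprn_ege1.
have KE n : K * E2 <= K * q ^+ n * E2.
  by rewrite ler_wpM2r// ler_peMr// (le_trans _ K1).
have H n : (n <= N)%N -> S n <= K * q ^+ n * E2 /\ ((n.+1 <= N)%N -> S n.+1 <= K * q ^+ n.+1 * E2).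
  elim: n => [|n IH] nN; first by split=> [|_]; [exact: le_trans (KE _)|exact: le_trans (KE _)].
  have [a b] := IH (ltnW nN); split=> [|nN2]; first exact: b.
  have {}b := b nN; apply: (le_trans (step n.+2 _)) => /=; first by rewrite nN2.
  have b' : E2 <= K * q ^+ n.+1 * E2.
    by rewrite ler_peMl// -[leLHS]mulr1 ler_pM.
  have a' : S n <= K * q ^+ n.+1 * E2.
    apply: (le_trans a); rewrite ler_wpM2r// ler_wpM2l ?(le_trans _ K1)// exprS.
    by rewrite ler_peMl// exprn_ge0.
  rewrite (_ : K * q ^+ n.+2 * E2 = K * q ^+ n.+1 * E2 + dl * C * (3 * (K * q ^+ n.+1 * E2))); last first.
    by rewrite [q ^+ n.+2]exprS /q; ring.
  by rewrite lerD// ler_wpM2l//; lra.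
by move=> n /H[].
Qed.

Lemma ler_sqrtP (x y : R) : 0 <= x -> x ^+ 2 <= y -> x <= Num.sqrt y.
Proof. by move=> x0 h; rewrite -[x]ger0_norm// -sqrtr_sqr ler_wsqrtr. Qed.

(* [th n i] and [thP i] stand for the errors of the scheme and of the predictor,
   [H] for h^(k+1); only the first step loses a power of [dl], in the predictor,
   and recovers it since its contribution is weighted by [dl]. *)
Lemma scheme_recursion (ne : nat) (T M L g1 Kg G : R) : 0 < T -> 0 <= M -> 0 <= L ->
  0 <= g1 -> 0 <= Kg -> 0 <= G -> exists2 C, 0 < C &
  forall N dl H (th : nat -> 'I_ne -> R) (thP : 'I_ne -> R),
  0 < dl -> N%:R * dl <= T -> dl <= T -> 0 <= H ->
  (forall n i, 0 <= th n i) -> (forall i, 0 <= thP i) ->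
  (forall i, th 0%N i <= 2 * H * M) ->
  (forall i, thP i ^+ 2 <= th 0%N i ^+ 2 + dl * G *
    (H + dl ^+ 2 + L * ((Kg * M + g1 * M) * dl + g1 * M * H)) ^+ 2) ->
  (forall i p, 0 <= p -> (forall j, thP j <= p) -> th 1%N i ^+ 2 <= th 0%N i ^+ 2 + dl * G *
    (H + dl ^+ 2 + L * (g1 * (M * (H + dl ^+ 2) + p))) ^+ 2) ->
  (forall n i p, (2 <= n <= N)%N -> 0 <= p -> (forall j, th n.-1 j + th n.-2 j <= p) ->
    th n i ^+ 2 <= th n.-1 i ^+ 2 + dl * G *
    (H + dl ^+ 2 + L * (g1 * (4 * M * (H + dl ^+ 2) + 2 * p))) ^+ 2) ->
  forall n i, (n <= N)%N -> th n i <= C * (H + dl ^+ 2).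
Proof.
move=> T0 M0 L0 g10 Kg0 G0.
pose a := Kg * M + g1 * M; pose b := g1 * M.
have a0 : 0 <= a by rewrite addr_ge0// mulr_ge0.
have b0 : 0 <= b by rewrite mulr_ge0.
(* [c1] collects the residual of the predictor, bounded by c1 (H + dl); [c2], [c3] those of the
   corrector, c2 E + c3 p; [c4], [c5] those of the later steps, c4 E + c5 p. [K1] bounds the squared
   first error by K1 E^2, and [CC] is the Gronwall rate after summation over the components. *)
pose c1 := 1 + T + L * (a + b); pose c2 := 1 + L * g1 * M; pose c3 := L * g1.
pose c4 := 1 + 4 * (L * g1 * M); pose c5 := 2 * (L * g1).
pose K1 := 4 * M ^+ 2 + 2 * T * G * c2 ^+ 2 +
  2 * G * c3 ^+ 2 * (4 * M ^+ 2 * T + G * c1 ^+ 2 * (T + 1) ^+ 2).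
pose K := 1 + ne%:R * K1; pose CC := ne%:R * (G * (3 * (c4 ^+ 2 + c5 ^+ 2))).
have Lg : 0 <= L * g1 by rewrite mulr_ge0.
have LgM : 0 <= L * g1 * M by rewrite mulr_ge0.
have K10 : 4 * M ^+ 2 <= K1.
  by rewrite /K1 -addrA lerDl; nonneg.
have K1p : 0 <= K1 by apply: le_trans K10; nonneg.
have K1le : 1 <= K by rewrite lerDl; nonneg.
have CC0 : 0 <= CC by rewrite /CC; nonneg.
exists (Num.sqrt (K * expR (3 * CC * T)) + 1).
  by rewrite ltr_wpDl// sqrtr_ge0.
move=> N dl H th thP dl0 NdT dlT H0 th0 thP0 h0 hP h1 hn n i nN.
set E := H + dl ^+ 2 in hP h1 hn *.
have E0 : 0 <= E by rewrite addr_ge0// sqr_ge0.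
have HE : H <= E by rewrite lerDl sqr_ge0.
have dE : dl ^+ 2 <= E by rewrite lerDr.
have h02 j : th 0%N j ^+ 2 <= 4 * M ^+ 2 * H ^+ 2.
  have := h0 j; have := th0 0%N j => x y.
  have := ler_pM x x y y; rewrite -expr2 => /le_trans; apply.
  by rewrite le_eqVlt; apply/orP; left; apply/eqP; ring.
pose P2 := 4 * M ^+ 2 * H ^+ 2 + dl * G * (c1 ^+ 2 * (H + dl) ^+ 2).
have hP2 j : thP j ^+ 2 <= P2.
  apply: (le_trans (hP j)); rewrite lerD// ler_wpM2l; [by []|by nonneg|].
  rewrite -/a -/b -exprMn lerXn2r ?nnegrE; [by []|by nonneg|by rewrite /c1; nonneg|].
  rewrite /E /c1.
  have t1 : dl ^+ 2 <= T * dl by rewrite expr2 ler_wpM2r// ltW.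
  have t2 : 0 <= L * a * H by nonneg.
  have t3 : 0 <= L * b * dl by nonneg.
  have t4 : 0 <= T * H by nonneg.
  nra.
have h12 j : th 1%N j ^+ 2 <= K1 * E ^+ 2.
  have p0 : 0 <= Num.sqrt P2 by exact: sqrtr_ge0.
  have P20 : 0 <= P2 by apply: le_trans (hP2 j); exact: sqr_ge0.
  have := h1 j _ p0 (fun j => ler_sqrtP (thP0 j) (hP2 j)) => /le_trans; apply.
  set p := Num.sqrt P2 in p0 *; have pp : p ^+ 2 = P2 by rewrite sqr_sqrtr.
  have -> : E + L * (g1 * (M * E + p)) = c2 * E + c3 * p by rewrite /c2 /c3; ring.
  have q1 : (c2 * E + c3 * p) ^+ 2 <= 2 * (c2 ^+ 2 * E ^+ 2) + 2 * (c3 ^+ 2 * P2).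
    by rewrite -pp; have := sqr_ge0 (c2 * E - c3 * p); nra.
  have HE2 : H ^+ 2 <= E ^+ 2 by rewrite lerXn2r.
  (* The weight [dl] turns dl (H + dl)^2 into the square of dl (H + dl), and dl H + dl^2 is at most
     (T + 1) E: the lost half power is recovered. *)
  have q2 : dl * P2 <= (4 * M ^+ 2 * T + G * c1 ^+ 2 * (T + 1) ^+ 2) * E ^+ 2.
    have e : dl * P2 = 4 * M ^+ 2 * (dl * H ^+ 2) + G * c1 ^+ 2 * (dl * (H + dl)) ^+ 2.
      by rewrite /P2; ring.
    rewrite e [leRHS]mulrDl lerD//.
      rewrite -[leRHS]mulrA ler_wpM2l; [by []|by nonneg|].
      by rewrite ler_pM ?sqr_ge0 ?(ltW dl0).
    rewrite -[leRHS]mulrA ler_wpM2l -?exprMn; [by []|by nonneg|].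
    have dH : dl * H <= T * E by rewrite ler_pM ?(ltW dl0).
    have dH0 : 0 <= dl * (H + dl) by rewrite mulr_ge0 ?addr_ge0 ?(ltW dl0).
    rewrite lerXn2r ?nnegrE; [by []|by []|by nonneg|].
    rewrite mulrDr -expr2; apply: (le_trans (lerD dH dE)).
    by rewrite mulrDl mul1r.
  have q3 : dl * G * (c2 * E + c3 * p) ^+ 2 <=
      2 * T * G * c2 ^+ 2 * E ^+ 2 + 2 * G * c3 ^+ 2 * (dl * P2).
    apply: (@le_trans _ _ (dl * G * (2 * (c2 ^+ 2 * E ^+ 2) + 2 * (c3 ^+ 2 * P2)))).
      by rewrite ler_wpM2l// mulr_ge0// ltW.
    have e : dl * G * (2 * (c2 ^+ 2 * E ^+ 2) + 2 * (c3 ^+ 2 * P2)) =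
        dl * (2 * G * c2 ^+ 2 * E ^+ 2) + 2 * G * c3 ^+ 2 * (dl * P2) by ring.
    rewrite e lerD2r (_ : 2 * T * _ * _ * _ = T * (2 * G * c2 ^+ 2 * E ^+ 2)); last by ring.
    by rewrite ler_wpM2r; [by []|by nonneg|by []].
  have q4 : 2 * G * c3 ^+ 2 * (dl * P2) <=
      2 * G * c3 ^+ 2 * ((4 * M ^+ 2 * T + G * c1 ^+ 2 * (T + 1) ^+ 2) * E ^+ 2).
    by rewrite ler_wpM2l; [by []|by nonneg|by []].
  have q5 : th 0%N j ^+ 2 <= 4 * M ^+ 2 * E ^+ 2.
    by apply: (le_trans (h02 j)); rewrite ler_wpM2l// mulr_ge0// sqr_ge0.
  have -> : K1 * E ^+ 2 = 4 * M ^+ 2 * E ^+ 2 + (2 * T * G * c2 ^+ 2 * E ^+ 2 +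
     2 * G * c3 ^+ 2 * ((4 * M ^+ 2 * T + G * c1 ^+ 2 * (T + 1) ^+ 2) * E ^+ 2)).
    by rewrite /K1; ring.
  by rewrite lerD// (le_trans q3)// lerD2l.
(* The components are coupled through the arguments of the coefficients, so Gronwall is applied to
   the sum of all squared errors. *)
pose S n := \sum_(j < ne) th n j ^+ 2.
have S0 m : 0 <= S m by apply: sumr_ge0 => j _; exact: sqr_ge0.
have thS m j : th m j ^+ 2 <= S m.
  by rewrite /S (bigD1 j)//= lerDl sumr_ge0// => j' _; exact: sqr_ge0.
have SK m : (forall j, th m j ^+ 2 <= K1 * E ^+ 2) -> S m <= K * E ^+ 2.
  move=> h; apply: (@le_trans _ _ (ne%:R * K1 * E ^+ 2)).
    apply: (@le_trans _ _ (\sum_(j < ne) (K1 * E ^+ 2))); first by apply: ler_sum => j _.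
    by rewrite sumr_const card_ord -[leLHS]mulr_natl mulrA.
  by rewrite ler_wpM2r ?sqr_ge0// lerDr.
have step m : (2 <= m <= N)%N -> S m <= S m.-1 + dl * CC * (E ^+ 2 + S m.-1 + S m.-2).
  move=> mN; pose p := Num.sqrt (S m.-1) + Num.sqrt (S m.-2).
  have p0 : 0 <= p by rewrite addr_ge0 ?sqrtr_ge0.
  have hp j : th m.-1 j + th m.-2 j <= p by rewrite lerD// ler_sqrtP.
  have q1 : (E + L * (g1 * (4 * M * E + 2 * p))) ^+ 2 <=
      3 * (c4 ^+ 2 + c5 ^+ 2) * (E ^+ 2 + S m.-1 + S m.-2).
    have -> : E + L * (g1 * (4 * M * E + 2 * p)) = c4 * E + c5 * Num.sqrt (S m.-1) + c5 * Num.sqrt (S m.-2).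
      by rewrite /c4 /c5 /p; ring.
    rewrite -{2}(sqr_sqrtr (S0 m.-1)) -{2}(sqr_sqrtr (S0 m.-2)).
    set x := Num.sqrt _; set y := Num.sqrt _.
    have u1 := sqr_ge0 (c4 * E - c5 * x); have u2 := sqr_ge0 (c4 * E - c5 * y).
    have u3 := sqr_ge0 (c5 * x - c5 * y).
    have u4 : 0 <= (c4 * x) ^+ 2 by exact: sqr_ge0.
    have u5 : 0 <= (c4 * y) ^+ 2 by exact: sqr_ge0.
    have u6 : 0 <= (c5 * E) ^+ 2 by exact: sqr_ge0.
    apply: (@le_trans _ _ (3 * ((c4 * E) ^+ 2 + (c5 * x) ^+ 2 + (c5 * y) ^+ 2))); first by lra.
    by rewrite !exprMn; rewrite !exprMn in u4 u5 u6; lra.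
  have q2 j : th m j ^+ 2 <= th m.-1 j ^+ 2 +
      dl * G * (3 * (c4 ^+ 2 + c5 ^+ 2) * (E ^+ 2 + S m.-1 + S m.-2)).
    apply: (le_trans (hn m j p mN p0 hp)); rewrite lerD2l ler_wpM2l//.
    by rewrite mulr_ge0// ltW.
  apply: (@le_trans _ _ (\sum_(j < ne) (th m.-1 j ^+ 2 +
      dl * G * (3 * (c4 ^+ 2 + c5 ^+ 2) * (E ^+ 2 + S m.-1 + S m.-2))))).
    by apply: ler_sum => j _; exact: q2.
  rewrite big_split/= lerD2l sumr_const card_ord -mulr_natl /CC.
  by rewrite le_eqVlt; apply/orP; left; apply/eqP; ring.
have SS0 : S 0%N <= K * E ^+ 2.
  apply: SK => j; apply: (le_trans (h02 j)).
  apply: (@le_trans _ _ (4 * M ^+ 2 * E ^+ 2)).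
    by rewrite ler_wpM2l ?mulr_ge0 ?sqr_ge0// lerXn2r.
  by rewrite ler_wpM2r ?sqr_ge0.
have := discrete_gronwall K1le CC0 (ltW dl0) (sqr_ge0 E) SS0 (SK 1%N h12) step nN => Sn.
have qx : (1 + 3 * CC * dl) ^+ n <= expR (3 * CC * T).
  have x0 : 0 <= 3 * CC * dl by nonneg.
  apply: (@le_trans _ _ (expR (3 * CC * dl) ^+ n)).
    by rewrite lerXn2r ?nnegrE ?expR_ge1Dx ?expR_ge0//; nonneg.
  rewrite -expRM_natl ler_expR; apply: (@le_trans _ _ (3 * CC * (N%:R * dl))).
    by rewrite mulrCA ler_wpM2l ?ler_wpM2r ?ler_nat ?(ltW dl0)//; nonneg.
  by rewrite ler_wpM2l//; nonneg.
have thn : th n i ^+ 2 <= K * expR (3 * CC * T) * E ^+ 2.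
  apply: (le_trans (thS n i)); apply: (le_trans Sn).
  by rewrite ler_wpM2r ?sqr_ge0// ler_wpM2l// (le_trans _ K1le).
apply: (le_trans (ler_sqrtP (th0 n i) thn)).
rewrite sqrtrM; last by rewrite mulr_ge0 ?expR_ge0// (le_trans _ K1le).
by rewrite sqrtr_sqr ger0_norm// ler_wpM2r// lerDl.
Qed.

End Recursion.

(** * The scheme *)

Section Data_constants.
Context {R : realType} {ne : nat}.
Local Notation mu := (@lebesgue_measure R).
Local Notation mR := (measurableTypeR R).
Variables (d : data R ne) (hd : standing_hypotheses d).
Local Notation T := (horizon d).

Let T0 : 0 < T. Proof. exact: T_gt0 hd. Qed.

Lemma row_norm_le (x : 'rV[R]_ne) (X : R) : 0 <= X -> (forall j, `|x 0 j| <= X) -> `|x| <= X.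
Proof.
move=> X0 h; have [->|n0] := eqVneq `|x| 0; first by [].
have [[i j] /= e] := mx_norm_neq0 n0.
by rewrite -[`|x|]/(mx_norm x) e ord1.
Qed.

Lemma gamma_C1 : C1_on 0 T (gamma d) (gamma' d) /\ cont_on 0 T (gamma' d).
Proof.
have [dda [ca ca' _ da _]] := alphaC2 hd; have [ddb [cb cb' _ db _]] := betaC2 hd.
split; last exact: cont_onB; split; first exact: cont_onB.
by move=> t tT; have := is_deriveB (db t tT) (da t tT); exact.
Qed.

(** Rows carry the maximum norm, hence the componentwise form. The sum of the Lipschitz constants
    serves for all [i] at once. *)
Lemma coef_lipschitz : exists2 L : R, 0 <= L &
  forall i (s s' : 'rV[R]_ne) (X : R), 0 <= X -> (forall j, `|s 0 j - s' 0 j| <= X) ->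
    `|coef d i s - coef d i s'| <= L * X.
Proof.
have /choice[L hL] : forall i, exists L, 0 <= L /\
    forall s s', `|coef d i s - coef d i s'| <= L * `|s - s'|.
  move=> i; have := a_lipschitz hd i => /pinfty_ex_gt0[L L0 hL].
  exists L; split; first exact: ltW.
  by move=> s s'; exact: (hL (s, s')).
exists (\sum_i L i); first by apply: sumr_ge0 => i _; have [] := hL i.
move=> i s s' X X0 h; have [L0 hLi] := hL i; apply: (le_trans (hLi s s')).
apply: ler_pM => //; last by apply: row_norm_le => // j; rewrite !mxE.
by rewrite (bigD1 i)//= lerDl sumr_ge0// => j _; have [] := hL j.
Qed.

(** These constants are extracted from the data alone, before the solution, the degree, the
    partition and the number of steps are introduced; the uniformity of the final constant rests on
    this order. *)
Lemma data_constants : exists g0 g1 Kg Cb Ma ma : R,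
  [/\ 0 < g0 /\ 0 <= g1, 0 <= Kg /\ lipschitz_on 0 T Kg (gamma d), 0 < ma,
      forall t, t \in `[0, T] -> [/\ g0 <= gamma d t, gamma d t <= g1,
        `|alpha' d t / gamma d t| + 2 * `|gamma' d t / gamma d t| <= Cb &
        0 <= gamma' d t / gamma d t] &
      forall i s, ma <= coef d i s <= Ma].
Proof.
have [g0 [g1 [g00 hg]]] := gamma_bounds hd; have [ma [Ma [ma0 hma]]] := a_bounds hd.
have [cg cg'] := gamma_C1; have [dda [_ ca' _ _ _]] := alphaC2 hd.
have [Kg Kg0 hKg] := cont_on_bounded (ltW T0) cg'.
have [Ka Ka0 hKa] := cont_on_bounded (ltW T0) ca'.
have zT : 0 \in `[0, T] by rewrite in_itv/= lexx ltW.
have g10 : 0 <= g1 by have /andP[? ?] := hg 0 zT; lra.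
exists g0, g1, Kg, (Ka / g0 + 2 * (Kg / g0)), Ma, ma; split=> //.
  by split=> //; exact: C1_on_lipschitz cg Kg0 hKg.
move=> t tT; have /andP[l r] := hg t tT; have gt0 := lt_trans g00 l.
split; [exact: ltW|exact: ltW| |].
  have q x K : 0 <= K -> `|x| <= K -> `|x / gamma d t| <= K / g0.
    move=> K0 xK; rewrite normrM [`|_^-1|]gtr0_norm ?invr_gt0//.
    by rewrite ler_pM ?invr_ge0 ?(ltW gt0)// lef_pV2 ?posrE// ltW.
  by rewrite lerD ?ler_wpM2l ?q ?hKa ?hKg.
rewrite divr_ge0 ?(ltW gt0)// /gamma'.
by have := alpha'_lt0 hd tT; have := beta'_gt0 hd tT; lra.
Qed.

Lemma b2_bounds g0 g1 t : 0 < g0 -> g0 <= gamma d t -> gamma d t <= g1 ->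
  (g1 ^+ 2)^-1 <= b2 d t <= (g0 ^+ 2)^-1.
Proof.
move=> g00 l r; have gt0 := lt_le_trans g00 l; have g10 := lt_le_trans gt0 r.
by apply/andP; split; rewrite lef_pV2 ?posrE ?exprn_gt0// lerXn2r ?nnegrE// ltW.
Qed.

(** The convection speed is affine in [y], which is why the general estimates carry two scalars [c]
    and [d]. *)
Lemma b1E t y : b1 d t y = alpha' d t / gamma d t + gamma' d t / gamma d t * y.
Proof. by rewrite /b1 mulrDl mulrAC. Qed.

Lemma cont_on_gammaV : cont_on 0 T (fun t => (gamma d t)^-1).
Proof.
have [g0 [g1 [Kg [Cb [Ma [ma [[g00 _] [Kg0 lg] _ hg _]]]]]]] := data_constants.
apply: (lipschitz_cont_on (K := Kg / g0 ^+ 2)) => s r sT rT.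
have [ls _ _ _] := hg s sT; have [lr _ _ _] := hg r rT.
have s0 := lt_le_trans g00 ls; have r0 := lt_le_trans g00 lr.
rewrite (_ : _ - _ = (gamma d s - gamma d r) / (gamma d r * gamma d s)); last first.
  by field; rewrite !gt_eqF.
rewrite normrM distrC [`|_^-1|]gtr0_norm ?invr_gt0 ?mulr_gt0//.
rewrite mulrAC ler_pM ?invr_ge0 ?mulr_ge0 ?(ltW s0) ?(ltW r0)//; first exact: lg.
by rewrite lef_pV2 ?posrE ?mulr_gt0 ?exprn_gt0// expr2 ler_pM// ltW.
Qed.

Lemma cont_on_b1 : cont_on 0 T (fun t => alpha' d t / gamma d t) /\
  cont_on 0 T (fun t => gamma' d t / gamma d t).
Proof.
have [_ cg'] := gamma_C1; have [dda [_ ca' _ _ _]] := alphaC2 hd.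
by split; apply: cont_onM => //; exact: cont_on_gammaV.
Qed.

Lemma cont_on_coef i (l : R -> 'rV[R]_ne) : (forall j, cont_on 0 T (fun t => l t 0 j)) ->
  cont_on 0 T (fun t => coef d i (l t)).
Proof.
move=> cl; have [L L0 hL] := coef_lipschitz; apply/cont_onP => t tT e e0.
have e1 : 0 < e / (L + 1) by rewrite divr_gt0// ltr_wpDl.
have /choice[dl hdl] : forall j, exists dl, 0 < dl /\ forall s, s \in `[0, T] ->
    `|s - t| < dl -> `|l s 0 j - l t 0 j| < e / (L + 1).
  by move=> j; have /cont_onP/(_ t tT _ e1)[dl d0 h] := cl j; exists dl.
exists (\big[Num.min/1]_j dl j).
  by elim/big_ind : _ => // [x y x0 y0|j _]; [rewrite lt_min x0|have [] := hdl j].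
move=> s sT sd.
have : `|coef d i (l s) - coef d i (l t)| <= L * (e / (L + 1)).
  apply: hL; first exact: ltW.
  move=> j; have [_ h] := hdl j; apply/ltW/h => //.
  by apply: (lt_le_trans sd); exact: bigmin_le_cond.
move=> /le_lt_trans; apply; rewrite mulrCA gtr_pMr//.
by rewrite ltr_pdivrMr ?mul1r; lra.
Qed.

End Data_constants.

(** * The regular solution of the problem and its projection *)

Section Solution.
Context {R : realType} {ne : nat}.
Local Notation mu := (@lebesgue_measure R).
Local Notation mR := (measurableTypeR R).
Local Notation ip := (ip (`]0, 1[%classic : set mR)).
Local Notation nrm := (nrm (`]0, 1[%classic : set mR)).
Local Notation sq_int := (sq_int (`]0, 1[%classic : set mR)).
Variables (d : data R ne) (hd : standing_hypotheses d).
Local Notation T := (horizon d).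
Variables (v : 'I_ne -> R -> R -> R) (hv : weak_solution d v).
Variables (k : nat) (k1 : (1 <= k)%N) (M : R) (M0 : 0 <= M) (hr : regular d k M v).

Let mitv a b : measurable (`]a, b[%classic : set mR).
Proof. exact: measurable_itv. Qed.

Let T0 : 0 < T. Proof. exact: T_gt0 hd. Qed.

Lemma solution_C0L2 i : C0L2 T (v i).
Proof. by have [] := hv i. Qed.

Lemma solution_moments i w : sq_int w -> exists A,
  [/\ C1_on 0 T (fun t => ip (v i t) w) A, lipschitz_on 0 T (M * nrm w) A,
      forall t, t \in `[0, T] -> `|A t| <= M * nrm w &
      forall t, t \in `[0, T] -> `|ip (v i t) w| <= M * nrm w].
Proof.
move=> sw; have vC := solution_C0L2 i.
have [_ hLv [vt [vtt [vttt [[td1 hvt] [td2 hvtt] [td3 hvttt]]]]]] := hr i.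
have [A [A' [cA _ [lA _] bA _]]] := ip_solution_C2 T0 M0 vC hLv hvt hvtt hvttt td1 td2 td3 sw.
exists A; split=> //.
apply: (@ae_le_cont_on _ 0 T _ (fun t => `|ip (v i t) w|)) => //.
  by apply: cont_on_norm; exact: C0L2_cont_on.
exact: (L2_valued_ip_le (LooHm_derivs M0 hLv).1 sw).
Qed.

Variables (gc : 'I_ne -> R -> R -> R) (hgc : continuous_repr d gc).
Variables (s : seq R) (ps : itv_partition 0 1 s).
Local Notation a t i := (coef d i (ells d t (fun j => v j t))).

Lemma ells_v t j : (ells d t (fun j => v j t)) 0 j = gamma d t * ip (v j t) (fun=> 1).
Proof. by rewrite mxE /ell; congr (_ * _); apply: eq_Rintegral => y _; rewrite mulr1. Qed.

Lemma measurable_g i : measurable_fun (cylinder T) (fun q => g d i q.1 q.2).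
Proof.
have [[mf _] _] := f_L2L1 hd i.
have [dda [ca _ _ _ _]] := alphaC2 hd; have [ddb [cb _ _ _ _]] := betaC2 hd.
apply: (measurable_moving_source (cont_on_measurable ca) (cont_on_measurable cb) _ mf) => t tT.
have [g0 [g1 [g00 hg]]] := gamma_bounds hd.
have tT' : t \in `[0, T] by move: tT; rewrite !in_itv/= => /andP[? ?]; rewrite !ltW.
by have /andP[l _] := hg t tT'; move: l; rewrite /gamma; lra.
Qed.

(** Everything the scheme needs to know about one component. [vh] precedes [W], while the exact
    moments [A] of the time derivative and [B] of dv/dy depend on [W]; their bounds involve only [M]
    and the norms of [W] and W'. *)
Lemma solution_package i : exists vh : R -> R -> R,
  [/\ forall t, t \in `[0, T] -> Sh s k (vh t),
   forall W, Sh s k W -> exists A A' B B',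
    [/\ [/\ C1_on 0 T (fun t => ip (v i t) W) A, C1_on 0 T A A' &
           lipschitz_on 0 T (M * nrm W) A'],
        C1_on 0 T B B' /\ lipschitz_on 0 T (M * nrm (derive1 W)) B',
        forall t, t \in `[0, T] -> `|B t| <= M * nrm (derive1 W),
        forall t, t \in `[0, T] -> ip (derive1 (vh t)) (derive1 W) = B t &
        forall t, t \in `[0, T] -> A t + a t i * b2 d t * B t +
          ip (v i t) (conv (alpha' d t / gamma d t) (gamma' d t / gamma d t) W) =
          ip (gc i t) W],
   forall t, t \in `[0, T] ->
     nrm (fun y => v i t y - vh t y) <= mesh s ^+ k.+1 * M &
   forall r t, r \in `[0, T] -> t \in `[0, T] ->
    nrm (fun y => (v i r y - vh r y) - (v i t y - vh t y)) <=
      mesh s ^+ k.+1 * M * `|r - t|].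
Proof.
have [vC _ vH10 _ [vws [vy [hvws tdws mvy wvy eqw]]]] := hv i.
have [_ hLv [vt [vtt [vttt [[td1 hvt] [td2 hvtt] [td3 hvttt]]]]]] := hr i.
have [vL [Dv [DvL aDv]]] := LooHm_derivs M0 hLv.
have [vtL [Dvt [DvtL aDvt]]] := LooHm_derivs M0 hvt.
have [vttL [Dvtt [DvttL aDvtt]]] := LooHm_derivs M0 hvtt.
have [vh [Svh hB r1 r2]] := elliptic_projection T0 M0 k1 vC vH10 hLv hvt hvtt td1
  td2 DvL aDv DvtL aDvt DvttL aDvtt ps.
exists vh; split=> // W hW.
have sW := Sh_sq_int ps hW; have sdW := Sh_derive1_sq_int ps hW.
have [A [A' [cA cA' [_ lA'] _ eA]]] := ip_solution_C2 T0 M0 vC hLv hvt hvtt hvttt td1 td2 td3 sW.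
have [B [B' [cB lB bB eB aeB]]] := hB _ (Sh_derive1 hW).
exists A, A', B, B'; split=> //.
have [cb1 cb2] := cont_on_b1 hd.
have ca : cont_on 0 T (fun t => a t i * b2 d t).
  apply: cont_onM; last first.
    rewrite (_ : b2 d = fun t => (gamma d t)^-1 * (gamma d t)^-1).
      by apply: cont_onM; exact: cont_on_gammaV.
    by apply/funext => t; rewrite /b2 expr2 invfM.
  apply: cont_on_coef => // j; have [[cg _] _] := gamma_C1 hd.
  under eq_fun do rewrite ells_v; apply: cont_onM => //.
  by apply: C0L2_cont_on; [exact: solution_C0L2|exact: sq_int_cst].
have [gC gE] := hgc i.
apply: (weak_equation T0 M0 ps hW vC hLv vtL td1 hvws tdws mvy wvy (measurable_g i) gC gE
  ca cb1 cb2 cA'.1 cB.1 eA).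
  (* The derivative in space from the definition of a solution and the one from the regularity
     assumption agree by uniqueness of weak derivatives. *)
  apply: aeS2 aDv (aeS2 (fun t => @conj _ _) wvy aeB) => t h1 [h2 h3] tT.
  rewrite -h3//; have w1 := (h1 tT).1 1%N isT; have w2 := h2 tT.
  have [_ m1] := weak_deriv_sq_int w1; have [_ m2] := weak_deriv_sq_int w2.
  by apply: (ae_eq_ip (mitv _ _) m2.1 m1.1 sdW.1); exact: weak_deriv_unique ltr01 w2 w1.
move=> phi tphi; have := eqw W (derive1 W) (Sh_H10 ps hW) (Sh_weak_deriv ps hW) phi tphi.
move=> <-; apply: eq_Rintegral => t _; congr ((_ + _ - _) * _).
by apply: eq_Rintegral => y _; rewrite b1E.
Qed.

End Solution.

(** * Energy estimate for each step and errors in the arguments of the coefficients *)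

Section Scheme_estimates.
Context {R : realType} {ne : nat}.
Local Notation mu := (@lebesgue_measure R).
Local Notation mR := (measurableTypeR R).
Local Notation ip := (ip (`]0, 1[%classic : set mR)).
Local Notation nrm := (nrm (`]0, 1[%classic : set mR)).
Local Notation sq_int := (sq_int (`]0, 1[%classic : set mR)).
Variables (d : data R ne) (hd : standing_hypotheses d).
Local Notation T := (horizon d).
Variables (v : 'I_ne -> R -> R -> R) (hv : weak_solution d v).
Variables (k : nat) (k1 : (1 <= k)%N) (M : R) (M0 : 0 <= M) (hr : regular d k M v).
Variables (gc : 'I_ne -> R -> R -> R).
Variables (s : seq R) (ps : itv_partition 0 1 s).
Variables (N : nat) (N1 : (1 <= N)%N).
Variables (g0 g1 Kg Cb Ma ma L : R).
Hypotheses (g00 : 0 < g0) (g10 : 0 <= g1) (Kg0 : 0 <= Kg)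
  (gL : lipschitz_on 0 T Kg (gamma d)) (ma0 : 0 < ma) (L0 : 0 <= L).
Hypothesis hg : forall t, t \in `[0, T] -> [/\ g0 <= gamma d t, gamma d t <= g1,
  `|alpha' d t / gamma d t| + 2 * `|gamma' d t / gamma d t| <= Cb &
  0 <= gamma' d t / gamma d t].
Hypothesis hma : forall i x, ma <= coef d i x <= Ma.
Hypothesis hL : forall i (x x' : 'rV[R]_ne) (X : R), 0 <= X ->
  (forall j, `|x 0 j - x' 0 j| <= X) -> `|coef d i x - coef d i x'| <= L * X.
Variable vh : 'I_ne -> R -> R -> R.
Local Notation a t i := (coef d i (ells d t (fun j => v j t))).
Local Notation H := (mesh s ^+ k.+1).
Local Notation dl := (step d N).
Local Notation E := (H + dl ^+ 2).
Hypothesis Svh : forall i t, t \in `[0, T] -> Sh s k (vh i t).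
Hypothesis hvh : forall i W, Sh s k W -> exists A A' B B',
    [/\ [/\ C1_on 0 T (fun t => ip (v i t) W) A, C1_on 0 T A A' &
           lipschitz_on 0 T (M * nrm W) A'],
        C1_on 0 T B B' /\ lipschitz_on 0 T (M * nrm (derive1 W)) B',
        forall t, t \in `[0, T] -> `|B t| <= M * nrm (derive1 W),
        forall t, t \in `[0, T] -> ip (derive1 (vh i t)) (derive1 W) = B t &
        forall t, t \in `[0, T] -> A t + a t i * b2 d t * B t +
          ip (v i t) (conv (alpha' d t / gamma d t) (gamma' d t / gamma d t) W) =
          ip (gc i t) W].
Hypothesis rho1 : forall i t, t \in `[0, T] ->
     nrm (fun y => v i t y - vh i t y) <= H * M.
Hypothesis rho2 : forall i r t, r \in `[0, T] -> t \in `[0, T] ->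
    nrm (fun y => (v i r y - vh i r y) - (v i t y - vh i t y)) <= H * M * `|r - t|.

Let mitv a b : measurable (`]a, b[%classic : set mR).
Proof. exact: measurable_itv. Qed.

Let T0 : 0 < T. Proof. exact: T_gt0 hd. Qed.

Lemma step_gt0 : 0 < dl.
Proof. by rewrite divr_gt0// ltr0n. Qed.

Lemma tn_itv n : (n <= N)%N -> tn d N n \in `[0, T].
Proof.
move=> nN; have d0 := step_gt0; rewrite in_itv/= /tn mulr_ge0 ?(ltW d0)//=.
apply: (@le_trans _ _ (N%:R * dl)); first by rewrite ler_wpM2r ?ler_nat ?(ltW d0).
by rewrite /step mulrCA mulfV ?mulr1// pnatr_eq0 -lt0n.
Qed.

Lemma tnS n : tn d N n.+1 = tn d N n + dl.
Proof. by rewrite /tn -natr1 mulrDl mul1r. Qed.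

Lemma tmidS n : tmid d N n.+1 = tn d N n + dl / 2.
Proof. by rewrite /tmid tnS/=; lra. Qed.

Lemma tmid_itv n : (n < N)%N -> tmid d N n.+1 \in `[0, T].
Proof.
move=> nN; have := tn_itv nN; have := tn_itv (ltnW nN).
by rewrite tmidS tnS !in_itv/= => /andP[? ?] /andP[? ?]; have := step_gt0; lra.
Qed.

(** The constant of [energy_step] for be = 1/g0^2 and mu0 = ma/g1^2. The factor M^2 appears because
    truncation, projection and coefficient errors are all proportional to [M]. *)
Definition energy_const : R :=
  (1 + (g0 ^+ 2)^-1 + Ma * (g0 ^+ 2)^-1 + Cb) ^+ 2 / (2 * (ma * (g1 ^+ 2)^-1)) * M ^+ 2.

Lemma solution_sq_int i t : t \in `[0, T] -> sq_int (v i t).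
Proof. exact: C0L2_sq_int (solution_C0L2 hv i). Qed.

Lemma H_ge0 : 0 <= H.
Proof. by rewrite exprn_ge0 ?mesh_ge0. Qed.

Lemma mulr_reassoc (a q m y : R) : a * (q * m) * y = a * q * (m * y).
Proof. by ring. Qed.

(** [energy_step] with eps = M dl^2 and eta = M h^(k+1). The kind of step enters only through [lam],
    the argument of the coefficients, and its error [Y]. *)
Lemma cn_step_estimate n lam (Vo Vn : 'I_ne -> R -> R) Y i : (n < N)%N -> 0 <= Y ->
  (forall j, Sh s k (Vo j)) -> (forall j, Sh s k (Vn j)) ->
  cn_step d gc s k N n.+1 lam Vo Vn ->
  (forall j, `|(ells d (tmid d N n.+1) (fun j => v j (tmid d N n.+1))) 0 j - lam 0 j| <= Y) ->
  nrm (fun y => Vn i y - vh i (tn d N n.+1) y) ^+ 2 <=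
  nrm (fun y => Vo i y - vh i (tn d N n) y) ^+ 2 + dl * energy_const * (E + L * Y) ^+ 2.
Proof.
move=> nN Y0 hVo hVn hcn hlam.
set t1 := tn d N n; set t2 := tn d N n.+1; set tm := tmid d N n.+1.
have i1 : t1 \in `[0, T] by exact: tn_itv (ltnW nN).
have i2 : t2 \in `[0, T] by exact: tn_itv.
have im : tm \in `[0, T] by exact: tmid_itv.
have d0 := step_gt0; have H0 := H_ge0.
have t12 : t2 - t1 = dl by rewrite /t2 tnS /t1; ring.
have t12' : t1 < t2 by rewrite -subr_gt0 t12.
have [l r cb dge] := hg im; have /andP[b21 b22] := b2_bounds g00 l r.
have /andP[a1 a2] := hma i lam.
have g1p : 0 < g1 by apply: lt_le_trans (le_trans l r).
have b20 : 0 < (g1 ^+ 2)^-1 by rewrite invr_gt0 exprn_gt0.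
have da : `|a tm i - coef d i lam| <= L * Y by exact: hL.
apply: (le_trans (@energy_step _ s k (Vo i) (Vn i) (vh i t1) (vh i t2) (v i t1) (v i t2)
  (v i tm) (gc i tm) dl (a tm i) (coef d i lam) (b2 d tm) (alpha' d tm / gamma d tm)
  (gamma' d tm / gamma d tm) (M * dl ^+ 2) (H * M) Cb M (g0 ^+ 2)^-1 Ma
  (ma * (g1 ^+ 2)^-1) ps (hVo i) (hVn i) (Svh i i1) (Svh i i2) (solution_sq_int i i1) (solution_sq_int i i2) (solution_sq_int i im)
  d0 _ _ cb dge _ _ _ M0 _ _ _ _ _ _)).
- by rewrite mulr_ge0 ?sqr_ge0.
- by rewrite mulr_ge0.
- by rewrite b22 (le_trans _ b21)// ltW.
- by rewrite a2 (le_trans _ a1)// ltW.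
- by rewrite mulr_gt0//= ler_pM// ltW.
- move=> W hW; apply: etrans (hcn i W hW); congr (_ + _ - _).
  by apply: eq_Rintegral => y _; rewrite b1E.
- move=> W hW; have [A [A' [B [B' [[cF cA lA'] [cB lB'] bB eB eW]]]]] := hvh i hW.
  have MW : 0 <= M * nrm W by rewrite mulr_ge0 ?nrm_ge0.
  have MW' : 0 <= M * nrm (derive1 W) by rewrite mulr_ge0 ?nrm_ge0.
  exists (A tm), (B tm); split; [exact: eW| | |exact: bB].
    have := midpoint_rule cF cA lA' MW i1 i2 t12'.
    by rewrite t12 distrC -/tm => /le_trans; apply; rewrite mulrAC.
  rewrite !eB//; have := second_difference cB lB' MW' i1 i2 (ltW t12').
  by rewrite t12 -/tm => /le_trans; apply; rewrite mulrAC.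
- move=> w sw; have [A [cF lA _ _]] := solution_moments hd hv M0 hr i sw.
  have MW : 0 <= M * nrm w by rewrite mulr_ge0 ?nrm_ge0.
  have := second_difference cF lA MW i1 i2 (ltW t12').
  by rewrite t12 -/tm => /le_trans; apply; rewrite mulrAC.
- exact: rho1.
- exact: rho1.
- by have := rho2 i i2 i1; rewrite t12 gtr0_norm// mulrC.
rewrite lerD2l /energy_const [leRHS]mulr_reassoc ler_wpM2l//.
  rewrite mulr_ge0 ?(ltW d0)// divr_ge0 ?sqr_ge0//.
  by rewrite mulr_ge0// mulr_ge0// ltW.
rewrite -exprMn.
have x0 : 0 <= M * `|a tm i - coef d i lam| by rewrite mulr_ge0.
have x1 : 0 <= M * dl ^+ 2 + H * M by rewrite addr_ge0// mulr_ge0// sqr_ge0.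
have LY : 0 <= L * Y by exact: mulr_ge0.
have E0 : 0 <= E by rewrite addr_ge0// sqr_ge0.
rewrite lerXn2r ?nnegrE; [by []|exact: addr_ge0|by rewrite mulr_ge0// addr_ge0|].
rewrite mulrDr lerD ?ler_wpM2l// mulrDr [H * M]mulrC addrC.
exact: lexx.
Qed.

Lemma ell_ip t w : ell d t w = gamma d t * ip w (fun=> 1).
Proof. by rewrite /ell; congr (_ * _); apply: eq_Rintegral => y _; rewrite mulr1. Qed.

Let s1 : sq_int (fun=> 1). Proof. exact: sq_int_cst. Qed.

Lemma mean_le w : sq_int w -> `|ip w (fun=> 1)| <= nrm w.
Proof.
by move=> sw; have := CS (mitv 0 1) sw s1; rewrite nrm_cst normr1 mulr1.
Qed.

Lemma mean_error j t U : t \in `[0, T] -> Sh s k U ->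
  `|ip (v j t) (fun=> 1) - ip U (fun=> 1)| <= H * M + nrm (fun y => U y - vh j t y).
Proof.
move=> tT hU; have sU := Sh_sq_int ps hU; have su := solution_sq_int j tT.
have sh := Sh_sq_int ps (Svh j tT).
rewrite -ipBl//; apply: (le_trans (mean_le (sq_intB (mitv _ _) su sU))).
have a1 := sq_intB (mitv 0 1) su sh; have a2 := sq_intB (mitv 0 1) sU sh.
apply: (@le_trans _ _ (nrm (fun y => (v j t y - vh j t y) - (U y - vh j t y)))).
  by rewrite le_eqVlt; apply/orP; left; apply/eqP; apply: eq_nrm => y _; ring.
by apply: (le_trans (nrmB (mitv _ _) a1 a2)); rewrite lerD2r rho1.
Qed.

Lemma gamma_norm t : t \in `[0, T] -> `|gamma d t| <= g1.
Proof. by move=> /hg[l r _ _]; rewrite ger0_norm// (le_trans _ l)// ltW. Qed.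

(* nrm 1 = 1, so that these are the constants of solution_moments for w = 1. *)
Lemma mean_moments j : exists A,
  [/\ C1_on 0 T (fun t => ip (v j t) (fun=> 1)) A, lipschitz_on 0 T M A,
      lipschitz_on 0 T M (fun t => ip (v j t) (fun=> 1)) &
      forall t, t \in `[0, T] -> `|ip (v j t) (fun=> 1)| <= M].
Proof.
have [A [cA lA bA bv]] := solution_moments hd hv M0 hr j s1.
have M1 : M * nrm (fun=> 1) = M by rewrite nrm_cst normr1 mulr1.
rewrite M1 in lA bA bv; exists A; split=> //.
exact: C1_on_lipschitz cA M0 bA.
Qed.

(** Extrapolation of the exact means costs 2 M dl^2; the errors at the two earlier times enter with
    weights 3/2 and 1/2, which add up to 2. *)
Lemma extrapolated_argument n (Vp Vpp : 'I_ne -> R -> R) p j : (n.+2 <= N)%N ->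
  Sh s k (Vp j) -> Sh s k (Vpp j) ->
  nrm (fun y => Vp j y - vh j (tn d N n.+1) y) +
  nrm (fun y => Vpp j y - vh j (tn d N n) y) <= p ->
  `|(ells d (tmid d N n.+2) (fun j => v j (tmid d N n.+2))) 0 j -
    (ells d (tmid d N n.+2) (fun j y => 3 / 2 * Vp j y - 1 / 2 * Vpp j y)) 0 j| <=
  g1 * (4 * M * E + 2 * p).
Proof.
move=> nN hVp hVpp hp; have d0 := step_gt0; have H0 := H_ge0.
have im : tmid d N n.+2 \in `[0, T] by exact: tmid_itv.
have i1 : tn d N n.+1 \in `[0, T] by exact: tn_itv (ltnW nN).
have i2 : tn d N n \in `[0, T] by apply: tn_itv; exact: ltnW (ltnW nN).
have [A [cA lA _ _]] := mean_moments j.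
have sp := Sh_sq_int ps hVp; have spp := Sh_sq_int ps hVpp.
rewrite !mxE !ell_ip -mulrBr normrM ler_pM ?gamma_norm//.
rewrite ipBl//; [|exact: sq_intZ..]; rewrite !ipZl//.
have e1 := mean_error j i1 hVp; have e2 := mean_error j i2 hVpp.
have x0 : tn d N n.+1 - dl = tn d N n by rewrite tnS; ring.
have := @extrapolation _ _ _ M _ A (tn d N n.+1) dl cA lA M0 (ltW d0).
rewrite x0 -tmidS => /(_ i2 im) e3.
have n1 := nrm_ge0 (`]0, 1[%classic : set mR) (fun y => Vp j y - vh j (tn d N n.+1) y).
have n2 := nrm_ge0 (`]0, 1[%classic : set mR) (fun y => Vpp j y - vh j (tn d N n) y).
move: e1 e2 e3 n1 n2 hp.
set q := ip (v j (tmid _ _ _)) _; set a1 := ip (v j (tn d N n.+1)) _.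
set a2 := ip (v j (tn d N n)) _; set u1 := ip (Vp j) _; set u2 := ip (Vpp j) _.
set r1 := nrm _; set r2 := nrm _ => e1 e2 e3 n1 n2 hp.
have MH : 0 <= M * H by exact: mulr_ge0.
have Md : 0 <= M * dl ^+ 2 by rewrite mulr_ge0 ?sqr_ge0.
have -> : q - (3 / 2 * u1 - 1 / 2 * u2) = (q - (3 / 2 * a1 - 1 / 2 * a2)) +
   (3 / 2 * (a1 - u1) + - (1 / 2 * (a2 - u2))) by ring.
apply: (le_trans (ler_normD _ _)).
apply: (@le_trans _ _ (2 * M * dl ^+ 2 + (3 / 2 * (H * M + r1) + 1 / 2 * (H * M + r2)))).
  rewrite lerD// (le_trans (ler_normD _ _))// normrN (normrM (3 / 2)) (normrM (1 / 2)).
  by rewrite (@ger0_norm _ (3 / 2))// (@ger0_norm _ (1 / 2))// lerD// ler_wpM2l.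
rewrite mulrDr; lra.
Qed.

(** The mean of the values at both ends is accurate to second order, and the predictor and the
    initial value each contribute half of their errors. *)
Lemma corrector_argument (P V0 : 'I_ne -> R -> R) p j : Sh s k (P j) -> Sh s k (V0 j) ->
  nrm (fun y => P j y - vh j (tn d N 1) y) <= p ->
  `|ip (v j 0) (fun=> 1) - ip (V0 j) (fun=> 1)| <= H * M ->
  `|(ells d (tmid d N 1) (fun j => v j (tmid d N 1))) 0 j -
    (ells d (tmid d N 1) (fun j y => (P j y + V0 j y) / 2)) 0 j| <=
  g1 * (M * E + p).
Proof.
move=> hP hV hp h0; have d0 := step_gt0; have H0 := H_ge0.
have im : tmid d N 1 \in `[0, T] by exact: tmid_itv.
have i1 : tn d N 1 \in `[0, T] by exact: tn_itv.
have i0 : tn d N 0 \in `[0, T] by exact: tn_itv.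
have t0 : tn d N 0 = 0 by rewrite /tn mul0r.
have t01 : tn d N 1 - tn d N 0 = dl by rewrite tnS; ring.
have t01' : tn d N 0 <= tn d N 1 by rewrite -subr_ge0 t01 ltW.
have [A [cA lA _ _]] := mean_moments j.
have sp := Sh_sq_int ps hP; have s0 := Sh_sq_int ps hV.
rewrite !mxE !ell_ip -mulrBr normrM ler_pM ?gamma_norm//.
have -> : ip (fun y => (P j y + V0 j y) / 2) (fun=> 1) =
    2^-1 * (ip (P j) (fun=> 1) + ip (V0 j) (fun=> 1)).
  rewrite -ipDl// -ipZl//; last exact: sq_intD.
  by apply: eq_ip => // y _; rewrite mulrC.
have e1 := mean_error j i1 hP.
have := second_difference cA lA M0 i0 i1 t01'; rewrite t01 -/(tmid d N 1) t0.
move: e1 h0 hp; set q := ip (v j (tmid _ _ _)) _; set a1 := ip (v j (tn d N 1)) _.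
set a0 := ip (v j 0) _; set u1 := ip (P j) _; set u0 := ip (V0 j) _.
set r1 := nrm _ => e1 h0 hp e2.
have MH : 0 <= H * M by exact: mulr_ge0.
have p0 : 0 <= p by apply: le_trans hp; exact: nrm_ge0.
have -> : q - 2^-1 * (u1 + u0) = (q - (a1 + a0) / 2) +
   (2^-1 * (a1 - u1) + 2^-1 * (a0 - u0)) by field.
apply: (le_trans (ler_normD _ _)).
apply: (@le_trans _ _ (M * dl ^+ 2 + (2^-1 * (H * M + r1) + 2^-1 * (H * M)))).
  rewrite lerD// (le_trans (ler_normD _ _))// !(normrM 2^-1).
  by rewrite (@ger0_norm _ 2^-1)// lerD// ler_wpM2l.
rewrite mulrDr; lra.
Qed.

(** The term with [Kg] pays for taking the factor gamma at [tau], the other term in [dl] for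
    replacing the solution at the midpoint by its value at time 0, the last one for interpolation.
    The order in [dl] is only one. *)
Lemma predictor_argument tau (V0 : 'I_ne -> R -> R) j : tau = tmid d N 1 \/ tau = 0 ->
  Sh s k (V0 j) -> `|ip (v j 0) (fun=> 1) - ip (V0 j) (fun=> 1)| <= H * M ->
  `|(ells d (tmid d N 1) (fun j => v j (tmid d N 1))) 0 j - (ells d tau V0) 0 j| <=
  (Kg * M + g1 * M) * dl + g1 * M * H.
Proof.
move=> htau hV h0; have d0 := step_gt0; have H0 := H_ge0.
have im : tmid d N 1 \in `[0, T] by exact: tmid_itv.
have z0 : 0 \in `[0, T] by rewrite in_itv/= lexx ltW.
have it : tau \in `[0, T] by case: htau => ->.
have tm0 : tmid d N 1 = dl / 2 by rewrite tmidS /tn mul0r add0r.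
have [A [cA lA lv bv]] := mean_moments j.
rewrite !mxE !ell_ip.
have e1 := bv _ im; have e2 := lv _ _ z0 im.
have e3 : `|gamma d (tmid d N 1) - gamma d tau| <= Kg * dl.
  apply: (le_trans (gL it im)); rewrite ler_wpM2l//.
  by case: htau => ->; rewrite ?subrr ?subr0 ?normr0 ?tm0 ?(ltW d0)// ger0_norm; lra.
have e4 := gamma_norm it.
rewrite subr0 tm0 [`|dl / 2|]ger0_norm in e2; last by lra.
rewrite tm0 in e1 e3 *; move: h0 e1 e2 e3 e4; set q := ip (v j (dl / 2)) _; set a0 := ip (v j 0) _.
set u0 := ip (V0 j) _; set gm := gamma d (dl / 2); set gt := gamma d tau => h0 e1 e2 e3 e4.
have -> : gm * q - gt * u0 = (gm - gt) * q + (gt * (q - a0) + gt * (a0 - u0)) by ring.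
apply: (le_trans (ler_normD _ _)).
apply: (@le_trans _ _ (Kg * dl * M + (g1 * (M * (dl / 2)) + g1 * (H * M)))).
  rewrite lerD//; first by rewrite normrM ler_pM.
  by rewrite (le_trans (ler_normD _ _))// lerD// normrM ler_pM.
have : 0 <= g1 * M * dl by rewrite !mulr_ge0// ltW.
lra.
Qed.

End Scheme_estimates.

Theorem theorem4p1 (R : realType) (ne : nat) (hne : (1 <= ne)%N)
    (d : data R ne) (hd : standing_hypotheses d) (M : R) (hM : 0 < M) :
  exists C : R, 0 < C /\
  forall v : 'I_ne -> R -> R -> R, weak_solution d v ->
  forall k : nat, (1 <= k)%N -> regular d k M v ->
  forall gc : 'I_ne -> R -> R -> R, continuous_repr d gc ->
  forall s : seq R, itv_partition 0 1 s ->
  forall z : nat -> seq R, interior_nodes s k z ->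
  forall N : nat, (1 <= N)%N ->
  forall tau : R, tau = tmid d N 1 \/ tau = 0 ->
  forall V : nat -> 'I_ne -> R -> R, cn_scheme d gc s k z N tau V ->
  forall (n : nat) (i : 'I_ne), (1 <= n <= N)%N ->
    (L2norm 0 1 (V n i \- v i (tn d N n))%R
       <= (C * (mesh s ^+ k.+1 + step d N ^+ 2))%:E)%E.
Proof.
have M0 := ltW hM; have T0 := T_gt0 hd.
have [g0 [g1 [Kg [Cb [Ma [ma [[g00 g10] [Kg0 gL] ma0 hg hma]]]]]]] := data_constants hd.
have [L L0 hL] := coef_lipschitz hd.
have G0 : 0 <= energy_const M g0 g1 Cb Ma ma.
  rewrite /energy_const mulr_ge0 ?sqr_ge0// divr_ge0 ?sqr_ge0// mulr_ge0//.
  by rewrite mulr_ge0 ?invr_ge0 ?sqr_ge0// ltW.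
have [C C0 hC] := scheme_recursion ne T0 M0 L0 g10 Kg0 G0.
(* [C] for the distance from the iterate to the projection, [M] for that from the projection to the
   solution. *)
exists (C + M); split; first exact: addr_gt0.
move=> v hv k k1 hr gc hgc s ps z hz N N1 tau htau V [hI hS [P [hP cP cC]] hn] n i /andP[n1 nN].
have mO : measurable (`]0, 1[%classic : set (measurableTypeR R)) by exact: measurable_itv.
have /choice[vh hvh] := solution_package hd hv k1 M0 hr hgc ps.
have Svh j t : t \in `[0, horizon d] -> Sh s k (vh j t) by have [h _ _ _] := hvh j; exact: h.
have hB j : forall W, Sh s k W -> _ := let: And4 _ h _ _ := hvh j in h.
have rho1 j t : t \in `[0, horizon d] ->
    nrm `]0, 1[ (fun y => v j t y - vh j t y) <= mesh s ^+ k.+1 * M.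
  by have [_ _ h _] := hvh j; exact: h.
have rho2 j r t : r \in `[0, horizon d] -> t \in `[0, horizon d] ->
    nrm `]0, 1[ (fun y => (v j r y - vh j r y) - (v j t y - vh j t y)) <=
      mesh s ^+ k.+1 * M * `|r - t|.
  by have [_ _ _ h] := hvh j; exact: h.
have d0 : 0 < step d N by exact: step_gt0.
have H0 := H_ge0 k s.
have E0 : 0 <= mesh s ^+ k.+1 + step d N ^+ 2 by rewrite addr_ge0// sqr_ge0.
pose th m j := nrm `]0, 1[ (fun y => V m j y - vh j (tn d N m) y).
(* The predictor approximates the solution at the end of the first step and is compared with the
   projection at that time. *)
pose thP j := nrm `]0, 1[ (fun y => P j y - vh j (tn d N 1) y).
have tn0 : tn d N 0 = 0 by rewrite /tn mul0r.
have z0 : 0 \in `[0, horizon d] by rewrite in_itv/= lexx ltW.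
have S0 j : Sh s k (V 0%N j) by exact: hS.
have init j : nrm `]0, 1[ (fun y => V 0%N j y - v j 0 y) <= mesh s ^+ k.+1 * M.
  have [hv0 _ _] := hr j; have [sv0 h] := interpolant_estimate k1 M0 ps hz hv0 (hI j).
  have [_ _ _ e _] := hv j; have sv := solution_sq_int hv j z0.
  have sV := Sh_sq_int ps (S0 j).
  rewrite (ae_eq_nrm mO (sq_intB mO sV sv).1 (sq_intB mO sV sv0).1)//.
  by apply: aeS e => y e yI; rewrite e.
have mean0 j : `|ip `]0, 1[ (v j 0) (fun=> 1) - ip `]0, 1[ (V 0%N j) (fun=> 1)| <=
    mesh s ^+ k.+1 * M.
  have sv := solution_sq_int hv j z0; have sV := Sh_sq_int ps (S0 j).
  rewrite -ipBl//; last exact: sq_int_cst.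
  apply: (le_trans (mean_le (sq_intB mO sv sV))); apply: le_trans (init j).
  rewrite -(nrmN mO (sq_intB mO sV sv)) le_eqVlt; apply/orP; left; apply/eqP.
  by apply: eq_nrm => y _; rewrite opprB.
have tri m j : (m <= N)%N -> nrm `]0, 1[ (fun y => V m j y - v j (tn d N m) y) <=
    th m j + mesh s ^+ k.+1 * M.
  move=> mN; have mT := tn_itv hd N1 mN.
  have sV := Sh_sq_int ps (hS m j mN); have sv := solution_sq_int hv j mT.
  have sh := Sh_sq_int ps (Svh j _ mT).
  rewrite (@eq_nrm _ _ _ (fun y => (V m j y - vh j (tn d N m) y) -
    (v j (tn d N m) y - vh j (tn d N m) y))); last by move=> y _; ring.
  apply: (le_trans (nrmB mO (sq_intB mO sV sh) (sq_intB mO sv sh))).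
  by rewrite lerD2l; exact: rho1.
have step_le := cn_step_estimate hd hv M0 hr ps N1 g00 ma0 L0 hg hma hL Svh hB rho1 rho2.
have thn : th n i <= C * (mesh s ^+ k.+1 + step d N ^+ 2).
  apply: (hC N (step d N) (mesh s ^+ k.+1) th thP) => //.
  - by rewrite /step mulrCA mulfV ?mulr1// pnatr_eq0 -lt0n.
  - rewrite /step ler_pdivrMr ?ltr0n// ler_peMr ?(ltW T0)// ler1n//.
  - by move=> m j; exact: nrm_ge0.
  - by move=> j; exact: nrm_ge0.
  (* Interpolation error and projection error of the initial value are each at most M h^(k+1). *)
  - move=> j; rewrite /th tn0.
    have sV := Sh_sq_int ps (S0 j); have sv := solution_sq_int hv j z0.
    have sh := Sh_sq_int ps (Svh j _ z0).
    rewrite (@eq_nrm _ _ _ (fun y => (V 0%N j y - v j 0 y) + (v j 0 y - vh j 0 y))); last first.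
      by move=> y _; ring.
    apply: (le_trans (nrmD mO (sq_intB mO sV sv) (sq_intB mO sv sh))).
    by have := init j; have := rho1 j 0 z0; lra.
  - move=> j; apply: (step_le 0%N _ _ _ _ j N1 _ S0 hP cP).
      by rewrite !addr_ge0 ?mulr_ge0 ?addr_ge0 ?mulr_ge0// ltW.
    move=> j'; exact: (predictor_argument hd hv M0 hr N1 g00 g10 Kg0 gL hg htau (S0 j') (mean0 j')).
  - move=> j p p0 hp; apply: (step_le 0%N _ _ _ _ j N1 _ S0 _ cC).
    + by rewrite mulr_ge0// addr_ge0// mulr_ge0.
    + by move=> j'; exact: hS.
    + move=> j'; exact: (corrector_argument hd hv M0 hr ps N1 g00 hg Svh rho1 (hP j') (S0 j')
        (hp j') (mean0 j')).
  - move=> [|[|m]]// j p /andP[_ mN] p0 hp.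
    have mN1 : (m.+1 <= N)%N by exact: ltnW.
    have mN0 : (m <= N)%N by exact: ltnW.
    apply: (step_le m.+1 _ _ _ _ j mN _ _ _ (hn m.+2 mN)).
    + by rewrite !mulr_ge0// addr_ge0// ?mulr_ge0// mulr_ge0.
    + by move=> j'; exact: hS.
    + by move=> j'; exact: hS.
    + move=> j'; exact: (extrapolated_argument hd hv M0 hr ps N1 g00 hg Svh rho1 mN
        (hS _ _ mN1) (hS _ _ mN0) (hp j')).
have nT := tn_itv hd N1 nN.
rewrite (L2normE (sq_intB mO (Sh_sq_int ps (hS n i nN)) (solution_sq_int hv i nT))) lee_fin.
by apply: (le_trans (tri n i nN)); rewrite mulrDl lerD// mulrC ler_wpM2l// lerDl sqr_ge0.
Qed.
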